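(* Let $k\le\ell$ be nonnegative integers. If the system (E) admits a parameterization of order $(k,\ell)$ at some jet, then either $S=T=J=0$ identically on $\Omega$, or $k\ge3$ and $\ell\ge4$.
   Context: Let $\Omega\subset\mathbb{R}^4$ be open connected and $g,h:\Omega\to\mathbb{R}$ real analytic in $(x,y,z,\lambda)$ with $g_4=\partial g/\partial\lambda$ nowhere zero and $G(x,y,z,\lambda)=(x,y,z,g(x,y,z,\lambda))$ a diffeomorphism of $\Omega$ onto $G(\Omega)$. (E) is the equation $\dot z=h(x,y,z,\lambda)+g(x,y,z,\lambda)\dot x$, $\lambda=\dot y-z\dot x$, for $t\mapsto(x(t),y(t),z(t))$; $\widehat\Omega=\{(x,y,z,\dot x,\dot y):(x,y,z,\dot y-z\dot x)\in\Omega\}$. Numeric subscripts are partial derivatives in the corresponding argument. $S=2g_4g_{4,4,4}-3g_{4,4}^2$, $T=2g_4h_{4,4,4}-3g_{4,4}h_{4,4}$; with $\omega^1=dy-z\,dx$, $\omega=-2g_4^2dx+(g_{4,4}h_4-g_4h_{4,4})\omega^1-g_{4,4}(dz-g\,dx)$, $\eta=dz-g\,dx-h_4\omega^1$, the function $J$ is defined by $d\omega\wedge\omega=-\big(\tfrac S{2g_4}d\lambda\wedge\eta+\tfrac T2d\lambda\wedge\omega^1+J\omega^1\wedge\eta\big)\wedge\omega$. Parameterization of order $(k,\ell)$ ($0\le k\le\ell$) at a jet $\mathcal X=(x_0,y_0,z_0,\dot x_0,\dot y_0,\dots,x_0^{(L)},y_0^{(L)})\in\widehat\Omega\times\mathbb{R}^{2L-2}$,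 $L>0$: a neighborhood $V$ of $\mathcal X$, an open $U\subset\mathbb{R}^{k+\ell+2}$ and real analytic $\varphi,\psi,\chi:U\to\mathbb{R}$ of $(u,\dots,u^{(k)},v,\dots,v^{(\ell)})$ such that, with $\mathcal U$ (resp. $\mathcal V$) the germs at $t=0$ of smooth $(u,v)$ (resp. $(x,y,z)$) whose jet of the corresponding order at $0$ lies in $U$ (resp. $V$), and $\Gamma(u,v)$ the germ of $t\mapsto(\varphi,\psi,\chi)(u(t),\dots,u^{(k)}(t),v(t),\dots,v^{(\ell)}(t))$: (i) each $\Gamma(u,v)$, $(u,v)\in\mathcal U$, solves (E); (ii) $\Gamma$ is open (Whitney $C^\infty$ topology) and $\Gamma(\mathcal U)\supset\mathcal V$; (iii) neither $(\varphi_{u^{(k)}},\psi_{u^{(k)}},\chi_{u^{(k)}})$ nor $(\varphi_{v^{(\ell)}},\psi_{v^{(\ell)}},\chi_{v^{(\ell)}})$ vanishes identically on an open subset of $U$. *)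

(* Defs.v *)
From HB Require Import structures.
From mathcomp Require Import all_boot all_order all_algebra.
From mathcomp Require Import all_classical all_reals all_analysis.
Set Implicit Arguments. Unset Strict Implicit. Unset Printing Implicit Defensive.
Import Order.TTheory GRing.Theory Num.Theory.
Import numFieldNormedType.Exports.
Local Open Scope classical_set_scope.
Local Open Scope ring_scope.

Section Defs.
Variable R : realType.

Definition evec n (i : 'I_n) : 'rV[R]_n := delta_mx 0 i.

Definition partial n (i : 'I_n) (f : 'rV[R]_n -> R) : 'rV[R]_n -> R :=
  fun x => 'D_(evec i) f x.

Definition iter_partial n (s : seq 'I_n) (f : 'rV[R]_n -> R) : 'rV[R]_n -> R :=
  foldr (fun i g => partial i g) f s.

Definition smooth_on n (A : set 'rV[R]_n) (f : 'rV[R]_n -> R) : Prop :=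
  forall s : seq 'I_n,
    {within A, continuous (iter_partial s f)} /\
    (forall (i : 'I_n) x, A x -> derivable (iter_partial s f) x (evec i)).

Definition mi_seq n (alpha : 'I_n -> nat) : seq 'I_n :=
  flatten [seq nseq (alpha i) i | i <- enum 'I_n].

Definition taylor_term n (f : 'rV[R]_n -> R) (p x : 'rV[R]_n)
  (alpha : 'I_n -> nat) : R :=
  iter_partial (mi_seq alpha) f p / (\prod_i ((alpha i)`!)%:R)
  * \prod_i (x 0 i - p 0 i) ^+ (alpha i).

Definition taylor_sum n (F : R -> R) (f : 'rV[R]_n -> R) (p x : 'rV[R]_n)
  (N : nat) : R :=
  \sum_(d < N.+1)
    \sum_(alpha : {ffun 'I_n -> 'I_d.+1} | (\sum_i (alpha i : nat) == d)%N)
       F (taylor_term f p x (fun i => (alpha i : nat))).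

Definition analytic_on n (A : set 'rV[R]_n) (f : 'rV[R]_n -> R) : Prop :=
  smooth_on A f /\
  forall p, A p -> exists2 r : R, 0 < r &
    forall x, A x -> `|x - p| < r ->
      cvg (taylor_sum Num.norm f p x @ \oo) /\
      taylor_sum id f p x @ \oo --> f x.

(* coordinates on R^4 : 0 = x, 1 = y, 2 = z, 3 = lambda *)
Definition i0 : 'I_4 := inord 0.
Definition i1 : 'I_4 := inord 1.
Definition i2 : 'I_4 := inord 2.
Definition i3 : 'I_4 := inord 3.

Definition mk4 (a b c d : R) : 'rV[R]_4 :=
  \row_(i < 4) nth 0 [:: a; b; c; d] i.

Definition Gmap (g : 'rV[R]_4 -> R) (p : 'rV[R]_4) : 'rV[R]_4 :=
  mk4 (p 0 i0) (p 0 i1) (p 0 i2) (g p).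

Definition diffeo_onto_image (A : set 'rV[R]_4) (F : 'rV[R]_4 -> 'rV[R]_4) :
  Prop :=
  open (F @` A) /\ {in A &, injective F} /\
  (forall j : 'I_4, smooth_on A (fun p => F p 0 j)) /\
  exists H : 'rV[R]_4 -> 'rV[R]_4,
    (forall p, A p -> H (F p) = p) /\
    (forall j : 'I_4, smooth_on (F @` A) (fun q => H q 0 j)).

Definition d4 (f : 'rV[R]_4 -> R) := partial i3 f.

Definition Sfun (g : 'rV[R]_4 -> R) (p : 'rV[R]_4) : R :=
  2 * d4 g p * d4 (d4 (d4 g)) p - 3 * (d4 (d4 g) p) ^+ 2.

Definition Tfun (g h : 'rV[R]_4 -> R) (p : 'rV[R]_4) : R :=
  2 * d4 g p * d4 (d4 (d4 h)) p - 3 * d4 (d4 g) p * d4 (d4 h) p.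

(* ---- differential forms on R^4 through their components ----
   a 1-form field is given by its coefficient functions (w = sum_j w_j dx_j);
   a 2-form by its antisymmetric components F_ij (F = sum_{i<j} F_ij dx_i^dx_j);
   a 3-form by its antisymmetric components. *)
Definition form1 := 'I_4 -> 'rV[R]_4 -> R.
Definition form2 := 'I_4 -> 'I_4 -> 'rV[R]_4 -> R.
Definition form3 := 'I_4 -> 'I_4 -> 'I_4 -> 'rV[R]_4 -> R.

Definition dform1 (w : form1) : form2 :=
  fun i j p => partial i (w j) p - partial j (w i) p.
Definition wedge11 (a b : form1) : form2 :=
  fun i j p => a i p * b j p - a j p * b i p.
Definition wedge21 (F : form2) (b : form1) : form3 :=
  fun i j k p => F i j p * b k p + F j k p * b i p + F k i p * b j p.
Definition scale1 (c : 'rV[R]_4 -> R) (a : form1) : form1 :=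
  fun i p => c p * a i p.
Definition add1 (a b : form1) : form1 := fun i p => a i p + b i p.
Definition coordform (j : 'I_4) : form1 :=
  fun i _ => if i == j then 1 else 0.

Definition dxf : form1 := coordform i0.
Definition dlf : form1 := coordform i3.
Definition omega1 : form1 :=
  add1 (coordform i1) (scale1 (fun p => - p 0 i2) dxf).
Definition dzg (g : 'rV[R]_4 -> R) : form1 :=
  add1 (coordform i2) (scale1 (fun p => - g p) dxf).

Definition omegaf (g h : 'rV[R]_4 -> R) : form1 :=
  add1 (scale1 (fun p => - 2 * d4 g p ^+ 2) dxf)
   (add1 (scale1 (fun p => d4 (d4 g) p * d4 h p - d4 g p * d4 (d4 h) p) omega1)
         (scale1 (fun p => - d4 (d4 g) p) (dzg g))).

Definition etaf (g h : 'rV[R]_4 -> R) : form1 :=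
  add1 (dzg g) (scale1 (fun p => - d4 h p) omega1).

Definition is_Jfun (Om : set 'rV[R]_4) (g h J : 'rV[R]_4 -> R) : Prop :=
  forall p, Om p -> forall i j k : 'I_4,
    wedge21 (dform1 (omegaf g h)) (omegaf g h) i j k p =
    - ( Sfun g p / (2 * d4 g p) * wedge21 (wedge11 dlf (etaf g h)) (omegaf g h) i j k p
      + Tfun g h p / 2 * wedge21 (wedge11 dlf omega1) (omegaf g h) i j k p
      + J p * wedge21 (wedge11 omega1 (etaf g h)) (omegaf g h) i j k p).

(* a curve with m components (representative of a germ at t = 0) *)
Definition curve (m : nat) := 'I_m -> R -> R.

Definition dern (n : nat) (f : R -> R) : R -> R := derive1n n f.

Definition smooth_on_int (e : R) (f : R -> R) : Prop :=
  forall (n : nat) (t : R), `|t| < e -> derivable (dern n f) t 1.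

Definition smooth_germ m (c : curve m) : Prop :=
  exists2 e : R, 0 < e & forall i, smooth_on_int e (c i).

Definition germ_eq m (c c' : curve m) : Prop :=
  exists2 e : R, 0 < e & forall i t, `|t| < e -> c i t = c' i t.

Definition germ_set m (A : set (curve m)) : Prop :=
  forall c c', germ_eq c c' -> A c -> A c'.

(* open sets of germs for the Whitney C^infinity topology: around each of
   its smooth elements c, A contains (the germs of) all curves that are
   C^r-close to c on some interval ]-e,e[ on which c is smooth, with a
   positive continuous tolerance eps on ]-e,e[ *)
Definition germ_open m (A : set (curve m)) : Prop :=
  germ_set A /\
  forall c, A c -> smooth_germ c ->
    exists e : R, exists r : nat, exists eps : R -> R,
      [/\ 0 < e, forall i, smooth_on_int e (c i),
          {within [set t | `|t| < e], continuous eps},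
          (forall t, `|t| < e -> 0 < eps t) &
          forall c' : curve m, (forall i, smooth_on_int e (c' i)) ->
            (forall i (j : nat) t, (j <= r)%N -> `|t| < e ->
               `|dern j (c' i) t - dern j (c i) t| < eps t) ->
            A c'].

Definition solves (Om : set 'rV[R]_4) (g h : 'rV[R]_4 -> R) (c : curve 3) :
  Prop :=
  exists2 e : R, 0 < e & forall t, `|t| < e ->
    let x := c (inord 0) in let y := c (inord 1) in let z := c (inord 2) in
    let P := mk4 (x t) (y t) (z t) (dern 1 y t - z t * dern 1 x t) in
    [/\ derivable x t 1, derivable y t 1, derivable z t 1, Om P &
        dern 1 z t = h P + g P * dern 1 x t].

Definition solset Om g h : set (curve 3) :=
  [set c | smooth_germ c /\ solves Om g h c].

Definition jet_uv (k l : nat) (c : curve 2) (t : R) : 'rV[R]_(k.+1 + l.+1) :=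
  row_mx (\row_(i < k.+1) dern i (c (inord 0)) t)
         (\row_(j < l.+1) dern j (c (inord 1)) t).

Definition jet_xyz (L : nat) (c : curve 3) :
  R * 'rV[R]_L.+1 * 'rV[R]_L.+1 :=
  (c (inord 2) 0,
   \row_(j < L.+1) dern j (c (inord 0)) 0,
   \row_(j < L.+1) dern j (c (inord 1)) 0).

Definition in_hatOmega (Om : set 'rV[R]_4) (L : nat)
  (X : R * 'rV[R]_L.+1 * 'rV[R]_L.+1) : Prop :=
  let: (z0, xs, ys) := X in
  Om (mk4 (xs 0 (inord 0)) (ys 0 (inord 0)) z0
          (ys 0 (inord 1) - z0 * xs 0 (inord 1))).

Definition Gam (k l : nat) (phi psi chi : 'rV[R]_(k.+1 + l.+1) -> R)
  (c : curve 2) : curve 3 :=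
  fun i t => let J := @jet_uv k l c t in
    if (i == 0 :> nat) then phi J else if (i == 1 :> nat) then psi J else chi J.

Definition Gam_img (k l : nat) (phi psi chi : 'rV[R]_(k.+1 + l.+1) -> R)
  (W : set (curve 2)) : set (curve 3) :=
  [set c | exists2 uv, W uv & germ_eq c (@Gam k l phi psi chi uv)].

Definition parameterization (Om : set 'rV[R]_4) (g h : 'rV[R]_4 -> R)
  (k l L : nat) (X : R * 'rV[R]_L.+1 * 'rV[R]_L.+1) : Prop :=
  exists V : set (R * 'rV[R]_L.+1 * 'rV[R]_L.+1),
  exists U : set 'rV[R]_(k.+1 + l.+1),
  exists phi psi chi : 'rV[R]_(k.+1 + l.+1) -> R,
    let cU := [set c : curve 2 | smooth_germ c /\ U (@jet_uv k l c 0)] in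
    let cV := [set c : curve 3 | solset Om g h c /\ V (@jet_xyz L c)] in
    let GamI := @Gam_img k l phi psi chi in
    [/\ open V /\ V X,
        open U /\ [/\ analytic_on U phi, analytic_on U psi & analytic_on U chi],
        (forall c, cU c -> solves Om g h (@Gam k l phi psi chi c)),
        (forall W, W `<=` cU -> germ_open W ->
           exists2 O, germ_open O & GamI W = O `&` solset Om g h)
        /\ cV `<=` GamI cU &
        let iu := lshift l.+1 (@ord_max k) in
        let iv := rshift k.+1 (@ord_max l) in
        forall O, open O -> O `<=` U -> O !=set0 ->
          (exists2 p, O p & [\/ partial iu phi p != 0, partial iu psi p != 0
                               | partial iu chi p != 0]) /\
          (exists2 p, O p & [\/ partial iv phi p != 0, partial iv psi p != 0
                               | partial iv chi p != 0])].

Definition admits_parameterization Om g h (k l : nat) : Prop :=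
  exists L : nat, (0 < L)%N /\
  exists X, @in_hatOmega Om L X /\ @parameterization Om g h k l L X.

End Defs.

(* Main.v *)
(** Germs of smooth functions of the jets of (u, v), taken along a maximal filter of open sets of jets of
    order (k+2, l+2), form a field K with commuting coordinate derivations and the total derivative T; the
    parameterization gives x, y, z in K with T z = h + g T x.

    Perturbing a solution of (E) by Picard iteration and a flat cut-off function, and using that Gamma is
    open, one sees that (x, y, z, Tx, Ty, TTx, TTy) maps every open set of jets onto a set containing a
    ball; hence the differentials of these seven functions are linearly independent over K.

    If k <= 2 or k = l = 3, differentiate T z = h + g T x with respect to the derivatives of highest order,
    and then bracket the coordinate derivations, reduced so as to kill x, with the part of T that keeps the
    order.  Unless S, T and J vanish in K, all coordinate derivations become combinations of too few of
    them on x, y, z and their first derivatives, against the independence.  By openness again S, T and J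
    vanish on an open subset of Omega, hence on Omega by the identity theorem for analytic functions. *)
Require Import Defs.
From HB Require Import structures.
From mathcomp Require Import all_boot all_order all_algebra.
From mathcomp Require Import boolp ring lra.
Set Implicit Arguments. Unset Strict Implicit. Unset Printing Implicit Defensive.
Import Order.TTheory GRing.Theory Num.Theory.
Local Open Scope ring_scope.

(** * Commuting derivations of a field *)

Section Derivations.
Variable K : fieldType.

(** The obstruction is a contact form. (E), differentiated in the top derivatives, shows that X,
    differentiation in x once x replaces u^(k) as a coordinate, is annihilated by dy - z dx or by
    omega; in the second case S = T = 0, so that omega is up to a factor a form on (x, y, z)-space,
    and J tells whether it is contact. For a contact form, a field that kills x and stays in the
    kernel, together with its bracket with X, must kill y and z. This propagates along E_0 = V_0,
    E_(j+1) = [E_j, D]: the E_j kill y and z as long as they commute with X. If the chain never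
    breaks, too few fields act; where it breaks, Jacobi identities contradict each other. For k = l
    = 3 the field E_4 is a combination of the U's alone, the identities leave more unknowns, and the
    contradiction is a comparison of degrees in one element that behaves as a variable. A field of
    germs makes every quantity either zero or invertible, which keeps these case distinctions free
    of shrinking neighborhoods. Jets go up to order (k+2, l+2) since T is applied twice to functions
    of order (k, l). *)

Definition der (d : K -> K) : Prop :=
  (forall a b, d (a + b) = d a + d b) /\ (forall a b, d (a * b) = d a * b + a * d b).

Variables (d : K -> K) (dd : der d).

Lemma derD a b : d (a + b) = d a + d b. Proof. exact: dd.1. Qed.
Lemma derM a b : d (a * b) = d a * b + a * d b. Proof. exact: dd.2. Qed.
Lemma der0 : d 0 = 0.
Proof. by apply: (addrI (d 0)); rewrite -derD !addr0. Qed.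
Lemma derN a : d (- a) = - d a.
Proof. by apply/eqP; rewrite -addr_eq0 -derD addNr der0. Qed.
Lemma derB a b : d (a - b) = d a - d b. Proof. by rewrite derD derN. Qed.
Lemma der1 : d 1 = 0.
Proof. by apply: (addrI (d 1)); rewrite addr0 -[in RHS](mulr1 1) derM !mulr1 mul1r. Qed.
Lemma der_nat n : d n%:R = 0.
Proof. by elim: n => [|n IH]; rewrite ?der0// mulrS derD der1 IH addr0. Qed.
Lemma derV a : d (a^-1) = - (d a / a ^+ 2).
Proof.
have [->|a0] := eqVneq a 0; first by rewrite invr0 der0 mul0r oppr0.
have : d (a * a^-1) = 0 by rewrite divff// der1.
rewrite derM => /eqP; rewrite addr_eq0 => /eqP h.
have -> : d a^-1 = a^-1 * (a * d a^-1) by rewrite mulrA mulVf// mul1r.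
have -> : a * d a^-1 = - (d a / a) by rewrite h opprK.
by field.
Qed.


End Derivations.
(** Lets [ring] or [field] deduce an identity from a known one: the two differences of left and
    right sides have to coincide. *)
Lemma lin_eq (R : zmodType) (a b c d : R) : a = b -> (c - d) - (a - b) = 0 -> c = d.
Proof. by move=> ->; rewrite subrr subr0 => /eqP; rewrite subr_eq0 => /eqP. Qed.


(* Along d the element q behaves as a variable; both sides are polynomials in q, of degrees 4
   and 3, and the coefficient of q^4 is eg0 / 4. *)
Lemma quartic_coef (K : fieldType) (d : K -> K) (q q1 kk g0 g1 g2 ug0 ng0 eg0 ug1 ng1 eg1
    ug2 ng2 eg2 uk nk ek ze z1 xz xz1 xek gg : K) : der d ->
  d q = 1 -> d q1 = kk - q -> d kk = 0 -> d g0 = 0 -> d g1 = 0 -> d g2 = 0 ->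
  d ug0 = ng0 -> d ng0 = eg0 -> d eg0 = 0 -> d ug1 = ng1 -> d ng1 = eg1 -> d eg1 = 0 ->
  d ug2 = ng2 -> d ng2 = eg2 -> d eg2 = 0 -> d uk = nk -> d nk = ek -> d ek = 0 ->
  d ze = z1 -> d z1 = ek -> d xz = xz1 + (kk - q) * z1 -> d xz1 = xek + (kk - q) * ek ->
  d xek = 0 -> d gg = ek ->
  ug2 - (kk + q) * ug1 - (uk + ze) * g1 + (kk * q - q1) * ug0
    + (uk * q + kk * ze - (xz + q * ze)) * g0
  = gg * (g2 - (kk + q) * g1 + (kk * q - q1) * g0) -> 6%:R * eg0 = 0.
Proof.
move=> dd dq dq1 dkk dg0 dg1 dg2 du0 dn0 de0 du1 dn1 de1 du2 dn2 de2 duk dnk dek dze dz1 dxz dxz1 dxek dgg h.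
have step a b : a = b -> d a = d b by move=> ->.
pose dE := (derB dd, derD dd, derM dd, derN dd, der0 dd, der1 dd, der_nat dd,
  (dq, dq1, dkk, dg0, dg1, dg2, du0, dn0, de0), (du1, dn1, de1, du2, dn2, de2),
  (duk, dnk, dek, dze, dz1, dxz), (dxz1, dxek, dgg)).
have h1 : ng2 - ug1 - (kk + q) * ng1 - (nk + z1) * g1 + q * ug0 + (kk * q - q1) * ng0
   + (nk * q + uk + kk * z1 - (xz1 + (kk - q) * z1 + ze + q * z1)) * g0
   = ek * (g2 - (kk + q) * g1 + (kk * q - q1) * g0) + gg * (- g1 + q * g0).
  by have := step _ _ h; rewrite !dE => e; apply: (lin_eq e); ring.
have h2 : eg2 - 2%:R * ng1 - (kk + q) * eg1 - (ek + ek) * g1 + ug0 + 2%:R * q * ng0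
   + (kk * q - q1) * eg0
   + (ek * q + 2%:R * nk + kk * ek - (xek + (kk - q) * ek + (kk - q) * ek + z1 + q * ek)) * g0
   = 2%:R * ek * (- g1 + q * g0) + gg * g0.
  by have := step _ _ h1; rewrite !dE => e; apply: (lin_eq e); ring.
have h3 : - 3%:R * eg1 + 3%:R * ng0 + 3%:R * q * eg0 + 3%:R * ek * g0 = 3%:R * ek * g0.
  by have := step _ _ h2; rewrite !dE => e; apply: (lin_eq e); ring.
by have := step _ _ h3; rewrite !dE => e; apply: (lin_eq e); ring.
Qed.

(** * Brackets of reduced derivations against a contact form *)

Section Core.
Variable K : fieldType.
(** Read [X] as d/dx, [U1], [U2], [U3] and [V j] as the reduced derivatives in u_(k-1), u_(k-2),
    u_(k-3) and v_(l-j), [D] as the part of the total derivative that keeps the order, and [tau] as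
    u_k, now a function of the new coordinates. *)
Variables (X U1 U2 U3 D : K -> K) (V : nat -> K -> K) (l : nat) (tau y z B : K).
Hypothesis char0 : forall n, n.+1%:R != 0 :> K.
Hypotheses (dX : der X) (dU1 : der U1) (dU2 : der U2) (dU3 : der U3) (dD : der D)
  (dV : forall j, der (V j)).
Hypotheses (XU1 : forall f, X (U1 f) = U1 (X f)) (XU2 : forall f, X (U2 f) = U2 (X f))
  (XU3 : forall f, X (U3 f) = U3 (X f)) (XV : forall j f, X (V j f) = V j (X f)).
Hypotheses (U21 : forall f, U2 (U1 f) = U1 (U2 f)) (U31 : forall f, U3 (U1 f) = U1 (U3 f))
  (U32 : forall f, U3 (U2 f) = U2 (U3 f)).
Hypotheses (VU1 : forall j f, V j (U1 f) = U1 (V j f)) (VU2 : forall j f, V j (U2 f) = U2 (V j f))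
  (VU3 : forall j f, V j (U3 f) = U3 (V j f)) (VV : forall i j f, V i (V j f) = V j (V i f)).
Hypothesis XD : forall f, X (D f) = D (X f) + X tau * U1 f.
Hypothesis U1D : forall f, U1 (D f) = D (U1 f) + U2 f + U1 tau * U1 f.
Hypothesis U2D : forall f, U2 (D f) = D (U2 f) + U3 f + U2 tau * U1 f.
Hypothesis U3D : forall f, U3 (D f) = D (U3 f) + U3 tau * U1 f.
Hypothesis VD : forall j f, V j (D f) = D (V j f) + V j.+1 f + V j tau * U1 f.
Hypothesis Vl : forall j f, (l < j)%N -> V j f = 0.
Hypothesis tx0 : X tau != 0.

(* abstractly, the fields that kill the coordinate x *)
Variable vf : (K -> K) -> Prop.
Hypothesis vf_der : forall W, vf W -> der W.
Hypotheses (vfU1 : vf U1) (vfU2 : vf U2) (vfU3 : vf U3) (vfV : forall j, vf (V j)).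
Hypothesis vf_ext : forall W W', vf W -> W =1 W' -> vf W'.
Hypothesis vf_lin : forall a W W', vf W -> vf W' -> vf (fun f => W f + a * W' f).

Definition K0 (W : K -> K) : Prop := W y = 0 /\ W z = 0.
Definition K1 (W : K -> K) : Prop := [/\ K0 W, W (X y) = 0 & W (X z) = 0].
(** Value, on a field killing x, of the one-form that annihilates [X], normalized to have dy
    coefficient 1 and dz coefficient [B]; on such fields its dx coefficient does not show. *)
Definition Th (W : K -> K) : K := W y + B * W z.
Definition br (W W' : K -> K) (f : K) : K := W (W' f) - W' (W f).

Hypothesis P0 : K0 (V 0).
Hypothesis P1 : forall W, vf W -> K0 W -> W B = 0.
Hypothesis P2 : forall W, vf W -> K0 W -> W (X y) + B * W (X z) = 0.
Hypothesis P3 : forall W, vf W -> K1 W -> W (D y) = 0 /\ W (D z) = 0.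
(** Non-integrability of the form: on (x, y, z)-space a field of the kernel whose bracket with [X]
    remains in the kernel is a multiple of [X], hence zero if it kills x. *)
Hypothesis P5 : forall W, vf W -> Th W = 0 -> Th (br X W) = 0 -> K0 W.
Definition prop1 (W : K -> K) : Prop := exists c, W y = c * U1 y /\ W z = c * U1 z.
(** [R3] and [R5] express independence: on x, y, z the coordinate derivations are not all
    combinations of [X] and one field, and on x, y, z, Tx, Ty they do not come from [X] and two
    fields. *)
Hypothesis R3 : prop1 U2 -> prop1 U3 -> (forall j, prop1 (V j)) -> False.
Definition prop2 (A1 A2 W : K -> K) : Prop := exists c1 c2, forall f,
  [\/ f = y, f = z, f = X y | f = X z] -> W f = c1 * A1 f + c2 * A2 f.
Hypothesis R5 : forall A1 A2, vf A1 -> vf A2 -> prop2 A1 A2 U1 -> prop2 A1 A2 U2 ->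
  prop2 A1 A2 U3 -> (forall j, prop2 A1 A2 (V j)) -> False.

Lemma C1 W : vf W -> K0 W -> Th (br X W) = 0.
Proof.
move=> vW kW; have [ky kz] := kW; have h := P2 vW kW; rewrite /Th /br ky kz !(der0 dX).
by rewrite !sub0r mulrN -opprD h oppr0.
Qed.

(** As W kills y, z and [B], it preserves the form: differentiating a value of the form only moves
    its argument. *)
Lemma C2 W W' : vf W -> vf W' -> K0 W -> W (Th W') = Th (br W W').
Proof.
move=> vW vW' kW; have [ky kz] := kW; have dW := vf_der vW; have h := P1 vW kW.
rewrite /Th /br ky kz (derD dW) (derM dW) h !(der0 (vf_der vW')) mul0r.
by ring.
Qed.

Lemma K0_K1 W : vf W -> K0 W -> W (X z) = 0 -> K1 W.
Proof.
move=> vW kW h; split=> //; have := P2 vW kW; rewrite h mulr0 addr0 //.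
Qed.

Lemma K0_commX W : vf W -> K0 W -> (forall f, X (W f) = W (X f)) -> K1 W.
Proof. by move=> vW kW h; apply: K0_K1 => //; rewrite -h kW.2 (der0 dX). Qed.

Definition comb a b c (f : K) : K := a * U1 f + b * U2 f + c * U3 f.

Lemma vf_comb a b c : vf (comb a b c).
Proof.
apply: (@vf_ext (fun f => ((U1 f + (a - 1) * U1 f) + b * U2 f) + c * U3 f)).
  exact: (vf_lin _ (vf_lin _ (vf_lin _ vfU1 vfU1) vfU2) vfU3).
by move=> f; rewrite /comb; ring.
Qed.

(** Otherwise [U1], which commutes with [X], lies in [K0] by the contact property; bracketing with
    [D] puts [U2], [U3] and, starting from [V 0], all [V j] there too, and y, z would vary with x
    alone, against [R3]. *)
Lemma pi_neq0 : Th U1 != 0.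
Proof.
apply/eqP => h0.
have kU1 : K0 U1 by apply: P5 => //; rewrite /br /Th !XU1 !subrr mulr0 addr0.
have step W : vf W -> (forall f, X (W f) = W (X f)) -> K0 W -> W (D y) = 0 /\ W (D z) = 0.
  by move=> vW cW kW; apply: P3 => //; exact: K0_commX.
have kU2 : K0 U2.
  have [] := step _ vfU1 XU1 kU1; rewrite !U1D kU1.1 kU1.2 !(der0 dD) !mulr0 !addr0 !add0r.
  by [].
have kU3 : K0 U3.
  have [] := step _ vfU2 XU2 kU2; rewrite !U2D kU2.1 kU2.2 kU1.1 kU1.2 !(der0 dD) !mulr0 !addr0 !add0r.
  by [].
have kV j : K0 (V j).
  elim: j => [|j IH]; first exact: P0.
  have [] := step _ (vfV j) (XV j) IH.
  by rewrite !VD IH.1 IH.2 kU1.1 kU1.2 !(der0 dD) !mulr0 !addr0 !add0r.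
have p0 W : K0 W -> prop1 W by move=> [h1 h2]; exists 0; rewrite h1 h2 !mul0r.
by apply: R3 => [||j]; exact: p0.
Qed.

(** Coefficients of [U1], [U2], [U3] in E_j, chosen so that E_0 = V_0 and E_(j+1) = [E_j, D] holds
    exactly ([E_D]). *)
Fixpoint coefs j : K * K * K :=
  if j isn't j'.+1 then (0, 0, 0) else
  let: (a, b, c) := coefs j' in
  (V j' tau + comb a b c tau - D a, a - D b, b - D c).
Definition al j := (coefs j).1.1.
Definition rh j := (coefs j).1.2.
Definition et j := (coefs j).2.
Definition E j (f : K) : K := V j f + comb (al j) (rh j) (et j) f.

Lemma alS j : al j.+1 = E j tau - D (al j).
Proof. by rewrite /E /al /rh /et /=; case: (coefs j) => [[a b] c] /=. Qed.
Lemma rhS j : rh j.+1 = al j - D (rh j).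
Proof. by rewrite /al /rh /et /=; case: (coefs j) => [[a b] c] /=. Qed.
Lemma etS j : et j.+1 = rh j - D (et j).
Proof. by rewrite /al /rh /et /=; case: (coefs j) => [[a b] c] /=. Qed.

Lemma vfE j : vf (E j).
Proof.
apply: (@vf_ext (fun f => V j f + 1 * comb (al j) (rh j) (et j) f)).
  exact: (vf_lin _ (vfV j) (vf_comb _ _ _)).
by move=> f; rewrite mul1r.
Qed.

Lemma E_D j f : E j (D f) = D (E j f) + E j.+1 f.
Proof.
rewrite /E /comb alS rhS etS VD U1D U2D U3D !(derD dD) !(derM dD) /E /comb.
by ring.
Qed.

Lemma X_comb a b c f : X (comb a b c f) = comb a b c (X f) + comb (X a) (X b) (X c) f.
Proof. by rewrite /comb !(derD dX) !(derM dX) XU1 XU2 XU3; ring. Qed.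

Lemma X_E j f : X (E j f) = E j (X f) + comb (X (al j)) (X (rh j)) (X (et j)) f.
Proof. by rewrite /E (derD dX) XV X_comb addrA. Qed.

(** E_j kills y, z and commutes with [X]. The condition on [et j] is weighted by [U3], so that the
    same definition serves when [U3] is zero. *)
Definition good j := [/\ K0 (E j), X (al j) = 0, X (rh j) = 0 & forall f, X (et j) * U3 f = 0].

Lemma goodX j : good j -> forall f, X (E j f) = E j (X f).
Proof. by move=> [_ a b c] f; rewrite X_E a b /comb c !mul0r !addr0. Qed.
Lemma goodK1 j : good j -> K1 (E j).
Proof. by move=> g; apply: K0_commX; [exact: vfE|case: g|exact: goodX]. Qed.

Lemma K1_next j : K1 (E j) -> K0 (E j.+1).
Proof.
move=> k1; have [[ky kz] _ _] := k1.
have [h1 h2] := P3 (vfE j) k1; split.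
  by move: h1; rewrite E_D ky (der0 dD) add0r.
by move: h2; rewrite E_D kz (der0 dD) add0r.
Qed.

Lemma good0 : good 0.
Proof.
split; rewrite /al /rh /et /= ?(der0 dX) //; last by move=> f; rewrite mul0r.
rewrite /K0 /E /comb /al /rh /et /= !mul0r !addr0.
exact: P0.
Qed.

Lemma Th_comb a : Th (comb a 0 0) = a * Th U1.
Proof. by rewrite /Th /comb; ring. Qed.

(** Only the [U1] component of [X, E_(j+1)] can survive; the form vanishes on that bracket by [C1],
    but not on [U1]. *)
Lemma good_next j : good j -> X (rh j.+1) = 0 -> (forall f, X (et j.+1) * U3 f = 0) -> good j.+1.
Proof.
move=> g hr he; have k := K1_next (goodK1 g); split=> //.
have := C1 (vfE _) k.
have -> : Th (br X (E j.+1)) = Th (comb (X (al j.+1)) 0 0).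
  by rewrite /Th /br !X_E hr /comb !he; ring.
by rewrite Th_comb => /eqP; rewrite mulf_eq0 (negPf pi_neq0) orbF => /eqP.
Qed.

(** As X tau is non-zero, the coefficient of [U2] breaks the commutation with [X] exactly when U1
    (rh j) is non-zero; the case distinctions below rest on this quantity. *)
Lemma X_rhS j : good j -> X (rh j.+1) = - (X tau * U1 (rh j)).
Proof. by move=> [_ a b c]; rewrite rhS (derB dX) a XD b (der0 dD) sub0r add0r. Qed.
Lemma K1K0 W : K1 W -> K0 W. Proof. by case. Qed.

Lemma Xcoef_eq0 W a : vf W -> K0 W ->
  (forall f, X (W f) = W (X f) + a * U1 f) -> a = 0.
Proof.
move=> vW kW h; have := C1 vW kW; rewrite /Th /br !h.
have -> : W (X y) + a * U1 y - W (X y) + B * (W (X z) + a * U1 z - W (X z)) = a * Th U1.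
  by rewrite /Th; ring.
by move/eqP; rewrite mulf_eq0 (negPf pi_neq0) orbF => /eqP.
Qed.

Lemma K0_multU1 a : K0 (comb a 0 0) -> a = 0.
Proof.
move=> [h1 h2]; have : a * Th U1 = 0 by rewrite -Th_comb /Th h1 h2 mulr0 addr0.
by move/eqP; rewrite mulf_eq0 (negPf pi_neq0) orbF => /eqP.
Qed.

Lemma vf_VU j rho : vf (fun f => V j f + rho * U1 f).
Proof. exact: vf_lin (vfV j) vfU1. Qed.

(** If U2 + c U1 were in [K0], then [U2] would act on y and z as - c U1; the chain started at V_0
    would stay of the form V_j + rho U1, and y, z would see [U1] alone, against [R3]. *)
Lemma noN_U3 c : (forall f, U3 f = 0) -> ~ K0 (comb c 1 0).
Proof.
move=> U30 kN.
have Nf f : U2 f = comb c 1 0 f - c * U1 f by rewrite /comb U30; ring.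
have hV j : exists rho, K0 (fun f => V j f + rho * U1 f) /\ X rho = 0.
  elim: j => [|j [rho [kF Xr]]].
    by exists 0; rewrite (der0 dX) /K0 !mul0r !addr0; split=> //; exact: P0.
  have vF := vf_VU j rho.
  have cF f : X (V j f + rho * U1 f) = V j (X f) + rho * U1 (X f).
    by rewrite (derD dX) (derM dX) Xr XV XU1; ring.
  have [q1 q2] := P3 vF (K0_commX vF kF cF).
  (* The bracket of V_j + rho U1 with D contains rho U2, traded here for - rho c U1. *)
  pose rho' := V j tau + rho * U1 tau - D rho - rho * c.
  exists rho'; have [k1 k2] := kF.
  have key f : V j f + rho * U1 f = 0 -> V j (D f) + rho * U1 (D f) = 0 ->
      comb c 1 0 f = 0 -> V j.+1 f + rho' * U1 f = 0.
    move=> e1 e2 e3; move: e2; rewrite VD U1D Nf e3.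
    have -> : V j f = - (rho * U1 f) by apply/eqP; rewrite -addr_eq0 e1.
    by rewrite (derN dD) (derM dD) /rho' => <-; ring.
  have kF' : K0 (fun f => V j.+1 f + rho' * U1 f).
    by split; apply: key => //; [exact: kN.1|exact: kN.2].
  split=> //; apply: (Xcoef_eq0 (vf_VU _ _) kF') => f.
  by rewrite (derD dX) (derM dX) XV XU1; ring.
apply: R3.
- by exists (- c); rewrite !Nf kN.1 kN.2; split; ring.
- by exists 0; rewrite !U30 !mul0r.
- move=> j; have [rho [[h1 h2] _]] := hV j; exists (- rho); split.
    by apply/eqP; rewrite mulNr -addr_eq0 h1.
  by apply/eqP; rewrite mulNr -addr_eq0 h2.
Qed.

(** This is the situation k <= 1; the zero field then plays the part of U2 + c U1 with c = 0. *)
Lemma core_k1 : (forall f, U2 f = 0) -> (forall f, U3 f = 0) -> False.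
Proof.
move=> U20 U30; apply: (@noN_U3 0 U30).
by rewrite /K0 /comb !U20 !U30 !mulr0 !mul0r !addr0.
Qed.

Section NoN.
Hypothesis noN : forall c, ~ K0 (comb c 1 0).

Lemma K0_span2 a b : K0 (comb a b 0) -> a = 0 /\ b = 0.
Proof.
move=> [h1 h2]; have [b0|b0] := eqVneq b 0.
  by subst b; split=> //; apply: K0_multU1; split.
have key f : comb (a / b) 1 0 f = b^-1 * comb a b 0 f by rewrite /comb; field.
by case: (@noN (a / b)); rewrite /K0 !key h1 h2 mulr0.
Qed.

Lemma comb_Th0 a b a' b' : Th (comb a b 0) = 0 -> b != 0 -> Th (comb a' b' 0) = 0 ->
  a' = b' / b * a.
Proof.
move=> h b0 h'.
have : (a' - b' / b * a) * Th U1 = 0.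
  have -> : (a' - b' / b * a) * Th U1 = Th (comb a' b' 0) - b' / b * Th (comb a b 0).
    by rewrite /Th /comb; field.
  by rewrite h h' mulr0 subr0.
by move/eqP; rewrite mulf_eq0 (negPf pi_neq0) orbF subr_eq0 => /eqP.
Qed.

(* P stands for some E_j in K1, commuting with X, and P' = [P, D] is not in K1. *)
Section Obstruction.
Variables (P P' Nh : K -> K) (m n n2 : K).
Hypothesis NhE : Nh =1 comb n n2 0.
Hypotheses (vP : vf P) (vP' : vf P') (kP : K1 P) (kP' : K0 P').
Hypothesis XP : forall f, X (P f) = P (X f).
Hypothesis PD : forall f, P (D f) = D (P f) + P' f.
Hypothesis PU1 : forall f, P (U1 f) = U1 (P f) + m * U1 f + Nh f.
Hypothesis n20 : n2 != 0.
Hypothesis XP' : forall f, X (P' f) = P' (X f) + X tau * Nh f.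

Let eps := X m.
Let vNh : vf Nh. Proof. by apply: vf_ext (vf_comb n n2 0) _ => f; rewrite NhE. Qed.
Let dP := vf_der vP.
Let dNh := vf_der vNh.

Lemma Th_Nh : Th Nh = 0.
Proof.
have := C1 vP' kP'; rewrite /Th /br !XP' => h.
have : X tau * Th Nh = 0 by rewrite -[RHS]h /Th; ring.
by move/eqP; rewrite mulf_eq0 (negPf tx0) => /eqP.
Qed.

Lemma P_pi : P (Th U1) = m * Th U1.
Proof.
rewrite (C2 vP vfU1 (K1K0 kP)). 
have -> : Th (br P U1) = m * Th U1 + Th Nh by rewrite /Th /br !PU1; ring.
by rewrite Th_Nh addr0.
Qed.

(** Jacobi identity for X, P, U1. *)
Lemma X_Nh f : X (Nh f) = Nh (X f) - eps * U1 f.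
Proof.
have h : X (P (U1 f)) = P (U1 (X f)) by rewrite XP XU1.
move: h; rewrite !PU1 !(derD dX) XU1 XP (derM dX) XU1 => h.
by apply: (lin_eq h); rewrite /eps; ring.
Qed.

(** Otherwise Nh, which lies in the kernel of the form, commutes with X, so it lies in [K0] by [P5],
    against [noN]. *)
Lemma eps_neq0 : eps != 0.
Proof.
apply/eqP => e0; have kN : K0 Nh.
  apply: P5 => //; first exact: Th_Nh.
  by rewrite /Th /br !X_Nh e0; ring.
have kN' : K0 (comb n n2 0) by rewrite /K0 -!NhE.
by have [_ h] := K0_span2 kN'; move/eqP: n20; apply.
Qed.

(** Jacobi identity for X, P, D; the Nh components cancel and the U1 component remains. *)
Lemma P_tx : P (X tau) = - m * X tau.
Proof.
have key f : (P (X tau) + m * X tau) * U1 f = 0.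
  have : X (P (D f)) = P (X (D f)) by rewrite XP.
  rewrite PD !(XD, derD dX, derD dP, derM dP, PU1, XP', XP) PD => h.
  by apply: (lin_eq (esym h)); ring.
have : (P (X tau) + m * X tau) * Th U1 = 0.
  by rewrite /Th mulrDr mulrCA !key mulr0 addr0.
move/eqP; rewrite mulf_eq0 (negPf pi_neq0) orbF addr_eq0 => /eqP ->.
by rewrite mulNr.
Qed.

(* Case [P, P'] = 0: Jacobi with X gives both X m = eps and X m = - eps. *)
Lemma obstruction0 : (forall f, P (P' f) = P' (P f)) -> False.
Proof.
move=> PP'.
have PN f : P (Nh f) = Nh (P f) + m * Nh f.
  have : X (P (P' f)) = X (P' (P f)) by rewrite PP'.
  rewrite XP !XP' (derD dP) (derM dP) P_tx XP PP' => h.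
  apply: (mulfI tx0); apply: (lin_eq h).
  by ring.
have key f : (P eps) * U1 f + 2%:R * eps * Nh f = 0.
  have : X (P (Nh f)) = P (X (Nh f)) by rewrite XP.
  rewrite PN (derD dX) (derM dX) !X_Nh (derB dP) (derM dP) PU1 !PN !XP -/eps => h.
  by apply: (lin_eq h); ring.
have e0 : P eps = 0.
  have : (P eps) * Th U1 = 0.
    have -> : P eps * Th U1 = P eps * Th U1 + 2%:R * eps * Th Nh by rewrite Th_Nh mulr0 addr0.
    have -> : P eps * Th U1 + 2%:R * eps * Th Nh =
      (P eps * U1 y + 2%:R * eps * Nh y) + B * (P eps * U1 z + 2%:R * eps * Nh z).
      by rewrite /Th; ring.
    by rewrite !key mulr0 addr0.
  by move/eqP; rewrite mulf_eq0 (negPf pi_neq0) orbF => /eqP.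
have N0 f : Nh f = 0.
  have /eqP := key f; rewrite e0 mul0r add0r !mulf_eq0 (negPf eps_neq0) orbF.
  by rewrite (negPf (char0 1)) => /eqP.
have kN' : K0 (comb n n2 0) by rewrite /K0 -!NhE.
by have [_ h] := K0_span2 kN'; move/eqP: n20; apply.
Qed.

(** The form separates U1 from Nh, and [noN] forbids Nh to kill both y and z. *)
Lemma U1_Nh_free a b : (forall f, f = y \/ f = z -> a * U1 f + b * Nh f = 0) -> a = 0 /\ b = 0.
Proof.
move=> h; have a0 : a = 0.
  have : a * Th U1 + b * Th Nh = 0.
    have -> : a * Th U1 + b * Th Nh = (a * U1 y + b * Nh y) + B * (a * U1 z + b * Nh z).
      by rewrite /Th; ring.
    by rewrite !h ?mulr0 ?addr0; auto.
  by rewrite Th_Nh mulr0 addr0 => /eqP; rewrite mulf_eq0 (negPf pi_neq0) orbF => /eqP.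
split=> //; apply/eqP; apply/negPn/negP => b0.
have N0 f : f = y \/ f = z -> comb n n2 0 f = 0.
  by move=> hf; have /eqP := h f hf; rewrite a0 mul0r add0r mulf_eq0 (negPf b0) NhE => /eqP.
have kN : K0 (comb n n2 0) by split; apply: N0; auto.
by have [_ e] := K0_span2 kN; move/eqP: n20; apply.
Qed.

Lemma P_Nh_eps (mu : K) : (forall f, P (Nh f) = Nh (P f) + mu * Nh f) ->
  X mu = - eps /\ P eps = eps * (mu - m).
Proof.
move=> PN; have [|h1 h2] := @U1_Nh_free (P eps - eps * (mu - m)) (X mu + eps).
  move=> f _; have : X (P (Nh f)) = P (X (Nh f)) by rewrite XP.
  rewrite PN (derD dX) (derM dX) !X_Nh (derB dP) (derM dP) PU1 !PN !XP -/eps => h.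
  by apply: (lin_eq h); ring.
by split; apply/eqP; [rewrite -addr_eq0 h2|rewrite -subr_eq0 h1].
Qed.

(** [P, Y] is a multiple q Y, and [X, Y] a multiple of Nh. The Jacobi identities give, for the
    rescaled multiple yh, both X yh = - 2 eps and P yh = yh (q - yh). Commuting X and P on yh forces
    q = 3 yh, whereas X q = 0 and eps is non-zero. *)
Lemma obstruction1 (Y : K -> K) (ya yb s : K) : (Y =1 comb ya yb s) ->
  (forall f, P (P' f) = P' (P f) + Y f) -> K0 Y -> X s = 0 ->
  (exists a b, forall f, P (Y f) = Y (P f) + comb a b (P s) f) -> False.
Proof.
move=> YE PP' kY Xs [a [b PY]].
have vY : vf Y by apply: vf_ext (vf_comb ya yb s) _ => f; rewrite YE.
have XY0 f : X (Y f) = Y (X f) + comb (X ya) (X yb) 0 f by rewrite !YE X_comb Xs.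
pose yy := X yb / n2.
have XY f : X (Y f) = Y (X f) + yy * Nh f.
  rewrite XY0 NhE; congr (_ + _).
  have t : Th (comb n n2 0) = 0 by have := Th_Nh; rewrite /Th !NhE.
  have t' : Th (comb (X ya) (X yb) 0) = 0.
    have := C1 vY kY; rewrite /Th /br !XY0 => h.
    by rewrite -[RHS]h; ring.
  by rewrite (comb_Th0 t n20 t') /comb /yy; field.
pose yh := yy / X tau.
have PN f : P (Nh f) = Nh (P f) + (yh + m) * Nh f.
  have : X (P (P' f)) = P (X (P' f)) by rewrite XP.
  rewrite PP' (derD dX) XY !XP' (derD dP) (derM dP) P_tx PP' XP => h.
  apply: (mulfI tx0); apply: (lin_eq (esym h)).
  by rewrite /yh; field.
have [e1 e2] := P_Nh_eps PN.
have Xyh : X yh = - 2%:R * eps.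
  by move: e1; rewrite (derD dX) -/eps => h; apply: (lin_eq h); ring.
have e0 := eps_neq0.
(* Without its U3 component Y would be a combination of U1 and U2 in [K0], hence zero, and yh would
   vanish with it. *)
have s0 : s != 0.
  apply/eqP => s0; have [_ b0] : ya = 0 /\ yb = 0.
    by apply: K0_span2; move: kY; rewrite /K0 !YE s0.
  have yh0 : yh = 0 by rewrite /yh /yy b0 (der0 dX) !mul0r.
  move/eqP: Xyh; rewrite yh0 (der0 dX) eq_sym mulf_eq0 oppr_eq0 (negPf e0) orbF.
  by rewrite (negPf (char0 1)).
pose q := P s / s.
have Xq : X q = 0.
  by rewrite /q (derM dX) (derV dX) XP Xs (der0 dP) !mul0r oppr0 mulr0 addr0.
have PYq f : P (Y f) = Y (P f) + q * Y f.
  have k0 : K0 (comb (a - q * ya) (b - q * yb) 0).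
    have key g : comb (a - q * ya) (b - q * yb) 0 g = P (Y g) - Y (P g) - q * Y g.
      by rewrite PY (YE g) /comb /q; field.
    have [y1 y2] := kY.
    have [kPy kPz] := K1K0 kP.
    by rewrite /K0 !key y1 y2 kPy kPz (der0 dP) (der0 (vf_der vY)) mulr0 !subr0.
  have [a0 b0] := K0_span2 k0.
  have -> : P (Y f) = Y (P f) + q * Y f + comb (a - q * ya) (b - q * yb) 0 f.
    by rewrite PY (YE f) /comb /q; field.
  by rewrite a0 b0 /comb; ring.
have ne : exists f, Nh f != 0.
  apply: contrapT => H; have [|_ /eqP] := @U1_Nh_free 0 1; last by rewrite oner_eq0.
  move=> f _; rewrite mul0r mul1r add0r; apply/eqP/negPn/negP => nz.
  by apply: H; exists f.
have [f Nf] := ne.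
have Pyy : P yy = yy * (q - yh - m).
  have : X (P (Y f)) = P (X (Y f)) by rewrite XP.
  rewrite PYq !(derD dX) (derM dX) Xq !XY !(derD dP) !(derM dP) PN PYq !XP => h.
  by apply: (mulIf Nf); apply: (lin_eq (esym h)); ring.
have Pyh : P yh = yh * (q - yh).
  by rewrite /yh (derM dP) (derV dP) P_tx Pyy /yh; field.
have : X (P yh) = P (X yh) by rewrite XP.
rewrite Xyh Pyh (derM dX) (derB dX) Xyh Xq (derM dP) (derN dP) (der_nat dP) e2 => h.
have q3 : q = 3%:R * yh.
  apply/eqP; rewrite -subr_eq0; have : (2%:R * eps) * (q - 3%:R * yh) = 0.
    by apply: (lin_eq (esym h)); ring.
  by move/eqP; rewrite !mulf_eq0 (negPf e0) (negPf (char0 1)).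
move: Xq; rewrite q3 (derM dX) (der_nat dX) Xyh => /eqP.
by rewrite mul0r add0r !mulf_eq0 oppr_eq0 (negPf e0) (negPf (char0 1)) (negPf (char0 2)).
Qed.

(** * The obstruction resolved by the quartic identity *)

Section Obstruction2.
Variables (r nu e1 e2 e3 : K) (Q0 : K -> K).
Hypothesis r0 : r != 0.
Hypothesis PP' : forall f, P (P' f) = P' (P f) + nu * P' f.
Let ga0 := Th D.
Hypothesis P'ga : P' ga0 != 0.
Hypothesis DE : forall f, D f = e1 * U1 f + e2 * Nh f + e3 * P' f + Q0 f.
Hypothesis Q0K : forall f, [\/ f = y, f = z, f = X y | f = X z] -> Q0 f = 0.
Hypothesis U1beta : U1 (e3 * r) = 0.
Let e0 := eps_neq0.
Let dP' := vf_der vP'.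
Let pi := Th U1.
Let pi0 : pi != 0 := pi_neq0.
Let tx := X tau.
Let c := eps / tx.

(** P' kills y and z, so these decide the first two coefficients; [ga0] then detects P'. *)
Lemma U1_Nh_P'_free a b e : (forall f, a * U1 f + b * Nh f + e * P' f = 0) ->
  [/\ a = 0, b = 0 & e = 0].
Proof.
move=> h; have [|a0 b0] := @U1_Nh_free a b.
  by move=> f hf; rewrite -[RHS](h f); case: hf => ->; rewrite (kP'.1, kP'.2) mulr0 addr0.
split=> //; have /eqP := h ga0; rewrite a0 b0 !mul0r !add0r mulf_eq0 (negPf P'ga) orbF.
by move/eqP.
Qed.

(** The Jacobi identities for (X, P, P') and then (X, P, Nh), the latter split into its three
    independent components. *)
Lemma P_Nh2 : [/\ X nu = - eps, P eps = eps * nu, X c = 0 &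
  forall f, P (Nh f) = Nh (P f) + (m + nu) * Nh f - c * P' f].
Proof.
pose w := X nu / tx.
have PN f : P (Nh f) = Nh (P f) + (m + nu) * Nh f + w * P' f.
  have : X (P (P' f)) = P (X (P' f)) by rewrite XP.
  rewrite PP' !(derD dX) (derM dX) !XP' (derD dP) (derM dP) P_tx !PP' !XP -/tx => h.
  apply: (mulfI tx0); apply: (lin_eq (esym h)).
  by rewrite /w -/tx; field.
have [|h1 h2 h3] := @U1_Nh_P'_free (P eps - eps * nu) (2%:R * eps + 2%:R * X nu) (X w).
  move=> f; have : X (P (Nh f)) = P (X (Nh f)) by rewrite XP.
  rewrite PN !(derD dX) !(derM dX) !X_Nh XP' (derB dP) (derM dP) PU1 !PN (derD dX) !XP -/eps => h.
  by apply: (lin_eq h); rewrite /w -/tx; field.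
have Xnu : X nu = - eps.
  have : 2%:R * (eps + X nu) = 0 by rewrite mulrDr.
  by move/eqP; rewrite mulf_eq0 (negPf (char0 1)) addr_eq0 => /eqP ->; rewrite opprK.
have cw : c = - w by rewrite /c /w Xnu; field.
split=> //; first by apply/eqP; rewrite -subr_eq0 h1.
  by rewrite cw (derN dX) h3 oppr0.
by move=> f; rewrite PN cw; ring.
Qed.

(** Logarithmic derivatives along X of pi = Th U1 and of kap = X tau * pi. Under P the two factors
    of kap scale oppositely, so kap and k1 are constant along P, while P Q = eps: along P / eps the
    element Q is a variable. *)
Let Q := X pi / pi.
Let Q1 := X Q.
Let kap := tx * pi.
Let k1 := X kap / kap.
Let Xpi : X pi = pi * Q. Proof. by rewrite /Q; field. Qed.
Let kap0 : kap != 0. Proof. by rewrite mulf_neq0. Qed.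
Let Xtx : X tx = tx * (k1 - Q).
Proof. by rewrite /k1 /kap (derM dX) Xpi; field; rewrite pi0. Qed.
Let Xeps : X eps = eps * (k1 - Q).
Proof.
have [_ _ h _] := P_Nh2; have -> : eps = c * tx by rewrite /c; field.
by rewrite (derM dX) h Xtx; ring.
Qed.
Let Pkap : P kap = 0.
Proof. by rewrite /kap (derM dP) P_tx P_pi /tx /pi; ring. Qed.
Let Pk1 : P k1 = 0.
Proof. by rewrite /k1 (derM dP) (derV dP) -XP Pkap (der0 dX) !mul0r oppr0 mulr0 addr0. Qed.
Let PQ : P Q = eps.
Proof. by rewrite /Q (derM dP) (derV dP) -XP P_pi (derM dX) /eps -/pi; field. Qed.
Let PQ1 : P Q1 = eps * (k1 - Q).
Proof. by rewrite /Q1 -XP PQ Xeps. Qed.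
Let Peps : P eps = eps * nu. Proof. by have [] := P_Nh2. Qed.
Let PNh f : P (Nh f) = Nh (P f) + (m + nu) * Nh f - c * P' f.
Proof. by have [_ _ _ h] := P_Nh2. Qed.
Let XNh f : X (Nh f) = Nh (X f) - eps * U1 f. Proof. exact: X_Nh. Qed.

Section Jacobi.
Variables (R A G pp ph : K).
Hypothesis RE : U1 r = R * r.
Hypothesis U1_Nh : forall f, U1 (Nh f) = Nh (U1 f) + A * Nh f + G * U1 f.
Hypothesis U1_P' : forall f, U1 (P' f) = P' (U1 f) + R * P' f + pp * U1 f + ph * Nh f.

(** [X_AG], [X_pph] and [P_G] come from the Jacobi identities for (X, U1, Nh), (X, U1, P') and (P,
    U1, Nh), split along independent fields. *)
Lemma X_AG : X A = 0 /\ X G = A * eps - U1 eps.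
Proof.
have [|h1 h2] := @U1_Nh_free (X G - A * eps + U1 eps) (X A).
  move=> f _; have : X (U1 (Nh f)) = U1 (X (Nh f)) by rewrite XU1.
  rewrite U1_Nh !(derD dX) !(derM dX) !XNh (derB dU1) (derM dU1) U1_Nh !XU1 => h.
  by apply: (lin_eq h); ring.
by split=> //; apply: (lin_eq h1); ring.
Qed.

Lemma X_pph : R * tx + X ph = U1 tx + tx * A /\ X pp - ph * eps = tx * G.
Proof.
have [|h1 h2 h3] := @U1_Nh_P'_free (X pp - ph * eps - tx * G) (R * tx + X ph - U1 tx - tx * A) (X R).
  move=> f; have : X (U1 (P' f)) = U1 (X (P' f)) by rewrite XU1.
  rewrite U1_P' !(derD dX) !(derM dX) !XNh !XP' (derD dU1) (derM dU1) U1_Nh U1_P' !XU1 -/tx => h.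
  by apply: (lin_eq h); ring.
by split; [apply: (lin_eq h2)|apply: (lin_eq h1)]; ring.
Qed.

(** By [C2], P' pi is the value of the form on [P', U1], and only the U1 component of that bracket
    contributes. *)
Lemma ppE : pp = - (P' pi / pi).
Proof.
rewrite /pi (C2 vP' vfU1 kP').
have -> : Th (br P' U1) = - (pp * Th U1).
  have := Th_Nh; have [k1' k2'] := kP'.
  have : Th P' = 0 by rewrite /Th k1' k2' mulr0 addr0.
  rewrite /Th /br !U1_P' => h1 h2.
  have h3 : R * (P' y + B * P' z) + ph * (Nh y + B * Nh z) = 0 by rewrite h1 h2 !mulr0 addr0.
  by apply: (lin_eq (esym h3)); ring.
by field; exact: pi0.
Qed.
Lemma P_G : P G = (m + nu) * G - Nh m - c * pp.
Proof.
have [|h1 h2 h3] := @U1_Nh_P'_free (P G - ((m + nu) * G - Nh m - c * pp))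
    (P A - (m * A - G + U1 m + U1 nu - c * ph)) (U1 c + c * R - c * A).
  move=> f; have := PU1 (Nh f).
  rewrite {1}U1_Nh !(derD dP) !(derM dP) !PNh !PU1 (derB dU1) !(derD dU1) !(derM dU1) (derD dU1) U1_Nh U1_P'.
  rewrite !(derD dNh) (derM dNh) => h.
  by apply: (lin_eq h); rewrite !U1_Nh; ring.
by apply/eqP; rewrite -subr_eq0 h1.
Qed.

Let nu1 := Nh pi / pi.
Let Lp := U1 pi / pi.
(** The combination of G with the logarithmic derivative of pi along Nh, scaled so as to be constant
    along P ([P_b]). *)
Let b := - (G + nu1) / (eps * pi).

Lemma P_b : P b = 0.
Proof.
have PNpi : P (Nh pi) = Nh m * pi + (2%:R * m + nu) * Nh pi - c * P' pi.
  by rewrite PNh {1}/pi P_pi (derM dNh) -/pi; ring.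
have Ppi : P pi = m * pi by rewrite /pi P_pi.
have hG : P (G * pi + Nh pi) = (2%:R * m + nu) * (G * pi + Nh pi).
  rewrite (derD dP) (derM dP) P_G PNpi Ppi ppE.
  by field; rewrite pi0.
have -> : b = - ((G * pi + Nh pi) / (eps * pi ^+ 2)).
  by rewrite /b /nu1; field; rewrite pi0 e0.
rewrite (derN dP) (derM dP) (derV dP) hG !(derM dP) Peps !Ppi.
by field; rewrite pi0 e0.
Qed.

Let bh := X b + b * k1.
Let gg := 2%:R * bh - (P' Q1 - (k1 - Q) * P' Q) / (kap * eps).

Lemma X_nu1 : X nu1 = Nh Q - eps * Lp.
Proof.
rewrite {1}/nu1 (derM dX) (derV dX) XNh Xpi (derM dNh) /nu1 /Lp.
by field.
Qed.

Lemma X_G : X G = - Nh Q + eps * Lp - eps * pi * bh.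
Proof.
have -> : G = - nu1 - b * (eps * pi) by rewrite /b; field; rewrite pi0 e0.
rewrite (derB dX (- nu1)) (derN dX nu1) X_nu1 (derM dX b) (derM dX eps) Xeps Xpi /bh.
by ring.
Qed.

Lemma phE : ph = - (P' Q / eps) + b * kap.
Proof.
have [_ h] := X_pph.
have hp : X pp = - (P' Q + tx * nu1).
  rewrite ppE (derN dX) (derM dX) (derV dX) XP' Xpi (derM dP') /nu1 -/tx.
  by field.
apply: (mulIf e0); apply: (lin_eq (esym h)); rewrite hp.
by rewrite /b /kap; field; rewrite pi0 e0.
Qed.

Lemma X_ph : X ph = - (P' Q1 + tx * Nh Q) / eps + P' Q * (k1 - Q) / eps + kap * bh.
Proof.
have Xkap : X kap = kap * k1 by rewrite /k1; field.
rewrite phE (derD dX) (derN dX) (derM dX (P' Q)) (derV dX) XP' (derM dX b) Xkap Xeps /bh -/Q1 -/tx.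
by field.
Qed.

(** The logarithmic derivative along U1 of eps * kap / r, which is the factor left over when [e3E]
    is inserted in [U1beta]. *)
Lemma gE : U1 eps / eps + U1 kap / kap - R = pi * gg.
Proof.
have [h1 _] := X_pph; have [_ h2] := X_AG.
have -> : U1 kap / kap = U1 tx / tx + Lp.
  by rewrite /kap (derM dU1) /Lp; field; rewrite pi0 tx0.
have -> : U1 tx = R * tx + X ph - tx * A by rewrite h1; ring.
have -> : U1 eps = A * eps - X G by rewrite h2; ring.
rewrite X_ph X_G /gg /kap.
by field; rewrite pi0 e0 tx0.
Qed.

(** [X_G] and [X_AG] determine A; the relation X A = 0 then becomes this formula. *)
Lemma U1Q : U1 Q = Nh Q1 / eps - Nh Q * (k1 - Q) / eps + pi * Q * bh + pi * X bh - U1 k1.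
Proof.
have [h1 h2] := X_AG.
have AE : A = - (Nh Q / eps) + Lp - pi * bh + U1 eps / eps.
  by apply: (mulIf e0); rewrite -[A * eps](subrK (U1 eps)) -h2 X_G; field.
have XLp : X Lp = U1 Q.
  rewrite {1}/Lp (derM dX) (derV dX) XU1 Xpi (derM dU1).
  by field.
have XU1eps : X (U1 eps / eps) = U1 k1 - U1 Q.
  rewrite (derM dX) (derV dX) XU1 Xeps (derM dU1) (derB dU1).
  by field.
move: h1; rewrite AE (derD dX) XU1eps (derB dX) (derD dX) XLp (derN dX) (derM dX (Nh Q)) (derV dX).
rewrite XNh Xeps -/Q1 (derM dX pi) Xpi => h.
by apply: (lin_eq h); field.
Qed.

(** [XD] applied to y and z, with D expanded by [DE], determines e1, e2, e3 in turn from [ga0], at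
    the price of one more derivative along X each time. *)
Lemma e3E : e3 = - (X (X ga0) - (k1 + Q) * X ga0 + (k1 * Q - Q1) * ga0) / (eps * kap).
Proof.
have e1E : e1 = ga0 / pi.
  rewrite /ga0 /Th !DE !Q0K; [|by constructor..].
  have [-> ->] := kP'; have := Th_Nh; rewrite /Th => hN.
  have -> : e1 * U1 y + e2 * Nh y + e3 * 0 + 0 + B * (e1 * U1 z + e2 * Nh z + e3 * 0 + 0)
    = e1 * pi + e2 * (Nh y + B * Nh z) by rewrite /pi /Th; ring.
  by rewrite hN; field.
have [|h1 h2] := @U1_Nh_free (X e1 - e2 * eps - tx) (X e2 + e3 * tx).
  move=> f hf; have := XD f.
  have q0 : Q0 f = 0 by apply: Q0K; case: hf => ->; constructor.
  have q1 : Q0 (X f) = 0 by apply: Q0K; case: hf => ->; constructor.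
  have p0 : P' f = 0 by case: hf => ->; rewrite (kP'.1, kP'.2).
  rewrite !DE q0 q1 addr0 !(derD dX) !(derM dX) XNh XP' p0 XU1 -/tx => h.
  by apply: (lin_eq h); ring.
have e2E : e2 = (X e1 - tx) / eps.
  by apply: (mulIf e0); apply: (lin_eq (esym h1)); field.
have -> : e3 = - X e2 / tx.
  by apply: (mulIf tx0); apply: (lin_eq h2); rewrite -/tx; field.
have Xe1 : X e1 = (X ga0 - Q * ga0) / pi.
  by rewrite e1E (derM dX) (derV dX) Xpi; field.
have Xkap : X tx = tx * (k1 - Q) by [].
rewrite e2E Xe1 (derM dX) (derV dX) Xeps (derB dX) (derM dX) (derV dX) Xpi.
rewrite (derB dX (X ga0)) (derM dX Q) -/Q1 Xkap /kap.
by field; rewrite pi0 e0 tx0.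
Qed.

(** The scalings make Q a variable with derivative 1 under [d], and make [d] send [uh] to [nh], [nh]
    to [ee] and [ee] to 0 on elements constant along P, which is the pattern required by
    [quartic_coef]. *)
Let d f := P f / eps.
Let ee f := - P' f / (kap * eps).
Let nh f := Nh f / (pi * eps).
Let uh f := U1 f / pi.

Lemma der_d : der d.
Proof. by split=> [f g|f g]; rewrite /d ?(derD dP) ?(derM dP); field. Qed.

Lemma Ppi : P pi = m * pi. Proof. exact: P_pi. Qed.

Lemma d_uh f : P f = 0 -> d (uh f) = nh f.
Proof.
move=> Pf; rewrite /d /uh /nh (derM dP) (derV dP) PU1 Pf (der0 dU1) Ppi.
by field; rewrite pi0 e0.
Qed.

Lemma d_ee f : d (ee f) = - P' (P f) / (kap * eps ^+ 2).
Proof.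
rewrite /d /ee (derM dP) (derV dP) (derN dP) PP' (derM dP kap) Pkap Peps.
by field; rewrite kap0 e0.
Qed.

Lemma d_nh f : d (nh f) = Nh (P f) / (pi * eps ^+ 2) + ee f.
Proof.
rewrite /d /ee /nh (derM dP) (derV dP) PNh (derM dP pi) Ppi Peps /c /kap.
by field; rewrite pi0 e0 tx0.
Qed.

Lemma d_ee0 f : P f = 0 -> d (ee f) = 0.
Proof. by move=> Pf; rewrite d_ee Pf (der0 dP') oppr0 mul0r. Qed.
Lemma d_nh0 f : P f = 0 -> d (nh f) = ee f.
Proof. by move=> Pf; rewrite d_nh Pf (der0 dNh) mul0r add0r. Qed.
Lemma d_X f : d (X f) = X (d f) + (k1 - Q) * d f.
Proof. by rewrite /d (derM dX) (derV dX) XP Xeps; field. Qed.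

(** With e3 from [e3E], the equation U1 (e3 r) = 0 becomes an identity between the normalized
    derivatives of [ga0], polynomial in Q along [d]. Its leading coefficient forces [ee ga0] = 0,
    that is P' ga0 = 0, which is excluded. *)
Lemma obstruction2 : False.
Proof.
have P0g : P ga0 = 0.
  rewrite /ga0 /Th (derD dP) (derM dP) (P1 vP (K1K0 kP)) !PD.
  by rewrite (K1K0 kP).1 (K1K0 kP).2 kP'.1 kP'.2 (der0 dD); ring.
have P1g : P (X ga0) = 0 by rewrite -XP P0g (der0 dX).
have P2g : P (X (X ga0)) = 0 by rewrite -XP P1g (der0 dX).
have d0 f : P f = 0 -> d f = 0 by move=> h; rewrite /d h mul0r.
have Pbh : P bh = 0.
  by rewrite /bh (derD dP) (derM dP) Pk1 -XP P_b (der0 dX); ring.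
have PXbh : P (X bh) = 0 by rewrite -XP Pbh (der0 dX).
have dd := der_d.
(* The value of d (uh Q), shown below by differentiating [U1Q]. *)
pose z1 := ee Q1 + (Q - k1) * ee Q + bh.
have dQ : d Q = 1 by rewrite /d PQ divff.
have dQ1 : d Q1 = k1 - Q by rewrite /d PQ1; field.
have dk : d k1 = 0 := d0 _ Pk1.
have dz1 : d z1 = ee k1.
  rewrite /z1 (derD dd) (d0 _ Pbh) (derD dd) (derM dd) (derB dd) dQ dk !d_ee PQ PQ1.
  rewrite (derM dP') (derB dP') /ee.
  by field; rewrite kap0 e0.
have zeE : uh Q = nh Q1 - nh Q * (k1 - Q) + Q * bh + X bh - uh k1.
  by rewrite /uh U1Q /nh; field; rewrite pi0 e0.
have dze : d (uh Q) = z1.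
  rewrite zeE (derB dd) (derD dd _ (X bh)) (derD dd _ (Q * bh)) (derB dd (nh Q1)).
  rewrite (derM dd (nh Q)) (derM dd Q) (derB dd k1) dk dQ.
  rewrite (d_uh Pk1) (d0 _ Pbh) (d0 _ PXbh) !d_nh PQ PQ1 (derM dNh) (derB dNh) /z1 /nh.
  by field; rewrite pi0 e0.
pose gb := 2%:R * bh + ee Q1 + (Q - k1) * ee Q.
have gbE : gg = gb by rewrite /gg /gb /ee; field; rewrite kap0 e0.
have dgb : d gb = ee k1.
  have -> : gb = z1 + bh by rewrite /gb /z1; ring.
  by rewrite (derD dd z1) dz1 (d0 _ Pbh) addr0.
have := @quartic_coef K d Q Q1 k1 ga0 (X ga0) (X (X ga0))
  (uh ga0) (nh ga0) (ee ga0) (uh (X ga0)) (nh (X ga0)) (ee (X ga0))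
  (uh (X (X ga0))) (nh (X (X ga0))) (ee (X (X ga0))) (uh k1) (nh k1) (ee k1)
  (uh Q) z1 (X (uh Q)) (X z1) (X (ee k1)) gb dd dQ dQ1 dk (d0 _ P0g) (d0 _ P1g) (d0 _ P2g)
  (d_uh P0g) (d_nh0 P0g) (d_ee0 P0g) (d_uh P1g) (d_nh0 P1g) (d_ee0 P1g)
  (d_uh P2g) (d_nh0 P2g) (d_ee0 P2g) (d_uh Pk1) (d_nh0 Pk1) (d_ee0 Pk1) dze dz1.
have h1 : d (X (uh Q)) = X z1 + (k1 - Q) * z1 by rewrite d_X dze.
have h2 : d (X z1) = X (ee k1) + (k1 - Q) * ee k1 by rewrite d_X dz1.
have h3 : d (X (ee k1)) = 0 by rewrite d_X (d_ee0 Pk1) (der0 dX); ring.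
move=> /(_ h1 h2 h3 dgb) H.
suff /eqP : 6%:R * ee ga0 = 0.
  rewrite /ee mulf_eq0 (negPf (char0 5)) mulf_eq0 oppr_eq0 (negPf P'ga).
  by rewrite invr_eq0 mulf_eq0 (negPf kap0) (negPf e0).
apply: H; rewrite -gbE.
have := U1beta; rewrite (derM dU1) RE e3E.
set B0 := X (X ga0) - (k1 + Q) * X ga0 + (k1 * Q - Q1) * ga0 => hb.
have UB : U1 B0 = pi * gg * B0.
  rewrite -gE; move: hb; rewrite (derM dU1) (derV dU1) (derN dU1) (derM dU1 eps) => hb.
  have r1 : - (eps * kap) / r != 0.
    by rewrite mulf_neq0 ?oppr_eq0 ?mulf_neq0 ?invr_eq0.
  have hb' := congr1 (fun t => - (eps * kap) / r * t) hb.
  apply: (lin_eq hb'); field.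
  by rewrite kap0 e0 r0.
have XuhQ : X (uh Q) = uh Q1 - Q * uh Q.
  by rewrite /uh (derM dX) (derV dX) XU1 Xpi -/Q1; field.
rewrite XuhQ; apply: (mulfI pi0); apply: (lin_eq UB).
have -> : U1 B0 = U1 (X (X ga0)) - ((U1 k1 + U1 Q) * X ga0 + (k1 + Q) * U1 (X ga0))
  + ((U1 k1 * Q + k1 * U1 Q - U1 Q1) * ga0 + (k1 * Q - Q1) * U1 ga0).
  rewrite /B0 (derD dU1) (derB dU1 (X (X ga0))) (derM dU1 (k1 + Q)) (derD dU1 k1).
  by rewrite (derM dU1 (k1 * Q - Q1)) (derB dU1 (k1 * Q)) (derM dU1 k1).
rewrite /uh /B0; field.
by [].
Qed.
End Jacobi.
End Obstruction2.
End Obstruction.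
End NoN.
(** Each E_j contains exactly one V, with coefficient 1, so no V survives in the brackets. *)
Lemma E_E i j f : E i (E j f) - E j (E i f) =
  comb (E i (al j) - E j (al i)) (E i (rh j) - E j (rh i)) (E i (et j) - E j (et i)) f.
Proof.
rewrite /E /comb !(derD (dV _)) !(derD dU1) !(derD dU2) !(derD dU3) !(derM (dV _)) !(derM dU1)
  !(derM dU2) !(derM dU3) !VU1 !VU2 !VU3 !U21 !U31 !U32 (VV j i).
by ring.
Qed.

Lemma E_E_K0 i j : K0 (E i) -> K0 (E j) ->
  K0 (comb (E i (al j) - E j (al i)) (E i (rh j) - E j (rh i)) (E i (et j) - E j (et i))).
Proof.
move=> [i1 i2] [j1 j2]; split; rewrite -E_E ?i1 ?i2 ?j1 ?j2;
  by rewrite !(der0 (vf_der (vfE _))) subrr.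
Qed.

Lemma E_U1 j f : E j (U1 f) = U1 (E j f) + comb (- U1 (al j)) (- U1 (rh j)) (- U1 (et j)) f.
Proof.
by rewrite /E /comb !(derD dU1) !(derM dU1) VU1 U21 U31; ring.
Qed.

Lemma K1_kills W f : vf W -> K1 W -> [\/ f = y, f = z, f = X y | f = X z] -> W f = 0.
Proof. by move=> vW [[a b] c d] [] ->. Qed.

(** If no U1 (rh j) obstructs the chain, all V_j act on y, z, Xy, Xz as combinations of U1 and U2,
    against [R5]. Where one does, [E_j, E_(j+1)] is a combination of U1 and U2 in [K0], hence zero,
    and [obstruction0] applies. *)
Lemma core_k2 : (forall f, U3 f = 0) -> False.
Proof.
move=> U30; have noN c : ~ K0 (comb c 1 0) by exact: noN_U3.
have stuck : exists j, good j /\ U1 (rh j) != 0.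
  apply: contrapT => H.
  have g j : good j.
    elim: j => [|j IH]; first exact: good0.
    apply: good_next => //; last by move=> f; rewrite U30 mulr0.
    rewrite X_rhS//; have [->|ne] := eqVneq (U1 (rh j)) 0; first by rewrite mulr0 oppr0.
    by case: H; exists j.
  apply: (R5 vfU1 vfU2).
  - by exists 1, 0 => f _; ring.
  - by exists 0, 1 => f _; ring.
  - by exists 0, 0 => f _; rewrite U30; ring.
  - move=> j; exists (- al j), (- rh j) => f hf.
    have := K1_kills (vfE j) (goodK1 (g j)) hf; rewrite /E /comb U30 => h.
    by apply: (lin_eq h); ring.
have [j [g ne]] := stuck.
have kj := goodK1 g; have kj' := K1_next kj.
pose n := X (al j.+1) / X tau; pose n2 := - U1 (rh j).
have XE' f : X (E j.+1 f) = E j.+1 (X f) + X tau * comb n n2 0 f.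
  by rewrite X_E X_rhS// /comb U30 /n /n2; field.
apply: (@obstruction0 noN (E j) (E j.+1) (comb n n2 0) (- U1 (al j) - n) n n2) => //.
- exact: vfE.
- exact: vfE.
- exact: goodX.
- exact: E_D.
- by move=> f; rewrite E_U1 /comb U30 /n2; ring.
- by rewrite oppr_eq0.
- move=> f; have := E_E_K0 (K1K0 kj) kj'.
  set a := (X in comb X); set b := (X in comb _ X); set c := (X in comb _ _ X) => k0.
  have [a0 b0] : a = 0 /\ b = 0.
    by apply: (K0_span2 noN); move: k0; rewrite /K0 /comb !U30 !mulr0.
  by apply/eqP; rewrite -subr_eq0 E_E -/a -/b -/c a0 b0 /comb U30; apply/eqP; ring.
Qed.

(** * The case k = l = 3 *)

Section Core33.
Hypothesis V4 : forall j f, (3 < j)%N -> V j f = 0.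
Hypothesis P4 : forall W, vf W -> K0 W -> W (D y) + B * W (D z) = 0 -> W (X z) = 0.
Definition jet2 (f : K) : Prop := exists2 e, e = y \/ e = z &
  f = e \/ f = X e \/ f = D e \/ f = X (X e) \/ f = X (D e) \/ f = D (X e) \/ f = D (D e).
(** Independence of x, y, z, Tx, Ty, TTx, TTy: besides [X] and the differentials of Tx and TTx, the
    three fields [U1], [U2], [U3] do not suffice. *)
Hypothesis R7 : (forall j, exists c1 c2 c3, forall f, jet2 f -> V j f = comb c1 c2 c3 f) -> False.
Variables (u0 v0 u1 v1 d1 d2 d3 c0 c1 c2 c3 : K).
Hypothesis DE : forall f, D f = comb d1 d2 d3 f + c0 * V 0 f + c1 * V 1 f + c2 * V 2 f + c3 * V 3 f.
(** [u1] and [v1] are the first derivatives of u and v: in [D] they multiply the derivatives in u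
    and v themselves, which are U_3 and V_3 here. *)
Hypotheses (d3E : d3 = u1) (c3E : c3 = v1) (U1u1 : U1 u1 = 0) (U1v1 : U1 v1 = 0).

Lemma small_coefs : [/\ rh 1 = 0, et 1 = 0, et 2 = 0, rh 2 = al 1 & et 3 = al 1].
Proof.
have r1 : rh 1 = 0 by rewrite rhS /al /rh /= (der0 dD) subr0.
have t1 : et 1 = 0 by rewrite etS /et /rh /= (der0 dD) subr0.
have t2 : et 2 = 0 by rewrite etS r1 t1 (der0 dD) subr0.
have r2 : rh 2 = al 1 by rewrite rhS r1 (der0 dD) subr0.
by split=> //; rewrite etS r2 t2 (der0 dD) subr0.
Qed.

Lemma goods : [/\ good 0, good 1 & good 2].
Proof.
have [r1 t1 t2 r2 t3] := small_coefs.
have g1 : good 1.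
  apply: (good_next good0); first by rewrite r1 (der0 dX).
  by move=> f; rewrite t1 (der0 dX) mul0r.
split=> //; first exact: good0.
apply: (good_next g1); first by rewrite r2; case: g1.
by move=> f; rewrite t2 (der0 dX) mul0r.
Qed.

Lemma V_E j f : V j f = E j f - comb (al j) (rh j) (et j) f.
Proof. by rewrite /E addrK. Qed.

(** If N = U2 + c U1 were in [K0], it would commute with X, and [N, D] would put some U3 + b U1 in
    [K0] as well. As E_0, E_1, E_2 are good, only [U1] and [V 3] would then act on y, z, Xy, Xz,
    against [R5]. *)
Lemma noN33 c : ~ K0 (comb c 1 0).
Proof.
move=> kN; have [g0 g1 g2] := goods.
have [r1 t1 t2 r2 t3] := small_coefs.
have vN := vf_comb c 1 0.
have Xc : X c = 0.
  apply: (Xcoef_eq0 vN kN) => f; rewrite X_comb (der0 dX) (der1 dX) /comb; ring.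
have kN1 : K1 (comb c 1 0).
  by apply: K0_commX => // f; rewrite X_comb Xc (der0 dX) (der1 dX) /comb; ring.
pose b := c * U1 tau + U2 tau - D c - c * c.
have ND f : comb c 1 0 (D f) = D (comb c 1 0 f) + c * comb c 1 0 f + comb b 0 1 f.
  rewrite /comb !U1D !U2D !(derD dD) !(derM dD) (der0 dD) (der1 dD) /b; ring.
have vN2 := vf_comb b 0 1.
have kN2 : K0 (comb b 0 1).
  have [q1 q2] := P3 vN kN1; have [y1 z1] := kN.
  split; [move: q1; rewrite ND y1|move: q2; rewrite ND z1];
  by rewrite (der0 dD) mulr0 !add0r.
have Xb : X b = 0.
  by apply: (Xcoef_eq0 vN2 kN2) => f; rewrite X_comb (der0 dX) (der1 dX) /comb; ring.
have kN3 : K1 (comb b 0 1).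
  by apply: K0_commX => // f; rewrite X_comb Xb (der0 dX) (der1 dX) /comb; ring.
have eU2 f : [\/ f = y, f = z, f = X y | f = X z] -> U2 f = - c * U1 f.
  by move=> hf; have := K1_kills vN kN1 hf; rewrite /comb => h; apply: (lin_eq h); ring.
have eU3 f : [\/ f = y, f = z, f = X y | f = X z] -> U3 f = - b * U1 f.
  by move=> hf; have := K1_kills vN2 kN3 hf; rewrite /comb => h; apply: (lin_eq h); ring.
have eV j f : good j -> [\/ f = y, f = z, f = X y | f = X z] ->
    V j f = (rh j * c + et j * b - al j) * U1 f + 0 * V 3 f.
  move=> g hf; rewrite V_E (K1_kills (vfE j) (goodK1 g) hf) /comb eU2// eU3//; ring.
apply: (R5 vfU1 (vfV 3)).
- by exists 1, 0 => f _; ring.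
- by exists (- c), 0 => f hf; rewrite eU2//; ring.
- by exists (- b), 0 => f hf; rewrite eU3//; ring.
- case=> [|[|[|[|j]]]].
  + by eexists _, _ => f; exact: eV.
  + by eexists _, _ => f; exact: eV.
  + by eexists _, _ => f; exact: eV.
  + by exists 0, 1 => f _; ring.
  + by exists 0, 0 => f _; rewrite V4//; ring.
Qed.

Lemma E_comb j a b c f : E j (comb a b c f) = comb a b c (E j f) +
  comb (E j a - comb a b c (al j)) (E j b - comb a b c (rh j)) (E j c - comb a b c (et j)) f.
Proof.
rewrite /E /comb !(derD (dV _)) !(derD dU1) !(derD dU2) !(derD dU3) !(derM (dV _)) !(derM dU1)
  !(derM dU2) !(derM dU3) !VU1 !VU2 !VU3 !U21 !U31 !U32.
by ring.
Qed.

(** The chain breaks at E_3, because rh 2 = al 1. Now [E_2, E_3] may have a component s along U3,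
    namely E_2 (al 1), which X kills; [obstruction1] allows for it. *)
Lemma core33_B : U1 (al 1) != 0 -> False.
Proof.
move=> ne; have [g0 g1 g2] := goods; have [r1 t1 t2 r2 t3] := small_coefs.
have X1 : X (al 1) = 0 by case: g1.
have k2 := goodK1 g2; have k3 := K1_next k2.
pose n := X (al 3) / X tau; pose n2 := - U1 (rh 2).
have XE3 f : X (E 3 f) = E 3 (X f) + X tau * comb n n2 0 f.
  by rewrite X_E X_rhS// t3 X1 /comb /n /n2; field.
set ya := E 2 (al 3) - E 3 (al 2); set yb := E 2 (rh 3) - E 3 (rh 2).
set s := E 2 (et 3) - E 3 (et 2).
have sE : s = E 2 (al 1) by rewrite /s t3 t2 (der0 (vf_der (vfE _))) subr0.
have Xs : X s = 0 by rewrite sE (goodX g2) X1 (der0 (vf_der (vfE _))).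
apply: (@obstruction1 noN33 (E 2) (E 3) (comb n n2 0) (- U1 (al 2) - n) n n2 (fun=> erefl)
  (vfE 2) (vfE 3) k2 k3 (goodX g2) (E_D 2) _ _ XE3 (comb ya yb s) ya yb s (fun=> erefl) _ _ Xs).
- by move=> f; rewrite E_U1 t2 (der0 dU1) /comb /n2; ring.
- by rewrite oppr_eq0 r2.
- by move=> f; rewrite -E_E; ring.
- exact: E_E_K0 (K1K0 k2) k3.
- exists (E 2 ya - comb ya yb s (al 2)), (E 2 yb - comb ya yb s (rh 2)) => f.
  by rewrite E_comb t2 /comb !(der0 dU1) !(der0 dU2) !(der0 dU3); ring.
Qed.

Lemma U1_comb2 n n2 f : n2 != 0 -> U1 (comb n n2 0 f) = comb n n2 0 (U1 f)
  + U1 n2 / n2 * comb n n2 0 f + (U1 n - U1 n2 / n2 * n) * U1 f.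
Proof.
by move=> n20; rewrite /comb !(derD dU1) !(derM dU1) !U21 (der0 dU1); field.
Qed.

Lemma U1_comb3 a b r n n2 f : n2 != 0 -> r != 0 -> U1 (comb a b r f) = comb a b r (U1 f)
  + U1 r / r * comb a b r f
  + (U1 a - U1 r / r * a - (U1 b - U1 r / r * b) / n2 * n) * U1 f
  + (U1 b - U1 r / r * b) / n2 * comb n n2 0 f.
Proof.
move=> n20 r0; rewrite /comb !(derD dU1) !(derM dU1) !U21 !U31.
by field; rewrite r0 n20.
Qed.

(** Here E_3 is still good, and E_4 is a combination of U1, U2, U3 since V_4 = 0. Its U3 coefficient
    r is non-zero by [R7]. If E_4 commutes with X, it expresses U3 through U1 and U2 on y, z, Xy,
    Xz, against [R5]; otherwise [obstruction2] applies. *)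
Lemma core33_C : U1 (al 1) = 0 -> False.
Proof.
move=> sg0; have [g0 g1 g2] := goods; have [r1 t1 t2 r2 t3] := small_coefs.
have X1 : X (al 1) = 0 by case: g1.
have g3 : good 3.
  apply: (good_next g2); first by rewrite X_rhS// r2 sg0 mulr0 oppr0.
  by move=> f; rewrite t3 X1 mul0r.
have k3 := goodK1 g3; have k4 := K1_next k3.
have E4 f : E 4 f = comb (al 4) (rh 4) (et 4) f by rewrite /E V4// add0r.
have gj j : (j <= 3)%N -> good j by case: j => [|[|[|[|]]]].
set r := et 4.
have r0 : r != 0.
  apply/eqP => rz.
  have [a0 b0] : al 4 = 0 /\ rh 4 = 0.
    by apply: (K0_span2 noN33); move: k4; rewrite /K0 !E4 -/r rz.
  have E40 f : E 4 f = 0 by rewrite E4 a0 b0 -/r rz /comb; ring.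
  have kill0 j e : (j <= 4)%N -> e = y \/ e = z -> [/\ E j e = 0, E j (X e) = 0 & E j (D e) = 0].
    rewrite leq_eqVlt => /orP[/eqP->|]; first by move=> _; split; rewrite E40.
    move=> /gj g he; have k := goodK1 g; have [[h1 h2] h3 h4] := k.
    by have [h5 h6] := P3 (vfE j) k; case: he => ->.
  apply: R7 => j; have [j3|j3] := leqP j 3; last first.
    by exists 0, 0, 0 => f _; rewrite V4// /comb; ring.
  exists (- al j), (- rh j), (- et j) => f hf.
  have cX := goodX (gj _ j3).
  suff h : E j f = 0 by rewrite V_E h /comb; ring.
  case: hf => e he; have [h1 h2 h3] := kill0 j e (leqW j3) he.
  have [h4 h5 h6] := kill0 j.+1 e j3 he.
  have z0 := der0 dX; have z1 := der0 dD.
  case=> [->|[->|[->|[->|[->|[->|->]]]]]] //.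
  - by rewrite -cX h2.
  - by rewrite -cX h3.
  - by rewrite E_D h2 h5 z1 addr0.
  - by rewrite E_D h3 h6 z1 addr0.
have Xr : X r = 0.
  rewrite /r etS (derB dX) XD t3 X1 (der0 dD) sg0 mulr0 addr0 subr0.
  by rewrite X_rhS// r2 sg0 mulr0 oppr0.
have [a0|ne] := eqVneq (U1 (rh 3)) 0.
  have g4 : good 4.
    apply: (good_next g3); first by rewrite X_rhS// a0 mulr0 oppr0.
    by move=> f; rewrite -/r Xr mul0r.
  have kill f : [\/ f = y, f = z, f = X y | f = X z] -> E 4 f = 0.
    exact: K1_kills (vfE 4) (goodK1 g4).
  have eU3 f : [\/ f = y, f = z, f = X y | f = X z] ->
      U3 f = - al 4 / r * U1 f + - rh 4 / r * U2 f.
    by move=> hf; have := kill f hf; rewrite E4 -/r /comb => h; apply: (mulfI r0); apply: (lin_eq h); field.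
  apply: (R5 vfU1 vfU2).
  + by exists 1, 0 => f _; ring.
  + by exists 0, 1 => f _; ring.
  + by eexists _, _ => f; exact: eU3.
  + move=> j; have [j3|j3] := leqP j 3; last by exists 0, 0 => f _; rewrite V4//; ring.
    exists (et j * al 4 / r - al j), (et j * rh 4 / r - rh j) => f hf.
    rewrite V_E (K1_kills (vfE j) (goodK1 (gj _ j3)) hf) /comb eU3//.
    by field.
pose n := X (al 4) / X tau; pose n2 := - U1 (rh 3).
have XE4 f : X (E 4 f) = E 4 (X f) + X tau * comb n n2 0 f.
  by rewrite X_E (X_rhS g3) -/r Xr /comb /n /n2; field.
have n20 : n2 != 0 by rewrite oppr_eq0.
(* Chosen to cancel the U3 component of [E_3, E_4] - nu E_4, so that [K0_span2] makes the rest
   vanish. *)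
pose nu := (E 3 (et 4) - E 4 (et 3)) / r.
have E34 f : E 3 (E 4 f) = E 4 (E 3 f) + nu * E 4 f.
  set a := E 3 (al 4) - E 4 (al 3) - nu * al 4; set b := E 3 (rh 4) - E 4 (rh 3) - nu * rh 4.
  have key g : E 3 (E 4 g) - E 4 (E 3 g) - nu * E 4 g = comb a b 0 g.
    by rewrite E_E (E4 g) -/r /comb /a /b /nu -/r; field.
  have [a0 b0] : a = 0 /\ b = 0.
    apply: (K0_span2 noN33); have [y4 z4] := k4; have [y3 z3] := K1K0 k3.
    by rewrite /K0 -!key y4 z4 y3 z3 !(der0 (vf_der (vfE _))) mulr0 !subr0.
  by apply: (lin_eq (key f)); rewrite a0 b0 /comb; ring.
(* If E_4 killed X z, then [X, E_4] would kill z; so N would kill z, and y as well since the form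
   vanishes on N. *)
have nk4 : E 4 (X z) != 0.
  apply/eqP => h.
  have c4 : Th (comb n n2 0) = 0.
    have := C1 (vfE 4) k4; rewrite /Th /br !XE4 => e.
    apply: (mulfI tx0); rewrite mulr0 -[RHS]e; ring.
  have Nz : comb n n2 0 z = 0.
    apply: (mulfI tx0); rewrite mulr0.
    have := XE4 z; rewrite k4.2 (der0 dX) h add0r => e.
    by rewrite -e.
  have Ny : comb n n2 0 y = 0 by move: c4; rewrite /Th Nz mulr0 addr0.
  by have [_ e] := K0_span2 noN33 (conj Ny Nz); move/eqP: n20; apply.
have ga : E 4 (Th D) != 0.
  apply: contra_neq nk4 => h; apply: (P4 (vfE 4) k4).
  by rewrite -[RHS]h /Th (derD (vf_der (vfE 4))) (derM (vf_der (vfE 4))) (P1 (vfE 4) k4); ring.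
(* Coordinates of D with respect to U1, N, E_4 and E_0, ..., E_3, found from the U3 component
   down. *)
pose q3 := d3 - (c0 * et 0 + c1 * et 1 + c2 * et 2 + c3 * et 3).
pose q2 := d2 - (c0 * rh 0 + c1 * rh 1 + c2 * rh 2 + c3 * rh 3).
pose q1 := d1 - (c0 * al 0 + c1 * al 1 + c2 * al 2 + c3 * al 3).
pose e3 := q3 / r; pose e2 := (q2 - e3 * rh 4) / n2; pose e1 := q1 - e3 * al 4 - e2 * n.
pose R := U1 r / r; pose A := U1 n2 / n2; pose G := U1 n - A * n.
pose ph := (U1 (rh 4) - R * rh 4) / n2; pose pp := U1 (al 4) - R * al 4 - ph * n.
apply: (@obstruction2 noN33 (E 3) (E 4) (comb n n2 0) (- U1 (al 3) - n) n n2 (fun=> erefl)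
  (vfE 3) (vfE 4) k3 k4 (goodX g3) (E_D 3) _ n20 XE4 r nu e1 e2 e3
  (fun f => c0 * E 0 f + c1 * E 1 f + c2 * E 2 f + c3 * E 3 f) r0 E34 ga _ _ _ R A G pp ph).
- by move=> f; rewrite E_U1 t3 sg0 /comb /n2; ring.
- move=> f; rewrite DE !V_E (E4 f) -/r.
  rewrite /e1 /e2 /e3 /q1 /q2 /q3 /comb; field.
  by rewrite ?ne ?n20 ?r0.
- move=> f hf; rewrite !(K1_kills (vfE _) _ hf); [ring|exact: k3|exact: goodK1|exact: goodK1|exact: goodK1].
(* Among et 0, ..., et 3 only et 3 = al 1 may be non-zero, and U1 kills u1, v1 and al 1. *)
- have -> : e3 * r = u1 - v1 * al 1.
    rewrite /e3 /q3 t1 t2 t3 d3E c3E {1}/et /=.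
    by field.
  by rewrite (derB dU1) (derM dU1) U1u1 U1v1 sg0; ring.
- by rewrite /R; field.
- by move=> f; exact: U1_comb2.
- by move=> f; rewrite !E4 -/r; exact: U1_comb3.
Qed.

Lemma core_33 : False.
Proof. by have [/core33_C|/core33_B] := eqVneq (U1 (al 1)) 0. Qed.
End Core33.
End Core.

(** * Derivations on jets and the differentiated equation *)

(* [p i] and [q j] stand for the partial derivatives with respect to u_(k+2-i) and v_(l+2-j), acting on
   germs of functions of the jets of order (k+2, l+2) of (u, v), and T for the total derivative; [ord f]
   says that f depends on the jets of order (k, l) only. *)
Section Alg.
Variable K : fieldType.
Hypothesis char0 : forall n, n.+1%:R != 0 :> K.
Variables (p q : nat -> K -> K) (u v : nat -> K) (T : K -> K) (k l : nat).
Hypotheses (dp : forall i, der (p i)) (dq : forall j, der (q j)).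
Hypotheses (pp : forall i j f, p i (p j f) = p j (p i f)) (pq : forall i j f, p i (q j f) = q j (p i f))
  (qq : forall i j f, q i (q j f) = q j (q i f)).
Hypotheses (pu : forall i j, p i (u j) = ((i == j) && (i <= k.+2)%N)%:R) (pv : forall i j, p i (v j) = 0)
  (qu : forall i j, q i (u j) = 0) (qv : forall i j, q i (v j) = ((i == j) && (i <= l.+2)%N)%:R).
Hypotheses (p0 : forall i f, (k.+2 < i)%N -> p i f = 0) (q0 : forall j f, (l.+2 < j)%N -> q j f = 0).
Hypothesis k3 : (k <= 3)%N.
(** As k <= 3, the derivations p 1, ..., p 5 include all derivatives in u of order below k+2;
    surplus terms vanish by [p0]. *)
Hypothesis TE : forall f, T f = \sum_(i < 5) u i * p i.+1 f + \sum_(j < l.+2) v j * q j.+1 f.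

Definition co (d : K -> K) := (exists i, d = p i) \/ (exists j, d = q j).
Definition ord (f : K) := [/\ p 0 f = 0, p 1 f = 0, q 0 f = 0 & q 1 f = 0].

Lemma co_der d : co d -> der d.
Proof. by case=> -[i ->]. Qed.

Lemma der_sum (d : K -> K) n (F : 'I_n -> K) : der d -> d (\sum_i F i) = \sum_i d (F i).
Proof.
move=> dd; elim: n F => [|n IH] F; first by rewrite !big_ord0 (der0 dd).
by rewrite !big_ord_recl (derD dd) IH.
Qed.

Lemma T_der : der T.
Proof.
split=> a b; rewrite !TE.
  rewrite [RHS]addrACA -!big_split /=; congr (_ + _); apply: eq_bigr => i _.
    by rewrite (derD (dp _)); ring.
  by rewrite (derD (dq _)); ring.
rewrite mulrDl mulrDr addrACA !mulr_suml !mulr_sumr -!big_split /=; congr (_ + _); apply: eq_bigr => i _.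
  by rewrite (derM (dp _)); ring.
by rewrite (derM (dq _)); ring.
Qed.

Lemma sum_pick n (m : nat) (F : nat -> K) (b : bool) : ((n <= m)%N -> b -> F m = 0) ->
  \sum_(i < n) ((m == i) && b)%:R * F i = b%:R * F m.
Proof.
move=> h; have [mn|nm] := ltnP m n.
  rewrite (bigD1 (Ordinal mn))//= eqxx/= big1 ?addr0// => i im.
  by rewrite (_ : (m == i) = false) ?mul0r//; apply: contra_neqF im => /eqP e; apply: val_inj.
rewrite big1 => [|i _]; first by case: b h => [h|]; rewrite ?mul0r// h// mulr0.
by rewrite (_ : (m == i) = false) ?mul0r//; apply/negbTE; rewrite neq_ltn (leq_trans (ltn_ord i) nm) orbT.
Qed.

Lemma pT m f : p m (T f) = T (p m f) + p m.+1 f.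
Proof.
rewrite !TE (derD (dp m)) !(der_sum _ (dp m)).
under eq_bigr => i _ do rewrite (derM (dp m)) pu pp.
under [X in _ + X = _]eq_bigr => i _ do rewrite (derM (dp m)) pv mul0r add0r pq.
rewrite big_split/= (@sum_pick 5 m (fun i => p i.+1 f)).
  case: (leqP m k.+2) => mk; first by rewrite mul1r; ring.
  by rewrite mul0r add0r (p0 _ (leqW mk)) addr0.
by move=> m5 _; apply: p0; rewrite ltnS (leq_trans _ m5)// ltnS.
Qed.

Lemma qT m f : q m (T f) = T (q m f) + q m.+1 f.
Proof.
rewrite !TE (derD (dq m)) !(der_sum _ (dq m)).
under eq_bigr => i _ do rewrite (derM (dq m)) qu mul0r add0r -pq.
under [X in _ + X = _]eq_bigr => i _ do rewrite (derM (dq m)) qv qq.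
rewrite [X in _ + X = _]big_split/= (@sum_pick l.+2 m (fun i => q i.+1 f)).
  case: (leqP m l.+2) => mk; first by rewrite mul1r; ring.
  by rewrite mul0r add0r (q0 _ (leqW mk)) addr0.
by move=> m5 _; apply: q0; rewrite ltnS.
Qed.

Variable x : K.
Hypothesis (ox : ord x).
Definition sf := T x.
Variables (y z : K).
Hypotheses (oy : ord y) (oz : ord z).
Definition lam := T y - z * sf.

(** The chain rule for a function of (x, y, z, lambda) with partial derivatives f1, ..., f4, as the
    coordinate derivations see it. *)
Definition chain (f f1 f2 f3 f4 : K) :=
  forall d, co d -> d f = f1 * d x + f2 * d y + f3 * d z + f4 * d lam.
Definition f7 (i : 'I_7) : K := nth 0 [:: x; y; z; sf; T y; T sf; T (T y)] i.
Hypothesis indep : forall mu : 'I_7 -> K,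
  (forall d, co d -> \sum_i mu i * d (f7 i) = 0) -> forall i, mu i = 0.
(** Words record iterated partial derivatives of g and h: 0, 1, 2, 3 stand for x, y, z, lambda, and
    the head of the word is the derivative taken last. *)
Variables cg ch : seq nat -> K.
Hypotheses (chg : forall w, chain (cg w) (cg (0 :: w)%N) (cg (1 :: w)%N) (cg (2 :: w)%N) (cg (3 :: w)%N))
  (chh : forall w, chain (ch w) (ch (0 :: w)%N) (ch (1 :: w)%N) (ch (2 :: w)%N) (ch (3 :: w)%N)).
Hypothesis eqn : T z = ch nil + cg nil * sf.

Section Nonzero.
Hypothesis a0 : p 2 x != 0.
Let a := p 2 x.
(* x is taken as the coordinate replacing u_k: [Xf] is d/dx, and [red d] is the part of d tangent to the
   level sets of x.  On functions of order (k, l), T = Df + (T x) Xf + v_(l+1) Vf 0. *)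
Definition Xf (f : K) := a^-1 * p 2 f.
Definition red (d : K -> K) (f : K) := d f - d x * Xf f.
Definition Uf i := red (p i.+2).
Definition Vf j := red (q j.+2).
Definition Df f := \sum_(i < 3) u i.+2 * Uf i.+1 f + \sum_(j < l) v j.+2 * Vf j.+1 f.

Lemma X_der : der Xf.
Proof.
by split=> b c; rewrite /Xf; [rewrite (derD (dp 2))|rewrite (derM (dp 2))]; ring.
Qed.

Lemma Xx : Xf x = 1.
Proof. by rewrite /Xf mulVf. Qed.

Lemma p2E f : p 2 f = a * Xf f.
Proof. by rewrite /Xf mulVKf. Qed.

Lemma red_der d : der d -> der (red d).
Proof.
move=> dd; split=> b c; rewrite /red; [rewrite (derD dd) (derD X_der)|rewrite (derM dd) (derM X_der)]; ring.
Qed.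

Lemma red_x d : red d x = 0.
Proof. by rewrite /red Xx mulr1 subrr. Qed.

Lemma co_p i : co (p i). Proof. by left; exists i. Qed.
Lemma co_q j : co (q j). Proof. by right; exists j. Qed.

Lemma coC d d' f : co d -> co d' -> d (d' f) = d' (d f).
Proof. by case=> -[i ->] [[j ->]|[j ->]]; [exact: pp|exact: pq|rewrite pq|exact: qq]. Qed.

Lemma coX d f : co d -> d (Xf f) = Xf (d f) - Xf (d x) * Xf f.
Proof.
move=> cd; have dd := co_der cd.
have e1 : d (p 2 f) = a * Xf (d f) by rewrite (coC f cd (co_p 2)) p2E.
have e2 : d a = a * Xf (d x) by rewrite /a (coC x cd (co_p 2)) p2E.
have a1 : a != 0 by [].
rewrite {1}/Xf (derM dd) (derV dd) e1 e2 p2E; move: (Xf (d f)) (Xf (d x)) (Xf f) => b c e.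
by field.
Qed.

Lemma X_red d f : co d -> Xf (red d f) = red d (Xf f).
Proof.
move=> cd; rewrite /red (derB X_der) (derM X_der) (coX f cd); ring.
Qed.

(** With x in place of u_k among the coordinates, reduced derivations are combinations of coordinate
    fields with constant coefficients; in the original coordinates the expression is symmetric in d
    and d'. *)
Lemma red_red d d' f : co d -> co d' -> red d (red d' f) = red d' (red d f).
Proof.
have E e e' : co e -> co e' -> red e (red e' f) = e (e' f) - e (e' x) * Xf f
    - e' x * (Xf (e f) - Xf (e x) * Xf f) - e x * (Xf (e' f) - Xf (e' x) * Xf f - e' x * Xf (Xf f)).
  move=> ce ce'; have de := co_der ce.
  rewrite {1}/red (X_red f ce') /red (derB de) (derM de) (coX f ce) (coX f ce'); ring.
move=> cd cd'; rewrite (E _ _ cd cd') (E _ _ cd' cd) (coC f cd cd') (coC x cd cd'); ring.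
Qed.

Lemma X_u i : Xf (u i.+2) = (i == 0)%:R * a^-1.
Proof. by rewrite /Xf pu; case: i => [|i] /=; rewrite ?mulr1 ?mul1r ?mulr0 ?mul0r. Qed.
Lemma X_v i : Xf (v i) = 0.
Proof. by rewrite /Xf pv mulr0. Qed.

(* Every reduced derivation commutes with the U's and V's, so its commutator with D only involves the
   derivatives of the jet coordinates. *)
Lemma D_der : der Df.
Proof.
split=> b c; rewrite /Df.
  rewrite [RHS]addrACA -!big_split /=; congr (_ + _); apply: eq_bigr => i _.
    by rewrite /Uf (derD (red_der (dp _))); ring.
  by rewrite /Vf (derD (red_der (dq _))); ring.
rewrite mulrDl mulrDr addrACA !mulr_suml !mulr_sumr -!big_split /=; congr (_ + _); apply: eq_bigr => i _.
  by rewrite /Uf (derM (red_der (dp _))); ring.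
by rewrite /Vf (derM (red_der (dq _))); ring.
Qed.

Lemma W_D (W : K -> K) f : der W -> (forall d f, co d -> W (red d f) = red d (W f)) ->
  W (Df f) = Df (W f) + (\sum_(i < 3) W (u i.+2) * Uf i.+1 f + \sum_(j < l) W (v j.+2) * Vf j.+1 f).
Proof.
move=> dW cW; rewrite /Df (derD dW) !(der_sum _ dW).
under eq_bigr => i _ do rewrite (derM dW) /Uf (cW _ _ (co_p _)).
under [X in _ + X = _]eq_bigr => i _ do rewrite (derM dW) /Vf (cW _ _ (co_q _)).
by rewrite !big_split/= addrACA addrC.
Qed.

Lemma XD f : Xf (Df f) = Df (Xf f) + Xf (u 2) * Uf 1 f.
Proof.
rewrite (W_D f X_der); last by move=> d g; exact: X_red.
rewrite !big_ord_recl big_ord0 /= !X_u /= !mul0r !addr0 [X in _ + (_ + X)]big1 ?addr0// => j _.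
by rewrite X_v mul0r.
Qed.

Lemma red_u d i : red d (u i.+2) = d (u i.+2) - (i == 0)%:R * (d x * a^-1).
Proof. by rewrite /red X_u; ring. Qed.

Lemma U0 i f : (k < i)%N -> Uf i f = 0.
Proof. by move=> ki; rewrite /Uf /red !p0// mul0r subrr. Qed.
Lemma V0 j f : (l < j)%N -> Vf j f = 0.
Proof. by move=> lj; rewrite /Vf /red !q0// mul0r subrr. Qed.

Lemma sum_first n (c : K) (F : nat -> K) : (0 < n)%N ->
  \sum_(i < n) (i == 0 :> nat)%:R * c * F i = c * F 0%N.
Proof.
case: n => // n _; rewrite big_ord_recl /= mul1r big1 ?addr0// => i _.
by rewrite !mul0r.
Qed.

Lemma U_D m f : Uf m.+1 (Df f) = Df (Uf m.+1 f) + Uf m.+2 f + Uf m.+1 (u 2) * Uf 1 f.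
Proof.
rewrite (@W_D (Uf m.+1) f (red_der (dp m.+3))); last first.
  by move=> d g cd; exact: red_red (co_p _) cd.
rewrite [X in _ + (_ + X)]big1 ?addr0 => [|j _]; last by rewrite /Uf /red pv X_v mulr0 subrr mul0r.
rewrite -[RHS]addrA; congr (_ + _).
transitivity (\sum_(i < 3) (((m.+1 == i) && (m.+3 <= k.+2)%N)%:R * Uf i.+1 f) -
   \sum_(i < 3) ((i == 0 :> nat)%:R * (p m.+3 x * a^-1) * Uf i.+1 f)).
  rewrite -sumrB; apply: eq_bigr => i _.
  have e : Uf m.+1 (u i.+2) = p m.+3 (u i.+2) - (i == 0 :> nat)%:R * (p m.+3 x * a^-1) := red_u _ _.
  by rewrite [X in X * _]e pu mulrBl.
rewrite (@sum_pick 3 m.+1 (fun i => Uf i.+1 f)); last first.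
  by move=> m2 mk; apply: U0; apply: leq_ltn_trans k3 _.
rewrite (@sum_first 3 _ (fun i => Uf i.+1 f))//; congr (_ + _).
  case: (leqP m.+3 k.+2) => mk; first by rewrite mul1r.
  by rewrite mul0r U0//; exact: leqW.
have e : Uf m.+1 (u 2) = p m.+3 (u 2) - 1 * (p m.+3 x * a^-1) := red_u _ 0.
by rewrite e pu /= sub0r mul1r mulNr.
Qed.

Lemma V_D j f : Vf j (Df f) = Df (Vf j f) + Vf j.+1 f + Vf j (u 2) * Uf 1 f.
Proof.
rewrite (@W_D (Vf j) f (red_der (dq j.+2))); last first.
  by move=> d g cd; exact: red_red (co_q _) cd.
rewrite -[RHS]addrA; congr (_ + _).
have -> : \sum_(i < 3) Vf j (u i.+2) * Uf i.+1 f = Vf j (u 2) * Uf 1 f.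
  rewrite -[RHS](@sum_first 3 _ (fun i => Uf i.+1 f))//; apply: eq_bigr => i _; congr (_ * _).
  by rewrite /Vf !red_u !qu /= sub0r; case: (i : nat) => [|i'] /=; ring.
rewrite addrC; congr (_ + _).
transitivity (\sum_(i < l) (((j == i) && (j.+2 <= l.+2)%N)%:R * Vf i.+1 f)).
  apply: eq_bigr => i _; congr (_ * _).
  by rewrite /Vf /red X_v mulr0 subr0 qv.
rewrite (@sum_pick l j (fun i => Vf i.+1 f)); last by move=> lj _; apply: V0.
case: (leqP j.+2 l.+2) => jl; first by rewrite mul1r.
by rewrite mul0r V0//; exact: leqW.
Qed.

Lemma ord_T f : ord f -> T f = Df f + sf * Xf f + v 1 * Vf 0 f.
Proof.
have E g : ord g -> T g = u 1 * p 2 g + \sum_(i < 3) u i.+2 * p i.+3 g + (v 1 * q 2 g + \sum_(j < l) v j.+2 * q j.+3 g).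
  move=> [_ g1 _ g2]; rewrite TE !big_ord_recl big_ord0 /= g1 g2 !mulr0 !add0r addr0.
  by congr (_ + (_ + _)); rewrite addrA.
move=> of_; rewrite /sf (E f of_) (E x ox).
have -> : Df f = \sum_(i < 3) u i.+2 * p i.+3 f - (\sum_(i < 3) u i.+2 * p i.+3 x) * Xf f +
    (\sum_(j < l) v j.+2 * q j.+3 f - (\sum_(j < l) v j.+2 * q j.+3 x) * Xf f).
  rewrite /Df !mulr_suml -!sumrB; congr (_ + _); apply: eq_bigr => i _; first by rewrite /Uf /red; ring.
  by rewrite /Vf /red; ring.
rewrite /Vf /red p2E [p 2 x]p2E Xx; ring.
Qed.

Lemma ord_X f : ord f -> ord (Xf f).
Proof.
have Z d : co d -> d x = 0 -> d f = 0 -> d (Xf f) = 0.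
  by move=> cd dx df; rewrite (coX f cd) dx df (der0 X_der) mul0r subrr.
by case: ox => x0 x1 x2 x3 [f0 f1 f2 f3]; split; apply: Z => //; [exact: co_p|exact: co_p|exact: co_q|exact: co_q].
Qed.

Lemma ord_red d f : co d -> ord f -> ord (red d f).
Proof.
move=> cd of_; have [X0 X1 X2 X3] := ord_X of_.
have Z e : co e -> e x = 0 -> e f = 0 -> e (Xf f) = 0 -> e (red d f) = 0.
  move=> ce ex ef eX; have de := co_der ce; have dd := co_der cd.
  by rewrite /red (derB de) (derM de) (coC f ce cd) (coC x ce cd) ex ef eX !(der0 dd) mul0r mulr0 addr0 subrr.
case: ox of_ => x0 x1 x2 x3 [f0 f1 f2 f3].
by split; apply: Z => //; [exact: co_p|exact: co_p|exact: co_q|exact: co_q].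
Qed.

Lemma ord_D f : ord f -> ord (Df f).
Proof.
move=> of_; have oU i : ord (Uf i f) by exact: ord_red (co_p _) of_.
have oV j : ord (Vf j f) by exact: ord_red (co_q _) of_.
have Z e : der e -> (forall i, e (u i.+2) = 0) -> (forall j, e (v j.+2) = 0) ->
    (forall i, e (Uf i f) = 0) -> (forall j, e (Vf j f) = 0) -> e (Df f) = 0.
  move=> de eu ev eU eV; rewrite /Df (derD de) !(der_sum _ de) !big1 ?addr0// => i _.
    by rewrite (derM de) ev eV mul0r mulr0 addr0.
  by rewrite (derM de) eu eU mul0r mulr0 addr0.
split; apply: Z => // i; rewrite ?pu ?pv ?qu ?qv//; by [case: (oU i)|case: (oV i)].
Qed.


Lemma ord_pT f : ord f -> [/\ p 0 (T f) = 0, p 1 (T f) = p 2 f, q 0 (T f) = 0 & q 1 (T f) = q 2 f].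
Proof. by case=> f0 f1 f2 f3; rewrite !pT !qT f0 f1 f2 f3 !(der0 T_der) !add0r. Qed.



(** Wide enough to be stable under combinations with coefficients in K, yet retaining the chain rule
    on which the contact hypotheses rest. *)
Definition cder (W : K -> K) := der W /\
  forall f f1 f2 f3 f4, chain f f1 f2 f3 f4 -> W f = f1 * W x + f2 * W y + f3 * W z + f4 * W lam.
Definition vf (W : K -> K) := cder W /\ W x = 0.

Lemma co_cder d : co d -> cder d.
Proof. by move=> cd; split=> [|f f1 f2 f3 f4]; [exact: co_der|exact]. Qed.

Lemma cder_lin c W W' : cder W -> cder W' -> cder (fun f => W f + c * W' f).
Proof.
move=> [dW cW] [dW' cW']; split.
  by split=> f g; rewrite ?(derD dW) ?(derD dW') ?(derM dW) ?(derM dW'); ring.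
by move=> f f1 f2 f3 f4 h; rewrite (cW _ _ _ _ _ h) (cW' _ _ _ _ _ h); ring.
Qed.

Lemma eq_cder W W' : cder W -> W =1 W' -> cder W'.
Proof.
move=> [dW cW] e; split; first by split=> f g; rewrite -!e ?(derD dW) ?(derM dW).
by move=> f f1 f2 f3 f4 h; rewrite -!e; exact: cW.
Qed.

Lemma X_cder : cder Xf.
Proof.
split; first exact: X_der.
by move=> f f1 f2 f3 f4 h; rewrite /Xf (h _ (co_p 2)); ring.
Qed.

Lemma red_vf d : co d -> vf (red d).
Proof.
move=> cd; split; last exact: red_x.
by apply: eq_cder (cder_lin (- d x) (co_cder cd) X_cder) _ => f; rewrite /red mulNr.
Qed.
Lemma U_vf i : vf (Uf i). Proof. exact: red_vf (co_p _). Qed.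
Lemma V_vf j : vf (Vf j). Proof. exact: red_vf (co_q _). Qed.
Lemma vf_ext W W' : vf W -> W =1 W' -> vf W'.
Proof. by move=> [cW Wx] e; split; [exact: eq_cder cW e|rewrite -e]. Qed.
Lemma vf_lin c W W' : vf W -> vf W' -> vf (fun f => W f + c * W' f).
Proof. by move=> [cW Wx] [cW' W'x]; split; [exact: cder_lin|rewrite Wx W'x mulr0 addr0]. Qed.


(** If fewer than m vectors span the columns of the Jacobian of the first m functions, a non-zero
    vector of the left kernel is a relation that [indep] excludes. *)
Lemma no_span r m (vec : 'I_r -> 'I_7 -> K) : (m <= 7)%N -> (r < m)%N ->
  (forall d, co d -> exists c : 'I_r -> K, forall i : 'I_7, (i < m)%N -> d (f7 i) = \sum_b c b * vec b i) -> False.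
Proof.
move=> m7 rm h.
pose M : 'M[K]_(r, m) := \matrix_(b, i) vec b (widen_ord m7 i).
have : kermx M^T != 0.
  rewrite -mxrank_eq0 mxrank_ker -lt0n subn_gt0.
  by apply: leq_ltn_trans (rank_leq_col _) _.
case/rowV0Pn => w /sub_kermxP wM w0; case/negP: w0; apply/eqP.
pose mu (i : 'I_7) : K := if insub (i : nat) is Some j then w 0 (j : 'I_m) else 0.
have muE (j : 'I_m) : mu (widen_ord m7 j) = w 0 j by rewrite /mu /= valK.
have sumE (F : 'I_7 -> K) : \sum_i mu i * F i = \sum_(j < m) w 0 j * F (widen_ord m7 j).
  rewrite (bigID (fun i : 'I_7 => (i < m)%N)) /= [X in _ + X]big1 ?addr0; last first.
    by move=> i im; rewrite /mu insubN ?mul0r.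
  rewrite (big_ord_narrow m7) /=; apply: eq_bigr => j _; by rewrite muE.
have mu0 : forall i, mu i = 0.
  apply: indep => d cd; have [c hc] := h d cd; rewrite sumE.
  under eq_bigr => j _ do rewrite (hc (widen_ord m7 j) (ltn_ord j)) mulr_sumr.
  rewrite exchange_big big1 //= => b _.
  have E : \sum_j w 0 j * M^T j b = 0.
    by have : (w *m M^T) 0 b = 0 by [rewrite wM mxE]; rewrite mxE.
  rewrite (_ : \sum_(j < m) _ = c b * \sum_j w 0 j * M^T j b); first by rewrite E mulr0.
  by rewrite mulr_sumr; apply: eq_bigr => j _; rewrite !mxE mulrCA.
by apply/rowP => j; rewrite mxE -muE.
Qed.

Section Rank.
Hypotheses (V0y : Vf 0 y = 0) (V0z : Vf 0 z = 0).
Hypothesis P3 : forall W, vf W -> K1 Xf y z W -> W (Df y) = 0 /\ W (Df z) = 0.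

Lemma TyE : T y = Df y + sf * Xf y.
Proof. by rewrite (ord_T oy) V0y mulr0 addr0. Qed.

(** On functions of order (k, l) the derivations p 0, p 1, q 0, q 1 act as zero, which leaves these
    fields besides [Xf]. *)
Lemma co_cases (d : K -> K) (Q : (K -> K) -> Prop) : co d ->
  (Q (fun=> 0)) -> Q (Uf 1) -> Q (Uf 2) -> Q (Uf 3) -> (forall j, Q (Vf j)) ->
  exists c W, Q W /\ W x = 0 /\ forall f, ord f -> d f = c * Xf f + W f.
Proof.
move=> cd QZ Q1 Q2 Q3 QV; have xx e f : e f = e x * Xf f + red e f by rewrite /red addrC subrK.
have Z e : (forall f, ord f -> e f = 0) -> exists c W, Q W /\ W x = 0 /\ forall f, ord f -> e f = c * Xf f + W f.
  by move=> h; exists 0, (fun=> 0); split=> //; split=> // f of_; rewrite h// mul0r addr0.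
case: cd => -[i ->].
  case: i => [|[|[|[|[|[|i]]]]]].
  - by apply: Z => f [].
  - by apply: Z => f [].
  - by exists a, (fun=> 0); split=> //; split=> // f _; rewrite p2E addr0.
  - by exists (p 3 x), (Uf 1); split=> //; split; [exact: red_x|move=> f _; exact: xx].
  - by exists (p 4 x), (Uf 2); split=> //; split; [exact: red_x|move=> f _; exact: xx].
  - by exists (p 5 x), (Uf 3); split=> //; split; [exact: red_x|move=> f _; exact: xx].
  - by apply: Z => f _; apply: p0; rewrite !ltnS (leq_trans k3)// leq_addl.
case: i => [|[|j]].
- by apply: Z => f [].
- by apply: Z => f [].
- by exists (q j.+2 x), (Vf j); split=> //; split; [exact: red_x|move=> f _; exact: xx].
Qed.

Lemma R3 : prop1 (Uf 1) y z (Uf 2) -> prop1 (Uf 1) y z (Uf 3) -> (forall j, prop1 (Uf 1) y z (Vf j)) -> False.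
Proof.
move=> h2 h3 hV.
pose vec (b : 'I_2) (i : 'I_7) := (if b == 0 then Xf else Uf 1) (f7 i).
apply: (@no_span 2 3 vec) => // d cd.
have [|||||c [W [[c1 [Wy Wz]] [Wx dW]]]] := @co_cases d (prop1 (Uf 1) y z) cd; rewrite //.
- by exists 0; rewrite !mul0r.
- by exists 1; rewrite !mul1r.
exists (fun b : 'I_2 => if b == 0 then c else c1) => i i3.
rewrite !big_ord_recl big_ord0 /vec /= addr0.
have Ux : Uf 1 x = 0 by exact: red_x.
case: i i3 => -[|[|[|i]]] hi // _; rewrite /f7 /= dW//; first by rewrite Wx Ux mulr0.
- by rewrite Wy.
- by rewrite Wz.
Qed.

Lemma dTy d : co d -> d (T y) = d (Df y) + sf * d (Xf y) + d sf * Xf y.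
Proof. by move=> cd; have dd := co_der cd; rewrite TyE (derD dd) (derM dd); ring. Qed.

(** [P3] extends a relation on y, z, Xy, Xz to Dy, and Ty = Dy + Tx Xy. The differential of Tx joins
    [Xf], A1, A2 as a fourth vector, for five functions. *)
Lemma R5 A1 A2 : vf A1 -> vf A2 -> prop2 Xf y z A1 A2 (Uf 1) -> prop2 Xf y z A1 A2 (Uf 2) ->
  prop2 Xf y z A1 A2 (Uf 3) -> (forall j, prop2 Xf y z A1 A2 (Vf j)) -> False.
Proof.
move=> vA1 vA2 h1 h2 h3 hV.
pose L (W : K -> K) (i : 'I_7) := nth 0 [:: W x; W y; W z; 0; W (Df y) + sf * W (Xf y)] i.
pose vec (b : 'I_4) (i : 'I_7) := nth 0 [:: L Xf i; L A1 i; L A2 i; nth 0 [:: 0; 0; 0; 1; Xf y] i] b.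
apply: (@no_span 4 5 vec) => // d cd.
pose Q W := exists c1 c2, [/\ W y = c1 * A1 y + c2 * A2 y, W z = c1 * A1 z + c2 * A2 z,
   W (Xf y) = c1 * A1 (Xf y) + c2 * A2 (Xf y) & W (Df y) = c1 * A1 (Df y) + c2 * A2 (Df y)].
have Qp W : vf W -> prop2 Xf y z A1 A2 W -> Q W.
  move=> vW [c1 [c2 hc]]; exists c1, c2.
  have e1 : W y = c1 * A1 y + c2 * A2 y by apply: hc; constructor 1.
  have e2 : W z = c1 * A1 z + c2 * A2 z by apply: hc; constructor 2.
  have e3 : W (Xf y) = c1 * A1 (Xf y) + c2 * A2 (Xf y) by apply: hc; constructor 3.
  have e4 : W (Xf z) = c1 * A1 (Xf z) + c2 * A2 (Xf z) by apply: hc; constructor 4.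
  split=> //; have [|e _] := P3 (vf_lin (- c2) (vf_lin (- c1) vW vA1) vA2).
    by split; [split; rewrite ?e1 ?e2; ring|rewrite e3; ring|rewrite e4; ring].
  by apply/eqP; rewrite -subr_eq0 -e; apply/eqP; ring.
have [|||||c [W [[c1 [c2 [Wy Wz WX WD]]] [Wx dW]]]] := @co_cases d Q cd.
- by exists 0, 0; rewrite !mul0r addr0.
- exact: Qp (U_vf _) h1.
- exact: Qp (U_vf _) h2.
- exact: Qp (U_vf _) h3.
- by move=> j; exact: Qp (V_vf _) (hV j).
exists (fun b : 'I_4 => nth 0 [:: c; c1; c2; d sf] b) => i i5.
rewrite !big_ord_recl big_ord0 /vec /= addr0 /L.
have [_ A1x] := vA1; have [_ A2x] := vA2.
case: i i5 => -[|[|[|[|[|i]]]]] hi // _; rewrite /f7 /=.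
- by rewrite dW// Wx A1x A2x; ring.
- by rewrite dW// Wy; ring.
- by rewrite dW// Wz; ring.
- by ring.
- rewrite (dTy cd) (dW _ (ord_D oy)) (dW _ (ord_X oy)) WX WD; ring.
Qed.

Lemma V0K1 : K1 Xf y z (Vf 0).
Proof.
by split=> //; rewrite /Vf -(X_red _ (co_q 2)) -/(Vf 0) ?V0y ?V0z (der0 X_der).
Qed.

Lemma TTyE : T (T y) = Df (Df y) + sf * Xf (Df y) + T sf * Xf y + sf * (Df (Xf y) + sf * Xf (Xf y)).
Proof.
have [e1 _] := P3 (V_vf 0) V0K1; have [_ e2 _] := V0K1.
rewrite {1}TyE (derD T_der) (derM T_der) (ord_T (ord_D oy)) (ord_T (ord_X oy)) e1 e2; ring.
Qed.

(** By [TTyE] the differential of TTy only involves those of the elements of [jet2], of Tx and of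
    TTx: six vectors for seven functions. *)
Lemma R7 : (forall j, exists c1 c2 c3, forall f, jet2 Xf Df y z f -> Vf j f = comb (Uf 1) (Uf 2) (Uf 3) c1 c2 c3 f) -> False.
Proof.
move=> hV.
pose L (W : K -> K) (i : 'I_7) := nth 0 [:: W x; W y; W z; 0; W (Df y) + sf * W (Xf y); 0;
   W (Df (Df y)) + sf * (W (Xf (Df y)) + W (Df (Xf y))) + sf ^+ 2 * W (Xf (Xf y)) + T sf * W (Xf y)] i.
pose vec (b : 'I_6) (i : 'I_7) := nth 0 [:: L Xf i; L (Uf 1) i; L (Uf 2) i; L (Uf 3) i;
  nth 0 [:: 0; 0; 0; 1; Xf y; 0; Xf (Df y) + Df (Xf y) + sf * Xf (Xf y) *+ 2] i;
  nth 0 [:: 0; 0; 0; 0; 0; 1; Xf y] i] b.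
apply: (@no_span 6 7 vec) => // d cd; have dd := co_der cd.
pose Q W := exists c1 c2 c3, forall f, jet2 Xf Df y z f -> W f = comb (Uf 1) (Uf 2) (Uf 3) c1 c2 c3 f.
have [|||||c [W [[c1 [c2 [c3 hW]]] [Wx dW]]]] := @co_cases d Q cd.
- by exists 0, 0, 0 => f _; rewrite /comb !mul0r !addr0.
- by exists 1, 0, 0 => f _; rewrite /comb !mul0r !addr0 mul1r.
- by exists 0, 1, 0 => f _; rewrite /comb !mul0r !addr0 mul1r add0r.
- by exists 0, 0, 1 => f _; rewrite /comb !mul0r !add0r mul1r.
- exact: hV.
exists (fun b : 'I_6 => nth 0 [:: c; c1; c2; c3; d sf; d (T sf)] b) => i _.
rewrite !big_ord_recl big_ord0 /vec /= addr0 /L.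
have Ux j : Uf j x = 0 by exact: red_x.
have jy f : f = y \/ f = Xf y \/ f = Df y \/ f = Xf (Xf y) \/ f = Xf (Df y) \/ f = Df (Xf y) \/ f = Df (Df y) ->
    d f = c * Xf f + (c1 * Uf 1 f + c2 * Uf 2 f + c3 * Uf 3 f).
  move=> hf; rewrite dW; first by rewrite hW//; exists y; [left|].
  have [o1 o2] := (ord_X oy, ord_D oy).
  by case: hf => [->|[->|[->|[->|[->|[->|->]]]]]]; [| | |exact: ord_X|exact: ord_X|exact: ord_D|exact: ord_D].
case: i => -[|[|[|[|[|[|[|i]]]]]]] hi //; rewrite /f7 /=.
- by rewrite dW// Wx !Ux; ring.
- by rewrite jy; [ring|left].
- by rewrite dW// hW; [rewrite /comb; ring|exists z; [right|left]].
- by ring.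
- by rewrite (dTy cd) (jy (Df y)); [rewrite (jy (Xf y)); [ring|right; left]|right; right; left].
- by ring.
- have ex (A B C E F G : K) : d (A + sf * B + G * C + sf * (E + sf * F)) = d A + sf * (d B + d E)
      + sf ^+ 2 * d F + d sf * (B + E + sf * F *+ 2) + d G * C + G * d C.
    rewrite !(derD dd) !(derM dd) (derD dd) (derM dd); ring.
  rewrite TTyE ex (jy (Df (Df y))); last by do 6 right.
  rewrite (jy (Xf (Df y))); last by do 4 right; left.
  rewrite (jy (Df (Xf y))); last by do 5 right; left.
  rewrite (jy (Xf (Xf y))); last by do 3 right; left.
  rewrite (jy (Xf y)); last by right; left.
  ring.
Qed.
End Rank.


Let g := cg nil. Let g4 := cg [:: 3]%N. Let g44 := cg [:: 3; 3]%N. Let g444 := cg [:: 3; 3; 3]%N.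
Let h4 := ch [:: 3]%N. Let h44 := ch [:: 3; 3]%N. Let h444 := ch [:: 3; 3; 3]%N.
Hypothesis g40 : g4 != 0.


(* [d] differentiates with respect to the coordinate next above the one of [e] *)
Definition top (d e : K -> K) := (d = p 1 /\ e = p 2) \/ (d = q 1 /\ e = q 2).

Lemma top_facts d e : top d e -> [/\ co d, co e, forall f, ord f -> d f = 0 & forall f, ord f -> d (T f) = e f].
Proof.
by case=> -[-> ->]; (split; [exact: co_p || exact: co_q|exact: co_p || exact: co_q|by move=> f []|
  by move=> f /ord_pT[]]).
Qed.

(** Value of omega^1 = dy - z dx on e. *)
Definition con (e : K -> K) := e y - z * e x.

Lemma top_lam d e : top d e -> d sf = e x /\ d lam = con e.
Proof.
move=> de; have [cd ce d0 dT] := top_facts de; have dd := co_der cd.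
split; first exact: dT.
by rewrite /lam (derB dd) (derM dd) (dT _ oy) (d0 _ oz) (dT _ ox) /con; ring.
Qed.

Lemma top_c d e w : top d e -> d (cg w) = cg (3 :: w)%N * con e /\ d (ch w) = ch (3 :: w)%N * con e.
Proof.
move=> de; have [cd ce d0 dT] := top_facts de; have [_ dl] := top_lam de.
by rewrite (chg w cd) (chh w cd) dl !d0// !mulr0 !add0r.
Qed.

(** Apply d to (E): z has order (k, l), so d (T z) = e z, while lambda contributes con e and Tx
    contributes e x. *)
Lemma first_order d e : top d e -> e z = (h4 + g4 * sf) * con e + g * e x.
Proof.
move=> de; have [cd ce d0 dT] := top_facts de; have dd := co_der cd.
have [ds _] := top_lam de; have [dg dh] := top_c nil de.
by rewrite -(dT _ oz) eqn (derD dd) (derM dd) dg dh ds -/g4 -/h4 -/g; ring.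
Qed.

Lemma ord_co d f : co d -> ord f -> ord (d f).
Proof.
move=> cd [f0 f1 f2 f3]; have dd := co_der cd.
split; first by rewrite -(coC f cd (co_p 0)) f0 (der0 dd).
- by rewrite -(coC f cd (co_p 1)) f1 (der0 dd).
- by rewrite -(coC f cd (co_q 0)) f2 (der0 dd).
- by rewrite -(coC f cd (co_q 1)) f3 (der0 dd).
Qed.

(** Second derivative in lambda of h + g s at s = Tx. *)
Definition H := h44 + g44 * sf.

(** Apply d' to [first_order]: e x, e y, e z have order (k, l) and are killed, so d' only acts
    through lambda and Tx. *)
Lemma second_order d e d' e' : top d e -> top d' e' ->
  H * con e' * con e + g4 * (e' x * con e + con e' * e x) = 0.
Proof.
move=> de de'; have [cd ce d0 dT] := top_facts de; have [cd' ce' d0' dT'] := top_facts de'.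
have dd := co_der cd'; have E := first_order de.
have [ds _] := top_lam de'; have [dg dh] := top_c nil de'; have [dg4 dh4] := top_c [:: 3]%N de'.
have ze : d' (e z) = 0 by apply: d0'; exact: ord_co.
have ye : d' (e y) = 0 by apply: d0'; exact: ord_co.
have xe : d' (e x) = 0 by apply: d0'; exact: ord_co.
move: ze; rewrite E (derD dd) !(derM dd) (derD dd) (derM dd) /con (derB dd) (derM dd) ye xe (d0' _ oz).
rewrite ds dg -/g4 dg4 dh4 -/g44 -/h44 /H /con => e0.
by rewrite -[RHS]e0 -/(con e); ring.
Qed.

Definition fnc (f : K) := exists f1 f2 f3 f4, chain f f1 f2 f3 f4.

Lemma fnc_cg w : fnc (cg w). Proof. by do 4 eexists; exact: chg. Qed.
Lemma fnc_ch w : fnc (ch w). Proof. by do 4 eexists; exact: chh. Qed.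
Lemma fncD f f' : fnc f -> fnc f' -> fnc (f + f').
Proof.
move=> [f1 [f2 [f3 [f4 c]]]] [e1 [e2 [e3 [e4 c']]]].
exists (f1 + e1), (f2 + e2), (f3 + e3), (f4 + e4) => d cd.
rewrite (derD (co_der cd)) (c _ cd) (c' _ cd); ring.
Qed.
Lemma fncM f f' : fnc f -> fnc f' -> fnc (f * f').
Proof.
move=> [f1 [f2 [f3 [f4 c]]]] [e1 [e2 [e3 [e4 c']]]].
exists (f1 * f' + f * e1), (f2 * f' + f * e2), (f3 * f' + f * e3), (f4 * f' + f * e4) => d cd.
rewrite (derM (co_der cd)) (c _ cd) (c' _ cd); ring.
Qed.
Lemma fnc_nat n : fnc n%:R.
Proof. by exists 0, 0, 0, 0 => d cd; rewrite (der_nat (co_der cd)) !mul0r !addr0. Qed.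
Lemma fncN f : fnc f -> fnc (- f).
Proof.
move=> [f1 [f2 [f3 [f4 c]]]]; exists (- f1), (- f2), (- f3), (- f4) => d cd.
rewrite (derN (co_der cd)) (c _ cd); ring.
Qed.

Lemma d_lam d : co d -> d lam = d (T y) - z * d sf - sf * d z.
Proof. by move=> cd; have dd := co_der cd; rewrite /lam (derB dd) (derM dd); ring. Qed.

Lemma indep5 c1 c2 c3 c4 c5 : (forall d, co d -> c1 * d x + c2 * d y + c3 * d z + c4 * d lam + c5 * d sf = 0) ->
  [/\ c1 = 0, c2 = 0, c3 = 0, c4 = 0 & c5 = 0].
Proof.
move=> h.
have mu0 := @indep (fun i => nth 0 [:: c1; c2; c3 - sf * c4; c5 - z * c4; c4] i) _.
have {mu0}M : forall i : 'I_7, nth 0 [:: c1; c2; c3 - sf * c4; c5 - z * c4; c4] i = 0.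
  apply: mu0 => d cd; rewrite -[RHS](h d cd) !big_ord_recl big_ord0 /f7 /= (d_lam cd); ring.
have e4 := M (@Ordinal 7 4 isT); have e3 := M (@Ordinal 7 3 isT); have e2 := M (@Ordinal 7 2 isT).
have e1 := M (@Ordinal 7 1 isT); have e0 := M (@Ordinal 7 0 isT).
by move: e0 e1 e2 e3 e4 => /= -> -> + + e4; rewrite e4 !mulr0 !subr0.
Qed.

(** The differential of Tx is independent of those of x, y, z and lambda, so its coefficient B in
    the differentiated relation must vanish. *)
Lemma fnc_lin A B : fnc A -> fnc B -> A + B * sf = 0 -> A = 0 /\ B = 0.
Proof.
move=> [a1 [a2 [a3 [a4 cA]]]] [b1 [b2 [b3 [b4 cB]]]] AB.
have [|_ _ _ _ B0] := @indep5 (a1 + sf * b1) (a2 + sf * b2) (a3 + sf * b3) (a4 + sf * b4) B.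
  move=> d cd; have dd := co_der cd; have := congr1 d AB.
  by rewrite (der0 dd) (derD dd) (derM dd) (cA _ cd) (cB _ cd) => e; rewrite -[RHS]e; ring.
by move: AB; rewrite B0 mul0r addr0.
Qed.

Lemma chain0 A a1 a2 a3 a4 : chain A a1 a2 a3 a4 -> A = 0 -> [/\ a1 = 0, a2 = 0, a3 = 0 & a4 = 0].
Proof.
move=> cA A0; have [|-> -> -> ->] := @indep5 a1 a2 a3 a4 0; last by [].
by move=> d cd; rewrite mul0r addr0 -(cA _ cd) A0 (der0 (co_der cd)).
Qed.

(* coefficients of omega and of its exterior derivative; [Jk] is the (x, y, z) component of
   d omega /\ omega *)
Definition qk := g44 * h4 - g4 * h44.
Definition om0 := - 2 * g4 ^+ 2 - z * qk + g44 * g.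
Definition qd i := cg [:: i; 3; 3]%N * h4 + g44 * ch [:: i; 3]%N - cg [:: i; 3]%N * h44 - g4 * ch [:: i; 3; 3]%N.
Definition om0d i := - 4 * g4 * cg [:: i; 3]%N - (i == 2)%N%:R * qk - z * qd i + cg [:: i; 3; 3]%N * g + g44 * cg [:: i]%N.
Definition Jk := (qd 0%N - om0d 1%N) * - g44 + (- cg [:: 1; 3; 3]%N - qd 2%N) * om0 + (om0d 2%N + cg [:: 0; 3; 3]%N) * qk.

Definition Sk := 2 * g4 * g444 - 3 * g44 ^+ 2.
Definition Tk := 2 * g4 * h444 - 3 * g44 * h44.

Let t1 : top (p 1) (p 2). Proof. by left. Qed.
Let t2 : top (q 1) (q 2). Proof. by right. Qed.
(** Value of omega^1 on [Xf]; whether it vanishes decides which of omega^1 and omega annihilates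
    [Xf]. *)
Let m := Xf y - z.

Lemma two0 : 2 != 0 :> K. Proof. exact: (char0 1). Qed.

Lemma con1 : con (p 2) = a * m.
Proof. by rewrite /con p2E /m -/a; ring. Qed.

Lemma XzE : Xf z = (h4 + g4 * sf) * m + g.
Proof. by rewrite {1}/Xf (first_order t1) con1 -/a; have a1 : a != 0 by []; field. Qed.

Lemma V0facts : con (q 2) = q 2 x * m -> Vf 0 y = 0 /\ Vf 0 z = 0.
Proof.
move=> e; rewrite /Vf /red XzE (first_order t2) e; split; last by ring.
by move: e; rewrite /con /m => /(canRL (subrK _)) ->; ring.
Qed.

(** * The case where omega^1 annihilates X *)

Section Case1.
Hypothesis m0 : m = 0.
Let Xy : Xf y = z. Proof. by apply/eqP; rewrite -subr_eq0 -/m m0. Qed.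

Lemma case1_V0 : Vf 0 y = 0 /\ Vf 0 z = 0.
Proof.
apply: V0facts; rewrite m0 mulr0; have := second_order t1 t2.
rewrite con1 m0 !mulr0 !add0r => /eqP; rewrite mulf_eq0 (negbTE g40) /= mulf_eq0 (negbTE a0) orbF.
by move/eqP.
Qed.

Let lamE : lam = Df y.
Proof. by have [e _] := case1_V0; rewrite /lam TyE// Xy; ring. Qed.

Let XzE1 : Xf z = g. Proof. by rewrite XzE m0 mulr0 add0r. Qed.

Let DzE : Df z = ch nil.
Proof.
have [_ e] := case1_V0; have := ord_T oz; rewrite e mulr0 addr0 eqn XzE1 -/g.
by rewrite mulrC => /addIr.
Qed.

Let Wc W w : vf W -> W y = 0 -> W z = 0 -> W (cg w) = cg (3 :: w)%N * W (Df y) /\ W (ch w) = ch (3 :: w)%N * W (Df y).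
Proof.
move=> [[_ cW] Wx] Wy Wz.
by rewrite (cW _ _ _ _ _ (chg w)) (cW _ _ _ _ _ (chh w)) Wx Wy Wz !mulr0 !add0r lamE.
Qed.

Lemma case1_P3 W : vf W -> K1 Xf y z W -> W (Df y) = 0 /\ W (Df z) = 0.
Proof.
move=> vW [[Wy Wz] _ WXz]; have [e1 e2] := Wc nil vW Wy Wz.
have L0 : W (Df y) = 0.
  by move: WXz; rewrite XzE1 e1 => /eqP; rewrite mulf_eq0 (negbTE g40) => /eqP.
by rewrite DzE e2 L0 mulr0.
Qed.

Lemma case1_P4 W : vf W -> K0 y z W -> W (Df y) + 0 * W (Df z) = 0 -> W (Xf z) = 0.
Proof.
move=> vW [Wy Wz]; rewrite mul0r addr0 => L0; have [e1 _] := Wc nil vW Wy Wz.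
by rewrite XzE1 e1 L0 mulr0.
Qed.

Lemma case1_P2 W : vf W -> K0 y z W -> W (Xf y) + 0 * W (Xf z) = 0.
Proof. by move=> _ [_ Wz]; rewrite Xy Wz mul0r addr0. Qed.

(** Non-integrability of dy - z dx: since X y = z, the bracket of X with W sends y to - W z once W y
    = 0. *)
Lemma case1_P5 W : vf W -> Th y z 0 W = 0 -> Th y z 0 (br Xf W) = 0 -> K0 y z W.
Proof.
move=> _; rewrite /Th !mul0r !addr0 /br => Wy; rewrite Wy (der0 X_der) Xy sub0r => /eqP.
by rewrite oppr_eq0 => /eqP.
Qed.
End Case1.

(** * The case where omega annihilates X *)

Section Case2.
Hypothesis m0 : m != 0.

(** [second_order] with both pairs equal to (p 1, p 2), freed of the factor a ^ 2 m. *)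
Lemma Hm : H * m = - 2 * g4.
Proof.
have := second_order t1 t1; rewrite con1 -/a => e; have a1 : a != 0 by [].
apply: (mulfI (mulf_neq0 (mulf_neq0 a1 a1) m0)); apply/eqP; rewrite -subr_eq0 -[X in _ == X]e; apply/eqP; ring.
Qed.

Lemma H0 : H != 0.
Proof.
apply/eqP => h; have := Hm; rewrite h mul0r => /esym/eqP.
by rewrite mulf_eq0 oppr_eq0 (negbTE two0) (negbTE g40).
Qed.

Lemma case2_V0 : Vf 0 y = 0 /\ Vf 0 z = 0.
Proof.
apply: V0facts; have := second_order t1 t2; rewrite con1 -/a => e; have a1 : a != 0 by [].
apply: (mulfI (mulf_neq0 a1 g40)); apply/eqP; rewrite -subr_eq0; apply/eqP.
have -> : a * g4 * con (q 2) - a * g4 * (q 2 x * m) = - (H * con (q 2) * (a * m) + g4 * (q 2 x * (a * m) + con (q 2) * a))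
   + con (q 2) * a * (H * m + 2 * g4) by ring.
by rewrite e Hm; ring.
Qed.

Definition H' := h444 + g444 * sf.

Lemma ord_m : ord m.
Proof.
have oX := ord_X oy; have Z d : co d -> d (Xf y) = 0 -> d z = 0 -> d m = 0.
  by move=> cd e1 e2; rewrite /m (derB (co_der cd)) e1 e2 subrr.
by case: oX oz => x0 x1 x2 x3 [z0 z1 z2 z3]; split; apply: Z => //; [exact: co_p|exact: co_p|exact: co_q|exact: co_q].
Qed.

(** Apply p 1 once more to [Hm]; m has order (k, l), so it is killed. *)
Lemma H'm : H' * m = - 3 * g44.
Proof.
have [cd _ d0 _] := top_facts t1; have dd := co_der cd; have [ds _] := top_lam t1.
have [dg4 _] := top_c [:: 3]%N t1; have [dg44 dh44] := top_c [:: 3; 3]%N t1.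
have := congr1 (p 1) Hm; rewrite !(derM dd) (derN dd) (der_nat dd) /H (derD dd) (derM dd) dg4 dg44 dh44 ds (d0 _ ord_m).
rewrite con1 -/a -/g444 -/h444 -/g44 => e; have a1 : a != 0 by [].
apply: (mulfI (mulf_neq0 a1 m0)); apply/eqP; rewrite -subr_eq0; apply/eqP.
have e' : (h444 * (a * m) + (g444 * (a * m) * sf + g44 * a)) * m + 2 * g44 * (a * m) = 0.
  by move/eqP: e; rewrite -subr_eq0 => /eqP e; rewrite -[RHS]e; ring.
by rewrite -[RHS]e' /H'; ring.
Qed.

(** The values of H m and H' m give (Tk + Sk s) m = 2 g4 (H' m) - 3 g44 (H m) = 0 with s = Tx, and
    [fnc_lin] separates the two coefficients. *)
Lemma ST0 : Sk = 0 /\ Tk = 0.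
Proof.
have fS : fnc Sk.
  rewrite /Sk expr2; apply: fncD; first by apply: fncM; [apply: fncM; [exact: (fnc_nat 2)|exact: fnc_cg]|exact: fnc_cg].
  by apply: fncN; apply: fncM; [exact: (fnc_nat 3)|apply: fncM; exact: fnc_cg].
have fT : fnc Tk.
  apply: fncD; first by apply: fncM; [apply: fncM; [exact: (fnc_nat 2)|exact: fnc_cg]|exact: fnc_ch].
  by apply: fncN; apply: fncM; [apply: fncM; [exact: (fnc_nat 3)|exact: fnc_cg]|exact: fnc_ch].
have [] := fnc_lin fT fS; last by [].
apply: (mulIf m0); rewrite mul0r.
have -> : (Tk + Sk * sf) * m = 2 * g4 * (H' * m) - 3 * g44 * (H * m) by rewrite /Tk /Sk /H /H'; ring.
by rewrite H'm Hm; ring.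
Qed.

Lemma lamE2 : lam = Df y + m * sf.
Proof. by have [e _] := case2_V0; rewrite /lam TyE// /m; ring. Qed.

Lemma DzE2 : Df z = ch nil + g * sf - sf * Xf z.
Proof. by have [_ e] := case2_V0; rewrite -[g * sf]/(cg nil * sf) -eqn (ord_T oz) e; ring. Qed.

(* Subtracting from W the multiple of d/ds that kills s does not change W on functions of order (k, l). *)
Lemma K0_facts W : vf W -> K0 y z W -> exists L,
  [/\ W (Df y) = L - W (Xf y) * sf, W (Xf z) = (h4 + g4 * sf) * W (Xf y) - g4 * L,
      H * W (Xf y) = g44 * L & W (Df z) = (h4 + g4 * sf) * L - sf * W (Xf z)].
Proof.
move=> [cW Wx] [Wy Wz].
pose W1 f := W f + (- (W sf / a)) * p 1 f.
have c1 : cder W1 by apply: cder_lin => //; exact: co_cder (co_p 1).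
have d1 := c1.1; have W1o f : ord f -> W1 f = W f by move=> [_ e _ _]; rewrite /W1 e mulr0 addr0.
have [ds _] := top_lam t1; have a1 : a != 0 by [].
have W1s : W1 sf = 0 by rewrite /W1 ds -/a mulNr divfK// subrr.
pose L := W1 lam.
have W1c w : W1 (cg w) = cg (3 :: w)%N * L /\ W1 (ch w) = ch (3 :: w)%N * L.
  by rewrite (c1.2 _ _ _ _ _ (chg w)) (c1.2 _ _ _ _ _ (chh w)) (W1o _ ox) (W1o _ oy) (W1o _ oz) Wx Wy Wz !mulr0 !add0r.
have [g_ h_] := W1c nil; have [g4_ h4_] := W1c [:: 3]%N; have [g44_ h44_] := W1c [:: 3; 3]%N.
have oX := ord_X oy; have oD := ord_D oy; have oXz := ord_X oz; have oDz := ord_D oz.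
have mE : W1 m = W (Xf y) by rewrite (W1o _ ord_m) /m (derB cW.1) Wz subr0.
have LE : L = W (Df y) + W (Xf y) * sf.
  by rewrite /L lamE2 (derD d1) (derM d1) mE W1s mulr0 addr0 (W1o _ oD).
have XzW : W (Xf z) = (h4 + g4 * sf) * W (Xf y) + (H * m + g4) * L.
  rewrite -(W1o _ oXz) XzE (derD d1) (derM d1) (derD d1) (derM d1) g_ g4_ h4_ mE W1s /H -/g4 -/g44 -/h44; ring.
have HmW : H' * L * m + H * W (Xf y) = - 2 * g44 * L.
  have := congr1 W1 Hm; rewrite !(derM d1) (derN d1) (der_nat d1) /H (derD d1) (derM d1) g4_ g44_ h44_ W1s mE.
  rewrite -/g444 -/h444 -/g44 => /eqP; rewrite -subr_eq0 => /eqP e; apply/eqP; rewrite -subr_eq0 -[X in _ == X]e /H /H'.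
  by apply/eqP; ring.
exists L; split.
- by rewrite LE; ring.
- by rewrite XzW Hm; ring.
- apply/eqP; rewrite -subr_eq0; apply/eqP.
  have -> : H * W (Xf y) - g44 * L = H' * L * m + H * W (Xf y) - H' * m * L - g44 * L by ring.
  by rewrite HmW H'm; ring.
- rewrite -(W1o _ oDz) DzE2 (derB d1) (derD d1) (derM d1 g sf) (derM d1 sf (Xf z)) g_ h_ W1s (W1o _ oXz) -/h4 -/g4; ring.
Qed.

Lemma case2_P3 W : vf W -> K1 Xf y z W -> W (Df y) = 0 /\ W (Df z) = 0.
Proof.
move=> vW [k0 WXy WXz]; have [L [e1 e2 _ e4]] := K0_facts vW k0.
have L0 : L = 0.
  by move: e2; rewrite WXy WXz mulr0 add0r => /esym/eqP; rewrite oppr_eq0 mulf_eq0 (negbTE g40) => /eqP.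
by rewrite e1 e4 WXy WXz L0 !mulr0 mul0r subrr.
Qed.


Section Case2a.
Hypotheses (n44 : g44 != 0) (J0 : Jk != 0).
(** omega / (- g44) = dz + A dy + C dx; [Ad] and [Cd] are the partial derivatives of A and C. The
    roles of y and z are exchanged in this case. *)
Let A := g4 * h44 / g44 - h4.
Let C := 2 * g4 ^+ 2 / g44 - z * A - g.
Let Ad i := (cg [:: i; 3]%N * h44 + g4 * ch [:: i; 3; 3]%N) / g44 - g4 * h44 * cg [:: i; 3; 3]%N / g44 ^+ 2 - ch [:: i; 3]%N.
Let Cd i := 4 * g4 * cg [:: i; 3]%N / g44 - 2 * g4 ^+ 2 * cg [:: i; 3; 3]%N / g44 ^+ 2 - (i == 2)%N%:R * A - z * Ad i - cg [:: i]%N.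

Let S0 : g444 = 3 * g44 ^+ 2 / (2 * g4).
Proof.
have [e _] := ST0; have t0 := two0; move/eqP: e; rewrite subr_eq0 => /eqP <-.
by rewrite mulrC mulKf// mulf_neq0.
Qed.
Let T0 : h444 = 3 * g44 * h44 / (2 * g4).
Proof.
have [_ e] := ST0; have t0 := two0; move/eqP: e; rewrite subr_eq0 => /eqP <-.
by rewrite mulrC mulKf// mulf_neq0.
Qed.

(** S = T = 0 enters here and in [Cd3]: the form dz + A dy + C dx does not involve lambda, so it
    lives on (x, y, z)-space. *)
Let Ad3 : Ad 3%N = 0.
Proof.
rewrite /Ad -/g44 -/h44 -/g444 -/h444 S0 T0; have t0 := two0; have g0 := g40.
by field; rewrite n44 g0 t0.
Qed.
Let Cd3 : Cd 3%N = 0.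
Proof.
rewrite /Cd Ad3 -/g44 -/g444 -/g4 S0 /=; have t0 := two0; have g0 := g40.
by field; rewrite n44 g0 t0.
Qed.

Let cA : chain A (Ad 0%N) (Ad 1%N) (Ad 2%N) 0.
Proof.
move=> d cd; have dd := co_der cd; have n := n44.
rewrite /A (derB dd) (derM dd) (derV dd) (derM dd) (chg [:: 3]%N cd) (chg [:: 3; 3]%N cd) (chh [:: 3]%N cd) (chh [:: 3; 3]%N cd).
rewrite -Ad3 /Ad -/g4 -/g44 -/g444 -/h4 -/h44 -/h444.
by field.
Qed.

Let cC : chain C (Cd 0%N) (Cd 1%N) (Cd 2%N) 0.
Proof.
move=> d cd; have dd := co_der cd; have n := n44.
rewrite /C (derB dd) (derB dd) (derM dd) (derM dd) (derM dd) (derV dd) (der_nat dd) expr2 (derM dd) (cA cd).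
rewrite (chg nil cd) (chg [:: 3]%N cd) (chg [:: 3; 3]%N cd).
rewrite -[X in _ = _ + X * _]Cd3 /Cd Ad3 -/g4 -/g44 -/g444 /=.
by field.
Qed.

Let ThX : Xf z = - A * Xf y - C.
Proof.
have e : Xf y = m + z by rewrite /m subrK.
apply/eqP; rewrite -subr_eq0; apply/eqP.
have -> : Xf z - (- A * Xf y - C) = g4 / g44 * (H * m + 2 * g4).
  by rewrite XzE e /C /A /H; have n := n44; field.
by rewrite Hm mulNr addNr mulr0.
Qed.

(** The last factor is, up to sign, the dx dy dz coefficient of theta wedge d theta for theta = dz +
    A dy + C dx. *)
Let jE : Jk = - g44 ^+ 2 * (- Ad 0%N + Ad 2%N * C + Cd 1%N - A * Cd 2%N).
Proof. by rewrite /Jk /om0d /qd /om0 /qk /Cd /C /Ad /A /=; have n := n44; field. Qed.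

Lemma case2a_P1 W : vf W -> K0 z y W -> W A = 0.
Proof. by move=> [cW Wx] [Wz Wy]; rewrite (cW.2 _ _ _ _ _ cA) Wx Wy Wz !mulr0 mul0r !addr0. Qed.

Let LE W : vf W -> K0 z y W -> exists L, [/\ W (Df y) = L - W (Xf y) * sf, W (Xf z) = - A * W (Xf y),
  L = H / g44 * W (Xf y) & W (Df z) = (h4 + g4 * sf) * L - sf * W (Xf z)].
Proof.
move=> vW [Wz Wy]; have [L [e1 e2 e3 e4]] := K0_facts vW (conj Wy Wz); exists L.
have n := n44; have eL : L = H / g44 * W (Xf y) by rewrite mulrAC e3 mulrAC divff// mul1r.
by split=> //; rewrite e2 eL /A /H; field.
Qed.

Lemma case2a_P2 W : vf W -> K0 z y W -> W (Xf z) + A * W (Xf y) = 0.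
Proof. by move=> vW k0; have [L [_ -> _ _]] := LE vW k0; rewrite mulNr addNr. Qed.

Lemma case2a_P4 W : vf W -> K0 z y W -> W (Df z) + A * W (Df y) = 0 -> W (Xf y) = 0.
Proof.
move=> vW k0; have [L [e1 e2 e3 e4]] := LE vW k0; rewrite e4 e1 e2 e3 => h; have n := n44.
have : g4 * H ^+ 2 / g44 ^+ 2 * W (Xf y) = 0 by rewrite -[RHS]h /A /H; field.
move/eqP; rewrite !mulf_eq0 invr_eq0 !expf_eq0 /= (negbTE n44) (negbTE H0) (negbTE g40) /=.
by move/eqP.
Qed.

Lemma case2a_P5 W : vf W -> Th z y A W = 0 -> Th z y A (br Xf W) = 0 -> K0 z y W.
Proof.
move=> [cW Wx] tW tB; have dW := cW.1.
have Wz : W z = - A * W y by apply/eqP; rewrite -subr_eq0 mulNr opprK; apply/eqP.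
have XA : Xf A = Ad 0%N + Ad 1%N * Xf y + Ad 2%N * Xf z.
  by rewrite (X_cder.2 _ _ _ _ _ cA) Xx mulr1 mul0r addr0.
have WA : W A = Ad 1%N * W y + Ad 2%N * W z by rewrite (cW.2 _ _ _ _ _ cA) Wx mulr0 add0r mul0r addr0.
have WC : W C = Cd 1%N * W y + Cd 2%N * W z by rewrite (cW.2 _ _ _ _ _ cC) Wx mulr0 add0r mul0r addr0.
have : (- Ad 0%N + Ad 2%N * C + Cd 1%N - A * Cd 2%N) * W y = 0.
  rewrite -[RHS]tB /Th /br Wz !(derM X_der) (derN X_der) XA ThX (derB dW) (derM dW) (derN dW) WA WC Wz; ring.
move/eqP; rewrite mulf_eq0 => /orP[/eqP j0|/eqP Wy]; last by rewrite /K0 Wz Wy mulr0.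
by move: J0; rewrite jE j0 mulr0 eqxx.
Qed.
End Case2a.

Section Case2b.
Hypotheses (z44 : g44 = 0) (J0 : Jk != 0).
(** With g44 = 0, omega / (- g4 h44) = dy + C dx. *)
Let C := 2 * g4 / h44 - z.
Let Cd i := 2 * cg [:: i; 3]%N / h44 - 2 * g4 * ch [:: i; 3; 3]%N / h44 ^+ 2 - (i == 2)%N%:R.

Let h0 : h44 != 0. Proof. by have := H0; rewrite /H z44 mul0r addr0. Qed.
Let zd : [/\ cg [:: 0; 3; 3]%N = 0, cg [:: 1; 3; 3]%N = 0, cg [:: 2; 3; 3]%N = 0 & g444 = 0].
Proof. exact: chain0 (chg [:: 3; 3]%N) z44. Qed.
Let h4440 : h444 = 0.
Proof.
have [_] := ST0; rewrite /Tk z44 mulr0 mul0r subr0 => /eqP; rewrite mulf_eq0 mulf_eq0 (negbTE two0) (negbTE g40) /=.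
by move/eqP.
Qed.
Let cC : chain C (Cd 0%N) (Cd 1%N) (Cd 2%N) 0.
Proof.
move=> d cd; have dd := co_der cd; have n := h0.
rewrite /C (derB dd) (derM dd) (derM dd) (derV dd) (der_nat dd) (chg [:: 3]%N cd) (chh [:: 3; 3]%N cd).
rewrite /Cd -/g4 -/g44 -/h444 h4440 z44 /=.
by field.
Qed.
Let XyE : Xf y = - C.
Proof.
have n := h0; have := Hm; rewrite /H z44 mul0r addr0 => e.
have -> : Xf y = m + z by rewrite /m subrK.
have -> : m = - 2 * g4 / h44 by rewrite -e mulrC mulKf.
by rewrite /C; field.
Qed.

Lemma case2b_P2 W : vf W -> K0 y z W -> W (Xf y) + 0 * W (Xf z) = 0.
Proof.
move=> vW k0; have [L [_ _ + _]] := K0_facts vW k0; rewrite z44 !mul0r addr0 => /eqP.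
by rewrite mulf_eq0 (negbTE H0) => /eqP.
Qed.

Lemma case2b_P4 W : vf W -> K0 y z W -> W (Df y) + 0 * W (Df z) = 0 -> W (Xf z) = 0.
Proof.
move=> vW k0; have := case2b_P2 vW k0; have [L [e1 e2 _ _]] := K0_facts vW k0; rewrite !mul0r !addr0 => mu0.
by rewrite e1 e2 mu0 mul0r subr0 mulr0 add0r => ->; rewrite mulr0 oppr0.
Qed.

Lemma case2b_P5 W : vf W -> Th y z 0 W = 0 -> Th y z 0 (br Xf W) = 0 -> K0 y z W.
Proof.
move=> [cW Wx]; rewrite /Th !mul0r !addr0 /br => Wy; rewrite Wy (der0 X_der) XyE (derN cW.1) sub0r opprK.
rewrite (cW.2 _ _ _ _ _ cC) Wx Wy !mulr0 mul0r !add0r addr0 => /eqP; rewrite mulf_eq0 => /orP[/eqP C2|/eqP//].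
have [z0 z1 z2 _] := zd; have n := h0; case/negP: J0; apply/eqP.
have -> : Jk = qk ^+ 2 * Cd 2%N.
  by rewrite /Jk /om0d /qd /om0 /qk /Cd z44 z0 z1 z2 /=; field.
by rewrite C2 mulr0.
Qed.
End Case2b.
End Case2.

(** One statement for the three contact forms: (y', z', B) is (y, z, 0) for dy - z dx and for dy + C
    dx, and (z, y, A) for dz + A dy + C dx. *)
Lemma finish (y' z' B : K) : (k <= 2)%N || ((k == 3) && (l == 3)) -> 
  K0 y' z' (Vf 0) ->
  (forall W, vf W -> K0 y' z' W -> W B = 0) ->
  (forall W, vf W -> K0 y' z' W -> W (Xf y') + B * W (Xf z') = 0) ->
  (forall W, vf W -> K1 Xf y' z' W -> W (Df y') = 0 /\ W (Df z') = 0) ->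
  (forall W, vf W -> K0 y' z' W -> W (Df y') + B * W (Df z') = 0 -> W (Xf z') = 0) ->
  (forall W, vf W -> Th y' z' B W = 0 -> Th y' z' B (br Xf W) = 0 -> K0 y' z' W) ->
  (prop1 (Uf 1) y' z' (Uf 2) -> prop1 (Uf 1) y' z' (Uf 3) -> (forall j, prop1 (Uf 1) y' z' (Vf j)) -> False) ->
  (forall A1 A2, vf A1 -> vf A2 -> prop2 Xf y' z' A1 A2 (Uf 1) -> prop2 Xf y' z' A1 A2 (Uf 2) ->
    prop2 Xf y' z' A1 A2 (Uf 3) -> (forall j, prop2 Xf y' z' A1 A2 (Vf j)) -> False) ->
  ((forall j, exists c1 c2 c3, forall f, jet2 Xf Df y' z' f -> Vf j f = comb (Uf 1) (Uf 2) (Uf 3) c1 c2 c3 f) -> False) ->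
  False.
Proof.
move=> kl k0 P1 P2 P3 P4 P5 r3 r5 r7.
have dU i : der (Uf i) := red_der (dp _).
have dV j : der (Vf j) := red_der (dq _).
have XU i f : Xf (Uf i f) = Uf i (Xf f) := X_red f (co_p _).
have XV j f : Xf (Vf j f) = Vf j (Xf f) := X_red f (co_q _).
have UU i j f : Uf i (Uf j f) = Uf j (Uf i f) := red_red f (co_p _) (co_p _).
have VU i j f : Vf i (Uf j f) = Uf j (Vf i f) := red_red f (co_q _) (co_p _).
have VV i j f : Vf i (Vf j f) = Vf j (Vf i f) := red_red f (co_q _) (co_q _).
have U4 f : Uf 4 f = 0 by apply: U0; exact: leq_ltn_trans k3 _.
have U3D f : Uf 3 (Df f) = Df (Uf 3 f) + Uf 3 (u 2) * Uf 1 f by rewrite U_D U4 addr0.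
have vder W : vf W -> der W by case=> -[].
have tx0 : Xf (u 2) != 0 by rewrite X_u mul1r invr_eq0.
have [k1|k1] := leqP k 1.
  by apply: (core_k1 X_der D_der (XU 1) (XU 2) XV (U_D 0) (U_D 1) V_D (U_vf 1) (U_vf 2) V_vf vf_lin k0 P2 P3 P5 r3) => f; apply: U0 => //; exact: ltnW.
have [k2|k2] := leqP k 2.
  by apply: (core_k2 char0 X_der (dU 1) (dU 2) (dU 3) D_der dV (XU 1) (XU 2) (XU 3) XV (UU 2 1) (UU 3 1) (UU 3 2)
    (fun j => VU j 1) (fun j => VU j 2) (fun j => VU j 3) VV XD (U_D 0) (U_D 1) U3D V_D tx0 vder
    (U_vf 1) (U_vf 2) (U_vf 3) V_vf vf_ext vf_lin k0 P2 P3 P5 r3 r5) => f; apply: U0.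
move: kl; rewrite leqNgt k2 /= => /andP[/eqP kE /eqP lE].
have DE f : Df f = comb (Uf 1) (Uf 2) (Uf 3) (u 2) (u 3) (u 4) f + 0 * Vf 0 f + v 2 * Vf 1 f + v 3 * Vf 2 f + v 4 * Vf 3 f.
  by rewrite /Df lE !big_ord_recl !big_ord0 /comb /=; ring.
have Uu : Uf 1 (u 4) = 0 by rewrite /Uf red_u pu /= mul0r subrr.
have Uv : Uf 1 (v 4) = 0 by rewrite /Uf /red pv X_v mulr0 subrr.
have V4 j f : (3 < j)%N -> Vf j f = 0 by move=> j3; apply: V0; rewrite lE.
exact: (core_33 char0 X_der (dU 1) (dU 2) (dU 3) D_der dV (XU 1) (XU 2) (XU 3) XV (UU 2 1) (UU 3 1) (UU 3 2)
    (fun j => VU j 1) (fun j => VU j 2) (fun j => VU j 3) VV XD (U_D 0) (U_D 1) U3D V_D tx0 vder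
    (U_vf 1) (U_vf 2) (U_vf 3) V_vf vf_ext vf_lin k0 P1 P2 P3 P5 r3 r5 V4 P4 r7 DE erefl erefl Uu Uv).
Qed.

Lemma K1C (W : K -> K) : K1 Xf z y W -> K1 Xf y z W. Proof. by case=> -[]. Qed.
Lemma prop1C A1 W : prop1 A1 z y W -> prop1 A1 y z W. Proof. by case=> c []; exists c. Qed.

Lemma prop2C A1 A2 W : prop2 Xf z y A1 A2 W -> prop2 Xf y z A1 A2 W.
Proof. by move=> [c1 [c2 h]]; exists c1, c2 => f hf; apply: h; case: hf => ->; [constructor 2|constructor 1|constructor 4|constructor 3]. Qed.
Lemma jet2C f : jet2 Xf Df y z f -> jet2 Xf Df z y f.
Proof. by move=> [w wE h]; exists w => //; case: wE; [right|left]. Qed.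

(** The form dy - z dx is always contact, so m = 0 is contradictory; for m != 0, [ST0] gives S = T =
    0 and only J != 0 has to be refuted. *)
Lemma alg_main : (k <= 2)%N || ((k == 3) && (l == 3)) -> [/\ Sk = 0, Tk = 0 & Jk = 0].
Proof.
move=> kl; case: (eqVneq m 0) => m0.
  have [e1 e2] := case1_V0 m0; have P3 := @case1_P3 m0; exfalso.
  apply: (@finish y z 0 kl (conj e1 e2) _ (case1_P2 m0) P3 (case1_P4 m0) (case1_P5 m0) R3 (R5 e1 P3) (R7 e1 e2 P3)).
  by move=> W [[dW _] _] _; exact: der0.
have [S0 T0] := ST0 m0; split=> //; apply/eqP; apply: contraT => J0; exfalso.
have [e1 e2] := case2_V0 m0; have P3 := @case2_P3 m0.
case: (eqVneq g44 0) => n44.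
  apply: (@finish y z 0 kl (conj e1 e2) _ (case2b_P2 m0 n44) P3 (case2b_P4 m0 n44) (case2b_P5 m0 n44 J0) R3 (R5 e1 P3) (R7 e1 e2 P3)).
  by move=> W [[dW _] _] _; exact: der0.
apply: (@finish z y (g4 * h44 / g44 - h4) kl (conj e2 e1) (case2a_P1 m0 n44) (case2a_P2 m0 n44) _ (case2a_P4 m0 n44) (case2a_P5 m0 n44 J0)).
- by move=> W vW /K1C kW; have [] := P3 _ vW kW.
- by move=> h2 h3 hV; apply: R3 => [||j]; apply: prop1C.
- by move=> A1 A2 v1 v2 h1 h2 h3 hV; apply: (R5 e1 P3 v1 v2) => [|||j]; apply: prop2C.
- move=> hV; apply: (R7 e1 e2 P3) => j; have [c1 [c2 [c3 h]]] := hV j.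
  by exists c1, c2, c3 => f /jet2C; exact: h.
Qed.

(** When y depends on u_k and x does not, [second_order] reduces to H = 0, hence g44 = h44 = 0, and
    every term of S, T and J contains such a factor or one of its derivatives. *)
Lemma alg_dep : p 2 x = 0 -> ~ (p 2 y = 0 /\ p 2 z = 0) -> [/\ Sk = 0, Tk = 0 & Jk = 0].
Proof.
move=> x0 yz0; have cE : con (p 2) = p 2 y by rewrite /con x0 mulr0 subr0.
have zE := first_order t1; rewrite cE x0 mulr0 addr0 in zE.
have y0 : p 2 y != 0 by apply/eqP => y0; apply: yz0; rewrite zE y0 mulr0.
have := second_order t1 t1; rewrite cE x0 mul0r mulr0 addr0 mulr0 addr0 => /eqP.
rewrite !mulf_eq0 (negbTE y0) !orbF => /eqP H00.
have [h0 g0] := fnc_lin (fnc_ch [:: 3; 3]%N) (fnc_cg [:: 3; 3]%N) H00.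
have [g1 g2 g3 g4_] := chain0 (chg [:: 3; 3]%N) g0; have [h1 h2 h3 h4_] := chain0 (chh [:: 3; 3]%N) h0.
by split; rewrite ?/Jk ?/Sk ?/Tk ?/om0d ?/om0 ?/qd ?/qk /g444 /h444 /g44 /h44 ?g0 ?h0 ?g1 ?g2 ?g3 ?g4_ ?h1 ?h2 ?h3 ?h4_; ring.
Qed.
End Nonzero.

Lemma alg_final : cg [:: 3]%N != 0 -> (k <= 2)%N || ((k == 3) && (l == 3)) -> ~ [/\ p 2 x = 0, p 2 y = 0 & p 2 z = 0] ->
  [/\ Sk = 0, Tk = 0 & Jk = 0].
Proof.
move=> g40 kl nz; case: (eqVneq (p 2 x) 0) => [x0|x0]; last exact: alg_main.
by apply: alg_dep => // -[y0 z0]; apply: nz.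
Qed.

End Alg.

From mathcomp Require Import all_classical all_reals all_analysis.
Import Order.TTheory GRing.Theory Num.Theory.
Import numFieldNormedType.Exports.
Local Open Scope classical_set_scope.
Local Open Scope ring_scope.

(** * Smooth functions of several variables *)

Section Calculus.
Variable R : realType.
Implicit Types (n m : nat).

Lemma rV_norm_lt n (x : 'rV[R]_n) r : 0 < r -> (forall i, `|x 0 i| < r) -> `|x| < r.
Proof.
move=> r0 h; rewrite [X in X < _]/Num.norm /= mx_normrE; apply/bigmax_ltP; split=> // -[i j] _ /=.
by rewrite ord1.
Qed.

Lemma rV_coord_le n (x : 'rV[R]_n) i : `|x 0 i| <= `|x|.
Proof.
rewrite [X in _ <= X]/Num.norm /= mx_normrE.
exact: (le_bigmax _ (fun ij => `|x ij.1 ij.2|) (0, i)).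
Qed.

Lemma rV_norm_le n (x : 'rV[R]_n) r : 0 <= r -> (forall i, `|x 0 i| <= r) -> `|x| <= r.
Proof.
move=> r0 h; rewrite [X in X <= _]/Num.norm /= mx_normrE; apply/bigmax_leP; split=> // -[i j] _ /=.
by rewrite ord1.
Qed.

Lemma evecE n (i j : 'I_n) : evec R i 0 j = (i == j)%:R.
Proof. by rewrite /evec mxE eqxx eq_sym. Qed.

Lemma is_derive_line (V W : normedModType R) (f : V -> W) (p v : V) t :
  derivable f (t *: v + p) v ->
  is_derive t 1 (fun t : R => f (t *: v + p)) ('D_v f (t *: v + p)).
Proof.
move=> h.
have E : (fun h => h^-1 *: (((fun t : R => f (t *: v + p)) \o shift t) (h *: 1) - f (t *: v + p)))
  = (fun h => h^-1 *: ((f \o shift (t *: v + p)) (h *: v) - f (t *: v + p))).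
  apply/funext => s /=; congr (_ *: (f _ - _)).
  by rewrite [s *: 1]mulr1 scalerDl addrA.
by apply: DeriveDef; rewrite /derivable /derive E.
Qed.

Definition between (a b c : R) : Prop := (a <= c <= b) \/ (b <= c <= a).

Lemma MVT_between (f df : R -> R) (a b : R) :
  (forall x, between a b x -> is_derive x 1 f (df x)) ->
  exists2 c, between a b c & f b - f a = df c * (b - a).
Proof.
move=> h.
have cont (x y : R) : (forall t, x <= t <= y -> between a b t) -> {within `[x, y], continuous f}.
  move=> H; apply: derivable_within_continuous => t; rewrite in_itv /= => ht.
  by have := h t (H _ ht) => -[].
have [ab|ba] := leP a b.
- have [t||c] := @MVT_segment R f df a b ab.
  + by rewrite in_itv /= => /andP[h1 h2]; apply: h; left; rewrite !ltW.
  + by apply: cont => t ht; left.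
  by rewrite in_itv /= => hc e; exists c => //; left.
- have [t||c] := @MVT_segment R f df b a (ltW ba).
  + by rewrite in_itv /= => /andP[h1 h2]; apply: h; right; rewrite !ltW.
  + by apply: cont => t ht; right.
  rewrite in_itv /= => hc e; exists c; first by right.
  by rewrite -[LHS]opprB e; ring.
Qed.

Lemma between_abs (a b c p r : R) : between a b c -> `|a - p| < r -> `|b - p| < r -> `|c - p| < r.
Proof.
rewrite !ltr_norml => h /andP[h1 h2] /andP[h3 h4]; apply/andP.
by case: h => /andP[h5 h6]; split; lra.
Qed.

Lemma between_dist (a b c : R) : between a b c -> `|c - a| <= `|b - a|.
Proof.
move=> [/andP[h1 h2]|/andP[h1 h2]].
  by rewrite !ger0_norm; lra.
by rewrite !ler0_norm; lra.
Qed.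

Definition box n (x y z : 'rV[R]_n) := forall i, between (x 0 i) (y 0 i) (z 0 i).

Lemma box_ball n (x y z p : 'rV[R]_n) r : box x y z -> `|x - p| < r -> `|y - p| < r -> `|z - p| < r.
Proof.
move=> b hx hy; apply: rV_norm_lt => [|i]; first exact: le_lt_trans hx.
have hx' := le_lt_trans (rV_coord_le (x - p) i) hx.
have hy' := le_lt_trans (rV_coord_le (y - p) i) hy.
by move: hx' hy'; rewrite !mxE; exact: between_abs.
Qed.


(** Move from x to y one coordinate at a time and use the mean value theorem on each edge. *)
Lemma staircase n (f : 'rV[R]_n -> R) (x y : 'rV[R]_n) :
  (forall z, box x y z -> forall i, derivable f z (evec R i)) ->
  exists xi : 'I_n -> 'rV[R]_n, (forall i, box x y (xi i)) /\
    f y - f x = \sum_i (y 0 i - x 0 i) * partial i f (xi i).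
Proof.
move=> df.
pose hyb k : 'rV[R]_n := \row_i if (i < k)%N then y 0 i else x 0 i.
have step (k : 'I_n) : exists xi, box x y xi /\
    f (hyb k.+1) - f (hyb k) = (y 0 k - x 0 k) * partial k f xi.
  pose p := hyb k - x 0 k *: evec R k.
  have pE t : t *: evec R k + p = \row_i if i == k then t else hyb k 0 i.
    apply/rowP => i; rewrite /p !mxE eqxx /=; have [->|ne] := eqVneq i k.
      by rewrite ltnn !mulr1; ring.
    by rewrite !mulr0 subr0 add0r.
  have bt t : between (x 0 k) (y 0 k) t -> box x y (t *: evec R k + p).
    move=> ht i; rewrite pE !mxE; have [->//|ne] := eqVneq i k.
    by case: ltnP => _; case: (leP (x 0 i) (y 0 i)) => h;
      [left|right|left|right]; rewrite ?lexx ?h ?(ltW h).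
  have [c hc e] := @MVT_between (fun t => f (t *: evec R k + p))
    (fun t => partial k f (t *: evec R k + p)) (x 0 k) (y 0 k)
    (fun t ht => is_derive_line (df _ (bt _ ht) k)).
  exists (c *: evec R k + p); split; first exact: bt.
  rewrite mulrC -e !pE; congr (f _ - f _); apply/rowP => i; rewrite !mxE.
    rewrite ltnS leq_eqVlt; have [->|ne] := eqVneq i k; first by rewrite eqxx.
    by rewrite (negPf (_ : i != k :> nat)).
  by have [->|//] := eqVneq i k; rewrite ltnn.
have [xi hxi] := choice step.
exists xi; split=> [i|]; first by case: (hxi i).
have -> : f y = f (hyb n) by congr f; apply/rowP => i; rewrite mxE ltn_ord.
have {1}-> : f x = f (hyb 0%N) by congr f; apply/rowP => i; rewrite mxE.
rewrite -(telescope_sumr (fun k => f (hyb k)) (leq0n n)) big_mkord.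
by apply: eq_bigr => i _; case: (hxi i).
Qed.

End Calculus.

Section Calculus2.
Variable R : realType.
Implicit Types (n m : nat).

Lemma open_ballE (V : normedModType R) (A : set V) x : open A -> A x ->
  exists2 r : R, 0 < r & forall y, `|y - x| < r -> A y.
Proof.
move=> oA Ax; have /nbhs_ballP[r /= r0 h] := open_nbhs_nbhs (conj oA Ax).
by exists r => // y hy; apply: h; rewrite -ball_normE /= distrC.
Qed.

Lemma open_ballI (V : normedModType R) (A : set V) :
  (forall x, A x -> exists2 r : R, 0 < r & forall y, `|y - x| < r -> A y) -> open A.
Proof.
move=> h; rewrite openE => x /h[r r0 hr]; apply/nbhs_ballP; exists r => // y.
by rewrite -ball_normE /= distrC; exact: hr.
Qed.

Lemma cont_ballE (V : normedModType R) (f : V -> R) x (e : R) : {for x, continuous f} -> 0 < e ->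
  exists2 r : R, 0 < r & forall y, `|y - x| < r -> `|f y - f x| < e.
Proof.
move=> /cvgrPdist_lt/(_ e) + e0 => /(_ e0)/nbhs_ballP[r /= r0 h].
by exists r => // y hy; rewrite distrC; apply: h; rewrite -ball_normE /= distrC.
Qed.

Lemma cont_ballI (V : normedModType R) (f : V -> R) x :
  (forall e : R, 0 < e -> exists2 r : R, 0 < r & forall y, `|y - x| < r -> `|f y - f x| < e) ->
  {for x, continuous f}.
Proof.
move=> h; apply/cvgrPdist_lt => e /h[r r0 hr]; apply/nbhs_ballP; exists r => // y.
by rewrite -ball_normE /= distrC (distrC (f x)); exact: hr.
Qed.

Lemma cont_eq_on (V : normedModType R) (A : set V) (f g : V -> R) x : open A -> A x ->
  (forall y, A y -> f y = g y) -> {for x, continuous f} -> {for x, continuous g}.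
Proof.
move=> oA Ax fg cf; apply: cont_ballI => e e0.
have [r1 r10 h1] := open_ballE oA Ax; have [r2 r20 h2] := cont_ballE cf e0.
exists (Order.min r1 r2) => [|y]; first by rewrite lt_min r10.
by rewrite lt_min => /andP[/h1 Ay /h2]; rewrite !fg.
Qed.

Lemma common_radius n (P : 'I_n -> R -> Prop) :
  (forall i r r', P i r -> 0 < r' -> r' <= r -> P i r') ->
  (forall i, exists2 r : R, 0 < r & P i r) -> exists2 r : R, 0 < r & forall i, P i r.
Proof.
move=> mono h; have [r hr] := choice (fun i => let: ex_intro2 r a b := h i in ex_intro _ r (conj a b)).
exists (\big[Order.min/1]_i r i).
  by elim/big_ind: _ => // [a b a0 b0|i _]; [rewrite lt_min a0|case: (hr i)].
move=> i; apply: (mono i (r i)); first by case: (hr i).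
  by elim/big_ind: _ => // [a b a0 b0|j _]; [rewrite lt_min a0|case: (hr j)].
exact: bigmin_le.
Qed.

(** The linear approximation at p is uniform over pairs of nearby points, by [staircase]; Lipschitz
    bounds and the straightening of fibres rely on this stronger form of differentiability. *)
Lemma strict_diff n (f : 'rV[R]_n -> R) (p : 'rV[R]_n) :
  (exists2 r : R, 0 < r & forall x, `|x - p| < r -> forall i, derivable f x (evec R i)) ->
  (forall i, {for p, continuous (partial i f)}) ->
  forall e : R, 0 < e -> exists2 d : R, 0 < d & forall x y, `|x - p| < d -> `|y - p| < d ->
    `|f y - f x - \sum_i (y 0 i - x 0 i) * partial i f p| <= e * `|y - x|.
Proof.
move=> [r0 r00 df] cf e e0.
pose e' := e / n.+1%:R; have e'0 : 0 < e' by rewrite divr_gt0.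
have [|i|r1 r10 hr1] := @common_radius n (fun i r => forall y, `|y - p| < r ->
    `|partial i f y - partial i f p| < e').
- by move=> i r r' h _ rr y hy; apply: h; exact: lt_le_trans rr.
- exact: cont_ballE.
pose d := Order.min r0 r1; exists d => [|x y hx hy]; first by rewrite lt_min r00.
have inb z : `|z - p| < d -> (forall i, derivable f z (evec R i)) /\
    (forall i, `|partial i f z - partial i f p| < e').
  by rewrite lt_min => /andP[h1 h2]; split=> i; [exact: df|exact: hr1].
have [|xi [bxi ->]] := @staircase R n f x y.
  by move=> z bz; case: (inb z (box_ball bz hx hy)).
rewrite -sumrB; apply: le_trans (ler_norm_sum _ _ _) _.
apply: le_trans (_ : \sum_(i < n) `|y - x| * e' <= _).
  apply: ler_sum => i _; rewrite -mulrBr normrM.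
  apply: ler_pM => //; first by have := rV_coord_le (y - x) i; rewrite !mxE.
  have [_ h] := inb _ (box_ball (bxi i) hx hy).
  exact: ltW.
rewrite sumr_const card_ord -mulr_natr -mulrA mulrC ler_wpM2r//.
by rewrite /e' mulrAC ler_pdivrMr//; apply: ler_wpM2l; rewrite ?ler_nat// ltW.
Qed.

Definition lform n (a : 'I_n -> R) (v : 'rV[R]_n) : R := \sum_i v 0 i * a i.

Lemma lform_linear n (a : 'I_n -> R) : linear (lform a).
Proof.
move=> k u v; rewrite /lform scaler_sumr -big_split /=; apply: eq_bigr => i _.
by rewrite !mxE mulrDl scalerAl.
Qed.

Lemma lform_continuous n (a : 'I_n -> R) : continuous (lform a).
Proof.
move=> v; pose C := 1 + \sum_i `|a i|.
have C0 : 0 < C by rewrite ltr_pwDl// sumr_ge0.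
apply: cont_ballI => e e0; exists (e / C) => [|w hw]; first by rewrite divr_gt0.
rewrite /lform -sumrB; apply: le_lt_trans (ler_norm_sum _ _ _) _.
apply: (@le_lt_trans _ _ (\sum_i `|w - v| * `|a i|)).
  apply: ler_sum => i _; rewrite -mulrBl normrM ler_wpM2r//.
  by have := rV_coord_le (w - v) i; rewrite !mxE.
rewrite -mulr_sumr; apply: le_lt_trans (_ : `|w - v| * C < _).
  by rewrite ler_wpM2l// lerDr.
by rewrite -ltr_pdivlMr.
Qed.

Lemma C1_differentiable n (f : 'rV[R]_n -> R) (p : 'rV[R]_n) :
  (exists2 r : R, 0 < r & forall x, `|x - p| < r -> forall i, derivable f x (evec R i)) ->
  (forall i, {for p, continuous (partial i f)}) ->
  differentiable f p /\ forall v, 'd f p v = \sum_i v 0 i * partial i f p.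
Proof.
move=> df cf; pose a i := partial i f p.
pose L : {linear 'rV[R]_n -> R} := HB.pack (lform a) (GRing.isLinear.Build _ _ _ _ _ (lform_linear a)).
have cL : continuous L by exact: lform_continuous.
have ex : f \o shift p = cst (f p) + L +o_ (0 : 'rV[R]_n) id.
  apply/eqaddoP => e e0.
  have [d d0 hd] := strict_diff df cf e0.
  apply/nbhs_ballP; exists d => //= h; rewrite -ball_normE /= sub0r normrN => hh.
  have := hd p (h + p); rewrite subrr normr0 addrK => /(_ d0 hh).
  rewrite opprD addrA; congr (`| _ - _ | <= _).
  by apply: eq_bigr => i _; rewrite !mxE addrK.
have E := diff_unique cL ex; split.
  apply/diff_locallyP; split; last by rewrite E.
  by rewrite E.
by move=> v; rewrite E.
Qed.

(** Restricting to the line through x in direction v turns c into a curve in finite dimension, where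
    componentwise differentiability is enough. *)
Lemma is_derive_comp_rV (V : normedModType R) m (F : 'rV[R]_m -> R) (c : V -> 'rV[R]_m) x v
    (dc : 'I_m -> R) :
  (exists2 r : R, 0 < r & forall q, `|q - c x| < r -> forall i, derivable F q (evec R i)) ->
  (forall i, {for c x, continuous (partial i F)}) ->
  (forall j, is_derive x v (fun u => c u 0 j) (dc j)) ->
  is_derive x v (F \o c) (\sum_j dc j * partial j F (c x)).
Proof.
move=> dF cF hc; have [DF EF] := C1_differentiable dF cF.
pose ga (h : R) := c (h *: v + x).
have ga0 : ga 0 = c x by rewrite /ga scale0r add0r.
have dga : derivable ga 0 1.
  apply/derivable_mxP => i j; rewrite ord1.
  have [h _] := hc j.
  exact: ((derivable1P (fun u => c u 0 j) x v).1 h).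
have Dga := (derivable1_diffP _ _).1 dga.
have DFg : differentiable F (ga 0) by rewrite ga0.
have DC : differentiable (F \o ga) 0 by exact: differentiable_comp.
have dR (W : normedModType R) (f : V -> W) : 'D_v f x = 'D_1 (fun h : R => f (h *: v + x)) 0.
  rewrite /derive; set g1 := fun h => h^-1 *: _; set g2 := fun h => h^-1 *: _.
  suff -> : g1 = g2 by [].
  by rewrite funeqE /g1 /g2 => h /=; rewrite addr0 scale0r add0r [_%:A]mulr1.
apply: DeriveDef.
  have h1 : derivable (F \o ga) 0 1 by exact: diff_derivable.
  exact: ((derivable1P (F \o c) x v).2 h1).
have e1 : 'd ga 0 1 = 'D_1 ga 0 by rewrite deriveE.
have -> : 'D_v (F \o c) x = 'D_1 (F \o ga) 0 by exact: dR.
have e2 : 'D_1 (F \o ga) 0 = 'd (F \o ga) 0 1 by exact: deriveE.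
have e3 : 'd (F \o ga) 0 = 'd F (ga 0) \o 'd ga 0 :> (R -> R) by exact: diff_comp.
rewrite e2 e3 [LHS]/comp ga0 EF e1.
apply: eq_bigr => j _; congr (_ * _).
rewrite derive_mx// mxE.
by rewrite -(dR _ (fun u => c u 0 j)); case: (hc j).
Qed.

(** [smooth_on] with continuity at points in place of subspace continuity; the two agree on open
    sets. *)
Definition smo n (A : set 'rV[R]_n) (f : 'rV[R]_n -> R) : Prop :=
  forall s x, A x -> {for x, continuous (iter_partial s f)} /\
    forall i, derivable (iter_partial s f) x (evec R i).

Lemma smooth_on_smo n (A : set 'rV[R]_n) f : open A -> smooth_on A f <-> smo A f.
Proof.
move=> oA; split=> h s.
  move=> x Ax; have [h1 h2] := h s; split=> [|i]; last exact: h2.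
  by move: h1; rewrite continuous_open_subspace//; apply; rewrite inE.
split=> [|i x Ax]; last by have [] := h s x Ax.
by rewrite continuous_open_subspace// => x; rewrite inE => Ax; have [] := h s x Ax.
Qed.

Lemma smo_partial n (A : set 'rV[R]_n) f i : smo A f -> smo A (partial i f).
Proof. by move=> h s; have := h (rcons s i); rewrite /iter_partial foldr_rcons. Qed.

Lemma smo_iter n (A : set 'rV[R]_n) f s : smo A f -> smo A (iter_partial s f).
Proof. by move=> h s'; have := h (s' ++ s); rewrite /iter_partial foldr_cat. Qed.

Lemma smo_sub n (A B : set 'rV[R]_n) f : B `<=` A -> smo A f -> smo B f.
Proof. by move=> BA h s x /BA; exact: h. Qed.

Lemma eq_iter_partial n (A : set 'rV[R]_n) (f g : 'rV[R]_n -> R) s : open A ->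
  (forall x, A x -> f x = g x) -> forall x, A x -> iter_partial s f x = iter_partial s g x.
Proof.
move=> oA fg; elim: s => [|i s IH] // x Ax /=; apply: near_eq_derive.
by have := open_nbhs_nbhs (conj oA Ax); apply: filterS => z; exact: IH.
Qed.

Lemma eq_partial n (A : set 'rV[R]_n) (f g : 'rV[R]_n -> R) i : open A ->
  (forall x, A x -> f x = g x) -> forall x, A x -> partial i f x = partial i g x.
Proof. exact: (@eq_iter_partial n A f g [:: i]). Qed.

Lemma eq_smo n (A : set 'rV[R]_n) (f g : 'rV[R]_n -> R) : open A ->
  (forall x, A x -> f x = g x) -> smo A f -> smo A g.
Proof.
move=> oA fg h s x Ax; have [h1 h2] := h s x Ax.
have near_eq : {near x, iter_partial s f =1 iter_partial s g}.
  have := open_nbhs_nbhs (conj oA Ax); apply: filterS => z.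
  exact: eq_iter_partial.
split=> [|i]; last exact: near_eq_derivable (h2 i).
exact: (cont_eq_on oA Ax (eq_iter_partial s oA fg)).
Qed.

Lemma smo_near n (A : set 'rV[R]_n) f x : open A -> smo A f -> A x ->
  (exists2 r : R, 0 < r & forall y, `|y - x| < r -> forall i, derivable f y (evec R i)) /\
  (forall i, {for x, continuous (partial i f)}).
Proof.
move=> oA h Ax; split=> [|i]; last by have [] := h [:: i] x Ax.
have [r r0 hr] := open_ballE oA Ax; exists r => // y /hr Ay.
by case: (h [::] y Ay).
Qed.

(** Induction on the number of derivatives for a whole class at once, stable under derivation up to
    equality on A: no formula for a higher derivative is needed. *)
Lemma smo_class n (A : set 'rV[R]_n) (P : ('rV[R]_n -> R) -> Prop) : open A ->
  (forall f, P f -> forall x, A x -> {for x, continuous f} /\ forall i, derivable f x (evec R i)) ->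
  (forall f i, P f -> exists2 g, P g & forall x, A x -> partial i f x = g x) ->
  forall f, P f -> smo A f.
Proof.
move=> oA h1 h2 f Pf s; elim/last_ind: s f Pf => [|s i IH] f Pf; first exact: h1.
have [g Pg fg] := h2 f i Pf.
have hg := IH g Pg.
move=> x Ax; rewrite /iter_partial foldr_rcons -/(iter_partial s (partial i f)).
have e := eq_iter_partial s oA fg.
have [c d] := hg x Ax.
have near_eq : {near x, iter_partial s g =1 iter_partial s (partial i f)}.
  by have := open_nbhs_nbhs (conj oA Ax); apply: filterS => z Az; rewrite e.
split=> [|j]; last exact: near_eq_derivable (d j).
apply: (cont_eq_on oA Ax _ c) => y Ay; exact/esym/e.
Qed.

Lemma continuous_row (V : normedModType R) n (q : 'I_n -> V -> R) x :
  (forall j, {for x, continuous (q j)}) -> {for x, continuous (fun t => \row_j q j t)}.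
Proof.
move=> h; apply/cvgrPdist_lt => e e0.
have [|i|r r0 hr] := @common_radius n (fun i r => forall y, `|y - x| < r -> `|q i y - q i x| < e).
- by move=> i r r' hh _ rr y hy; apply: hh; exact: lt_le_trans rr.
- exact: cont_ballE.
apply/nbhs_ballP; exists r => // y; rewrite -ball_normE /= distrC => hy.
by apply: rV_norm_lt => // i; rewrite !mxE distrC; exact: hr.
Qed.

(** Smooth functions closed under the operations: the derivative of each constructor stays in the
    class, as [smo_class] requires. *)
Inductive sm n (A : set 'rV[R]_n) : ('rV[R]_n -> R) -> Prop :=
| sm_base f : smo A f -> sm A f
| sm_add f g : sm A f -> sm A g -> sm A (fun x => f x + g x)
| sm_mul f g : sm A f -> sm A g -> sm A (fun x => f x * g x)
| sm_inv f : sm A f -> (forall x, A x -> f x != 0) -> sm A (fun x => (f x)^-1)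
| sm_comp m (B : set 'rV[R]_m) F (q : 'I_m -> 'rV[R]_n -> R) : open B -> smo B F ->
    (forall j, sm A (q j)) -> (forall x, A x -> B (\row_j q j x)) ->
    sm A (fun x => F (\row_j q j x)).

Lemma smo_cst n (A : set 'rV[R]_n) (a : R) : open A -> smo A (fun=> a).
Proof.
move=> oA; apply: (@smo_class n A (fun f => exists a, f = fun=> a)) => //; last by exists a.
  by move=> _ [b ->] x _; split=> [|i]; [exact: (@cst_continuous _ _ b)|exact: derivable_cst].
by move=> _ i [b ->]; exists (fun=> 0); [exists 0|move=> x _; exact: derive_cst].
Qed.

Lemma smo_coord n (A : set 'rV[R]_n) (i : 'I_n) : open A -> smo A (fun x => x 0 i).
Proof.
move=> oA; apply: (@smo_class n A (fun f => (exists a, f = fun=> a) \/ f = fun x => x 0 i)) => //;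
  last by right.
  move=> f [[a ->]|->] x Ax.
    by split=> [|j]; [exact: (@cst_continuous _ _ a)|exact: derivable_cst].
  split=> [|j]; first exact: (@coord_continuous R 1 n 0 i x).
  by apply: diff_derivable; exact: differentiable_coord.
move=> f j [[a ->]|->].
  by exists (fun=> 0); [left; exists 0|move=> x _; exact: derive_cst].
exists (fun=> (evec R j) 0 i); first by left; exists (evec R j 0 i).
move=> x Ax; have dI : derivable (id : 'rV[R]_n -> 'rV[R]_n) x (evec R j) by exact: derivable_id.
have := derive_mx dI.
by rewrite derive_id => /matrixP/(_ 0 i); rewrite [RHS]mxE => e; rewrite /partial -e.
Qed.

End Calculus2.

Section Calculus3.
Variable R : realType.
Implicit Types (n m : nat).

Lemma is_derive_comp_smo (V : normedModType R) m (B : set 'rV[R]_m) (F : 'rV[R]_m -> R)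
    (q : 'I_m -> V -> R) x v (dq : 'I_m -> R) :
  open B -> smo B F -> B (\row_j q j x) -> (forall j, is_derive x v (q j) (dq j)) ->
  is_derive x v (fun u => F (\row_j q j u)) (\sum_j dq j * partial j F (\row_j q j x)).
Proof.
move=> oB sF Bx hq; have [h1 h2] := smo_near oB sF Bx.
apply: (@is_derive_comp_rV R V m F (fun u => \row_j q j u)) => // j.
by have := hq j; congr is_derive; apply/funext => u; rewrite mxE.
Qed.

Lemma sm_sum n (A : set 'rV[R]_n) m (F : 'I_m -> 'rV[R]_n -> R) : open A ->
  (forall j, sm A (F j)) -> sm A (fun x => \sum_j F j x).
Proof.
move=> oA hF; elim: m F hF => [|m IH] F hF.
  by under eq_fun do rewrite big_ord0; apply: sm_base; exact: smo_cst.
by under eq_fun do rewrite big_ord_recl; apply: sm_add => //; exact: IH.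
Qed.

Lemma sm_spec n (A : set 'rV[R]_n) f : open A -> sm A f ->
  (forall x, A x -> {for x, continuous f} /\ forall i, derivable f x (evec R i)) /\
  (forall i, exists2 g, sm A g & forall x, A x -> partial i f x = g x).
Proof.
move=> oA; elim => {f}.
- move=> f sf; split=> [x Ax|i]; first exact: (sf [::]).
  by exists (partial i f) => //; apply: sm_base; exact: smo_partial.
- move=> f g sf [f1 f2] sg [g1 g2]; split=> [x Ax|i].
    have [cf df] := f1 x Ax; have [cg dg] := g1 x Ax.
    by split=> [|i]; [exact: continuousD|exact: derivableD].
  have [f' sf' ef] := f2 i; have [g' sg' eg] := g2 i.
  exists (fun x => f' x + g' x); first exact: sm_add.
  move=> x Ax; rewrite -ef// -eg//; apply: deriveD.
    by case: (f1 x Ax).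
  by case: (g1 x Ax).
- move=> f g sf [f1 f2] sg [g1 g2]; split=> [x Ax|i].
    have [cf df] := f1 x Ax; have [cg dg] := g1 x Ax.
    by split=> [|i]; [exact: continuousM|exact: derivableM].
  have [f' sf' ef] := f2 i; have [g' sg' eg] := g2 i.
  exists (fun x => f x * g' x + g x * f' x); first by apply: sm_add; apply: sm_mul.
  move=> x Ax; rewrite -ef// -eg//; apply: deriveM.
    by case: (f1 x Ax).
  by case: (g1 x Ax).
- move=> f sf [f1 f2] fn; split=> [x Ax|i].
    have [cf df] := f1 x Ax.
    by split=> [|i]; [apply: continuousV => //; exact: fn|apply: derivableV => //; exact: fn].
  have [f' sf' ef] := f2 i.
  exists (fun x => (-1) * ((f x)^-1 * (f x)^-1) * f' x).
    have sfi : sm A (fun x => (f x)^-1) by exact: sm_inv.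
    apply: sm_mul => //; apply: sm_mul; last exact: sm_mul.
    by apply: sm_base; exact: smo_cst.
  move=> x Ax; rewrite -ef// /partial deriveV; last by case: (f1 x Ax).
    by rewrite /GRing.scale /= mulN1r expr2 invfM.
  exact: fn.
- move=> m B F q oB sF sq IH hB.
  have dq x i : A x -> forall j, is_derive x (evec R i) (q j) (partial i (q j) x).
    by move=> Ax j; apply: derivableP; have [h _] := IH j; case: (h x Ax).
  have key x i : A x -> is_derive x (evec R i) (fun u => F (\row_j q j u))
      (\sum_j partial i (q j) x * partial j F (\row_j q j x)).
    by move=> Ax; exact: (is_derive_comp_smo oB sF (hB x Ax) (dq x i Ax)).
  split=> [x Ax|i].
    split=> [|i]; last by case: (key x i Ax).
    have cr : {for x, continuous (fun t => \row_j q j t)}.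
      by apply: continuous_row => j; have [h _] := IH j; case: (h x Ax).
    have [cF _] := sF [::] _ (hB x Ax).
    exact: (@continuous_comp _ _ _ (fun t => \row_j q j t) F).
  have /choice[q' hq'] : forall j, exists g, sm A g /\ forall x, A x -> partial i (q j) x = g x.
    by move=> j; have [_ /(_ i)[g sg eg]] := IH j; exists g.
  exists (fun x => \sum_j q' j x * partial j F (\row_j q j x)).
    apply: sm_sum => // j; apply: sm_mul; first by case: (hq' j).
    exact: (@sm_comp R n A m B (partial j F) q oB (smo_partial j sF) sq hB).
  move=> x Ax; have [_ e] := key x i Ax; apply: etrans e _; apply: eq_bigr => j _.
  by have [_ ->] := hq' j.
Qed.

Lemma sm_smo n (A : set 'rV[R]_n) f : open A -> sm A f -> smo A f.
Proof.
move=> oA; apply: (@smo_class R n A (sm A)) => // [g sg|g i sg].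
  by have [h _] := sm_spec oA sg.
by have [_ h] := sm_spec oA sg.
Qed.

Section Closure.
Variables (n : nat) (A : set 'rV[R]_n) (oA : open A).
Let B := @sm_base R n A.
Lemma smoD f g : smo A f -> smo A g -> smo A (fun x => f x + g x).
Proof. by move=> /B sf /B sg; apply: sm_smo => //; exact: sm_add. Qed.
Lemma smoM f g : smo A f -> smo A g -> smo A (fun x => f x * g x).
Proof. by move=> /B sf /B sg; apply: sm_smo => //; exact: sm_mul. Qed.
Lemma smoZ a f : smo A f -> smo A (fun x => a * f x).
Proof. by move=> sf; exact: (smoM (smo_cst a oA) sf). Qed.
Lemma smoN f : smo A f -> smo A (fun x => - f x).
Proof. by move=> /(smoZ (-1)); under eq_fun do rewrite mulN1r. Qed.
Lemma smoB f g : smo A f -> smo A g -> smo A (fun x => f x - g x).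
Proof. by move=> sf /smoN; exact: smoD. Qed.
Lemma smoV f : smo A f -> (forall x, A x -> f x != 0) -> smo A (fun x => (f x)^-1).
Proof. by move=> /B sf h; apply: sm_smo => //; exact: sm_inv. Qed.
Lemma smo_comp m (C : set 'rV[R]_m) F (q : 'I_m -> 'rV[R]_n -> R) : open C -> smo C F ->
  (forall j, smo A (q j)) -> (forall x, A x -> C (\row_j q j x)) -> smo A (fun x => F (\row_j q j x)).
Proof. by move=> oC sF sq h; apply: sm_smo => //; apply: (@sm_comp R n A m C) => // j; exact: B. Qed.
Lemma smo_sum m (F : 'I_m -> 'rV[R]_n -> R) :
  (forall j, smo A (F j)) -> smo A (fun x => \sum_j F j x).
Proof. by move=> h; apply: sm_smo => //; apply: sm_sum => // j; exact: B. Qed.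

Lemma smo_is_derive f x i : smo A f -> A x -> is_derive x (evec R i) f (partial i f x).
Proof. by move=> sf Ax; apply: derivableP; have [_] := sf [::] x Ax; exact. Qed.

Lemma smo_derivable f x i : smo A f -> A x -> derivable f x (evec R i).
Proof. by move=> sf Ax; have [_] := sf [::] x Ax; exact. Qed.

Lemma partialD f g i x : smo A f -> smo A g -> A x ->
  partial i (fun x => f x + g x) x = partial i f x + partial i g x.
Proof.
move=> sf sg Ax; have [df ef] := smo_is_derive i sf Ax; have [dg eg] := smo_is_derive i sg Ax.
exact: deriveD.
Qed.
Lemma partialM f g i x : smo A f -> smo A g -> A x ->
  partial i (fun x => f x * g x) x = partial i f x * g x + f x * partial i g x.
Proof.
move=> sf sg Ax; have [df ef] := smo_is_derive i sf Ax; have [dg eg] := smo_is_derive i sg Ax.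
by rewrite addrC [X in _ + X]mulrC; exact: deriveM.
Qed.
Lemma partial_cst a i x : partial i (fun _ : 'rV[R]_n => a) x = 0.
Proof. exact: derive_cst. Qed.
Lemma partial_coord i j x : partial i (fun x : 'rV[R]_n => x 0 j) x = (i == j)%:R.
Proof.
have dI : derivable (id : 'rV[R]_n -> 'rV[R]_n) x (evec R i) by exact: derivable_id.
have := derive_mx dI.
by rewrite derive_id => /matrixP/(_ 0 j); rewrite [RHS]mxE evecE => e; rewrite /partial -e.
Qed.
Lemma partial_comp m (C : set 'rV[R]_m) F (q : 'I_m -> 'rV[R]_n -> R) i x : open C -> smo C F ->
  (forall j, smo A (q j)) -> C (\row_j q j x) -> A x ->
  partial i (fun x => F (\row_j q j x)) x = \sum_j partial i (q j) x * partial j F (\row_j q j x).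
Proof.
move=> oC sF sq h Ax.
have [_ e] := is_derive_comp_smo oC sF h (fun j => smo_is_derive i (sq j) Ax).
exact: e.
Qed.
End Closure.

Lemma dist_via (a b c e : R) : `|c - b| < e / 2 -> `|c - a| < e / 2 -> `|a - b| < e.
Proof. by rewrite !ltr_norml => /andP[h1 h2] /andP[h3 h4]; apply/andP; split; lra. Qed.

Lemma partial_sym n (A : set 'rV[R]_n) f i j x : open A -> smo A f -> A x ->
  partial i (partial j f) x = partial j (partial i f) x.
Proof.
move=> oA sf Ax; have [r0 r00 hr0] := open_ballE oA Ax.
pose g := partial i (partial j f); pose h := partial j (partial i f).
have cg : {for x, continuous g} by have [] := sf [:: i; j] x Ax.
have ch : {for x, continuous h} by have [] := sf [:: j; i] x Ax.
apply/eqP; rewrite -subr_eq0 -normr_le0; apply/ler_addgt0Pl => e e0.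
have e20 : 0 < e / 2 by rewrite divr_gt0.
have [r1 r10 hr1] := cont_ballE cg e20.
have [r2 r20 hr2] := cont_ballE ch e20.
pose r := Order.min r0 (Order.min r1 r2).
have rp : 0 < r by rewrite !lt_min r00 r10 r20.
have [t tp t2] : exists2 t, 0 < t & t + t < r by exists (r / 3); rewrite ?divr_gt0//; lra.
have inb (k l : 'I_n) a b : between 0 t a -> between 0 t b ->
    `|a *: evec R k + (b *: evec R l + x) - x| < r.
  have tt c : between 0 t c -> `|c| <= t.
    by case=> /andP[h1 h2]; rewrite ler_norml; apply/andP; split; lra.
  move=> /tt ha /tt hb; rewrite addrA addrK.
  have ev (q : 'I_n) c : `|c *: evec R q| <= `|c|.
    apply: rV_norm_le => // u; rewrite mxE evecE normrM.
    by case: (q == u); rewrite ?normr1 ?normr0 ?mulr1 ?mulr0.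
  apply: le_lt_trans (ler_normD _ _) _.
  apply: (@le_lt_trans _ _ (t + t)) => //.
  by apply: lerD; [exact: le_trans (ev k a) ha|exact: le_trans (ev l b) hb].
(* mean value theorem applied twice to the second difference in directions k, l *)
have sd (k l : 'I_n) : exists2 z, `|z - x| < r &
    f (t *: evec R k + (t *: evec R l + x)) - f (t *: evec R k + (0 *: evec R l + x))
    - (f (0 *: evec R k + (t *: evec R l + x)) - f (0 *: evec R k + (0 *: evec R l + x)))
    = partial l (partial k f) z * t * t.
  have Ab y : `|y - x| < r -> A y by rewrite lt_min => /andP[/hr0].
  have b0 : between 0 t 0 by left; rewrite lexx ltW.
  have bt : between 0 t t by left; rewrite lexx ltW.
  have [c hc ec] := @MVT_between R
    (fun a => f (a *: evec R k + (t *: evec R l + x)) - f (a *: evec R k + (0 *: evec R l + x)))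
    (fun a => partial k f (a *: evec R k + (t *: evec R l + x)) - partial k f (a *: evec R k + (0 *: evec R l + x))) 0 t
    (fun a ha => is_deriveB
       (is_derive_line ((smo_derivable sf (Ab _ (inb k l a t ha bt)))))
       (is_derive_line ((smo_derivable sf (Ab _ (inb k l a 0 ha b0)))))).
  have E b : c *: evec R k + (b *: evec R l + x) = b *: evec R l + (c *: evec R k + x).
    by rewrite addrCA.
  have [b hb eb] := @MVT_between R (fun b => partial k f (b *: evec R l + (c *: evec R k + x)))
    (fun b => partial l (partial k f) (b *: evec R l + (c *: evec R k + x))) 0 t
    (fun b hb => is_derive_line ((smo_derivable (smo_partial k sf)
       (Ab _ (eq_ind _ (fun z => `|z - x| < r) (inb k l c b hc hb) _ (E b)))))).
  exists (b *: evec R l + (c *: evec R k + x)); first by rewrite -E; exact: inb.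
  rewrite ec !E eb; ring.
have [z1 hz1 e1] := sd i j; have [z2 hz2 e2] := sd j i.
have tn : t != 0 by rewrite gt_eqF.
have E : f (t *: evec R j + (0 *: evec R i + x)) = f (0 *: evec R i + (t *: evec R j + x)) /\
         f (0 *: evec R j + (t *: evec R i + x)) = f (t *: evec R i + (0 *: evec R j + x)) /\
         f (t *: evec R j + (t *: evec R i + x)) = f (t *: evec R i + (t *: evec R j + x)) /\
         f (0 *: evec R j + (0 *: evec R i + x)) = f (0 *: evec R i + (0 *: evec R j + x)).
  by split; [|split; [|split]]; congr f; rewrite addrCA.
have [E1 [E2 [E3 E4]]] := E.
have eq12 : partial j (partial i f) z1 = partial i (partial j f) z2.
  apply: (mulIf tn (mulIf tn (etrans (esym e1) (etrans _ e2)))).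
  rewrite E1 E2 E3 E4; move: (f _) => a1; move: (f _) => a2; move: (f _) => a3; move: (f _) => a4; ring.
have := hr1 z2; have := hr2 z1.
move: hz1 hz2; rewrite !lt_min => /and3P[_ _ q2] /and3P[_ q1 _] /(_ q2) b2 /(_ q1) b1.
rewrite addr0; apply: ltW.
have b3 : `|partial i (partial j f) z2 - h x| < e / 2 := eq_ind _ (fun q => `|q - h x| < e / 2) b2 _ eq12.
exact: (dist_via b3 b1).
Qed.

End Calculus3.

(** * Cauchy estimates for analytic functions *)

Section Analytic1.
Variable R : realType.

Section Hom.
Variable n : nat.
Implicit Types (f g : 'rV[R]_n -> R) (s : seq 'I_n).

(** Homogeneous polynomials of degree d, with a bound A for the sum of the absolute values of their
    coefficients that is easy to follow under differentiation. *)
Inductive hom : nat -> R -> ('rV[R]_n -> R) -> Prop :=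
| hom_zero d A : 0 <= A -> hom d A (fun=> 0)
| hom_cst c : hom 0 `|c| (fun=> c)
| hom_mul i d A f : hom d A f -> hom d.+1 A (fun x => x 0 i * f x)
| hom_add d A B f g : hom d A f -> hom d B g -> hom d (A + B) (fun x => f x + g x).

Lemma hom_ge0 d A f : hom d A f -> 0 <= A.
Proof. by elim=> // {d A f} *; rewrite addr_ge0. Qed.

Lemma hom_le d A f : hom d A f -> forall x, `|f x| <= A * `|x| ^+ d.
Proof.
elim => {d A f}.
- by move=> d A A0 x; rewrite normr0 mulr_ge0// exprn_ge0.
- by move=> c x; rewrite expr0 mulr1.
- move=> i d A f hf IH x; rewrite normrM exprS mulrCA.
  by apply: ler_pM => //; exact: rV_coord_le.
- move=> d A B f g hf IHf hg IHg x.
  by rewrite mulrDl; apply: le_trans (ler_normD _ _) _; apply: lerD.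
Qed.

Lemma hom_smo d A f : hom d A f -> smo [set: 'rV[R]_n] f.
Proof.
have oT : open [set: 'rV[R]_n] by exact: openT.
elim => {d A f}.
- by move=> *; exact: smo_cst.
- by move=> *; exact: smo_cst.
- by move=> i d A f _ sf; exact: (smoM oT (smo_coord i oT) sf).
- by move=> d A B f g _ sf _ sg; exact: smoD.
Qed.

Lemma hom_partial d A f i : hom d A f -> hom d.-1 (d%:R * A) (partial i f).
Proof.
have oT : open [set: 'rV[R]_n] by exact: openT.
elim => {d A f}.
- move=> d A A0; have -> : partial i (fun _ : 'rV[R]_n => 0 : R) = (fun=> 0).
    by apply/funext => x; exact: partial_cst.
  by apply: hom_zero; rewrite mulr_ge0.
- move=> c; have -> : partial i (fun _ : 'rV[R]_n => c) = (fun=> 0).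
    by apply/funext => x; exact: partial_cst.
  by apply: hom_zero; rewrite mul0r.
- move=> j d A f hf IH.
  have -> : partial i (fun x : 'rV[R]_n => x 0 j * f x) =
      (fun x => (if i == j then f else fun=> 0) x + x 0 j * partial i f x).
    apply/funext => x; rewrite (partialM i (smo_coord j oT) (hom_smo hf) I) partial_coord.
    by case: (i == j); rewrite ?mul1r ?mul0r.
  have h1 : hom d A (if i == j then f else fun=> 0).
    by case: (i == j) => //; apply: hom_zero; exact: hom_ge0 hf.
  rewrite /= -nat1r mulrDl mul1r; apply: hom_add => //.
  case: d hf IH h1 => [|d] hf IH _; last exact: hom_mul.
  have -> : (fun x : 'rV[R]_n => x 0 j * partial i f x) = (fun=> 0).
    apply/funext => x; have := hom_le IH x; rewrite !mul0r normr_le0 => /eqP ->.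
    by rewrite mulr0.
  by apply: hom_zero; rewrite mul0r.
- move=> d A B f g hf IHf hg IHg.
  have -> : partial i (fun x => f x + g x) = (fun x => partial i f x + partial i g x).
    by apply/funext => x; exact: (partialD i (hom_smo hf) (hom_smo hg) I).
  by rewrite mulrDr; exact: hom_add.
Qed.

Lemma hom_iter d A f s : hom d A f ->
  hom (d - size s) ((d ^_ size s)%:R * A) (iter_partial s f).
Proof.
move=> hf; elim: s => [|i s IH] /=; first by rewrite subn0 mul1r.
have := hom_partial i IH.
by rewrite subnS ffactnSr natrM mulrA [_%:R * _%:R]mulrC.
Qed.

Lemma hom_mulX k i d A f : hom d A f -> hom (k + d) A (fun x => x 0 i ^+ k * f x).
Proof.
move=> hf; elim: k => [|k IH].
  by rewrite (_ : (fun _ => _) = f)//; apply/funext => x; rewrite expr0 mul1r.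
rewrite (_ : (fun _ => _) = (fun x : 'rV[R]_n => x 0 i * (x 0 i ^+ k * f x))).
  exact: hom_mul.
by apply/funext => x; rewrite exprS mulrA.
Qed.

Lemma hom_monomial c (al : 'I_n -> nat) (r : seq 'I_n) :
  hom (\sum_(i <- r) al i) `|c| (fun x => c * \prod_(i <- r) x 0 i ^+ al i).
Proof.
elim: r => [|i r IH].
  rewrite big_nil (_ : (fun _ => _) = (fun=> c)); first exact: hom_cst.
  by apply/funext => x; rewrite big_nil mulr1.
rewrite big_cons (_ : (fun _ => _) = (fun x : 'rV[R]_n => x 0 i ^+ al i * (c * \prod_(i <- r) x 0 i ^+ al i))).
  exact: hom_mulX.
by apply/funext => x; rewrite big_cons mulrCA.
Qed.

Lemma hom_bigsum (I : Type) (r : seq I) (P : pred I) d (A : I -> R) (F : I -> 'rV[R]_n -> R) :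
  (forall i, P i -> hom d (A i) (F i)) ->
  hom d (\sum_(i <- r | P i) A i) (fun x => \sum_(i <- r | P i) F i x).
Proof.
move=> h; elim: r => [|i r IH].
  rewrite big_nil (_ : (fun _ => _) = (fun=> 0)); first exact: hom_zero.
  by apply/funext => x; rewrite big_nil.
rewrite big_cons (_ : (fun _ => _) = (fun x => (if P i then F i x else 0) + \sum_(i <- r | P i) F i x)).
  case: ifP => Pi.
    by apply: hom_add => //; exact: h.
  by rewrite (_ : (fun _ => _) = (fun x => \sum_(i <- r | P i) F i x))//; apply/funext => x; rewrite add0r.
by apply/funext => x; rewrite big_cons; case: (P i) => //; rewrite add0r.
Qed.

Lemma partial_shift f p i : partial i (fun x => f (x - p)) = (fun x => partial i f (x - p)).
Proof.
apply/funext => x; rewrite /partial /derive.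
have -> // : (fun h : R => h^-1 *: (((fun x => f (x - p)) \o shift x) (h *: evec R i) - f (x - p))) =
  (fun h => h^-1 *: ((f \o shift (x - p)) (h *: evec R i) - f (x - p))).
by apply/funext => h /=; rewrite addrA.
Qed.

Lemma iter_partial_shift f p s :
  iter_partial s (fun x => f (x - p)) = (fun x => iter_partial s f (x - p)).
Proof. by elim: s => //= i s ->; rewrite partial_shift. Qed.

Lemma iter_partialD (A : set 'rV[R]_n) f g s x : open A -> smo A f -> smo A g -> A x ->
  iter_partial s (fun x => f x + g x) x = iter_partial s f x + iter_partial s g x.
Proof.
move=> oA sf sg; elim: s x => [//|i s IH] x Ax /=.
rewrite (eq_partial i oA IH Ax).
exact: (partialD i (smo_iter s sf) (smo_iter s sg) Ax).
Qed.

Lemma smo_shift f p : smo [set: 'rV[R]_n] f -> smo [set: 'rV[R]_n] (fun x => f (x - p)).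
Proof.
move=> sf; have oT : open [set: 'rV[R]_n] by exact: openT.
have -> : (fun x => f (x - p)) = (fun x => f (\row_j (x 0 j - p 0 j))).
  by apply/funext => x; congr f; apply/rowP => j; rewrite !mxE.
exact: (smo_comp oT oT sf (q := fun j (x : 'rV[R]_n) => x 0 j - p 0 j)
  (fun j => smoB oT (smo_coord j oT) (smo_cst (p 0 j) oT)) (fun _ _ => I)).
Qed.

(* By the mean value theorem the derivative at x is close to a difference quotient over a short step,
   uniformly in the index, since the second derivatives are uniformly bounded. *)
Lemma iter_partial_lim (S : nat -> 'rV[R]_n -> R) (F : 'rV[R]_n -> R) p r
    (b : nat -> R) :
  0 < r ->
  (forall N, smo [set: 'rV[R]_n] (S N)) -> smo [set x | `|x - p| < r] F ->
  (forall s N x, `|x - p| < r -> `|iter_partial s (S N) x| <= b (size s)) ->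
  (forall x, `|x - p| < r -> forall e, 0 < e -> exists N0, forall N, (N0 <= N)%N -> `|S N x - F x| < e) ->
  forall s x, `|x - p| < r -> forall e, 0 < e -> exists N0, forall N, (N0 <= N)%N ->
    `|iter_partial s (S N) x - iter_partial s F x| < e.
Proof.
move=> r0 sS sF bS cS; elim => [//|i s IH] x xr e e0 /=.
set u := fun N => iter_partial s (S N); set v := iter_partial s F.
have oB : open [set x : 'rV[R]_n | `|x - p| < r].
  apply: open_ballI => y /= yr; exists (r - `|y - p|); first by rewrite subr_gt0.
  by move=> z; rewrite ltrBrDr => h; apply: le_lt_trans h; rewrite -[z - p](subrKA y) ler_normD.
have sv : smo [set x : 'rV[R]_n | `|x - p| < r] v by exact: smo_iter.
have cv : {for x, continuous (partial i v)} by have [] := sv [:: i] x xr.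
have e40 : 0 < e / 4 by rewrite divr_gt0.
have [r1 r10 h1] := cont_ballE cv e40.
have [r2 r20 h2] := open_ballE oB xr.
set B := b (size s).+2; have B0 : 0 <= B by apply: le_trans (bS [:: i, i & s] 0 x xr).
set t := Order.min (Order.min r1 r2 / 2) (e / 4 / (B + 1)).
have B1 : 0 < B + 1 by rewrite ltr_wpDl.
have t0 : 0 < t by rewrite !lt_min !divr_gt0// lt_min r10 r20.
have tB : t * B < e / 4.
  have : t <= e / 4 / (B + 1) by rewrite ge_min lexx orbT.
  rewrite ler_pdivlMr// mulrDr mulr1; lra.
have tr : t < r1 /\ t < r2.
  have : t <= Order.min r1 r2 / 2 by rewrite ge_min lexx.
  have : Order.min r1 r2 <= r1 by rewrite ge_min lexx.
  have : Order.min r1 r2 <= r2 by rewrite ge_min lexx orbT.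
  by split; lra.
have ev (d : R) : `|d *: evec R i| <= `|d|.
  apply: rV_norm_le => // q; rewrite mxE evecE normrM.
  by case: (i == q); rewrite ?normr1 ?normr0 ?mulr1 ?mulr0.
have dc c : `|c| <= t -> `|c *: evec R i + x - x| <= t.
  by move=> ct; rewrite addrK; exact: le_trans (ev c) ct.
have inB c : `|c| <= t -> `|c *: evec R i + x - p| < r.
  by move=> ct; apply: h2; apply: le_lt_trans (dc _ ct) _; case: tr.
have bc a c : between 0 a c -> `|a| <= t -> `|c| <= t.
  by move=> /between_dist; rewrite !subr0; exact: le_trans.
have tt : `|t| <= t by rewrite gtr0_norm.
have mvt (w : 'rV[R]_n -> R) a : smo [set x : 'rV[R]_n | `|x - p| < r] w -> `|a| <= t ->
    exists2 c, `|c| <= t & w (a *: evec R i + x) - w x = partial i w (c *: evec R i + x) * a.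
  move=> sw ha.
  have [c hc ec] := @MVT_between R (fun a => w (a *: evec R i + x))
    (fun a => partial i w (a *: evec R i + x)) 0 a
    (fun c hc => is_derive_line ((smo_derivable sw (inB c (bc _ _ hc ha))))).
  exists c; first exact: bc hc ha.
  by rewrite subr0 scale0r add0r in ec.
have [c ct ec] := mvt v t sv tt.
have e2 : 0 < e / 8 * t by rewrite mulr_gt0// divr_gt0.
have [N1 hN1] := IH x xr _ e2.
have [N2 hN2] := IH _ (inB t tt) _ e2.
exists (maxn N1 N2) => N; rewrite geq_max => /andP[/hN1 k1 /hN2 k2].
have su : smo [set x : 'rV[R]_n | `|x - p| < r] (u N).
  by apply: (@smo_sub _ _ setT) => //; apply: smo_iter.
have [c1 c1t ec1] := mvt (u N) t su tt.
have [c2 c2t ec2] := mvt (partial i (u N)) c1 (smo_partial i su) c1t.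
have k3 : `|partial i v (c *: evec R i + x) - partial i v x| < e / 4.
  by apply: h1; apply: le_lt_trans (dc _ ct) _; case: tr.
have k4 : `|partial i (u N) (c1 *: evec R i + x) - partial i (u N) x| < e / 4.
  rewrite ec2 normrM; apply: le_lt_trans tB; rewrite mulrC; apply: ler_pM => //.
  exact: (bS [:: i, i & s] N _ (inB c2 c2t)).
have k5 : `|partial i (u N) (c1 *: evec R i + x) - partial i v (c *: evec R i + x)| < e / 4.
  rewrite -(ltr_pM2r t0) -[X in _ * X < _](gtr0_norm t0) -normrM mulrBl -ec1 -ec.
  move: k1 k2; rewrite -/(u N) -/v => k1 k2.
  rewrite (_ : _ - _ = (u N (t *: evec R i + x) - v (t *: evec R i + x)) - (u N x - v x)); last by ring.
  apply: le_lt_trans (ler_normB _ _) _; move: k1 k2.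
  rewrite (_ : e / 4 * t = e / 8 * t + e / 8 * t); last by field.
  by move=> k1 k2; rewrite addrC ltrD.
move: k3 k4 k5; rewrite !ltr_norml.
move=> /andP[a1 a2] /andP[a3 a4] /andP[a5 a6]; apply/andP; split; lra.
Qed.

(** Cauchy estimates with the factorial of the total order instead of those of a multi-index, so
    that words of derivatives can stay unsorted. *)
Definition CE (F : 'rV[R]_n -> R) p := exists C M r : R, [/\ 0 <= C, 0 <= M, 0 < r &
  forall s x, `|x - p| < r -> `|iter_partial s F x| <= C * M ^+ size s * (size s)`!%:R].

Lemma ffact_le_expn d k : (d ^_ k <= k`! * 2 ^ d)%N.
Proof.
rewrite -bin_ffact mulnC leq_mul2l; apply/orP; right.
case: (leqP k d) => [kd|dk]; last by rewrite bin_small.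
rewrite -[2%N]/(1 + 1)%N expnDn (bigD1 (Ordinal (kd : (k < d.+1)%N)))//= !exp1n !muln1.
exact: leq_addr.
Qed.

Lemma sum_half N : \sum_(d < N) (2^-1 : R) ^+ d <= 2.
Proof.
suff -> : \sum_(d < N) (2^-1 : R) ^+ d = 2 - 2 * 2^-1 ^+ N by rewrite lerBlDr lerDl mulr_ge0// exprn_ge0// invr_ge0.
elim: N => [|N IH]; first by rewrite big_ord0 expr0 mulr1 subrr.
by rewrite big_ord_recr/= IH exprS; lra.
Qed.

End Hom.
End Analytic1.

Section Analytic2.
Variable R : realType.

Lemma pow_half_small (C e : R) : 0 < e -> exists m : nat, C * 2^-1 ^+ m < e.
Proof.
move=> e0; have [C0|C0] := leP C 0.
  by exists 0%N; rewrite mulr1; exact: le_lt_trans e0.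
have := archi_boundP (divr_ge0 (ltW C0) (ltW e0)).
set m := Num.bound _ => hm; exists m.
rewrite exprVn ltr_pdivrMr ?exprn_gt0// mulrC -ltr_pdivrMr// (lt_le_trans hm)//.
by rewrite -natrX ler_nat ltnW// ltn_expl.
Qed.

Section N.
Variable n : nat.
Implicit Types (F G : 'rV[R]_n -> R) (s : seq 'I_n).

Lemma iter_partial_rcons F s i : iter_partial (rcons s i) F = iter_partial s (partial i F).
Proof. by rewrite /iter_partial foldr_rcons. Qed.

Lemma iter_partial0 s x : iter_partial s (fun=> 0 : R) x = 0 :> R.
Proof.
suff -> : iter_partial s (fun _ : 'rV[R]_n => 0 : R) = (fun=> 0) by [].
by elim: s => //= i s ->; apply/funext => y; exact: partial_cst.
Qed.

Lemma iter_partial_sum (A : set 'rV[R]_n) (f : nat -> 'rV[R]_n -> R) s N x : open A ->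
  (forall d, smo A (f d)) -> A x ->
  iter_partial s (fun x => \sum_(d < N) f d x) x = \sum_(d < N) iter_partial s (f d) x.
Proof.
move=> oA sf Ax; elim: N => [|N IH].
  rewrite big_ord0 -[RHS](iter_partial0 s x); congr (iter_partial s _ x).
  by apply/funext => y; rewrite big_ord0.
rewrite big_ord_recr/= -IH -(iter_partialD s oA _ (sf N) Ax).
  by congr (iter_partial s _ x); apply/funext => y; rewrite big_ord_recr.
by apply: smo_sum => // j; exact: sf.
Qed.

(** The Taylor polynomials are sums of homogeneous ones, whose derivatives are bounded independently
    of the degree of truncation on a smaller ball; [iter_partial_lim] carries the bounds to F. *)
Lemma analytic_CE (A : set 'rV[R]_n) F p : open A -> analytic_on A F -> A p -> CE F p.
Proof.
move=> oA [/(smooth_on_smo _ oA) sF aF] Ap.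
have [r1 r10 h1] := open_ballE oA Ap; have [r2 r20 h2] := aF p Ap.
pose r := Order.min r1 r2.
have rp : 0 < r by rewrite lt_min r10.
have [tau tau0 taur] : exists2 t, 0 < t & t < r by exists (r / 2); [rewrite divr_gt0|lra].
move: taur; rewrite lt_min => /andP[tr1 tr2].
pose coef (al : 'I_n -> nat) := iter_partial (mi_seq al) F p / (\prod_i ((al i)`!)%:R).
pose P d := fun al : {ffun 'I_n -> 'I_d.+1} => (\sum_i (al i : nat) == d)%N.
pose a d : R := \sum_(al : {ffun 'I_n -> 'I_d.+1} | P d al) `|coef (fun i => al i)|.
pose f d (h : 'rV[R]_n) : R :=
  \sum_(al : {ffun 'I_n -> 'I_d.+1} | P d al) coef (fun i => al i) * \prod_i h 0 i ^+ al i.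
have hf d : hom d (a d) (f d).
  apply: hom_bigsum => al /eqP e; rewrite -[X in hom X]e.
  exact: (hom_monomial (coef (fun i => al i)) (fun i => (al i : nat))).
have a0 d : 0 <= a d by apply: hom_ge0 (hf d).
have fE x N : \sum_(d < N.+1) f d (x - p) = taylor_sum id F p x N.
  apply: eq_bigr => d _; apply: eq_bigr => al _; rewrite /taylor_term; congr (_ * _).
  by apply: eq_bigr => i _; rewrite !mxE.
(* At this corner each monomial of degree d equals tau ^ d, so absolute convergence there bounds a d
   * tau ^ d. *)
pose x0 : 'rV[R]_n := \row_j (p 0 j + tau).
have x0p : `|x0 - p| <= tau.
  apply: rV_norm_le => [|i]; first exact: ltW.
  by rewrite !mxE addrAC subrr add0r ger0_norm ?lexx// ltW.
have [c0 _] := h2 x0 (h1 _ (le_lt_trans x0p tr1)) (le_lt_trans x0p tr2).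
have [C C0 aC] : exists2 C, 0 <= C & forall d, a d * tau ^+ d <= C.
  have [M [Mr hM]] := cvg_seq_bounded c0.
  have k1 : M < `|M| + 1 by rewrite ltr_pwDr// ler_norm.
  exists (`|M| + 1) => [|d]; first by rewrite addr_ge0.
  have := hM _ k1 d I; apply: le_trans; apply: le_trans (ler_norm _).
  rewrite /taylor_sum big_ord_recr/= -[X in X <= _]add0r; apply: lerD.
    by apply: sumr_ge0 => i _; apply: sumr_ge0 => al _; exact: normr_ge0.
  rewrite mulr_suml; apply: ler_sum => al /eqP e.
  rewrite /taylor_term [X in _ <= X]normrM; apply: (ler_wpM2l (normr_ge0 _)).
  rewrite normr_prod -{1}e -prodrXr; apply: ler_prod => i _.
  by rewrite !mxE addrAC subrr add0r normrX ger0_norm ?(ltW tau0)// exprn_ge0 ?lexx// ltW.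
(* One factor 2 compensates the 2 ^ d of [ffact_le_expn], the other leaves a geometric series of
   ratio 1/2. *)
pose rho := tau / 4; have rho0 : 0 < rho by rewrite divr_gt0.
pose b k : R := 2 * C * rho^-1 ^+ k * k`!%:R.
pose S N (x : 'rV[R]_n) : R := \sum_(d < N.+1) f d (x - p).
have oT : open [set: 'rV[R]_n] by exact: openT.
have sS N : smo [set: 'rV[R]_n] (S N).
  exact: (smo_sum oT (fun j => smo_shift p (hom_smo (hf j)))).
have rin x : `|x - p| < rho -> A x /\ `|x - p| < r2.
  have rt : rho < tau by rewrite /rho; lra.
  by move=> h; split; [apply: h1; exact: lt_trans (lt_trans h rt) tr1|exact: lt_trans (lt_trans h rt) tr2].
have bS s N x : `|x - p| < rho -> `|iter_partial s (S N) x| <= b (size s).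
  move=> xr; rewrite /S (iter_partial_sum (f := fun d x => f d (x - p)) s N.+1 oT _ I); last first.
    by move=> d; apply: smo_shift; exact: (hom_smo (hf d)).
  apply: le_trans (ler_norm_sum _ _ _) _.
  apply: (@le_trans _ _ (\sum_(d < N.+1) C * rho^-1 ^+ size s * (size s)`!%:R * 2^-1 ^+ d)).
    apply: ler_sum => d _; rewrite iter_partial_shift.
    apply: le_trans (hom_le (hom_iter s (hf d)) _) _.
    have [sd|ds] := leqP (size s) d; last first.
      by rewrite ffact_small// !mul0r !mulr_ge0// exprn_ge0// invr_ge0// ltW.
    have e1 : `|x - p| ^+ (d - size s) <= rho ^+ d * rho^-1 ^+ size s.
      rewrite exprVn -expfB_cond ?(gt_eqF rho0)//.
      by apply: lerXn2r; rewrite ?nnegrE ?normr_ge0 ?ltW.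
    have e2 : a d <= C / tau ^+ d by rewrite ler_pdivlMr// exprn_gt0.
    have e3 : (d ^_ size s)%:R <= (size s)`!%:R * 2 ^+ d :> R by rewrite -natrX -natrM ler_nat ffact_le_expn.
    apply: (@le_trans _ _ ((size s)`!%:R * 2 ^+ d * (C / tau ^+ d) * (rho ^+ d * rho^-1 ^+ size s))).
      by apply: ler_pM => //; [rewrite mulr_ge0|apply: ler_pM].
    have -> : tau = 4 * rho by rewrite /rho; field.
    rewrite exprMn (_ : 4 ^+ d = 2 ^+ d * 2 ^+ d :> R); last by rewrite -exprMn; congr (_ ^+ _); ring.
    rewrite [2^-1 ^+ d]exprVn le_eqVlt; apply/orP; left; apply/eqP.
    have : rho ^+ d != 0 by rewrite expf_neq0// gt_eqF.
    have : 2 ^+ d != 0 :> R by rewrite expf_neq0.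
    move: (rho ^+ d) (2 ^+ d : R) (rho^-1 ^+ size s) ((size s)`!%:R : R) => u v w z u0 v0.
    by field; rewrite u0.
  rewrite -mulr_sumr /b.
  rewrite (_ : 2 * C * _ * _ = C * rho^-1 ^+ size s * (size s)`!%:R * 2); last by ring.
  apply: ler_wpM2l; last exact: sum_half.
  by rewrite !mulr_ge0// exprn_ge0// invr_ge0 ltW.
have cS x : `|x - p| < rho -> forall e, 0 < e -> exists N0, forall N, (N0 <= N)%N -> `|S N x - F x| < e.
  move=> /rin[Ax xr] e e0; have [_ /cvgrPdist_lt/(_ e e0)[N0 _ hN0]] := h2 x Ax xr.
  by exists N0 => N hN; rewrite distrC /S fE; exact: hN0.
have sB : smo [set x | `|x - p| < rho] F by apply: (smo_sub _ sF) => x /rin[].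
have lim := iter_partial_lim rho0 sS sB bS cS.
exists (2 * C), rho^-1, rho; split => //; [by rewrite mulr_ge0|by rewrite invr_ge0 ltW|].
move=> s x xr; apply/ler_addgt0Pl => e e0.
have [N /(_ N (leqnn _)) hN] := lim s x xr e e0.
have := bS s N x xr; rewrite -/(b (size s)) => h.
rewrite -[iter_partial s F x](subKr (iter_partial s (S N) x)).
apply: le_trans (ler_normB _ _) _; rewrite addrC; apply: lerD => //.
exact: ltW.
Qed.

(** Analyticity through Cauchy estimates, which pass directly to sums, products and derivatives and
    are enough for the identity theorem. *)
Definition an (A : set 'rV[R]_n) F := smo A F /\ forall p, A p -> CE F p.

Section A.
Variables (A : set 'rV[R]_n) (oA : open A).

Lemma an_partial i F : an A F -> an A (partial i F).
Proof.
move=> [sF cF]; split=> [|p Ap]; first exact: smo_partial.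
have [C [M [r [C0 M0 r0 h]]]] := cF p Ap.
exists (C * M), (M * 2), r; split; rewrite ?mulr_ge0// => s x xr.
rewrite -iter_partial_rcons; apply: le_trans (h _ _ xr) _; rewrite size_rcons.
set k := size s; rewrite factS natrM exprS exprMn.
have e : k.+1%:R <= 2 ^+ k :> R by rewrite -natrX ler_nat ltn_expl.
rewrite (_ : C * M * _ * _ = C * (M * M ^+ k) * (2 ^+ k * k`!%:R)); last by ring.
by apply: ler_wpM2l; [rewrite !mulr_ge0// exprn_ge0|apply: ler_wpM2r].
Qed.

Lemma CE_mono (C M C' M' : R) k : 0 <= C -> 0 <= M -> C <= C' -> M <= M' ->
  C * M ^+ k * k`!%:R <= C' * M' ^+ k * k`!%:R.
Proof.
move=> C0 M0 hC hM; apply: ler_wpM2r => //; apply: ler_pM => //; first exact: exprn_ge0.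
by apply: lerXn2r => //; rewrite nnegrE //; exact: le_trans hM.
Qed.

Lemma CE2 F G p : A p -> CE F p -> CE G p -> exists C M r : R, [/\ 0 <= C, 0 <= M, 0 < r &
  forall x, `|x - p| < r -> A x /\ forall s, `|iter_partial s F x| <= C * M ^+ size s * (size s)`!%:R /\
    `|iter_partial s G x| <= C * M ^+ size s * (size s)`!%:R].
Proof.
move=> Ap [C [M [r [C0 M0 r0 h]]]] [C' [M' [r' [C'0 M'0 r'0 h']]]].
have [r1 r10 h1] := open_ballE oA Ap.
exists (C + C'), (M + M'), (Order.min r1 (Order.min r r')); split; rewrite ?addr_ge0// ?lt_min ?r10 ?r0//.
move=> x; rewrite !lt_min => /and3P[k1 k2 k3]; split; first exact: h1.
move=> s; split; [apply: le_trans (h s x k2) _|apply: le_trans (h' s x k3) _]; apply: CE_mono => //.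
- by rewrite lerDl.
- by rewrite lerDl.
- by rewrite lerDr.
- by rewrite lerDr.
Qed.

Lemma anD F G : an A F -> an A G -> an A (fun x => F x + G x).
Proof.
move=> [sF cF] [sG cG]; split=> [|p Ap]; first exact: smoD.
have [C [M [r [C0 M0 r0 h]]]] := CE2 Ap (cF p Ap) (cG p Ap).
exists (C + C), M, r; split; rewrite ?addr_ge0// => s x xr; have [Ax /(_ s)[h1 h2]] := h x xr.
rewrite (iter_partialD s oA sF sG Ax) !mulrDl.
by apply: le_trans (ler_normD _ _) _; exact: lerD.
Qed.

(** Weights bounding the derivatives of order s of a product of derivatives of orders a and b. Their
    recursion [WS] has the shape of the Leibniz rule, which avoids binomial sums. *)
Let W (s a b : nat) : R := a`!%:R * b`!%:R * (a + b + s).+1`!%:R / (a + b).+1`!%:R.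

Let WS (s a b : nat) : W s a.+1 b + W s a b.+1 = W s.+1 a b.
Proof.
have alg (x y u v f g : R) : u != 0 -> x + y != 0 ->
    x * f * g * v / ((x + y) * u) + f * (y * g) * v / ((x + y) * u) = f * g * v / u.
  by move=> u0 xy; field; rewrite ?u0 ?xy.
rewrite /W !addSn !addnS !addSn (factS a) (factS b) (factS (a + b).+1) !natrM.
have -> : (a + b).+2%:R = a.+1%:R + b.+1%:R :> R by rewrite -natrD addSn addnS.
apply: alg; last by rewrite -natrD pnatr_eq0.
by rewrite -natrM pnatr_eq0 -lt0n; exact: (fact_gt0 (a + b).+1).
Qed.

Lemma anM F G : an A F -> an A G -> an A (fun x => F x * G x).
Proof.
move=> [sF cF] [sG cG]; split=> [|p Ap]; first exact: smoM.
have [C [M [r [C0 M0 r0 h]]]] := CE2 Ap (cF p Ap) (cG p Ap).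
have key s : forall a b x, `|x - p| < r ->
    `|iter_partial s (fun y => iter_partial a F y * iter_partial b G y) x|
      <= C * C * M ^+ (size s + size a + size b) * W (size s) (size a) (size b).
  elim/last_ind: s => [|s i IH] a b x xr.
    have [Ax hx] := h x xr.
    rewrite /= normrM /W addn0 mulfK ?pnatr_eq0 -?lt0n ?fact_gt0// add0n exprD.
    have [h1 _] := hx a; have [_ h2] := hx b.
    apply: le_trans (ler_pM (normr_ge0 _) (normr_ge0 _) h1 h2) _.
    by rewrite le_eqVlt; apply/orP; left; apply/eqP; ring.
  have [Ax _] := h x xr.
  rewrite iter_partial_rcons size_rcons -WS mulrDr.
  rewrite (@eq_iter_partial R n A _ (fun y => iter_partial (i :: a) F y * iter_partial b G y +
     iter_partial a F y * iter_partial (i :: b) G y) s oA _ x Ax); last first.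
    by move=> y Ay; exact: (partialM i (smo_iter a sF) (smo_iter b sG) Ay).
  rewrite (iter_partialD s oA _ _ Ax).
  - apply: le_trans (ler_normD _ _) _; apply: lerD.
      by have := IH (i :: a) b x xr; rewrite /= addSnnS.
    have := IH a (i :: b) x xr; rewrite /= addnS.
    by rewrite -2!addSn.
  - exact: (smoM oA (smo_iter _ sF) (smo_iter _ sG)).
  - exact: (smoM oA (smo_iter _ sF) (smo_iter _ sG)).
exists (C * C), (M * 2), r; split; rewrite ?mulr_ge0// => s x xr.
apply: le_trans (key s [::] [::] x xr) _.
rewrite /W /= !addn0 add0n !fact0 !mul1r divr1 exprMn factS natrM.
set k := size s; have e : k.+1%:R <= 2 ^+ k :> R by rewrite -natrX ler_nat ltn_expl.
rewrite (_ : C * C * (M ^+ k * 2 ^+ k) * k`!%:R = C * C * M ^+ k * (2 ^+ k * k`!%:R)); last by ring.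
by apply: ler_wpM2l; [rewrite !mulr_ge0// exprn_ge0|apply: ler_wpM2r].
Qed.

Lemma an_cst (c : R) : an A (fun=> c).
Proof.
split=> [|p Ap]; first exact: smo_cst.
exists `|c|, 1, 1; split=> // s x _; case/lastP: s => [|s i]; first by rewrite /= !mulr1.
rewrite iter_partial_rcons.
have -> : partial i (fun _ : 'rV[R]_n => c) = (fun=> 0) by apply/funext => y; exact: partial_cst.
by rewrite iter_partial0 normr0 !mulr_ge0// exprn_ge0.
Qed.

Lemma an_coord i : an A (fun x => x 0 i).
Proof.
split=> [|p Ap]; first exact: smo_coord.
have N0 : 0 <= `|p| by exact: normr_ge0.
exists (`|p| + 1), 1, 1; split; rewrite ?addr_ge0//.
move=> s x xp; rewrite expr1n mulr1; case/lastP: s => [|s j].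
  rewrite /= mulr1; apply: le_trans (rV_coord_le x i) _.
  rewrite -[x](subrK p) addrC; apply: le_trans (ler_normD _ _) _; apply: lerD => //.
  exact: ltW.
rewrite iter_partial_rcons.
have -> : partial j (fun x : 'rV[R]_n => x 0 i) = (fun=> (j == i)%:R) by apply/funext => y; exact: partial_coord.
have f1 (m : nat) : 1 <= m`!%:R :> R by rewrite ler1n fact_gt0.
case/lastP: s => [|s l].
  rewrite /= mulr1; case: (j == i); rewrite ?normr1 ?normr0; last by rewrite addr_ge0.
  by rewrite lerDr.
rewrite iter_partial_rcons.
have -> : partial l (fun _ : 'rV[R]_n => (j == i)%:R : R) = (fun=> 0) by apply/funext => y; exact: partial_cst.
by rewrite iter_partial0 normr0 mulr_ge0// addr_ge0.
Qed.

Lemma anN F : an A F -> an A (fun x => - F x).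
Proof. by move=> /(anM (an_cst (-1))); under eq_fun do rewrite mulN1r. Qed.

End A.
End N.
End Analytic2.

(** * Functions constant along the fibres of others *)

Section Rank.
Variable R : realType.

Lemma is_derive_eps (q : R -> R) (t D : R) :
  (forall e, 0 < e -> exists2 dl : R, 0 < dl & forall t', `|t' - t| < dl ->
    `|q t' - q t - D * (t' - t)| <= e * `|t' - t|) -> is_derive t 1 q D.
Proof.
move=> h; have cv : (fun s : R => s^-1 *: ((q \o shift t) (s *: 1) - q t)) @ 0^' --> D.
  apply/cvgrPdist_le => e e0; have [dl dl0 hdl] := h e e0.
  rewrite /dnbhs /within; apply/nbhs_ballP; exists dl => // s.
  rewrite -ball_normE /= sub0r normrN => sd s0.
  have := hdl (s + t); rewrite addrK => /(_ sd) k.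
  rewrite /GRing.scale /= mulr1.
  have sp : 0 < `|s| by rewrite normr_gt0.
  rewrite -(ler_pM2r sp) -normrM.
  have -> : (D - s^-1 * (q (s + t) - q t)) * s = - (q (s + t) - q t - D * s) by field.
  by rewrite normrN.
by split; [apply: (cvgP D)|apply: cvg_lim].
Qed.

(** The limit is the supremum of the increasing sequence u_k - 2 C 2^-k, which stays below the
    decreasing sequence u_k + 2 C 2^-k. *)
Lemma geometric_limit (u : nat -> R) (C : R) : (forall k, `|u k.+1 - u k| <= C * 2^-1 ^+ k) ->
  exists l, forall k, `|l - u k| <= 2 * C * 2^-1 ^+ k.
Proof.
move=> hu; have C0 : 0 <= C by have := hu 0%N; rewrite expr0 mulr1; apply: le_trans.
have q0 j : 0 <= (2^-1 : R) ^+ j by rewrite exprn_ge0// invr_ge0.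
pose v k := u k - 2 * C * 2^-1 ^+ k; pose w k := u k + 2 * C * 2^-1 ^+ k.
have step k : v k <= v k.+1 /\ w k.+1 <= w k.
  have := hu k; rewrite ler_norml /v /w exprS => /andP[h1 h2].
  by move: h1 h2; clear; move: (u k) (u k.+1) (2^-1 ^+ k) => a b c h1 h2; split; nra.
have vm i j : (i <= j)%N -> v i <= v j.
  by apply: (@homo_leq _ v (fun x y => x <= y)) => [//|? ? ?|k]; [exact: le_trans|case: (step k)].
have wm i j : (i <= j)%N -> w j <= w i.
  by apply: (@homo_leq _ w (fun x y => y <= x)) => [//|? ? ? h1 h2|k]; [exact: le_trans h2 h1|case: (step k)].
have vw i : v i <= w i.
  have : 0 <= 2 * C * 2^-1 ^+ i by rewrite !mulr_ge0.
  by rewrite /v /w; clear; move: (u i) (2 * C * _) => a b; lra.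
have ub i : ubound (range v) (w i).
  move=> _ [j _ <-]; apply: le_trans (vm _ _ (leq_maxl j i)) _.
  exact: le_trans (vw _) (wm _ _ (leq_maxr j i)).
exists (sup (range v)) => k.
have h1 : v k <= sup (range v) by apply: ub_le_sup; [exists (w 0%N)|exists k].
have h2 : sup (range v) <= w k by apply: ge_sup => //; exists (v 0%N), 0%N.
by move: h1 h2; rewrite ler_norml /v /w => h1 h2; apply/andP; split; lra.
Qed.

Lemma geometric_limit_rV n (u : nat -> 'rV[R]_n) (C : R) : (forall k, `|u k.+1 - u k| <= C * 2^-1 ^+ k) ->
  exists l, forall k, `|l - u k| <= 2 * C * 2^-1 ^+ k.
Proof.
move=> hu; have C0 : 0 <= C by have := hu 0%N; rewrite expr0 mulr1; apply: le_trans.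
have /choice[l hl] : forall i, exists l, forall k, `|l - u k 0 i| <= 2 * C * 2^-1 ^+ k.
  move=> i; apply: geometric_limit => k.
  by apply: le_trans (hu k); have := rV_coord_le (u k.+1 - u k) i; rewrite !mxE.
exists (\row_i l i) => k; apply: rV_norm_le => [|i].
  by rewrite !mulr_ge0// exprn_ge0// invr_ge0.
by rewrite !mxE.
Qed.

(** Iterate x -> x + (y - F x) from p: the steps are at least halved each time, so the sequence
    stays within twice the first one. *)
Lemma perturb_id_onto n (F : 'rV[R]_n -> 'rV[R]_n) (p : 'rV[R]_n) (d : R) : 0 < d ->
  (forall x y, `|x - p| < d -> `|y - p| < d -> `|(F y - F x) - (y - x)| <= 2^-1 * `|y - x|) ->
  forall y, `|y - F p| < d / 4 -> exists2 x, `|x - p| < d & F x = y.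
Proof.
move=> d0 hF y hy.
pose step (x : 'rV[R]_n) := x + (y - F x).
pose u := fix u k := if k is k'.+1 then step (u k') else p.
have uS k : u k.+1 = u k + (y - F (u k)) by [].
have q0 j : 0 <= (2^-1 : R) ^+ j by rewrite exprn_ge0// invr_ge0.
have N0 : 0 <= `|y - F p| by exact: normr_ge0.
have lt (z : 'rV[R]_n) j : `|z - p| <= `|y - F p| * 2 * (1 - 2^-1 ^+ j) -> `|z - p| < d.
  move=> h; apply: le_lt_trans h _; apply: (@le_lt_trans _ _ (`|y - F p| * 2)); last by clear -hy d0; lra.
  by rewrite ler_piMr ?mulr_ge0// lerBlDr lerDl.
have inv k : `|u k - p| <= `|y - F p| * 2 * (1 - 2^-1 ^+ k) /\ `|u k.+1 - u k| <= `|y - F p| * 2^-1 ^+ k.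
  elim: k => [|k [IH1 IH2]].
    rewrite uS /u subrr normr0 expr0 subrr mulr0 mulr1; split=> //.
    by rewrite addrAC subrr add0r.
  have h1 : `|u k.+1 - p| <= `|y - F p| * 2 * (1 - 2^-1 ^+ k.+1).
    rewrite -(subrKA (u k) (u k.+1)); apply: le_trans (ler_normD _ _) _.
    apply: le_trans (lerD IH2 IH1) _; rewrite exprS.
    by clear; move: (`|y - F p|) (2^-1 ^+ k) => a b; rewrite le_eqVlt; apply/orP; left; apply/eqP; field.
  split => //.
  have -> : u k.+2 - u k.+1 = - ((F (u k.+1) - F (u k)) - (u k.+1 - u k)).
    have alg (a b f0 f1 c : 'rV[R]_n) : b = a + (y - f0) -> c = b + (y - f1) -> c - b = - ((f1 - f0) - (b - a)).
      by move=> -> ->; apply/rowP => i; rewrite !mxE; clear; ring.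
    exact: alg (uS k) (uS k.+1).
  rewrite normrN; apply: le_trans (hF _ _ (lt _ _ IH1) (lt _ _ h1)) _.
  by rewrite exprS mulrCA; apply: ler_wpM2l => //; rewrite invr_ge0.
have [x hx] := @geometric_limit_rV n u _ (fun k => (inv k).2).
have xp : `|x - p| < d.
  apply: le_lt_trans (hx 0%N) _; rewrite expr0 mulr1; clear -hy d0; lra.
exists x => //; apply/eqP; rewrite eq_sym -subr_eq0 -normr_le0.
apply/ler_addgt0Pl => e e0; rewrite addr0.
have [m hm] := pow_half_small (8 * `|y - F p|) e0.
have -> : y - F x = (u m.+1 - u m) + (F (u m) - F x).
  by rewrite uS; apply/rowP => i; rewrite !mxE; clear; ring.
have hd := hF _ _ xp (lt _ _ (inv m).1).
have h2 : `|F (u m) - F x| <= 2 * `|x - u m|.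
  rewrite -[F (u m) - F x](subrK (u m - x)); apply: le_trans (ler_normD _ _) _.
  apply: le_trans (lerD hd (lexx _)) _; rewrite [`|u m - x|]distrC.
  by have : 0 <= `|x - u m| by []; move: (`|x - u m|) => a; lra.
apply: le_trans (ler_normD _ _) _; apply: le_trans (lerD (inv m).2 h2) _.
have := hx m; move: hm; clear -q0 N0; move: (`|x - u m|) (`|y - F p|) N0 (q0 m) => a b.
move: (2^-1 ^+ m) => c b0 c0 h1 h2; have h3 : 0 <= b * c by exact: mulr_ge0.
by clear -h1 h2 h3; nra.
Qed.

(* If the differential of phi is a combination of those of f_1,..,f_r, which are independent at p,
   then phi is constant along the fibres of f near p.  With B a right inverse of the Jacobian of f at p,
   F x = x + B (f x - f p - Df(p) (x - p)) straightens these fibres: Df(p) (F x) - f x is constant. *)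
Lemma fibre_constant n r (A : set 'rV[R]_n) (f : 'I_r -> 'rV[R]_n -> R) (phi : 'rV[R]_n -> R)
    (nu : 'I_r -> 'rV[R]_n -> R) (B : 'I_r -> 'I_n -> R) p :
  open A -> A p -> (forall a, smo A (f a)) -> smo A phi ->
  (forall x i, A x -> partial i phi x = \sum_a nu a x * partial i (f a) x) ->
  (forall a b, \sum_i B a i * partial i (f b) p = (a == b)%:R) ->
  exists2 d : R, 0 < d & (forall x, `|x - p| < d -> A x) /\
    forall x y, `|x - p| < d -> `|y - p| < d -> (forall a, f a x = f a y) -> phi x = phi y.
Proof.
move=> oA Ap sf sphi hphi hB.
pose F (x : 'rV[R]_n) : 'rV[R]_n := \row_i (x 0 i + \sum_a B a i *
  (f a x - f a p - \sum_j (x 0 j - p 0 j) * partial j (f a) p)).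
pose M := 1 + \sum_a \sum_i `|B a i|.
have M1 : 1 <= M by rewrite lerDl; apply: sumr_ge0 => a _; apply: sumr_ge0.
have M0 : 0 < M by exact: lt_le_trans M1.
have [d1 d10 hd1] := open_ballE oA Ap.
have e0 : 0 < (2 * M)^-1 by rewrite invr_gt0 mulr_gt0.
have [|a|d2 d20 hd2] := @common_radius R r (fun a d => forall x y, `|x - p| < d -> `|y - p| < d ->
    `|f a y - f a x - \sum_i (y 0 i - x 0 i) * partial i (f a) p| <= (2 * M)^-1 * `|y - x|).
  by move=> a r1 r2 h _ r21 x y hx hy; apply: h; [exact: lt_le_trans hx _|exact: lt_le_trans hy _].
  have [k1 k2] := smo_near oA (sf a) Ap.
  exact: (strict_diff k1 k2).
pose d := Order.min d1 d2.
have dp : 0 < d by rewrite lt_min d10.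
have dA x : `|x - p| < d -> A x by rewrite lt_min => /andP[/hd1].
have FE x y i : F y 0 i - F x 0 i = (y 0 i - x 0 i) + \sum_a B a i *
    (f a y - f a x - \sum_j (y 0 j - x 0 j) * partial j (f a) p).
  rewrite !mxE opprD addrACA; congr (_ + _); rewrite -sumrB; apply: eq_bigr => a _.
  rewrite -mulrBr; congr (_ * _).
  rewrite (_ : \sum_j (y 0 j - x 0 j) * _ = \sum_j (y 0 j - p 0 j) * partial j (f a) p -
     \sum_j (x 0 j - p 0 j) * partial j (f a) p); first by clear; ring.
  by rewrite -sumrB; apply: eq_bigr => j _; clear; ring.
have hF x y : `|x - p| < d -> `|y - p| < d -> `|(F y - F x) - (y - x)| <= 2^-1 * `|y - x|.
  rewrite !lt_min => /andP[_ xd] /andP[_ yd].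
  apply: rV_norm_le => [|i]; first by rewrite mulr_ge0// invr_ge0.
  have -> : (F y - F x - (y - x)) 0 i = \sum_a B a i *
    (f a y - f a x - \sum_j (y 0 j - x 0 j) * partial j (f a) p).
    have mxB (u v : 'rV[R]_n) : (u - v) 0 i = u 0 i - v 0 i by rewrite !mxE.
    by rewrite !mxB FE addrAC subrr add0r.
  apply: le_trans (ler_norm_sum _ _ _) _.
  apply: (@le_trans _ _ (\sum_a `|B a i| * ((2 * M)^-1 * `|y - x|))).
    by apply: ler_sum => a _; rewrite normrM; apply: ler_wpM2l => //; exact: hd2.
  rewrite -mulr_suml mulrA; apply: ler_wpM2r => //.
  rewrite ler_pdivrMr ?mulr_gt0// mulrA mulVf// mul1r /M.
  apply: (@le_trans _ _ (\sum_a \sum_i `|B a i|)); last by rewrite lerDr.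
  by apply: ler_sum => a _; rewrite (bigD1 i)//= lerDl; exact: sumr_ge0.
pose w a (z : 'rV[R]_n) := \sum_i z 0 i * partial i (f a) p.
have wF a x y : w a (F y - F x) = f a y - f a x.
  rewrite /w; have mxB (u v : 'rV[R]_n) i : (u - v) 0 i = u 0 i - v 0 i by rewrite !mxE.
  under eq_bigr do rewrite mxB FE mulrDl mulr_suml.
  rewrite big_split/= exchange_big/=.
  set rem := fun b => f b y - f b x - \sum_j (y 0 j - x 0 j) * partial j (f b) p.
  transitivity (w a (y - x) + \sum_b (b == a)%:R * rem b).
    congr (_ + _); first by apply: eq_bigr => i _; rewrite mxB.
    by apply: eq_bigr => b _; rewrite -hB mulr_suml; apply: eq_bigr => i _; rewrite mulrAC.
  rewrite (bigD1 a)//= eqxx mul1r [X in rem a + X]big1; last by move=> b /negbTE ->; rewrite mul0r.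
  rewrite addr0 /rem (_ : w a (y - x) = \sum_j (y 0 j - x 0 j) * partial j (f a) p).
    by rewrite addrCA subrr addr0.
  by apply: eq_bigr => i _; rewrite mxB.
have lip x y : `|x - p| < d -> `|y - p| < d -> `|y - x| <= 2 * `|F y - F x|.
  move=> hx hy; have := hF x y hx hy.
  have : `|y - x| <= `|F y - F x| + `|(F y - F x) - (y - x)|.
    by rewrite -{1}[y - x](subKr (F y - F x)); exact: ler_normB.
  by clear; move: (`|y - x|) (`|F y - F x|) (`|_ - (y - x)|) => a b c; lra.
have onto := perturb_id_onto dp hF.
have Fp : F p = p.
  apply/rowP => i; rewrite mxE big1 ?addr0// => a _; rewrite subrr sub0r.
  by rewrite big1 ?oppr0 ?mulr0// => j _; rewrite subrr mul0r.
have F2 x : `|x - p| < d -> `|F x - p| <= 2 * `|x - p|.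
  move=> hx; have p0 : `|p - p| < d by rewrite subrr normr0.
  have := hF p x p0 hx; rewrite Fp => h.
  rewrite -[F x - p](subrK (x - p)); apply: le_trans (ler_normD _ _) _.
  by move: h; clear; move: (`|_ - (x - p)|) (`|x - p|) (normr_ge0 (x - p)) => a b b0; lra.
(* As F at most doubles distances to p and t, 1 - t are at most 2 in absolute value, points of the
   segment below stay within 8 d / 40 < d / 4 of p, where [onto] applies. *)
have d80 : 0 < d / 40 by rewrite divr_gt0.
have d8d z : `|z - p| < d / 40 -> `|z - p| < d.
  by move=> hz; apply: lt_trans hz _; rewrite ltr_pdivrMr// ltr_pMr// ltr1n.
exists (d / 40) => //; split=> [x hx|x y hx hy fxy]; first by apply: dA; exact: d8d.
(* The segment from F x to F y lifts to a path g from x to y on which every f_a is constant. The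
   path is only known to be Lipschitz, which suffices for the derivative of phi along it to be 0.
   The range ]-1, 2[ gives two-sided derivatives on [0, 1]. *)
pose P (t : R) := t *: (F y - F x) + F x.
have Pin t : -1 < t < 2 -> `|P t - p| < d / 4.
  move=> /andP[t0 t1].
  have -> : P t - p = t *: (F y - p) + (1 - t) *: (F x - p).
    by apply/rowP => i; rewrite /P !mxE; clear; ring.
  apply: le_lt_trans (ler_normD _ _) _; rewrite !normrZ.
  have h1 : `|t| <= 2 by rewrite ler_norml; apply/andP; split; clear -t0 t1; lra.
  have h2 : `|1 - t| <= 2 by rewrite ler_norml; apply/andP; split; clear -t0 t1; lra.
  have k1 := ler_pM (normr_ge0 _) (normr_ge0 _) h1 (F2 _ (d8d _ hy)).
  have k2 := ler_pM (normr_ge0 _) (normr_ge0 _) h2 (F2 _ (d8d _ hx)).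
  apply: le_lt_trans (lerD k1 k2) _; move: hx hy dp; clear.
  by move: (`|x - p|) (`|y - p|) => a b; lra.
have [g hg] : exists g : R -> 'rV[R]_n, forall t, -1 < t < 2 -> `|g t - p| < d /\ F (g t) = P t.
  have /choice[g hg] : forall t, exists z, -1 < t < 2 -> `|z - p| < d /\ F z = P t.
    move=> t; have [t01|] := boolP (-1 < t < 2); last by exists p.
    by have [|z z1 z2] := onto (P t); [rewrite Fp; exact: Pin|exists z].
  by exists g.
have Finj z z' : `|z - p| < d -> `|z' - p| < d -> F z = F z' -> z = z'.
  move=> h1 h2 e; have := lip _ _ h1 h2; rewrite e subrr normr0 mulr0 normr_le0 subr_eq0.
  by move=> /eqP.
have t01 : -1 < (0 : R) < 2 by rewrite ltrN10 ltr0n.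
have t11 : -1 < (1 : R) < 2 by rewrite ltr1n andbT; clear; lra.
have g0 : g 0 = x.
  by have [h1 h2] := hg 0 t01; apply: Finj => //; [exact: d8d|rewrite h2 /P scale0r add0r].
have g1 : g 1 = y.
  by have [h1 h2] := hg 1 t11; apply: Finj => //; [exact: d8d|rewrite h2 /P scale1r subrK].
have fg t t' a : -1 < t < 2 -> -1 < t' < 2 -> f a (g t) = f a (g t').
  move=> h h'; have [_ e] := hg _ h; have [_ e'] := hg _ h'.
  apply/eqP; rewrite -subr_eq0 -wF e e' /P.
  rewrite opprD addrACA subrr addr0 -scalerBl /w.
  under eq_bigr do rewrite mxE -mulrA.
  by rewrite -mulr_sumr -/(w a (F y - F x)) wF fxy subrr mulr0.
have glip t t' : -1 < t < 2 -> -1 < t' < 2 -> `|g t - g t'| <= 2 * `|F y - F x| * `|t - t'|.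
  move=> h h'; have [h1 e] := hg _ h; have [h2 e'] := hg _ h'.
  apply: le_trans (lip _ _ h2 h1) _.
  by rewrite e e' /P opprD addrACA subrr addr0 -scalerBl normrZ -mulrA [`|t - t'| * _]mulrC.
set C := 2 * `|F y - F x| in glip.
have C0 : 0 <= C by rewrite mulr_ge0.
have small (q : 'rV[R]_n -> R) t : smo A q -> -1 < t < 2 -> forall e, 0 < e -> exists2 dl : R, 0 < dl &
    forall t', -1 < t' < 2 -> `|t' - t| < dl ->
    `|q (g t') - q (g t) - \sum_i (g t' 0 i - g t 0 i) * partial i q (g t)| <= e * `|t' - t|.
  move=> sq ht e ep; have [gd _] := hg _ ht.
  have [k1 k2] := smo_near oA sq (dA _ gd).
  have C1 : 0 < C + 1 by rewrite ltr_wpDl.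
  have [dl dl0 hdl] := strict_diff k1 k2 (divr_gt0 ep C1).
  exists (dl / (C + 1)); first by rewrite divr_gt0.
  move=> t' ht'; rewrite ltr_pdivlMr// => h.
  have h1 : `|g t' - g t| < dl.
    apply: le_lt_trans (glip _ _ ht' ht) _; apply: le_lt_trans h.
    by rewrite mulrC; apply: ler_wpM2l => //; rewrite lerDl.
  apply: le_trans (hdl (g t) (g t') _ h1) _; first by rewrite subrr normr0.
  rewrite -mulrA; apply: ler_wpM2l; first exact: ltW.
  rewrite mulrC ler_pdivrMr//; apply: le_trans (glip _ _ ht' ht) _.
  by rewrite mulrC; apply: ler_wpM2l => //; rewrite lerDl.
have flat t : -1 < t < 2 -> forall e, 0 < e -> exists2 dl : R, 0 < dl &
    forall t', -1 < t' < 2 -> `|t' - t| < dl -> `|phi (g t') - phi (g t)| <= e * `|t' - t|.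
  move=> ht e ep.
  have S0 : 0 < 1 + \sum_a `|nu a (g t)| by rewrite ltr_pwDl// sumr_ge0.
  have e20 : 0 < e / 2 by rewrite divr_gt0.
  have e30 : 0 < e / 2 / (1 + \sum_a `|nu a (g t)|) by rewrite divr_gt0.
  have [dl1 dl10 h1] := small phi t sphi ht _ e20.
  have [|a|dl2 dl20 h2] := @common_radius R r (fun a dl => forall t', -1 < t' < 2 -> `|t' - t| < dl ->
    `|f a (g t') - f a (g t) - \sum_i (g t' 0 i - g t 0 i) * partial i (f a) (g t)|
       <= e / 2 / (1 + \sum_a `|nu a (g t)|) * `|t' - t|).
    by move=> a r1 r2 h _ r21 t' h' ht'; apply: h => //; exact: lt_le_trans ht' _.
    exact: (small (f a) t (sf a) ht _ e30).
  exists (Order.min dl1 dl2); first by rewrite lt_min dl10.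
  move=> t' ht'; rewrite lt_min => /andP[k1 k2].
  have [gd _] := hg _ ht.
  have e1 : \sum_i (g t' 0 i - g t 0 i) * partial i phi (g t) =
     \sum_a nu a (g t) * (\sum_i (g t' 0 i - g t 0 i) * partial i (f a) (g t)).
    under eq_bigr => i _ do rewrite (hphi _ _ (dA _ gd)) mulr_sumr.
    rewrite exchange_big/=; apply: eq_bigr => a _; rewrite mulr_sumr.
    by apply: eq_bigr => i _; rewrite mulrCA.
  have e2 : `|\sum_i (g t' 0 i - g t 0 i) * partial i phi (g t)| <= e / 2 * `|t' - t|.
    rewrite e1; apply: le_trans (ler_norm_sum _ _ _) _.
    apply: (@le_trans _ _ (\sum_a `|nu a (g t)| * (e / 2 / (1 + \sum_a `|nu a (g t)|) * `|t' - t|))).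
      apply: ler_sum => a _; rewrite normrM; apply: ler_wpM2l => //.
      by have := h2 a t' ht' k2; rewrite (fg _ _ a ht' ht) subrr sub0r normrN.
    rewrite -mulr_suml mulrA; apply: ler_wpM2r => //.
    by rewrite mulrCA ler_piMr ?(ltW e20)// ler_pdivrMr// mul1r lerDr.
  rewrite -[phi (g t') - phi (g t)](subrK (\sum_i (g t' 0 i - g t 0 i) * partial i phi (g t))).
  apply: le_trans (ler_normD _ _) _; apply: le_trans (lerD (h1 _ ht' k1) e2) _.
  by rewrite -mulrDl -splitr.
have dq (t : R) : -1 < t < 2 -> is_derive t 1 (fun t => phi (g t)) 0.
  move=> ht; apply: is_derive_eps => e ep; have [dl dl0 hdl] := flat t ht e ep.
  have [dl' dl'0 hdl'] : exists2 dl' : R, 0 < dl' & forall t', `|t' - t| < dl' -> -1 < t' < 2.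
    case/andP: ht => h1 h2; exists (Order.min (t + 1) (2 - t)).
      by rewrite lt_min; apply/andP; split; clear -h1 h2; lra.
    move=> t'; rewrite lt_min !ltr_norml => /andP[/andP[k1 k2] /andP[k3 k4]].
    by apply/andP; split; clear -k1 k2 k3 k4; lra.
  exists (Order.min dl dl'); first by rewrite lt_min dl0.
  by move=> t'; rewrite lt_min mul0r subr0 => /andP[q1 q2]; apply: hdl => //; exact: hdl'.
have b01 (c : R) : between 0 1 c -> -1 < c < 2.
  by case=> /andP[h1 h2]; apply/andP; split; clear -h1 h2; lra.
have [c _] := @MVT_between R (fun t => phi (g t)) (fun=> 0) 0 1 (fun c hc => dq c (b01 c hc)).
by rewrite mul0r g0 g1 => /eqP; rewrite subr_eq0 => /eqP ->.
Qed.

End Rank.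

(** * Perturbation of solutions *)

Section Ode.
Variable R : realType.

Lemma antiderivative (f : R -> R) : continuous f ->
  exists2 P : R -> R, P 0 = 0 & forall t : R, `|t| < 1 -> is_derive t 1 P (f t).
Proof.
move=> cf.
pose F := fun x : R => (\int[lebesgue_measure]_(t in [set` Interval (BLeft (-1)) (BRight x)]) f t)%R.
have dF (t : R) : `|t| < 1 -> is_derive t 1 F (f t).
  rewrite ltr_norml => /andP[t1 t2].
  have ci : lebesgue_measure.-integrable [set` Interval (BLeft (-1)) (BRight 1)] (EFin \o f).
    apply: continuous_compact_integrable; first exact: segment_compact.
    by apply: continuous_subspaceT.
  have [d1 d2] := continuous_FTC1_closed t2 ci t1 (cf t).
  by split; [exact: d1|rewrite -derive1E; exact: d2].
exists (fun t => F t - F 0); first by rewrite subrr.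
move=> t ht; have h := dF t ht; rewrite -[f t]subr0; exact: (is_deriveB h (is_derive_cst _ _ _)).
Qed.

Lemma derive_diff_bound (f g f' g' : R -> R) (rho M t : R) : `|t| <= rho ->
  (forall s : R, `|s| <= rho -> is_derive s 1 f (f' s)) -> (forall s : R, `|s| <= rho -> is_derive s 1 g (g' s)) ->
  (forall s : R, `|s| <= rho -> `|f' s - g' s| <= M) ->
  `|f t - g t| <= `|f 0 - g 0| + rho * M.
Proof.
move=> ht df dg hM; have r0 : 0 <= rho by exact: le_trans ht.
have bs (c : R) : between 0 t c -> `|c| <= rho.
  by move=> /between_dist; rewrite !subr0 => h; exact: le_trans ht.
have [c hc ec] := @MVT_between R (fun s => f s - g s) (fun s => f' s - g' s) 0 t
  (fun c hc => is_deriveB (df c (bs c hc)) (dg c (bs c hc))).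
rewrite -[f t - g t](subrK (f 0 - g 0)) addrC; apply: le_trans (ler_normD _ _) _.
apply: lerD => //; rewrite ec subr0 normrM mulrC; apply: ler_pM => //.
by apply: hM; exact: bs.
Qed.

Lemma derivable_ball (f : R -> R) (t e : R) : derivable f t 1 -> 0 < e ->
  exists2 r : R, 0 < r & forall s, `|s - t| < r -> `|f s - f t| < e.
Proof.
by move=> /derivable1_diffP/differentiable_continuous cf; exact: (cont_ballE cf).
Qed.

(** * Picard iteration around an approximate solution *)

Section Picard.
Variables (n : nat) (l : 'I_n -> 'rV[R]_n -> R) (w0 : R -> 'rV[R]_n) (w0' : 'I_n -> R -> R)
  (p a : 'rV[R]_n) (b K rho m d : R).
Hypotheses (b0 : 0 < b) (rho0 : 0 < rho) (rho1 : rho < 1) (K0 : 0 <= K) (rK : rho * K <= 2^-1) (m0 : 0 <= m).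
Hypothesis lip : forall i x y, `|x - p| < b -> `|y - p| < b -> `|l i x - l i y| <= K * `|x - y|.
Hypothesis hw0 : forall t : R, `|t| <= rho -> `|w0 t - p| < b / 2 /\
  forall i, is_derive t 1 (fun t => w0 t 0 i) (w0' i t) /\ `|w0' i t - l i (w0 t)| <= m.
Hypotheses (had : `|a - w0 0| + rho * m <= d) (hd : d < b / 4).

(** Clamping the time to [-rho, rho] makes the integrands continuous on the whole line. *)
Let cl (t : R) := Order.max (- rho) (Order.min rho t).
Let cl_le t : `|cl t| <= rho.
Proof.
rewrite ler_norml le_max lexx/= ge_max ge_min lexx/= andbT.
by rewrite (le_trans _ (ltW rho0))// oppr_le0 ltW.
Qed.
Let cl_id t : `|t| <= rho -> cl t = t.
Proof. by rewrite ler_norml => /andP[h1 h2]; rewrite /cl min_r// max_r. Qed.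
Let cl_lip s t : `|cl s - cl t| <= `|s - t|.
Proof.
have maxl (c y z : R) : `|Order.max c y - Order.max c z| <= `|y - z|.
  wlog st : y z / y <= z.
    by move=> h; case: (leP y z) => [|/ltW] /h//; rewrite distrC [`|y - z|]distrC.
  rewrite [X in _ <= X]distrC [X in _ <= X]ger0_norm ?subr_ge0// ler_norml.
  by case: (leP c y) => h1; case: (leP c z) => h2; apply/andP; split; lra.
have minl (c y z : R) : `|Order.min c y - Order.min c z| <= `|y - z|.
  wlog st : y z / y <= z.
    by move=> h; case: (leP y z) => [|/ltW] /h//; rewrite distrC [`|y - z|]distrC.
  rewrite [X in _ <= X]distrC [X in _ <= X]ger0_norm ?subr_ge0// ler_norml.
  by case: (leP c y) => h1; case: (leP c z) => h2; apply/andP; split; lra.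
exact: le_trans (maxl _ _ _) (minl _ _ _).
Qed.

Let cw (w : R -> 'rV[R]_n) := forall s e, 0 < e -> exists2 r : R, 0 < r &
  forall s', `|s' - s| < r -> `|w (cl s') - w (cl s)| < e.
Let good w := cw w /\ forall t : R, `|t| <= rho -> `|w t - w0 t| <= 2 * d.

Let good_in w (t : R) : good w -> `|t| <= rho -> `|w t - p| < b.
Proof.
move=> [_ h] ht; rewrite -(subrKA (w0 t)); apply: le_lt_trans (ler_normD _ _) _.
have [h0 _] := hw0 ht; have := h t ht; move: h0; have := hd.
by move: (`|w t - w0 t|) (`|w0 t - p|) => x y; lra.
Qed.

Let cw_der (w : R -> 'rV[R]_n) : (forall (t : R) i, `|t| <= rho -> derivable (fun t => w t 0 i) t 1) -> cw w.
Proof.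
move=> h s e e0; have e20 : 0 < e / 2 by rewrite divr_gt0.
have [|i|r r0 hr] := @common_radius R n (fun i r => forall s', `|s' - s| < r -> `|w (cl s') 0 i - w (cl s) 0 i| < e / 2).
- by move=> i r r' h1 _ rr s' h2; apply: h1; exact: lt_le_trans rr.
- have [r r0 hr] := derivable_ball (h (cl s) i (cl_le s)) e20.
  by exists r => // s' hs; apply: hr; exact: le_lt_trans (cl_lip _ _) hs.
exists r => // s' hs; apply: (@le_lt_trans _ _ (e / 2)); last by rewrite ltr_pdivrMr// ltr_pMr// ltr1n.
by apply: rV_norm_le => [|i]; [exact: ltW|rewrite !mxE ltW// hr].
Qed.

(** The Picard operator; on curves that are not [good] its value is arbitrary, so that it can be
    chosen as a total function. *)
Let Tex (w : R -> 'rV[R]_n) : exists w' : R -> 'rV[R]_n, good w -> w' 0 = a /\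
  forall (t : R) i, `|t| < 1 -> is_derive t 1 (fun t => w' t 0 i) (l i (w (cl t))).
Proof.
have [gw|ng] := pselect (good w); last by exists w.
have ci i : continuous (fun s => l i (w (cl s))).
  move=> s; apply: cont_ballI => e e0.
  have K1 : 0 < K + 1 by rewrite ltr_wpDl.
  have [r r0 hr] := gw.1 s _ (divr_gt0 e0 K1).
  exists r => // s' hs; apply: le_lt_trans (lip i (good_in gw (cl_le s')) (good_in gw (cl_le s))) _.
  have := hr s' hs; rewrite ltr_pdivlMr// => h; apply: le_lt_trans h.
  by rewrite mulrC; apply: ler_wpM2l => //; rewrite lerDl.
have /choice[P hP] : forall i, exists P : R -> R, P 0 = 0 /\ forall t : R, `|t| < 1 -> is_derive t 1 P (l i (w (cl t))).
  by move=> i; have [P P0 hP] := antiderivative (ci i); exists P.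
exists (fun t => \row_i (a 0 i + P i t)) => _; split.
  by apply/rowP => i; rewrite mxE (hP i).1 addr0.
move=> t i ht; have -> : (fun t => (\row_i (a 0 i + P i t)) 0 i) = (fun t => a 0 i + P i t).
  by apply/funext => s; rewrite mxE.
have h := (hP i).2 t ht.
rewrite -[l i _]add0r; exact: (is_deriveD (is_derive_cst (a 0 i) _ _) h).
Qed.

(** w0 satisfies the equation up to a defect m. A constant w0 yields existence; an exact solution,
    with m = 0, yields dependence on the initial value. As rho K <= 1/2 the increments are halved,
    and the total deviation is at most 2 d. *)
Lemma picard : exists w : R -> 'rV[R]_n, w 0 = a /\ forall t : R, `|t| <= rho ->
  `|w t - w0 t| <= 2 * d /\ forall i, is_derive t 1 (fun t => w t 0 i) (l i (w t)).
Proof.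
have d0 : 0 <= d by apply: le_trans had; rewrite addr_ge0// mulr_ge0// ltW.
have [T hT] := choice Tex.
pose u := fix u k := if k is k'.+1 then T (u k') else w0.
have q0 j : 0 <= (2^-1 : R) ^+ j by rewrite exprn_ge0// invr_ge0.
have r1 (t : R) : `|t| <= rho -> `|t| < 1 by move=> h; exact: le_lt_trans rho1.
have z0 : `|0 : R| <= rho by rewrite normr0 ltW.
have cT w : good w -> cw (T w).
  by move=> gw; apply: cw_der => t i ht; have [_ /(_ t i (r1 _ ht))[]] := hT w gw.
have cmp w w' M : good w -> good w' -> (forall t : R, `|t| <= rho -> `|w t - w' t| <= M) ->
    forall t : R, `|t| <= rho -> `|T w t - T w' t| <= 2^-1 * M.
  move=> gw gw' h t ht.
  have M0 : 0 <= M by apply: le_trans (h 0 z0).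
  apply: rV_norm_le => [|i]; first by rewrite mulr_ge0// invr_ge0.
  have [e1 D1] := hT w gw; have [e2 D2] := hT w' gw'.
  rewrite !mxE.
  have := @derive_diff_bound (fun t => T w t 0 i) (fun t => T w' t 0 i) _ _ rho (K * M) t ht
    (fun s hs => D1 s i (r1 _ hs)) (fun s hs => D2 s i (r1 _ hs)).
  rewrite e1 e2 subrr normr0 add0r mulrA => hh; apply: le_trans (hh _) _.
    move=> s hs; rewrite (cl_id hs); apply: le_trans (lip i (good_in gw hs) (good_in gw' hs)) _.
    by apply: ler_wpM2l => //; exact: h.
  by apply: ler_wpM2r.
have gw0 : good w0.
  split=> [|t _]; last by rewrite subrr normr0 mulr_ge0.
  by apply: cw_der => t i ht; have [_ /(_ i)[[]]] := hw0 ht.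
have inv k : good (u k) /\ forall t : R, `|t| <= rho -> `|u k t - w0 t| <= 2 * d * (1 - 2^-1 ^+ k) /\
    `|u k.+1 t - u k t| <= d * 2^-1 ^+ k.
  elim: k => [|k [gk IH]].
    split=> // t ht; rewrite (_ : u 0%N = w0)// (_ : u 1%N = T w0)// expr0 !subrr normr0 mulr0 mulr1; split=> //.
    have [e1 D1] := hT w0 gw0.
    apply: rV_norm_le => [//|i]; rewrite !mxE.
    have := @derive_diff_bound (fun t => T w0 t 0 i) (fun t => w0 t 0 i) _ _ rho m t ht
      (fun s hs => D1 s i (r1 _ hs)) (fun s hs => ((hw0 hs).2 i).1).
    move=> hh; apply: le_trans (hh _) _.
      by move=> s hs; rewrite (cl_id hs) distrC; exact: ((hw0 hs).2 i).2.
    apply: le_trans had; rewrite lerD2r e1; have := rV_coord_le (a - w0 0) i; by rewrite !mxE.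
  have h1 (t : R) : `|t| <= rho -> `|u k.+1 t - w0 t| <= 2 * d * (1 - 2^-1 ^+ k.+1).
    move=> ht; have [h1 h2] := IH t ht; rewrite -(subrKA (u k t)).
    apply: le_trans (ler_normD _ _) _; apply: le_trans (lerD h2 h1) _; rewrite exprS.
    by move: (2^-1 ^+ k) => q; rewrite le_eqVlt; apply/orP; left; apply/eqP; field.
  have gk1 : good (u k.+1).
    split; first exact: cT.
    move=> t ht; apply: le_trans (h1 t ht) _.
    by rewrite ler_piMr ?mulr_ge0// lerBlDr lerDl.
  split=> // t ht; split; first exact: h1.
  have := cmp _ _ _ gk1 gk (fun t ht => (IH t ht).2) t ht.
  by rewrite exprS mulrCA.
have /choice[W hW] : forall t : R, exists l, `|t| <= rho -> forall k, `|l - u k t| <= 2 * d * 2^-1 ^+ k.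
  move=> t; have [ht|nt] := boolP (`|t| <= rho); last by exists 0.
  by have [x hx] := geometric_limit_rV (fun k => ((inv k).2 t ht).2); exists x.
have gW : good W.
  split; last by move=> t ht; have := hW t ht 0%N; rewrite expr0 mulr1.
  move=> s e e0; have e3 : 0 < e / 3 by rewrite divr_gt0.
  have [k hk] := pow_half_small (2 * d) e3.
  have [r r0 hr] := (inv k).1.1 s _ e3.
  exists r => // s' hs.
  have h1 := hW _ (cl_le s) k; have h2 := hW _ (cl_le s') k; have h3 := hr _ hs.
  have -> : W (cl s') - W (cl s) = (W (cl s') - u k (cl s')) + (u k (cl s') - u k (cl s)) - (W (cl s) - u k (cl s)).
    by apply/rowP => j; rewrite !mxE; ring.
  apply: le_lt_trans (ler_normB _ _) _; apply: le_lt_trans (lerD (ler_normD _ _) (lexx _)) _.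
  move: h1 h2 h3 hk; move: (`|_ - _|) (`|_ - _|) (`|_ - _|) (2 * d * _) => x y z v; lra.
have WE (t : R) : `|t| <= rho -> T W t = W t.
  move=> ht; apply/eqP; rewrite -subr_eq0 -normr_le0; apply/ler_addgt0Pl => e e0; rewrite addr0.
  have [k hk] := pow_half_small (2 * d) e0.
  have h1 := cmp _ _ _ gW (inv k).1 (fun t ht => hW t ht k) t ht.
  have h2 := hW t ht k.+1.
  rewrite -(subrKA (u k.+1 t)); apply: le_trans (ler_normD _ _) _.
  apply: le_trans (lerD h1 _) _; first by rewrite distrC; exact: h2.
  rewrite exprS; move: hk; move: (2^-1 ^+ k) => q; lra.
have [e1 D1] := hT W gW.
exists (T W); split=> // t ht; split; first by rewrite WE//; exact: gW.2.
by move=> i; have := D1 t i (r1 _ ht); rewrite (cl_id ht) WE.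
Qed.
End Picard.
End Ode.

(** * The identity theorem for analytic functions *)

Section Identity.
Variable R : realType.

Lemma is_derive_aff (a b t : R) : is_derive t 1 (fun t : R => t * a + b) a.
Proof.
apply: is_derive_eps => e e0; exists 1 => // t' _.
have -> : t' * a + b - (t * a + b) - a * (t' - t) = 0 by ring.
by rewrite normr0 mulr_ge0// ltW.
Qed.

(** Takes the place of an integration: compare f with c t^(m+1) / (m+1) by the mean value
    theorem. *)
Lemma derive_pow_bound (f df : R -> R) (c : R) m :
  (forall t : R, 0 <= t <= 1 -> is_derive t 1 f (df t)) ->
  (forall t : R, 0 <= t <= 1 -> df t <= c * t ^+ m) -> f 0 = 0 -> f 1 <= c / m.+1%:R.
Proof.
move=> hd hb f0.
have b01 (s : R) : between 0 1 s -> 0 <= s <= 1.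
  by case=> // /andP[h1 h2]; have := le_trans h1 h2; rewrite ler10.
have dp (s : R) : is_derive s 1 (fun t : R => c / m.+1%:R * t ^+ m.+1) (c * s ^+ m).
  have h := is_deriveZ (c / m.+1%:R) (is_deriveX m.+1 (is_derive_id s (1 : R))).
  have E1 : (fun t : R => c / m.+1%:R * t ^+ m.+1) = (c / m.+1%:R) \*: (id : R -> R) ^+ m.+1.
    by apply/funext => t; rewrite !fctE.
  rewrite E1; have E2 : c * s ^+ m = (c / m.+1%:R) *: ((m.+1%:R * id s ^+ m) *: 1).
    by rewrite /GRing.scale /= mulr1 mulrA divfK// pnatr_eq0.
  by rewrite E2; exact: h.
have [s hs es] := @MVT_between R (fun t => f t - c / m.+1%:R * t ^+ m.+1) (fun s => df s - c * s ^+ m) 0 1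
  (fun s hs => is_deriveB (hd s (b01 s hs)) (dp s)).
have h := hb s (b01 s hs).
have : f 1 - c / m.+1%:R * 1 ^+ m.+1 - (f 0 - c / m.+1%:R * 0 ^+ m.+1) <= 0.
  by rewrite es subr0 mulr1 subr_le0.
by rewrite f0 expr0n/= mulr0 subrr subr0 expr1n mulr1 subr_le0.
Qed.

Variable n : nat.
Implicit Types (F G : 'rV[R]_n -> R) (s : seq 'I_n) (A : set 'rV[R]_n).

Lemma open_ball_rV (p : 'rV[R]_n) (r : R) : open [set x | `|x - p| < r].
Proof.
apply: open_ballI => y /= yr; exists (r - `|y - p|); first by rewrite subr_gt0.
by move=> z; rewrite ltrBrDr => h; apply: le_lt_trans h; rewrite -(subrKA y z) ler_normD.
Qed.

Lemma is_derive_ray A F (p v : 'rV[R]_n) (t : R) : open A -> smo A F -> A (t *: v + p) ->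
  is_derive t 1 (fun t : R => F (t *: v + p)) (\sum_i v 0 i * partial i F (t *: v + p)).
Proof.
move=> oA sF Ax; have E (t' : R) : t' *: v + p = \row_j (t' * v 0 j + p 0 j).
  by apply/rowP => j; rewrite !mxE.
have -> : (fun t : R => F (t *: v + p)) = (fun t : R => F (\row_j (t * v 0 j + p 0 j))).
  by apply/funext => t'; rewrite E.
rewrite E; apply: (is_derive_comp_smo oA sF (q := fun j (t : R) => t * v 0 j + p 0 j)).
  by rewrite -E.
by move=> j; exact: is_derive_aff.
Qed.

(** All derivatives vanish at p, so the Cauchy bounds can be integrated m times along the ray to x;
    this gives |F x| <= C (M a)^m with a = n |x - p|. *)
Lemma CE_eq0 A F p : open A -> smo A F -> CE F p -> A p -> (forall s, iter_partial s F p = 0) ->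
  exists2 r : R, 0 < r & forall x, `|x - p| < r -> A x /\ F x = 0.
Proof.
move=> oA sF [C [M [r0 [C0 M0 r00 hF]]]] Ap F0.
have [r1 r10 h1] := open_ballE oA Ap.
(* This radius makes M a at most 1/2. *)
pose q := (2 * (M + 1) * (n%:R + 1))^-1.
have n1 : 0 < n%:R + 1 :> R by rewrite ltr_wpDl.
have M1 : 0 < M + 1 by rewrite ltr_wpDl.
have q0 : 0 < q by rewrite invr_gt0 !mulr_gt0.
exists (Order.min q (Order.min r0 r1)) => [|x]; first by rewrite !lt_min q0 r00.
rewrite !lt_min => /and3P[xq xr0 xr1]; split; first exact: h1.
have N0 : 0 <= `|x - p| by exact: normr_ge0.
set v := x - p in xq xr0 xr1 N0 *.
have vt (t : R) : 0 <= t <= 1 -> `|t *: v + p - p| <= `|v|.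
  by move=> /andP[t0 t1]; rewrite addrK normrZ ger0_norm// ler_piMl.
have vA (t : R) : 0 <= t <= 1 -> A (t *: v + p).
  by move=> ht; apply: h1; exact: le_lt_trans (vt t ht) xr1.
have vp : 1 *: v + p = x by rewrite scale1r subrK.
set a := n%:R * `|v|; have a0 : 0 <= a by rewrite mulr_ge0.
have key m : forall s (t : R), 0 <= t <= 1 ->
    `|iter_partial s F (t *: v + p)| <= C * M ^+ (size s + m) * (size s + m)`!%:R / m`!%:R * a ^+ m * t ^+ m.
  elim: m => [|m IH] s t ht.
    rewrite addn0 !expr0 !mulr1 divr1; apply: hF; exact: le_lt_trans (vt t ht) xr0.
  have [t0 t1] := andP ht.
  have tu (u : R) : 0 <= u <= 1 -> 0 <= u * t <= 1.
    by move=> /andP[u0 u1]; rewrite mulr_ge0// mulr_ile1.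
  pose c := C * M ^+ (size s + m.+1) * (size s + m.+1)`!%:R / m`!%:R * a ^+ m.+1 * t ^+ m.+1.
  have hv (u : R) : 0 <= u <= 1 -> 
     `|\sum_i (t *: v) 0 i * partial i (iter_partial s F) (u *: (t *: v) + p)| <= c * u ^+ m.
    move=> hu; apply: le_trans (ler_norm_sum _ _ _) _.
    set B := C * M ^+ (size s + m.+1) * (size s + m.+1)`!%:R / m`!%:R * a ^+ m * (u * t) ^+ m.
    apply: (@le_trans _ _ (\sum_(i < n) (t * `|v|) * B)).
      apply: ler_sum => i _; rewrite normrM mxE; apply: ler_pM => //.
        by rewrite normrM ger0_norm//; apply: ler_wpM2l => //; exact: rV_coord_le.
      rewrite scalerA; have := IH (i :: s) (u * t) (tu u hu).
      by rewrite /= addSnnS.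
    rewrite sumr_const card_ord -mulr_natl /B /c /a !exprS !exprMn le_eqVlt; apply/orP; left; apply/eqP.
    by ring.
  have dr (u : R) : 0 <= u <= 1 -> is_derive u 1 (fun u : R => iter_partial s F (u *: (t *: v) + p))
      (\sum_i (t *: v) 0 i * partial i (iter_partial s F) (u *: (t *: v) + p)).
    by move=> hu; apply: (is_derive_ray oA (smo_iter s sF)); rewrite scalerA; apply: vA; exact: tu.
  have f10 : iter_partial s F ((0 : R) *: (t *: v) + p) = 0 by rewrite scale0r add0r F0.
  have U := derive_pow_bound dr (fun u hu => le_trans (ler_norm _) (hv u hu)) f10.
  have L := @derive_pow_bound (fun u : R => - iter_partial s F (u *: (t *: v) + p)) _ c m
    (fun u hu => is_deriveN (dr u hu)) (fun u hu => le_trans (ler_norm _) (eq_ind_r (fun x => x <= _) (hv u hu) (normrN _))) (etrans (congr1 -%R f10) (oppr0 _)).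
  have -> : C * M ^+ (size s + m.+1) * (size s + m.+1)`!%:R / m.+1`!%:R * a ^+ m.+1 * t ^+ m.+1 = c / m.+1%:R.
    rewrite /c factS natrM invfM; ring.
  by move: U L; rewrite scale1r ler_norml lerNl => -> ->.
have F1 m : `|F x| <= C * 2^-1 ^+ m.
  have t1 : 0 <= (1 : R) <= 1 by rewrite ler01 lexx.
  have := key m [::] 1 t1; rewrite vp /= add0n expr1n mulr1 => h; apply: le_trans h _.
  rewrite mulfK ?pnatr_eq0 -?lt0n ?fact_gt0// -mulrA -exprMn; apply: ler_wpM2l => //.
  apply: lerXn2r; rewrite ?nnegrE ?mulr_ge0// ?invr_ge0//.
  have hMa : M * a <= (M + 1) * ((n%:R + 1) * q).
    apply: ler_pM => //; first by rewrite lerDl.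
    by apply: ler_pM => //; [rewrite lerDl|exact: ltW].
  apply: le_trans hMa _; rewrite /q le_eqVlt; apply/orP; left; apply/eqP.
  by field; rewrite !gt_eqF.
apply/eqP; rewrite -normr_le0; apply/ler_addgt0Pl => e e0; rewrite addr0.
by have [m hm] := pow_half_small C e0; exact: le_trans (F1 m) (ltW hm).
Qed.

(** The points of A where all derivatives vanish form an open set, by [CE_eq0], and a relatively
    closed one, by continuity. *)
Lemma an_eq0 A F (O : set 'rV[R]_n) : open A -> connected A -> an A F ->
  open O -> O !=set0 -> O `<=` A -> (forall x, O x -> F x = 0) -> forall x, A x -> F x = 0.
Proof.
move=> oA cA [sF cF] oO [y0 Oy0] OA FO.
pose Z := [set x | A x /\ forall s, iter_partial s F x = 0].
suff ZA : Z = A.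
  move=> x Ax; have Zx : Z x by rewrite ZA.
  exact: (Zx.2 [::]).
have F0 (s : seq 'I_n) x (B : set 'rV[R]_n) : open B -> B x -> (forall y, B y -> F y = 0) -> iter_partial s F x = 0.
  move=> oB Bx FB; by rewrite (eq_iter_partial s oB FB Bx) iter_partial0.
have oZ : open Z.
  apply: open_ballI => x [Ax hx]; have [r r0 hr] := CE_eq0 oA sF (cF x Ax) Ax hx.
  exists r => // y yr; split=> [|s]; first by case: (hr y yr).
  by apply: (F0 s y [set z | `|z - x| < r]) => [|//|z hz]; [exact: open_ball_rV|case: (hr z hz)].
apply: cA.
- by exists y0; split=> [|s]; [exact: OA|exact: F0 oO Oy0 FO].
- by exists Z => //; rewrite predeqE => x; split=> [[Ax hx]|[]].
- pose Y := [set x | A x /\ ~ Z x].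
  have oY : open Y.
    apply: open_ballI => x [Ax nZ].
    have [s /eqP sx] : exists s, iter_partial s F x <> 0.
      by apply: contra_notP nZ => h; split=> // s; apply: contra_notP h => h; exists s.
    have [cs _] := sF s x Ax.
    have [r1 r10 h1] := open_ballE oA Ax.
    have s0 : 0 < `|iter_partial s F x| by rewrite normr_gt0.
    have [r2 r20 h2] := cont_ballE cs s0.
    exists (Order.min r1 r2) => [|y]; first by rewrite lt_min r10.
    rewrite lt_min => /andP[/h1 Ay /h2 hy]; split=> // -[_ /(_ s) e].
    by move: hy; rewrite e sub0r normrN ltxx.
  exists (~` Y); first exact: open_closedC.
  rewrite predeqE => x; split=> [Zx|[Ax nY]]; first by split; [case: Zx|case].
  by apply: contra_notP nY => nZ; split.
Qed.

End Identity.

(** * Successive derivatives, flows and cut-off functions *)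

Section Flow.
Variable R : realType.

(** An explicit sequence of successive derivatives; [dern_family] identifies it with the iterated
    derivatives of its first term. *)
Definition family (I : set R) (F : nat -> R -> R) :=
  forall k t, I t -> is_derive t 1 (F k) (F k.+1 t).

Lemma dern_family (I : set R) (F : nat -> R -> R) (f : R -> R) : open I -> family I F ->
  (forall t, I t -> f t = F 0%N t) ->
  forall k t, I t -> dern k f t = F k t /\ derivable (dern k f) t 1.
Proof.
move=> oI hF f0; suff E k t : I t -> dern k f t = F k t.
  move=> k t It; split; first exact: E.
  have near_eq : {near t, F k =1 dern k f}.
    by have := open_nbhs_nbhs (conj oI It); apply: filterS => s /E.
  by have [d _] := hF k t It; apply: (near_eq_derivable near_eq d).
elim: k t => [|k IH] t It; first exact: f0.
rewrite /dern derive1nS derive1E.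
have near_eq : {near t, dern k f =1 F k}.
  by have := open_nbhs_nbhs (conj oI It); apply: filterS => s /IH.
rewrite (near_eq_derive (1 : R) near_eq).
by have [_ ->] := hF k t It.
Qed.

Lemma family_dern (e : R) (f : R -> R) : smooth_on_int e f -> family [set t | `|t| < e] (fun k => dern k f).
Proof.
move=> sf k t /= te; have d := sf k t te.
split; first exact: d.
have e1 : dern k.+1 f t = 'D_1 (dern k f) t by rewrite /dern derive1nS derive1E.
exact: esym e1.
Qed.

Lemma familyD I F G : family I F -> family I G -> family I (fun k t => F k t + G k t).
Proof. by move=> hF hG k t It; apply: is_deriveD; [exact: hF|exact: hG]. Qed.

(** The j-th derivative of F_a G_b as an unexpanded sum of 2^j products, which makes [leib_bound]
    immediate. *)
Fixpoint leib (F G : nat -> R -> R) (j a b : nat) (t : R) : R :=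
  if j is j'.+1 then leib F G j' a.+1 b t + leib F G j' a b.+1 t else F a t * G b t.

Lemma familyM I F G : family I F -> family I G -> family I (fun k => leib F G k 0 0).
Proof.
move=> hF hG k; suff h j : forall a b t, I t -> is_derive t 1 (leib F G j a b) (leib F G j.+1 a b t).
  by move=> t; exact: h.
elim: j => [|j IH] a b t It.
  have h := is_deriveM (hF a t It) (hG b t It).
  rewrite [leib _ _ _ _ _ _]/= addrC [X in _ + X]mulrC.
  by have := h.
exact: (is_deriveD (IH a.+1 b t It) (IH a b.+1 t It)).
Qed.

Lemma leib_bound F G (M N t : R) r : 0 <= M -> 0 <= N ->
  (forall k, (k <= r)%N -> `|F k t| <= M) -> (forall k, (k <= r)%N -> `|G k t| <= N) ->
  forall j a b, (j + a <= r)%N -> (j + b <= r)%N -> `|leib F G j a b t| <= 2 ^+ j * (M * N).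
Proof.
move=> M0 N0 hF hG; elim=> [|j IH] a b ha hb /=.
  by rewrite mul1r normrM; apply: ler_pM => //; [exact: hF|exact: hG].
rewrite exprS -mulrA mulrDl mul1r; apply: le_trans (ler_normD _ _) _; apply: lerD; apply: IH => //.
- by rewrite addnS -addSn.
- by apply: leq_trans hb; rewrite leq_add2r.
- by apply: leq_trans ha; rewrite leq_add2r.
- by rewrite addnS -addSn.
Qed.

Lemma is_derive_dir (V : normedModType R) (g : V -> R) (p v : V) (D : R) :
  is_derive (0 : R) 1 (fun h : R => g (h *: v + p)) D -> is_derive p v g D.
Proof.
move=> [d e].
have E : (fun h : R => h^-1 *: (((fun h : R => g (h *: v + p)) \o shift 0) (h *: 1) - g ((0 : R) *: v + p)))
  = (fun h : R => h^-1 *: ((g \o shift p) (h *: v) - g p)).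
  apply/funext => h /=; rewrite scale0r add0r addr0; congr (_ *: (g _ - _)).
  by rewrite /GRing.scale/= mulr1.
by split; [move: d; rewrite /derivable E|rewrite -e /derive E].
Qed.

Lemma smo_coord_fun n (i : 'I_n) (I : set R) (Q : (R -> R) -> Prop) : open I ->
  (forall f, Q f -> exists2 f', Q f' & forall t, I t -> is_derive t 1 f (f' t)) ->
  forall f, Q f -> smo [set p : 'rV[R]_n | I (p 0 i)] (fun p => f (p 0 i)).
Proof.
move=> oI hQ f Qf.
have oA : open [set p : 'rV[R]_n | I (p 0 i)].
  apply: open_ballI => p /= Ip; have [r r0 hr] := open_ballE oI Ip.
  exists r => // q hq; apply: hr; have := rV_coord_le (q - p) i; rewrite !mxE => h.
  exact: le_lt_trans h hq.
pose P g := (exists2 f, Q f & g = (fun p : 'rV[R]_n => f (p 0 i))) \/ g = (fun=> 0).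
have dP (f1 f2 : R -> R) (k : 'I_n) (p : 'rV[R]_n) : is_derive (p 0 i) 1 f1 (f2 (p 0 i)) ->
    is_derive p (evec R k) (fun p : 'rV[R]_n => f1 (p 0 i)) ((k == i)%:R * f2 (p 0 i)).
  move=> df; apply: is_derive_dir.
  have E : (fun h : R => f1 ((h *: evec R k + p) 0 i)) = f1 \o (fun h : R => h * (k == i)%:R + p 0 i).
    by apply/funext => h /=; congr f1; rewrite -evecE !mxE.
  rewrite E mulrC; apply: is_derive1_comp; last exact: is_derive_aff.
  by rewrite mul0r add0r; exact: df.
apply: (@smo_class R n _ P oA); last by left; exists f.
- move=> g [[f1 Qf1 ->]|->] x Ix; last first.
    by split=> [|k]; [exact: (@cst_continuous _ _ (0 : R))|exact: derivable_cst].
  have [f2 _ df] := hQ f1 Qf1.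
  split=> [|k]; last by have [] := dP f1 f2 k x (df _ Ix).
  have [d _] := df _ Ix.
  apply: cont_ballI => e e0; have [r r0 hr] := derivable_ball d e0.
  exists r => // y hy; apply: hr; have := rV_coord_le (y - x) i; rewrite !mxE => h.
  exact: le_lt_trans h hy.
- move=> g k [[f1 Qf1 ->]|->]; last first.
    by exists (fun=> 0); [right|move=> x _; exact: partial_cst].
  have [f2 Qf2 df] := hQ f1 Qf1.
  have [ki|ki] := boolP (k == i).
    exists (fun p => f2 (p 0 i)); first by left; exists f2.
    by move=> x Ix; have [_] := dP f1 f2 k x (df _ Ix); rewrite ki mul1r.
  exists (fun=> 0); first by right.
  by move=> x Ix; have [_] := dP f1 f2 k x (df _ Ix); rewrite (negbTE ki) mul0r.
Qed.

Definition Lie n (ell : 'I_n -> 'rV[R]_n -> R) (F : 'rV[R]_n -> R) (x : 'rV[R]_n) : R :=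
  \sum_i ell i x * partial i F x.

Lemma smo_Lie n (A : set 'rV[R]_n) ell F j : open A -> (forall i, smo A (ell i)) -> smo A F ->
  smo A (iter j (Lie ell) F).
Proof.
move=> oA sl sF; elim: j => [//|j IH].
apply: (@smo_sum R n A oA n (fun i x => ell i x * partial i (iter j (Lie ell) F) x)) => i.
exact: (smoM oA (sl i) (smo_partial i IH)).
Qed.

Lemma family_flow n (A : set 'rV[R]_n) ell (w : R -> 'rV[R]_n) (I : set R) F :
  open A -> (forall i, smo A (ell i)) -> smo A F ->
  (forall t, I t -> A (w t) /\ forall i, is_derive t 1 (fun t : R => w t 0 i) (ell i (w t))) ->
  family I (fun k t => iter k (Lie ell) F (w t)).
Proof.
move=> oA sl sF hw k t It; have [Aw dw] := hw t It.
have [h1 h2] := smo_near oA (smo_Lie k oA sl sF) Aw.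
exact: (is_derive_comp_rV h1 h2 dw).
Qed.

(** For x = 1/t the factor x ^ 2 provides a bound quadratic in t, hence the derivative 0 of [flat]
    at 0. *)
Lemma exp_flat (p : {poly R}) : exists2 C : R, 0 <= C & forall x : R, 0 < x ->
  `|p.[x] * expR (- x)| * x ^+ 2 <= C.
Proof.
have pw k : exists2 C : R, 0 <= C & forall x : R, 0 < x -> x ^+ k * expR (- x) <= C.
  case: k => [|k].
    by exists 1 => // x x0; rewrite mul1r -expR0 ler_expR oppr_le0 ltW.
  exists (k.+1%:R ^+ k.+1) => [|x x0]; first by rewrite exprn_ge0.
  have kp : 0 < k.+1%:R :> R by rewrite ltr0n.
  have h : x / k.+1%:R <= expR (x / k.+1%:R).
    by apply: le_trans (expR_ge1Dx _); rewrite lerDr.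
  have : (x / k.+1%:R) ^+ k.+1 <= expR x.
    have -> : expR x = expR (x / k.+1%:R) ^+ k.+1.
      by rewrite -expRM_natl mulrC divfK// gt_eqF.
    by apply: lerXn2r => //; rewrite nnegrE ?expR_ge0 ?divr_ge0// ltW.
  by rewrite expRN ler_pdivrMr ?expR_gt0// exprMn exprVn ler_pdivrMr ?exprn_gt0// mulrC.
have [C hC] : exists C : nat -> R, forall k, 0 <= C k /\ forall x : R, 0 < x -> x ^+ k * expR (- x) <= C k.
  have /choice[C hC] : forall k, exists C : R, 0 <= C /\ forall x : R, 0 < x -> x ^+ k * expR (- x) <= C.
    by move=> k; have [C C0 hC] := pw k; exists C.
  by exists C.
exists (\sum_(i < size p) `|p`_i| * C (i + 2)%N).
  by apply: sumr_ge0 => i _; rewrite mulr_ge0//; case: (hC (i + 2)%N).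
move=> x x0; rewrite horner_coef normrM.
apply: (@le_trans _ _ ((\sum_(i < size p) `|p`_i * x ^+ i|) * expR (- x) * x ^+ 2)).
  apply: ler_wpM2r; first by rewrite exprn_ge0// ltW.
  by rewrite [`|expR _|]ger0_norm ?expR_ge0//; apply: ler_wpM2r; [exact: expR_ge0|exact: ler_norm_sum].
rewrite 2!mulr_suml; apply: ler_sum => i _.
rewrite normrM [`|x ^+ i|]ger0_norm ?exprn_ge0 ?(ltW x0)// -!mulrA; apply: ler_wpM2l => //.
rewrite (_ : x ^+ i * (expR (- x) * x ^+ 2) = x ^+ (i + 2) * expR (- x)); last by rewrite exprD; ring.
by case: (hC (i + 2)%N) => _ /(_ x x0).
Qed.

(** p (1/t) exp (-1/t), extended by 0: a class stable under derivation, which replaces p by X^2 (p -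
    p'). *)
Definition flat (p : {poly R}) (t : R) : R := if 0 < t then p.[t^-1] * expR (- t^-1) else 0.

Lemma is_derive_near (f g : R -> R) (t D r : R) : 0 < r -> (forall s, `|s - t| < r -> f s = g s) ->
  is_derive t 1 f D -> is_derive t 1 g D.
Proof.
move=> r0 h [d e]; have near_eq : {near t, f =1 g}.
  by apply/nbhs_ballP; exists r => // s; rewrite -ball_normE /= distrC => /h.
by split; [exact: near_eq_derivable near_eq d|rewrite -(near_eq_derive (1 : R) near_eq)].
Qed.

Lemma flat_derive p (t : R) : is_derive t 1 (flat p) (flat ('X^2 * (p - p^`())) t).
Proof.
case: (ltgtP 0 t) => [t0|t0|<-].
- have -> : flat ('X^2 * (p - p^`())) t =
      p^`().[t^-1] * (- t ^- 2 *: 1) * expR (- t^-1) + p.[t^-1] * (expR (- t^-1) * - (- t ^- 2 *: 1)).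
    by rewrite /flat t0 hornerM hornerXn hornerD hornerN /GRing.scale/= exprVn; ring.
  have di : is_derive t 1 (fun t : R => t^-1) (- t ^- 2 *: 1).
    exact: (is_deriveV (lt0r_neq0 t0) (is_derive_id t (1 : R))).
  have h1 := is_derive1_comp (is_derive_poly p t^-1) di.
  have h2 := @is_derive1_comp R expR (fun t => - t^-1) t _ _ (is_derive_expR (- t^-1)) (is_deriveN di).
  apply: (@is_derive_near (fun t => p.[t^-1] * expR (- t^-1)) _ t _ t t0) => [s|].
    rewrite ltr_norml => /andP[h _]; rewrite /flat ifT//; move: h; lra.
  have h := is_deriveM h1 h2.
  rewrite addrC [X in _ + X]mulrC; exact: h.
- have e1 : flat ('X^2 * (p - p^`())) t = 0 by rewrite /flat ltNge ltW.
  rewrite e1; apply: (@is_derive_near (fun=> 0) _ t 0 (- t)); rewrite ?oppr_gt0// => s.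
  by rewrite ltr_norml => /andP[_ h]; rewrite /flat ifF//; apply/negbTE; rewrite -leNgt; move: h; lra.
- rewrite {2}/flat ltxx; apply: is_derive_eps => e e0.
  have [C C0 hC] := exp_flat p; have C1 : 0 < C + 1 by rewrite ltr_wpDl.
  exists (e / (C + 1)); rewrite ?divr_gt0// => s; rewrite subr0 {2}/flat ltxx subr0 mul0r subr0.
  rewrite /flat; case: ifP => s0; last by rewrite normr0 mulr_ge0// ltW.
  rewrite [`|s|]gtr0_norm// ltr_pdivlMr// => hs.
  have s1 : 0 < s^-1 by rewrite invr_gt0.
  have := hC _ s1; rewrite exprVn ler_pdivrMr ?exprn_gt0// => h.
  apply: le_trans h _; rewrite expr2 mulrA; apply: ler_wpM2r; first exact: ltW.
  apply: ltW; apply: le_lt_trans hs; rewrite mulrC; apply: ler_wpM2l; [exact: ltW|by rewrite lerDl].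
Qed.

Lemma smo_flat n (i : 'I_n) : smo [set: 'rV[R]_n] (fun p => flat 1 (p 0 i)).
Proof.
have oT : open [set: R] by exact: openT.
have := @smo_coord_fun n i setT (fun f => exists p, f = flat p) oT.
apply; last by exists 1.
by move=> f [p ->]; exists (flat ('X^2 * (p - p^`()))); [exists ('X^2 * (p - p^`()))|move=> t _; exact: flat_derive].
Qed.

Lemma smo_family (F : 'rV[R]_1 -> R) : smo setT F ->
  family setT (fun k (t : R) => iter k (Lie (fun _ _ => 1)) F (\row_(j < 1) t)).
Proof.
move=> sF; have oT : open [set: 'rV[R]_1] by exact: openT.
apply: (family_flow (w := fun t => \row_(j < 1) t) oT _ sF) => [i|t _]; first exact: smo_cst.
split=> // i; have -> : (fun t : R => (\row_(j < 1) t) 0 i) = id by apply/funext => s; rewrite mxE.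
exact: is_derive_id.
Qed.

(** The quotient flat u / (flat u + flat v) with u = 4 a^2 - t^2 and v = t^2 - a^2, which are never
    both nonpositive. *)
Lemma bump (a : R) : 0 < a -> exists2 chi : nat -> R -> R, family setT chi &
  (forall t, `|t| <= a -> chi 0%N t = 1) /\ (forall t, 2 * a <= `|t| -> chi 0%N t = 0).
Proof.
move=> a0; have oT : open [set: 'rV[R]_1] by exact: openT.
pose u (x : 'rV[R]_1) := 4 * a ^+ 2 - x 0 0 * x 0 0; pose v (x : 'rV[R]_1) := x 0 0 * x 0 0 - a ^+ 2.
have su : smo setT u by exact: (smoB oT (smo_cst _ oT) (smoM oT (smo_coord 0 oT) (smo_coord 0 oT))).
have sv : smo setT v by exact: (smoB oT (smoM oT (smo_coord 0 oT) (smo_coord 0 oT)) (smo_cst _ oT)).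
have sfl q : smo setT q -> smo setT (fun x : 'rV[R]_1 => flat 1 (q x)).
  move=> sq; have := @smo_comp R 1 setT oT 1 setT _ (fun _ => q) oT (smo_flat ord0).
  by under eq_fun do rewrite mxE; apply.
have fl0 t : 0 <= flat 1 t by rewrite /flat; case: ifP => // _; rewrite hornerC mul1r expR_ge0.
have flp t : 0 < t -> 0 < flat 1 t by move=> t0; rewrite /flat t0 hornerC mul1r expR_gt0.
have fln t : t <= 0 -> flat 1 t = 0 by move=> t0; rewrite /flat ltNge t0.
have uv x : 0 < u x \/ 0 < v x.
  rewrite /u /v; have : 0 < a ^+ 2 by rewrite exprn_gt0.
  move: (x 0 0 * x 0 0) (a ^+ 2) => y b b0.
  by case: (ltP y (2 * b)) => h; [left|right]; lra.
have den x : flat 1 (u x) + flat 1 (v x) != 0.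
  by rewrite gt_eqF//; case: (uv x) => /flp h; [rewrite ltr_pwDl|rewrite ltr_wpDl].
pose F x := flat 1 (u x) * (flat 1 (u x) + flat 1 (v x))^-1.
have sF : smo setT F.
  exact: (smoM oT (sfl _ su) (smoV oT (smoD oT (sfl _ su) (sfl _ sv)) (fun x _ => den x))).
exists (fun k t => iter k (Lie (fun _ _ => 1)) F (\row_(j < 1) t)); first exact: smo_family.
have sq (b t : R) : 0 <= b -> (`|t| <= b) = (t * t <= b * b).
  move=> b0; rewrite -[t * t]ger0_norm; last by rewrite -expr2 sqr_ge0.
  by rewrite normrM -!expr2 ler_sqr ?nnegrE.
split=> t /=; rewrite /F /u /v !mxE => ht.
  have h : t * t <= a * a by rewrite -sq// ltW.
  rewrite [flat 1 (t * t - _)]fln ?expr2 ?subr_le0// addr0 mulfV// gt_eqF// flp//.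
  by have : 0 < a * a := mulr_gt0 a0 a0; lra.
rewrite fln ?mul0r//; have h : 4 * a ^+ 2 <= t * t; last by lra.
rewrite (_ : 4 * a ^+ 2 = (2 * a) * (2 * a)); last by ring.
by rewrite -[t * t]ger0_norm -?expr2 ?sqr_ge0// expr2 normrM; apply: ler_pM => //; rewrite mulr_ge0// ltW.
Qed.

End Flow.

(** * Perturbing the jet at 0 of a solution of (E) *)

Section Perturb.
Variable R : realType.
Variables (Om : set 'rV[R]_4) (g h : 'rV[R]_4 -> R).
Hypotheses (oOm : open Om) (sg : smo Om g) (sh : smo Om h).

Lemma local_lipschitz n (A : set 'rV[R]_n) F p : open A -> smo A F -> A p ->
  exists b K : R, [/\ 0 < b, 0 <= K & forall x y, `|x - p| < b -> `|y - p| < b -> `|F x - F y| <= K * `|x - y|].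
Proof.
move=> oA sF Ap; have [h1 h2] := smo_near oA sF Ap.
have [b b0 hb] := strict_diff h1 h2 (@ltr01 R).
exists b, (1 + \sum_i `|partial i F p|); split=> //; first by rewrite addr_ge0// sumr_ge0.
move=> x y hx hy; have := hb y x hy hx; rewrite mul1r mulrDl mul1r => k.
rewrite -[F x - F y](subrK (\sum_i (x 0 i - y 0 i) * partial i F p)).
apply: le_trans (ler_normD _ _) _; apply: lerD => //.
apply: le_trans (ler_norm_sum _ _ _) _; rewrite mulr_suml; apply: ler_sum => i _.
rewrite normrM mulrC; apply: ler_wpM2l => //.
by have := rV_coord_le (x - y) i; rewrite !mxE.
Qed.

Lemma common_lipschitz n m (A : set 'rV[R]_n) (F : 'I_m -> 'rV[R]_n -> R) p : open A -> A p ->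
  (forall i, smo A (F i)) ->
  exists b K : R, [/\ 0 < b, 0 <= K & forall i x y, `|x - p| < b -> `|y - p| < b -> `|F i x - F i y| <= K * `|x - y|].
Proof.
move=> oA Ap sF.
have /choice[K hK] : forall i, exists K, 0 <= K /\ exists2 b : R, 0 < b &
    forall x y, `|x - p| < b -> `|y - p| < b -> `|F i x - F i y| <= K * `|x - y|.
  by move=> i; have [b [K [b0 K0 hb]]] := local_lipschitz oA (sF i) Ap; exists K; split=> //; exists b.
have [|i|b b0 hb] := @common_radius R m (fun i b => forall x y, `|x - p| < b -> `|y - p| < b -> `|F i x - F i y| <= K i * `|x - y|).
- by move=> i r r' h1 _ rr x y hx hy; apply: h1; exact: lt_le_trans rr.
- by have [_ []] := hK i; move=> b; exists b.
exists b, (\sum_i K i); split=> //; first by apply: sumr_ge0 => i _; case: (hK i).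
move=> i x y hx hy; apply: le_trans (hb i x y hx hy) _; apply: ler_wpM2r => //.
by rewrite (bigD1 i)//= lerDl; apply: sumr_ge0 => j _; case: (hK j).
Qed.

(* The system z' = h + g x' along x = x_c + al0 + al1 t + al2 t^2/2, y = y_c + be0 + be1 t + be2 t^2/2,
   as an autonomous system for the state (t, z, al0, al1, al2, be0, be1, be2). *)
Variable c : curve R 3.
Variables (e0 e1 : R) (e10 : 0 < e1) (e1e : e1 <= e0) (sc : forall i, smooth_on_int e0 (c i)).
Let x := c (inord 0). Let y := c (inord 1). Let z := c (inord 2).
Let k_ (j : nat) : 'I_8 := inord j.
Let I0 : set R := [set t | `|t| < e0].
Let A0 : set 'rV[R]_8 := [set p | I0 (p 0 (k_ 0))].
Let X (p : 'rV[R]_8) := x (p 0 (k_ 0)) + (p 0 (k_ 2) + p 0 (k_ 3) * p 0 (k_ 0) + p 0 (k_ 4) * (p 0 (k_ 0) * p 0 (k_ 0) * 2^-1)).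
Let Y (p : 'rV[R]_8) := y (p 0 (k_ 0)) + (p 0 (k_ 5) + p 0 (k_ 6) * p 0 (k_ 0) + p 0 (k_ 7) * (p 0 (k_ 0) * p 0 (k_ 0) * 2^-1)).
Let Xd (p : 'rV[R]_8) := dern 1 x (p 0 (k_ 0)) + (p 0 (k_ 3) + p 0 (k_ 4) * p 0 (k_ 0)).
Let Yd (p : 'rV[R]_8) := dern 1 y (p 0 (k_ 0)) + (p 0 (k_ 6) + p 0 (k_ 7) * p 0 (k_ 0)).
Let q (j : 'I_4) (p : 'rV[R]_8) := nth 0 [:: X p; Y p; p 0 (k_ 1); Yd p - p 0 (k_ 1) * Xd p] j.
Let P p : 'rV[R]_4 := \row_j q j p.
Let A : set 'rV[R]_8 := [set p | A0 p /\ Om (P p)].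
Let f p := h (P p) + g (P p) * Xd p.
Let ell (i : 'I_8) (p : 'rV[R]_8) : R := nth (fun=> 0) [:: (fun=> 1); f] i p.

Let oI0 : open I0.
Proof.
apply: open_ballI => t /= te; exists (e0 - `|t|); first by rewrite subr_gt0.
by move=> s; rewrite ltrBrDr => k; apply: le_lt_trans k; rewrite -{1}[s](subrK t) ler_normD.
Qed.

Let oA0 : open A0.
Proof.
apply: open_ballI => p /= Ip; have [r r0 hr] := open_ballE oI0 Ip.
exists r => // s hs; apply: hr; have := rV_coord_le (s - p) (k_ 0); rewrite !mxE => k.
exact: le_lt_trans k hs.
Qed.

Let sdern (i : 'I_3) j : smo A0 (fun p : 'rV[R]_8 => dern j (c i) (p 0 (k_ 0))).
Proof.
apply: (@smo_coord_fun R 8 (k_ 0) I0 (fun u => exists j, u = dern j (c i)) oI0); last by exists j.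
move=> _ [m ->]; exists (dern m.+1 (c i)); first by exists m.+1.
by move=> t It; apply: (family_dern (@sc i)).
Qed.

Let sco j : smo A0 (fun p : 'rV[R]_8 => p 0 (k_ j)). Proof. exact: smo_coord. Qed.
Let s_half : smo A0 (fun p : 'rV[R]_8 => p 0 (k_ 0) * p 0 (k_ 0) * 2^-1).
Proof. exact: (smoM oA0 (smoM oA0 (sco 0) (sco 0)) (smo_cst _ oA0)). Qed.
Let sX : smo A0 X.
Proof. exact: (smoD oA0 (sdern _ 0) (smoD oA0 (smoD oA0 (sco 2) (smoM oA0 (sco 3) (sco 0))) (smoM oA0 (sco 4) s_half))). Qed.
Let sY : smo A0 Y.
Proof. exact: (smoD oA0 (sdern _ 0) (smoD oA0 (smoD oA0 (sco 5) (smoM oA0 (sco 6) (sco 0))) (smoM oA0 (sco 7) s_half))). Qed.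
Let sXd : smo A0 Xd.
Proof. exact: (smoD oA0 (sdern _ 1) (smoD oA0 (sco 3) (smoM oA0 (sco 4) (sco 0)))). Qed.
Let sYd : smo A0 Yd.
Proof. exact: (smoD oA0 (sdern _ 1) (smoD oA0 (sco 6) (smoM oA0 (sco 7) (sco 0)))). Qed.
Let sq j : smo A0 (q j).
Proof.
case: j => -[|[|[|[|j]]]] hj; [exact: sX|exact: sY|exact: sco| |exact: (False_ind _ (notF hj))].
exact: (smoB oA0 sYd (smoM oA0 (sco 1) sXd)).
Qed.

Let oA : open A.
Proof.
apply: open_ballI => p [Ap Op]; have [r1 r10 h1] := open_ballE oOm Op.
have [r2 r20 h2] := open_ballE oA0 Ap.
have cP : {for p, continuous P}.
  by apply: continuous_row => j; have [] := sq j [::] Ap.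
have [r3 r30 h3] : exists2 r : R, 0 < r & forall u, `|u - p| < r -> `|P u - P p| < r1.
  move: cP => /cvgrPdist_lt/(_ r1 r10)/nbhs_ballP[r r0 hr]; exists r => // u hu.
  by rewrite distrC; apply: hr; rewrite -ball_normE /= distrC.
exists (Order.min r2 r3) => [|u]; first by rewrite lt_min r20.
by rewrite lt_min => /andP[u2 u3]; split; [exact: h2|apply: h1; exact: h3].
Qed.

Let AA0 : A `<=` A0. Proof. by move=> p []. Qed.
Let sf : smo A f.
Proof.
have sqA j : smo A (q j) by apply: smo_sub AA0 _; exact: sq.
have PA : forall p, A p -> Om (P p) by move=> p [].
exact: (smoD oA (smo_comp oA oOm sh sqA PA) (smoM oA (smo_comp oA oOm sg sqA PA) (smo_sub AA0 sXd))).
Qed.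

Let sell i : smo A (ell i).
Proof.
case: i => -[|[|i]] hi; rewrite /ell /=; [exact: smo_cst|exact: sf|].
by rewrite nth_nil; exact: smo_cst.
Qed.

Let w0 (t : R) : 'rV[R]_8 := \row_(j < 8) nth 0 [:: t; z t] j.

Let w0E t : [/\ w0 t 0 (k_ 0) = t, w0 t 0 (k_ 1) = z t & forall j, (1 < j < 8)%N -> w0 t 0 (k_ j) = 0].
Proof.
split; rewrite ?mxE ?inordK// => -[|[|j]]// /andP[_ hj].
by rewrite mxE inordK// /= nth_nil.
Qed.

Lemma flow_const (w : R -> 'rV[R]_8) (rho : R) (i : 'I_8) (D : R) (G : R -> R) (t : R) :
  (forall s : R, `|s| <= rho -> forall i, is_derive s 1 (fun s => w s 0 i) (ell i (w s))) ->
  (forall s : R, is_derive s 1 G D) -> (forall u, ell i u = D) -> w 0 0 i = G 0 ->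
  `|t| <= rho -> w t 0 i = G t.
Proof.
move=> hwd dG hell h0 ht; apply/eqP; rewrite -subr_eq0 -normr_le0.
have := @derive_diff_bound R (fun t => w t 0 i) G (fun s => ell i (w s)) (fun=> D) rho 0 t ht
  (fun s hs => hwd s hs i) (fun s _ => dG s).
by rewrite h0 subrr normr0 mulr0 addr0; apply => s _; rewrite hell subrr normr0.
Qed.

(** x and y are kept and z is solved for, by Picard iteration around the constant state, whose
    defect is the size of the field at that point. *)
Lemma solution_exists : Om (mk4 (x 0) (y 0) (z 0) (dern 1 y 0 - z 0 * dern 1 x 0)) ->
  exists c' : curve R 3, [/\ smooth_germ c', solves Om g h c', c' (inord 2) 0 = z 0,
    c' (inord 0) = x & c' (inord 1) = y].
Proof.
move=> Om0; pose p := w0 0; have [p0 p1 pj] := w0E 0.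
have e00 : 0 < e0 by exact: lt_le_trans e1e.
have Ap : A p.
  split; first by rewrite /A0 /= p0 /I0 /= normr0.
  have -> : P p = mk4 (x 0) (y 0) (z 0) (dern 1 y 0 - z 0 * dern 1 x 0) => //.
  by apply/rowP => j; rewrite !mxE /q /X /Y /Xd /Yd p0 p1 !pj// !mul0r !addr0.
have [b1 [K1 [b10 K10 L1]]] := common_lipschitz oA Ap sell.
have [b3 b30 A3] := open_ballE oA Ap.
pose b := Order.min b1 b3.
have b0 : 0 < b by rewrite lt_min b10.
pose m := \sum_i `|ell i p|.
have m0 : 0 <= m by exact: sumr_ge0.
have K11 : 0 < K1 + 1 by rewrite ltr_wpDl.
have m1 : 0 < m + 1 by rewrite ltr_wpDl.
have b8 : 0 < b / 8 by rewrite divr_gt0.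
have i2 : 0 < 2^-1 :> R by rewrite invr_gt0.
pose rho := Order.min (Order.min (2^-1) (e0 / 2)) (Order.min (b / 8 / (m + 1)) (2^-1 / (K1 + 1))).
have rho0 : 0 < rho by rewrite !lt_min i2 !divr_gt0.
have rho1 : rho < 1 by rewrite !gt_min invf_lt1// ltr1n.
have rhoe : rho < e0 by rewrite !gt_min [e0 / 2 < e0]ltr_pdivrMr// ltr_pMr// ltr1n orbT.
have rK : rho * K1 <= 2^-1.
  apply: (@le_trans _ _ (2^-1 / (K1 + 1) * (K1 + 1))); last by rewrite divfK// gt_eqF.
  by apply: ler_pM => //; rewrite ?ge_min ?lexx ?orbT ?lerDl// ltW.
have rm : rho * m <= b / 8.
  apply: (@le_trans _ _ (b / 8 / (m + 1) * (m + 1))); last by rewrite divfK// gt_eqF.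
  by apply: ler_pM => //; rewrite ?ge_min ?lexx ?orbT ?lerDl// ltW.
have lip1 i u v : `|u - p| < b -> `|v - p| < b -> `|ell i u - ell i v| <= K1 * `|u - v|.
  by rewrite !lt_min => /andP[u1 _] /andP[v1 _]; exact: L1.
have hw0 (t : R) : `|t| <= rho -> `|(fun=> p) t - p| < b / 2 /\
    forall i, is_derive t 1 (fun t : R => (fun=> p) t 0 i) ((fun _ _ => 0) i t) /\ `|(fun _ _ => 0) i t - ell i ((fun=> p) t)| <= m.
  move=> ht; split; first by rewrite subrr normr0 divr_gt0.
  move=> i; split; first exact: is_derive_cst.
  by rewrite sub0r normrN /m (bigD1 i)//= lerDl sumr_ge0.
have had : `|p - (fun=> p) (0 : R)| + rho * m <= b / 8 by rewrite subrr normr0 add0r.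
have db : b / 8 < b / 4 by rewrite ltr_pM2l// ltf_pV2 ?posrE// ltr_nat.
have [w [wa hwd]] := picard rho0 rho1 K10 rK m0 lip1 hw0 had db.
have hwd' (t : R) : `|t| <= rho -> forall i, is_derive t 1 (fun t => w t 0 i) (ell i (w t)) by move=> /hwd[].
have wA (t : R) : `|t| <= rho -> A (w t).
  move=> /hwd[h1 _]; apply: A3; apply: le_lt_trans h1 _; apply: (@lt_le_trans _ _ b); last by rewrite ge_min lexx orbT.
  by move: b0; move: (b) => bb; lra.
have wt (t : R) : `|t| <= rho -> w t 0 (k_ 0) = t.
  move=> ht; have h1 u : ell (k_ 0) u = 1 by rewrite /ell inordK.
  have h2 : w 0 0 (k_ 0) = id 0 by rewrite wa p0.
  exact: (flow_const hwd' (fun s => is_derive_id s (1 : R)) h1 h2 ht).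
have wj (t : R) j : (1 < j < 8)%N -> `|t| <= rho -> w t 0 (k_ j) = 0.
  move=> hj ht; have [j1 j8] := andP hj.
  have h1 u : ell (k_ j) u = 0 by rewrite /ell inordK// nth_default.
  have h2 : w 0 0 (k_ j) = 0 by rewrite wa pj.
  have h3 (s : R) : is_derive s 1 (fun=> 0 : R) (0 : R) by exact: is_derive_cst.
  by rewrite (flow_const hwd' h3 h1 h2 ht).
pose I1 : set R := [set t | `|t| < rho].
have oI1 : open I1.
  apply: open_ballI => t /= te; exists (rho - `|t|); first by rewrite subr_gt0.
  by move=> s; rewrite ltrBrDr => k; apply: le_lt_trans k; rewrite -{1}[s](subrK t) ler_normD.
have fam : family I1 (fun k t => iter k (Lie ell) (fun u : 'rV[R]_8 => u 0 (k_ 1)) (w t)).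
  by apply: (family_flow oA sell (smo_coord _ oA)) => t /= /ltW ht; split; [exact: wA|exact: hwd'].
pose c' : curve R 3 := fun i => if i == inord 2 then (fun t => w t 0 (k_ 1)) else c i.
have c0 : c' (inord 0) = x by rewrite /c' ifF//; apply/eqP => /(congr1 val); rewrite /= !inordK.
have c1 : c' (inord 1) = y by rewrite /c' ifF//; apply/eqP => /(congr1 val); rewrite /= !inordK.
have c2 : c' (inord 2) = (fun t => w t 0 (k_ 1)) by rewrite /c' eqxx.
have sc' i : smooth_on_int rho (c' i).
  move=> k t ht; rewrite /c'; case: ifP => _; last by apply: sc; exact: lt_trans rhoe.
  by have [_] := dern_family oI1 fam (fun s _ => erefl) k ht.
exists c'; split=> //.
- by exists rho.
- exists rho => // t ht /=; have ht' := ltW ht.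
  have XE : X (w t) = x t by rewrite /X wt// !wj// !mul0r !addr0.
  have YE : Y (w t) = y t by rewrite /Y wt// !wj// !mul0r !addr0.
  have XdE : Xd (w t) = dern 1 x t by rewrite /Xd wt// !wj// !mul0r !addr0.
  have YdE : Yd (w t) = dern 1 y t by rewrite /Yd wt// !wj// !mul0r !addr0.
  have PE : mk4 (c' (inord 0) t) (c' (inord 1) t) (c' (inord 2) t)
      (dern 1 (c' (inord 1)) t - c' (inord 2) t * dern 1 (c' (inord 0)) t) = P (w t).
    by rewrite c0 c1 c2; apply/rowP => j; rewrite !mxE /q XE YE XdE YdE.
  have D2 : dern 1 (c' (inord 2)) t = f (w t).
    have [_ e1'] := hwd' t ht' (k_ 1).
    by rewrite c2 /dern derive1nS derive1E; apply: etrans e1' _; rewrite /ell inordK.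
  split; rewrite ?PE//; [exact: (sc' (inord 0) 0%N t ht)|exact: (sc' (inord 1) 0%N t ht)|exact: (sc' (inord 2) 0%N t ht)| |].
    by have [] := wA t ht'.
  by apply: etrans D2 _; rewrite /f c0 XdE.
- by rewrite c2 wa p1.
Qed.

Section Near.
Hypothesis solc : forall t : R, `|t| < e1 ->
  Om (mk4 (x t) (y t) (z t) (dern 1 y t - z t * dern 1 x t)) /\
  dern 1 z t = h (mk4 (x t) (y t) (z t) (dern 1 y t - z t * dern 1 x t)) +
    g (mk4 (x t) (y t) (z t) (dern 1 y t - z t * dern 1 x t)) * dern 1 x t.

Let w0_flow t : `|t| < e1 -> A (w0 t) /\ forall i, is_derive t 1 (fun t : R => w0 t 0 i) (ell i (w0 t)).
Proof.
move=> te; have [E0 E1 E2] := w0E t.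
have PE : P (w0 t) = mk4 (x t) (y t) (z t) (dern 1 y t - z t * dern 1 x t).
  apply/rowP => j; rewrite !mxE /q /X /Y /Xd /Yd E0 E1 !E2// !mul0r !addr0.
  by [].
have XE : Xd (w0 t) = dern 1 x t by rewrite /Xd E0 !E2// mul0r !addr0.
have [s1 s2] := solc te; have te0 := lt_le_trans te e1e.
split; first by split; rewrite ?PE// /A0 /= E0.
move=> i; have -> : (fun t : R => w0 t 0 i) = (fun t => nth 0 [:: t; z t] i) by apply/funext => s; rewrite mxE.
case: i => -[|[|i]] hi; rewrite /ell /=; first exact: is_derive_id.
  by rewrite /f PE XE -s2; exact: (@family_dern R e0 z (@sc (inord 2)) 0%N t te0).
have N1 : nth (fun=> 0) [:: (fun=> 1); f] i.+2 = (fun=> 0) by rewrite nth_default.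
have N2 : (fun t => nth 0 [:: t; z t] i.+2) = (fun=> 0) by apply/funext => s; rewrite nth_default.
by move: N1 N2 => /= -> ->; exact: is_derive_cst.
Qed.


Variables (r : nat) (eps : R -> R).
Hypotheses (ceps : {within [set t | `|t| < e0], continuous eps}) (epsp : forall t, `|t| < e0 -> 0 < eps t).

Let vx (al : 'I_8 -> R) (a b d : nat) (k : nat) (t : R) : R :=
  nth 0 [:: al (k_ a) + al (k_ b) * t + al (k_ d) * (t * t * 2^-1); al (k_ b) + al (k_ d) * t; al (k_ d)] k.

Let vx_family al a b d : family setT (vx al a b d).
Proof.
have dI (t : R) : is_derive t 1 (fun t : R => t) 1 by exact: is_derive_id.
have dA (u v t : R) : is_derive t 1 (fun t : R => u + v * t) v.
  have -> : (fun t : R => u + v * t) = (fun t => t * v + u) by apply/funext => s; rewrite addrC mulrC.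
  exact: is_derive_aff.
move=> [|[|[|k]]] t _; rewrite /vx /=.
- apply: is_derive_eps => e ep; have d0 : 0 <= `|al (k_ d)| by [].
  exists (e / (`|al (k_ d)| + 1)); first by rewrite divr_gt0// ltr_wpDl.
  move=> s; rewrite ltr_pdivlMr ?ltr_wpDl// => hs.
  rewrite [X in `|X|](_ : _ = al (k_ d) * 2^-1 * (s - t) * (s - t)); last by field.
  rewrite normrM; apply: ler_wpM2r => //; rewrite !normrM; apply: le_trans (ltW hs).
  rewrite [`|2^-1|]ger0_norm ?invr_ge0// mulrC; apply: ler_wpM2l => //.
  by apply: le_trans (_ : `|al (k_ d)| * 1 <= _); [apply: ler_wpM2l => //; rewrite invf_le1// ler1n|rewrite mulr1 lerDl].
- exact: dA.
- exact: is_derive_cst.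
- by rewrite !nth_nil; exact: is_derive_cst.
Qed.

(** Picard iteration controls the perturbed solution on a short interval only, whereas closeness is
    demanded on all of ]-e0, e0[: the difference with c is multiplied by a function equal to 1 near
    0. The outcome solves (E) near 0, which is all that a germ has to do, and its jet there is
    shifted by [al]. *)
Lemma perturb : exists2 dl : R, 0 < dl & forall al : 'I_8 -> R,
  (forall j, `|al j| < dl) -> exists c' : curve R 3,
    [/\ forall i, smooth_on_int e0 (c' i),
        forall i j t, (j <= r)%N -> `|t| < e0 -> `|dern j (c' i) t - dern j (c i) t| < eps t,
        solves Om g h c',
        c' (inord 2) 0 = z 0 + al (k_ 1) &
        (forall j, (j <= 2)%N -> dern j (c' (inord 0)) 0 = dern j x 0 + al (inord (2 + j)%N)) /\
        (forall j, (j <= 2)%N -> dern j (c' (inord 1)) 0 = dern j y 0 + al (inord (5 + j)%N))].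
Proof.
pose p := w0 0.
have z0 : `|0 : R| < e1 by rewrite normr0.
have e00 : 0 < e0 by exact: lt_le_trans e1e.
have [Ap _] := w0_flow z0.
(* Difference between the z of a state and that of c. It vanishes along w0, so Lipschitz bounds on
   its Lie derivatives control all derivatives of the perturbation of z. *)
pose Psi (u : 'rV[R]_8) := u 0 (k_ 1) - z (u 0 (k_ 0)).
have sPsi : smo A Psi.
  exact: (smoB oA (smo_coord _ oA) (smo_sub AA0 (sdern (inord 2) 0))).
have [b1 [K1 [b10 K10 L1]]] := common_lipschitz oA Ap sell.
have [b2 [K2 [b20 K20 L2]]] := common_lipschitz (F := fun (m : 'I_r.+2) => iter m (Lie ell) Psi) oA Ap
  (fun m => smo_Lie m oA sell sPsi).
have [b3 b30 A3] := open_ballE oA Ap.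
pose b := Order.min b1 (Order.min b2 b3).
have b0 : 0 < b by rewrite !lt_min b10 b20.
have [rho [rho0 rho1 rhoe rK hw]] : exists rho : R, [/\ 0 < rho, rho < 1, rho < e1, rho * K1 <= 2^-1 &
    forall t : R, `|t| <= rho -> `|w0 t - p| < b / 2].
  have [|i|r1 r10 hr1] := @common_radius R 8 (fun i r1 => forall t : R, `|t| < r1 -> `|w0 t 0 i - p 0 i| < b / 4).
  - by move=> i u v hu _ vu t ht; apply: hu; exact: lt_le_trans vu.
  - have [_ /(_ i)[di _]] := w0_flow z0.
    have b4 : 0 < b / 4 by rewrite divr_gt0.
    by have [r1 r10 hr1] := derivable_ball di b4; exists r1 => // t; rewrite -{1}[t]subr0; exact: hr1.
  have K11 : 0 < K1 + 1 by rewrite ltr_wpDl.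
  exists (Order.min (Order.min (2^-1) (e1 / 2)) (Order.min (r1 / 2) (2^-1 / (K1 + 1)))); split.
  - have i2 : 0 < 2^-1 :> R by rewrite invr_gt0.
    by rewrite !lt_min i2 !divr_gt0.
  - by rewrite !gt_min invf_lt1// ltr1n.
  - by rewrite !gt_min ltr_pdivrMr// ltr_pMr// ltr1n orbT.
  - apply: (@le_trans _ _ (2^-1 / (K1 + 1) * (K1 + 1))); last by rewrite divfK// gt_eqF.
    by apply: ler_pM => //; rewrite ?le_min ?ge_min ?lexx ?orbT ?lerDl// !divr_ge0// ltW// ltW.
  - move=> t; rewrite !le_min => /andP[_ /andP[tr _]].
    apply: (@le_lt_trans _ _ (b / 4)); last by rewrite ltr_pM2l// ltf_pV2 ?posrE// ltr_nat.
    apply: rV_norm_le => [|i]; first by rewrite divr_ge0// ltW.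
    have := hr1 i t; rewrite (le_lt_trans tr) ?ltr_pdivrMr ?ltr_pMr ?ltr1n// => /(_ isT) hh.
    by move: (ltW hh); rewrite !mxE.
have in1' (t : R) : `|t| <= rho -> `|t| < e1 by move=> ht; exact: le_lt_trans rhoe.
have in0 (t : R) : `|t| <= rho -> `|t| < e0 by move=> /in1' ht; exact: lt_le_trans e1e.
have in0' (t : R) : `|t| < rho -> `|t| < e0 by move=> /ltW; exact: in0.
have r40 : 0 < rho / 4 by rewrite divr_gt0.
have [chi fchi [chi1 chi0]] := bump r40.
have [m m0 hm] : exists2 m : R, 0 < m & forall t, `|t| <= rho -> m <= eps t.
  have cI : {within `[- rho, rho], continuous eps}.
    by apply: continuous_subspaceW ceps => t /=; rewrite in_itv/= -ler_norml; exact: in0.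
  have rr : - rho <= rho by rewrite (le_trans _ (ltW rho0))// oppr_le0 ltW.
  have [t0 ht0 hmin] := EVT_min rr cI.
  exists (eps t0); first by apply: epsp; apply: in0; move: ht0; rewrite in_itv/= -ler_norml.
  by move=> t ht; apply: hmin; rewrite in_itv/= -ler_norml.
have [M M0 hM] : exists2 M : R, 0 <= M & forall k t, (k <= r)%N -> `|t| <= rho -> `|chi k t| <= M.
  have rr : - rho <= rho by rewrite (le_trans _ (ltW rho0))// oppr_le0 ltW.
  have /choice[Mk hMk] : forall k, exists M : R, 0 <= M /\ forall t, `|t| <= rho -> `|chi k t| <= M.
    move=> k; have cI : {within `[- rho, rho], continuous (fun t => `|chi k t|)}.
      apply: continuous_subspaceT => t; have [d _] := fchi k t I.
      apply: (@continuous_comp _ _ _ (chi k) Num.norm); last exact: norm_continuous.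
      by apply: differentiable_continuous; apply/derivable1_diffP.
    have [t0 ht0 hmax] := EVT_max rr cI.
    by exists `|chi k t0|; split=> // t ht; apply: hmax; rewrite in_itv/= -ler_norml.
  exists (\sum_(k < r.+1) Mk k); first by apply: sumr_ge0 => k _; case: (hMk k).
  move=> k t kr ht; apply: le_trans ((hMk k).2 t ht) _.
  rewrite (bigD1 (Ordinal (kr : (k < r.+1)%N)))//= lerDl; apply: sumr_ge0 => j _; by case: (hMk j).
(* 2 ^ r stems from the Leibniz rule, M bounds the cut-off function, 3 + 2 K2 bounds the
   perturbation per unit of d, and the final 1 makes the inequality strict. *)
pose N1 := 2 ^+ r * (M * (3 + 2 * K2)) + 1.
have N10 : 0 < N1 by rewrite ltr_wpDl// !mulr_ge0// ?exprn_ge0// ?addr_ge0// ?mulr_ge0.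
exists (Order.min (b / 8) (m / N1)); first by rewrite lt_min !divr_gt0.
move=> al hal; pose d := Order.min (b / 8) (m / N1).
have d0 : 0 < d by rewrite lt_min !divr_gt0.
have db : d < b / 4.
  by apply: (@le_lt_trans _ _ (b / 8)); [rewrite ge_min lexx|rewrite ltr_pM2l// ltf_pV2 ?posrE// ltr_nat].
pose a : 'rV[R]_8 := \row_j ((if j == k_ 0 then 0 else al j) + p 0 j).
have ap : `|a - w0 0| <= d.
  apply: rV_norm_le => [|j]; first exact: ltW.
  rewrite !mxE addrK; case: ifP => _; first by rewrite normr0 ltW.
  exact: ltW (hal j).
have lip1 i u v : `|u - p| < b -> `|v - p| < b -> `|ell i u - ell i v| <= K1 * `|u - v|.
  by rewrite !lt_min => /andP[u1 _] /andP[v1 _]; exact: L1.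
have hw0 (t : R) : `|t| <= rho -> `|w0 t - p| < b / 2 /\
    forall i, is_derive t 1 (fun t => w0 t 0 i) (ell i (w0 t)) /\ `|ell i (w0 t) - ell i (w0 t)| <= 0.
  move=> ht; split; first exact: hw.
  move=> i.
  have [_ hh] := w0_flow (in1' t ht); split; [exact: hh|by rewrite subrr normr0].
have had : `|a - w0 0| + rho * 0 <= d by rewrite mulr0 addr0.
have [w [wa hwd]] := picard rho0 rho1 K10 rK (lexx 0) lip1 hw0 had db.
rewrite -/p in ap hwd.
have wp (t : R) : `|t| <= rho -> `|w t - w0 t| <= 2 * d.
  by move=> ht; have [h1 _] := hwd t ht.
have wb (t : R) : `|t| <= rho -> `|w t - p| < b.
  move=> ht; rewrite -(subrKA (w0 t)); apply: le_lt_trans (ler_normD _ _) _.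
  by have := wp t ht; have := hw t ht; move: db; move: (`|w t - w0 t|) (`|w0 t - p|) => u v; lra.
have wA (t : R) : `|t| <= rho -> A (w t).
  by move=> /wb; rewrite !lt_min => /and3P[_ _ h3]; exact: A3.
have w0b (t : R) : `|t| <= rho -> `|w0 t - p| < b.
  by move=> /hw h1; apply: lt_trans h1 _; rewrite ltr_pdivrMr// ltr_pMr// ltr1n.
have [p0 p1 pj] := w0E 0.
have hwd' (t : R) : `|t| <= rho -> forall i, is_derive t 1 (fun t => w t 0 i) (ell i (w t)) by move=> /hwd[].
have wt (t : R) : `|t| <= rho -> w t 0 (k_ 0) = t.
  move=> ht; have h1 u : ell (k_ 0) u = 1 by rewrite /ell inordK.
  have h2 : w 0 0 (k_ 0) = id 0 by rewrite wa mxE eqxx add0r p0.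
  exact: (flow_const hwd' (fun s => is_derive_id s (1 : R)) h1 h2 ht).
have wj (t : R) j : (1 < j < 8)%N -> `|t| <= rho -> w t 0 (k_ j) = al (k_ j).
  move=> hj ht; have [j1 j8] := andP hj.
  have h1 u : ell (k_ j) u = 0 by rewrite /ell inordK// nth_default.
  have h2 : w 0 0 (k_ j) = al (k_ j).
    rewrite wa mxE pj// addr0 ifF//; apply/negbTE; apply/eqP => /(congr1 val).
    by rewrite /= !inordK// => e; move: j1; rewrite e.
  have h3 (s : R) : is_derive s 1 (fun=> al (k_ j)) (0 : R) by exact: is_derive_cst.
  have e := flow_const hwd' h3 h1 h2 ht.
  by rewrite e.
pose I1 : set R := [set t | `|t| < rho].
have ball0 (e : R) : open [set t : R | `|t| < e].
  apply: open_ballI => t /= te; exists (e - `|t|); first by rewrite subr_gt0.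
  by move=> s; rewrite ltrBrDr => k; apply: le_lt_trans k; rewrite -{1}[s](subrK t) ler_normD.
have oI1 : open I1 by exact: ball0.
pose vz k t := iter k (Lie ell) Psi (w t).
have fvz : family I1 vz.
  by apply: (family_flow oA sell sPsi) => t /= /ltW ht; split; [exact: wA|exact: (hwd t ht).2].
have vz0 k t : `|t| <= rho -> iter k (Lie ell) Psi (w0 t) = 0.
  move=> /in1' te; pose I4 : set R := [set t | `|t| < e1].
  have oI4 : open I4 by exact: ball0.
  have F0 := family_flow oA sell sPsi (I := I4) (w := w0) w0_flow.
  have z1 s : I4 s -> (fun=> 0) s = iter 0 (Lie ell) Psi (w0 s).
    by move=> _; have [q0 q1 _] := w0E s; rewrite /= /Psi q1 q0 subrr.
  have [<- _] := dern_family oI4 F0 z1 k te.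
  have zf : family I4 (fun _ _ => 0) by move=> j s _; exact: is_derive_cst.
  by have [-> _] := dern_family oI4 zf (fun s _ => erefl) k te.
have bz k t : (k <= r)%N -> `|t| <= rho -> `|vz k t| <= K2 * (2 * d).
  move=> kr ht; have kr2 : (k < r.+2)%N by rewrite ltnS (leq_trans kr).
  have := L2 (Ordinal kr2) (w t) (w0 t).
  have := wb t ht; have := w0b t ht; rewrite !lt_min => /and3P[_ u2 _] /and3P[_ u1 _] /(_ u1 u2).
  rewrite /= vz0// subr0 => h1; apply: le_trans h1 _; apply: ler_wpM2l => //; exact: wp.
pose V (i : 'I_3) := nth vz [:: vx al 2 3 4; vx al 5 6 7] i.
have ald j : `|al j| <= d by apply: ltW; exact: hal.
have bx a1 b1' d1 k t : `|t| <= rho -> `|vx al a1 b1' d1 k t| <= 3 * d.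
  move=> ht; have t1 : `|t| <= 1 by rewrite ltW// (le_lt_trans ht).
  have q1 j : `|al j * t| <= d.
    by rewrite normrM -[d]mulr1; apply: ler_pM.
  have q2 j : `|al j * (t * t * 2^-1)| <= d.
    rewrite normrM -[d]mulr1; apply: ler_pM => //; rewrite !normrM [`|2^-1|]ger0_norm ?invr_ge0//.
    have tt : `|t| * `|t| <= 1 by exact: mulr_ile1.
    have h2 : 2^-1 <= 1 :> R by rewrite invf_le1// ler1n.
    by apply: mulr_ile1.
  have d1' : 0 <= d by exact: ltW.
  case: k => [|[|[|k]]]; rewrite /vx /=.
  - apply: le_trans (ler_normD _ _) _; rewrite (_ : 3 * d = (d + d) + d); last by ring.
    by apply: lerD => //; apply: le_trans (ler_normD _ _) _; exact: lerD.
  - apply: le_trans (ler_normD _ _) _; rewrite (_ : 3 * d = d + d + d); last by ring.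
    by apply: (@le_trans _ _ (d + d)); [exact: lerD|rewrite lerDl].
  - by apply: le_trans (ald _) _; rewrite ler_peMl// ler1n.
  - by rewrite nth_nil normr0 mulr_ge0.
have fV i : family I1 (V i).
  by case: i => -[|[|i]] hi; rewrite /V /=; [move=> k t _; exact: vx_family|move=> k t _; exact: vx_family|rewrite nth_nil].
have bV i k t : (k <= r)%N -> `|t| <= rho -> `|V i k t| <= (3 + 2 * K2) * d.
  move=> kr ht; have f1 : 3 * d <= (3 + 2 * K2) * d by apply: ler_wpM2r; [exact: ltW|rewrite lerDl mulr_ge0].
  have f2 : K2 * (2 * d) <= (3 + 2 * K2) * d.
    by rewrite mulrA [K2 * 2]mulrC; apply: ler_wpM2r; [exact: ltW|rewrite lerDr].
  case: i => -[|[|i]] hi; rewrite /V /=.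
  - exact: le_trans (bx _ _ _ _ _ ht) f1.
  - exact: le_trans (bx _ _ _ _ _ ht) f1.
  - by rewrite nth_nil; exact: le_trans (bz _ _ kr ht) f2.
(* The cut-off function vanishes for |t| >= rho / 2, so the two branches agree on an overlap and c'
   is smooth. *)
pose c' : curve R 3 := fun i t => if `|t| < rho then c i t + chi 0%N t * V i 0%N t else c i t.
have fc1 i : family I1 (fun k => dern k (c i)).
  by move=> k t It; apply: (@family_dern R e0 (c i) (@sc i) k t); exact: in0'.
have fchi1 : family I1 chi by move=> k t _; exact: fchi.
have in1 i k t : `|t| < rho -> dern k (c' i) t = dern k (c i) t + leib chi (V i) k 0 0 t /\ derivable (dern k (c' i)) t 1.
  move=> ht.
  apply: (@dern_family R I1 _ (c' i) oI1 (familyD (@fc1 i) (familyM fchi1 (@fV i))) _ k t ht) => s Is.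
  by rewrite /c' Is.
pose I2 : set R := [set t | rho / 2 < `|t| /\ `|t| < e0].
have oI2 : open I2.
  apply: open_ballI => t [t1 t2]; exists (Order.min (`|t| - rho / 2) (e0 - `|t|)); first by rewrite lt_min !subr_gt0 t1.
  move=> s; rewrite lt_min => /andP[s1 s2]; split.
    have := ler_normB t s; rewrite distrC in s1.
    have : `|t| <= `|t - s| + `|s| by rewrite -{1}[t](subrK s) ler_normD.
    by move: s1; move: (`|t - s|) (`|s|) (`|t|) => u1 u2 u3; lra.
  by move: s2; rewrite ltrBrDr => k; apply: le_lt_trans k; rewrite -{1}[s](subrK t) ler_normD.
have in2 i k t : I2 t -> dern k (c' i) t = dern k (c i) t /\ derivable (dern k (c' i)) t 1.
  have fc2 : family I2 (fun k => dern k (c i)).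
    by move=> j s [_ It]; exact: (@family_dern R e0 (c i) (@sc i) j s It).
  apply: (@dern_family R I2 _ (c' i) oI2 fc2) => s [s1 s2]; rewrite /c'; case: ifP => // _.
  by rewrite chi0 ?mul0r ?addr0//; apply: ltW; apply: le_lt_trans s1; lra.
have cases t : `|t| < e0 -> `|t| < rho \/ I2 t.
  move=> te; case: (ltP `|t| rho) => h1; [by left|right; split=> //].
  by apply: lt_le_trans h1; rewrite ltr_pdivrMr// ltr_pMr// ltr1n.
have sc' i : smooth_on_int e0 (c' i).
  by move=> k t /cases[/(in1 i k)[]|/(in2 i k)[]].
pose I3 : set R := [set t | `|t| < rho / 4].
have oI3 : open I3 by exact: ball0.
have I31 t : I3 t -> `|t| < rho.
  by move=> h1; apply: lt_trans h1 _; rewrite ltr_pdivrMr// ltr_pMr// ltr1n.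
have c'3 i t : I3 t -> c' i t = c i t + V i 0%N t.
  by move=> h1; rewrite /c' (I31 _ h1) chi1 ?mul1r// ltW.
have in3 i k t : I3 t -> dern k (c' i) t = dern k (c i) t + V i k t.
  move=> h1.
  have fc3 : family I3 (fun k => dern k (c i)) by move=> j s /I31; exact: fc1.
  have fV3 : family I3 (V i) by move=> j s /I31; exact: fV.
  by have [] := @dern_family R I3 _ (c' i) oI3 (familyD fc3 fV3) (c'3 i) k t h1.
have V0 : V (inord 0) = vx al 2 3 4 by rewrite /V inordK.
have V1 : V (inord 1) = vx al 5 6 7 by rewrite /V inordK.
have V2 : V (inord 2) = vz by rewrite /V inordK.
have z3 : I3 0 by rewrite /I3 /= normr0.
have z1 : `|0 : R| <= rho by rewrite normr0 ltW.
have c2 t : I3 t -> c' (inord 2) t = w t 0 (k_ 1).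
  move=> h1; have ht := ltW (I31 _ h1); rewrite c'3// V2 /vz /= /Psi wt// -/z.
  by rewrite addrC subrK.
exists c'; split=> //.
- move=> i j t jr /cases[ht|It]; last by have [-> _] := in2 i j t It; rewrite subrr normr0; apply: epsp; case: It.
  have [-> _] := in1 i j t ht; rewrite addrAC subrr add0r.
  have ht' := ltW ht.
  have M2 : 0 <= (3 + 2 * K2) * d by rewrite mulr_ge0 ?(ltW d0)// addr_ge0// mulr_ge0.
  have := @leib_bound R chi (V i) M ((3 + 2 * K2) * d) t r M0 M2 (fun k kr => hM k t kr ht') (fun k kr => bV i k t kr ht') j 0 0.
  rewrite !addn0 => /(_ jr jr) h1; apply: le_lt_trans h1 _; apply: lt_le_trans (hm t ht').
  apply: (@lt_le_trans _ _ (N1 * d)); last first.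
    by rewrite mulrC -ler_pdivlMr// ge_min lexx orbT.
  rewrite /N1 [X in _ < X]mulrDl mul1r; apply: ltr_pwDr => //.
  rewrite -[X in _ <= X]mulrA -[M * _ * d]mulrA; apply: ler_wpM2r; first by rewrite mulr_ge0.
  by rewrite ler_eXn2l// ltr1n.
- exists (rho / 4) => // t h1 /=.
  have ht := ltW (I31 _ h1); have te := in0 _ ht.
  have E0 : c' (inord 0) t = X (w t).
    by rewrite c'3// V0 /vx /= /X !wt// !wj.
  have E1 : c' (inord 1) t = Y (w t).
    by rewrite c'3// V1 /vx /= /Y !wt// !wj.
  have E2 := c2 t h1.
  have D0 : dern 1 (c' (inord 0)) t = Xd (w t).
    by rewrite in3// V0 /vx /= /Xd !wt// !wj.
  have D1 : dern 1 (c' (inord 1)) t = Yd (w t).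
    by rewrite in3// V1 /vx /= /Yd !wt// !wj.
  have PE : mk4 (c' (inord 0) t) (c' (inord 1) t) (c' (inord 2) t)
      (dern 1 (c' (inord 1)) t - c' (inord 2) t * dern 1 (c' (inord 0)) t) = P (w t).
    by rewrite E0 E1 E2 D0 D1; apply/rowP => j; rewrite !mxE.
  have D2 : dern 1 (c' (inord 2)) t = f (w t).
    have dz := (hwd t ht).2 (k_ 1).
    have [r1 r10 hr1] := open_ballE oI3 h1.
    have [_ f1] := is_derive_near r10 (fun s hs => esym (c2 s (hr1 s hs))) dz.
    rewrite /dern derive1nS derive1E; apply: etrans f1 _.
    by rewrite /ell inordK.
  split; rewrite ?PE//; [exact: (sc' (inord 0) 0%N t te)|exact: (sc' (inord 1) 0%N t te)|exact: (sc' (inord 2) 0%N t te)| |].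
    by have [] := wA t ht.
  by apply: etrans D2 _; rewrite /f -D0.
- rewrite c2// wa mxE p1 addrC ifF//; apply/negbTE; apply/eqP => /(congr1 val).
  by rewrite /= !inordK.
- split=> j j2; rewrite in3// ?V0 ?V1; congr (_ + _).
    by case: j j2 => [|[|[|//]]] _; rewrite /vx /= ?mulr0 ?mul0r ?mulr0 ?addr0.
  by case: j j2 => [|[|[|//]]] _; rewrite /vx /= ?mulr0 ?mul0r ?mulr0 ?addr0.
Qed.

End Near.
End Perturb.

(** * The field of germs *)

Section GermField.
Variables (R : realType) (n : nat).

(* [gs_alt] makes every germ of a smooth function either zero or invertible *)
Record gfilter := GFilter {
  gs :> set 'rV[R]_n -> Prop;
  gsT : gs setT;
  gsI : forall A B, gs A -> gs B -> gs (A `&` B);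
  gsS : forall A B, A `<=` B -> gs A -> gs B;
  gs0 : ~ gs set0;
  gs_alt : forall A, open A -> gs A \/ gs (interior (~` A)) }.

(** Take an ultrafilter containing the open sets dense in W, cut down to W. The union of an open A
    and the interior of its complement is open and dense, so one of the two belongs to it. *)
Lemma gfilter_exists (W : set 'rV[R]_n) : open W -> W !=set0 -> exists F : gfilter, F W.
Proof.
move=> oW W0.
pose dns (D : set 'rV[R]_n) := open D /\ forall B, open B -> B !=set0 -> B `<=` W -> (B `&` D) !=set0.
pose F : set (set 'rV[R]_n) := [set A | exists2 D, dns D & D `&` W `<=` A].
have dI D D' : dns D -> dns D' -> dns (D `&` D').
  move=> [oD h] [oD' h']; split=> [|B oB B0 BW]; first exact: openI.
  have := h' (B `&` D) (openI oB oD) (h B oB B0 BW) (fun x hx => BW x hx.1).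
  by rewrite setIA.
have dT : dns setT by split=> [|B _ B0 _]; [exact: openT|rewrite setIT].
have PF : ProperFilter F.
  split.
    move=> [D [oD h] hD]; have [x [Wx Dx]] := h W oW W0 (fun x hx => hx).
    exact: (hD x (conj Dx Wx)).
  split; first by exists setT.
    move=> A B [D dD hD] [D' dD' hD']; exists (D `&` D'); first exact: dI.
    by move=> x [[Dx D'x] Wx]; split; [exact: hD|exact: hD'].
  by move=> A B AB [D dD hD]; exists D => // x /hD; exact: AB.
have [G [UG FG]] := ultraFilterLemma PF.
have PG : ProperFilter G by exact: ultra_proper.
have alt A : open A -> G A \/ G (interior (~` A)).
  move=> oA; have GD : G (A `|` interior (~` A)).
    apply: FG; exists (A `|` interior (~` A)); last by move=> x [].
    split=> [|B oB [b Bb] BW]; first exact: openU oA (open_interior _).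
    have [[x [Bx Ax]]|nA] := pselect ((B `&` A) !=set0); first by exists x; split=> //; left.
    exists b; split=> //; right; have := open_nbhs_nbhs (conj oB Bb); apply: filterS => x Bx Ax.
    by apply: nA; exists x.
  have [|GA] := in_ultra_setVsetC A UG; first by left.
  by right; apply: filterS (filterI GD GA) => x [[|//]].
exists (@GFilter G filterT (@filterI _ G _) (@filterS _ G _) (@filter_not_empty _ G _) alt).
by apply: FG; exists setT => // x [].
Qed.

Variable F : gfilter.

Definition smG (f : 'rV[R]_n -> R) := exists O, [/\ open O, F O & smo O f].
Definition eqG (f g : 'rV[R]_n -> R) := exists O, [/\ open O, F O & forall x, O x -> f x = g x].

Lemma eqG_refl f : eqG f f.
Proof. by exists setT; split=> //; [exact: openT|exact: gsT]. Qed.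
Lemma eqG_sym f g : eqG f g -> eqG g f.
Proof. by move=> [ O [oO FO h]]; exists O; split=> // x /h. Qed.
Lemma eqG_trans f g h : eqG f g -> eqG g h -> eqG f h.
Proof.
move=> [ O [oO FO e]] [ O' [oO' FO' e']]; exists (O `&` O'); split; [exact: openI|exact: gsI|].
by move=> x [/e -> /e'].
Qed.

(** A representative that depends on the germ only; it gives germs an equality on which field
    operations can be built. *)
Definition grep f : 'rV[R]_n -> R := xget (fun=> 0) [set g | smG g /\ eqG f g].

Lemma grepP f : smG f -> smG (grep f) /\ eqG f (grep f).
Proof. by move=> sf; apply: (@xgetPex _ (fun=> 0) [set g | smG g /\ eqG f g]); exists f; split=> //; exact: eqG_refl. Qed.

Lemma grep_eq f g : eqG f g -> grep f = grep g.
Proof.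
move=> fg; rewrite /grep; congr xget; rewrite predeqE => u; split=> -[su eu]; split=> //.
  exact: eqG_trans (eqG_sym fg) eu.
exact: eqG_trans fg eu.
Qed.

Opaque grep.

Definition germ := {f : 'rV[R]_n -> R | `[< smG f /\ grep f = f >]}.

Lemma smG_cst a : smG (fun=> a).
Proof. by exists setT; split; [exact: openT|exact: gsT|apply: smo_cst; exact: openT]. Qed.

Lemma grep_ok f : smG f -> `[< smG (grep f) /\ grep (grep f) = grep f >].
Proof. by move=> sf; have [h1 h2] := grepP sf; apply/asboolP; split=> //; apply: grep_eq; exact: eqG_sym. Qed.

(* The operations are sealed to keep conversion from unfolding representatives. *)
Fact cl_key : {c : ('rV[R]_n -> R) -> germ | forall f, smG f -> val (c f) = grep f}.
Proof.
exists (fun f => if pselect (smG f) is left sf then exist _ (grep f) (grep_ok sf)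
  else exist _ (grep (fun=> 0)) (grep_ok (smG_cst 0))).
by move=> f sf; case: pselect.
Qed.
Definition cl := sval cl_key.

Lemma cl_val f : smG f -> val (cl f) = grep f.
Proof. exact: (svalP cl_key). Qed.


Lemma clP f g : smG f -> smG g -> cl f = cl g <-> eqG f g.
Proof.
move=> sf sg; split=> [/(congr1 val)|e].
  rewrite (cl_val sf) (cl_val sg) => e; have [_ h1] := grepP sf; have [_ h2] := grepP sg.
  by apply: eqG_trans h1 _; rewrite e; exact: eqG_sym.
by apply: val_inj; rewrite (cl_val sf) (cl_val sg); exact: (grep_eq e).
Qed.

Lemma valG (a : germ) : smG (val a).
Proof. by case: a => f /= /asboolP[]. Qed.

Lemma cl_val_id (a : germ) : cl (val a) = a.
Proof. by apply: val_inj; rewrite cl_val; [case: a => f /= /asboolP[]|exact: valG]. Qed.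

Lemma val_cl f : smG f -> eqG (val (cl f)) f.
Proof. by move=> sf; rewrite (cl_val sf); apply: eqG_sym; exact: (grepP sf).2. Qed.

Lemma smG2 f g : smG f -> smG g -> exists O, [/\ open O, F O, smo O f & smo O g].
Proof.
move=> [ O [oO FO sf]] [ O' [oO' FO' sg]]; exists (O `&` O'); split; [exact: openI|exact: gsI| |].
  by apply: smo_sub sf => x [].
by apply: smo_sub sg => x [].
Qed.

Lemma smGD f g : smG f -> smG g -> smG (fun x => f x + g x).
Proof. by move=> sf sg; have [ O [oO FO s1 s2]] := smG2 sf sg; exists O; split; [exact: oO|exact: FO|exact: (smoD oO s1 s2)]. Qed.
Lemma smGM f g : smG f -> smG g -> smG (fun x => f x * g x).
Proof. by move=> sf sg; have [ O [oO FO s1 s2]] := smG2 sf sg; exists O; split; [exact: oO|exact: FO|exact: (smoM oO s1 s2)]. Qed.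
Lemma smGN f : smG f -> smG (fun x => - f x).
Proof. by move=> [ O [oO FO sf]]; exists O; split; [exact: oO|exact: FO|exact: (smoN oO sf)]. Qed.
Lemma smG_partial f i : smG f -> smG (partial i f).
Proof. by move=> [ O [oO FO sf]]; exists O; split; [exact: oO|exact: FO|exact: (smo_partial i sf)]. Qed.
Lemma eqGD f g f' g' : eqG f f' -> eqG g g' -> eqG (fun x => f x + g x) (fun x => f' x + g' x).
Proof.
move=> [ O [oO FO e]] [ O' [oO' FO' e']]; exists (O `&` O'); split; [exact: openI|exact: gsI|].
by move=> x [/e -> /e' ->].
Qed.
Lemma eqGM f g f' g' : eqG f f' -> eqG g g' -> eqG (fun x => f x * g x) (fun x => f' x * g' x).
Proof.
move=> [ O [oO FO e]] [ O' [oO' FO' e']]; exists (O `&` O'); split; [exact: openI|exact: gsI|].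
by move=> x [/e -> /e' ->].
Qed.
Lemma eqG1 (u : R -> R) f f' : eqG f f' -> eqG (fun x => u (f x)) (fun x => u (f' x)).
Proof. by move=> [ O [oO FO e]]; exists O; split=> // x /e ->. Qed.
Lemma eqG_partial f g i : eqG f g -> eqG (partial i f) (partial i g).
Proof. by move=> [ O [oO FO e]]; exists O; split; [exact: oO|exact: FO|move=> x Ox; exact: (eq_partial i oO e Ox)]. Qed.

(** The source of inverses: [gs_alt] applied to the open set where f is non-zero. *)
Lemma germ_alt f : smG f -> eqG f (fun=> 0) \/ exists O, [/\ open O, F O, smo O f & forall x, O x -> f x != 0].
Proof.
move=> [ O [oO FO sf]].
have oN : open (O `&` [set x | f x != 0]).
  apply: open_ballI => x [Ox fx]; have [r1 r10 h1] := open_ballE oO Ox.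
  have cf : {for x, continuous f} by have [] := sf [::] x Ox.
  have f0 : 0 < `|f x| by rewrite normr_gt0.
  have [r2 r20 h2] := cont_ballE cf f0.
  exists (Order.min r1 r2) => [|y]; first by rewrite lt_min r10.
  rewrite lt_min => /andP[y1 y2]; split; first exact: h1.
  by apply/eqP => fy; have := h2 y y2; rewrite fy sub0r normrN ltxx.
have [h|h] := gs_alt F oN; [right|left].
  exists (O `&` [set x | f x != 0]); split; [exact: oN|exact: h| |by move=> x []].
  by apply: smo_sub sf => x [].
exists (O `&` interior (~` (O `&` [set x | f x != 0]))); split.
- by apply: openI => //; exact: open_interior.
- exact: gsI.
- move=> x [Ox /interior_subset nx]; apply/eqP; apply: contra_notT nx => fx; split=> //.
Qed.

Lemma smGV f : smG f -> smG (fun x => (f x)^-1).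
Proof.
move=> sf; have [[ O [oO FO e]]|[ O [oO FO s h]]] := germ_alt sf; last first.
  by exists O; split; [exact: oO|exact: FO|exact: (smoV oO s h)].
exists O; split; [exact: oO|exact: FO|].
by apply: (eq_smo oO _ (smo_cst 0 oO)) => y Oy; rewrite (e y Oy) invr0.
Qed.

Fact gadd_key : {op : germ -> germ -> germ |
  forall f g, smG f -> smG g -> op (cl f) (cl g) = cl (fun x => f x + g x)}.
Proof.
exists (fun a b => cl (fun x => val a x + val b x)) => f g sf sg.
apply/(clP (smGD (valG (cl f)) (valG (cl g))) (smGD sf sg)); exact: (eqGD (val_cl sf) (val_cl sg)).
Qed.
Definition gadd := sval gadd_key.
Lemma gaddE f g : smG f -> smG g -> gadd (cl f) (cl g) = cl (fun x => f x + g x).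
Proof. exact: (svalP gadd_key). Qed.

Fact gmul_key : {op : germ -> germ -> germ |
  forall f g, smG f -> smG g -> op (cl f) (cl g) = cl (fun x => f x * g x)}.
Proof.
exists (fun a b => cl (fun x => val a x * val b x)) => f g sf sg.
apply/(clP (smGM (valG (cl f)) (valG (cl g))) (smGM sf sg)); exact: (eqGM (val_cl sf) (val_cl sg)).
Qed.
Definition gmul := sval gmul_key.
Lemma gmulE f g : smG f -> smG g -> gmul (cl f) (cl g) = cl (fun x => f x * g x).
Proof. exact: (svalP gmul_key). Qed.

Fact gopp_key : {op : germ -> germ | forall f, smG f -> op (cl f) = cl (fun x => - f x)}.
Proof.
exists (fun a => cl (fun x => - val a x)) => f sf.
apply/(clP (smGN (valG (cl f))) (smGN sf)); exact: (eqG1 -%R (val_cl sf)).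
Qed.
Definition gopp := sval gopp_key.
Lemma goppE f : smG f -> gopp (cl f) = cl (fun x => - f x).
Proof. exact: (svalP gopp_key). Qed.

Fact ginv_key : {op : germ -> germ | forall f, smG f -> op (cl f) = cl (fun x => (f x)^-1)}.
Proof.
exists (fun a => cl (fun x => (val a x)^-1)) => f sf.
apply/(clP (smGV (valG (cl f))) (smGV sf)); exact: (eqG1 GRing.inv (val_cl sf)).
Qed.
Definition ginv := sval ginv_key.
Lemma ginvE f : smG f -> ginv (cl f) = cl (fun x => (f x)^-1).
Proof. exact: (svalP ginv_key). Qed.

Lemma germP (a : germ) : exists f, smG f /\ a = cl f.
Proof. by exists (val a); split; [exact: valG|rewrite cl_val_id]. Qed.
Let ext f g : (forall x, f x = g x) -> cl f = cl g.
Proof. by move=> /funext ->. Qed.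

Lemma gaddA : associative gadd.
Proof. move=> a b c; have [f [sf ->]] := germP a; have [g [sg ->]] := germP b; have [h [sh ->]] := germP c; rewrite (gaddE sg sh) (gaddE sf (smGD sg sh)) (gaddE sf sg) (gaddE (smGD sf sg) sh); apply: ext => x; exact: addrA. Qed.
Lemma gaddC : commutative gadd.
Proof. move=> a b; have [f [sf ->]] := germP a; have [g [sg ->]] := germP b; rewrite (gaddE sf sg) (gaddE sg sf); apply: ext => x; exact: addrC. Qed.
Lemma gadd0 : left_id (cl (fun=> 0)) gadd.
Proof. move=> a; have [f [sf ->]] := germP a; rewrite (gaddE (smG_cst 0) sf); apply: ext => x; exact: add0r. Qed.
Lemma gaddN : left_inverse (cl (fun=> 0)) gopp gadd.
Proof. move=> a; have [f [sf ->]] := germP a; rewrite (goppE sf) (gaddE (smGN sf) sf); apply: ext => x; exact: addNr. Qed.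
Lemma gmulA : associative gmul.
Proof. move=> a b c; have [f [sf ->]] := germP a; have [g [sg ->]] := germP b; have [h [sh ->]] := germP c; rewrite (gmulE sg sh) (gmulE sf (smGM sg sh)) (gmulE sf sg) (gmulE (smGM sf sg) sh); apply: ext => x; exact: mulrA. Qed.
Lemma gmulC : commutative gmul.
Proof. move=> a b; have [f [sf ->]] := germP a; have [g [sg ->]] := germP b; rewrite (gmulE sf sg) (gmulE sg sf); apply: ext => x; exact: mulrC. Qed.
Lemma gmul1 : left_id (cl (fun=> 1)) gmul.
Proof. move=> a; have [f [sf ->]] := germP a; rewrite (gmulE (smG_cst 1) sf); apply: ext => x; exact: mul1r. Qed.
Lemma gmulD : left_distributive gmul gadd.
Proof. move=> a b c; have [f [sf ->]] := germP a; have [g [sg ->]] := germP b; have [h [sh ->]] := germP c; rewrite (gaddE sf sg) (gmulE (smGD sf sg) sh) (gmulE sf sh) (gmulE sg sh) (gaddE (smGM sf sh) (smGM sg sh)); apply: ext => x; exact: mulrDl. Qed.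
Lemma cl_neq0 f : smG f -> cl f <> cl (fun=> 0) -> exists O, [/\ open O, F O, smo O f & forall x, O x -> f x != 0].
Proof. by move=> sf h; have [e|] := germ_alt sf; [case: h; apply/(clP sf (smG_cst 0))|apply]. Qed.
Lemma cl_cst_inj (a b : R) : cl (fun=> a) = cl (fun=> b) -> a = b.
Proof.
move/clP => /(_ (smG_cst a) (smG_cst b))[ O [oO FO h]].
have [[x Ox]|n0] := pselect (O !=set0); first exact: h Ox.
by case: (gs0 (gsS _ FO)) => x Ox; apply: n0; exists x.
Qed.
Lemma g10 : cl (fun=> 1) != cl (fun=> 0).
Proof. by apply/eqP => /cl_cst_inj /eqP; rewrite oner_eq0. Qed.
Lemma gmulV (a : germ) : a != cl (fun=> 0) -> gmul (ginv a) a = cl (fun=> 1).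
Proof. 
have [f [sf ->]] := germP a; move=> /eqP f0; have [ O [oO FO s h]] := cl_neq0 sf f0.
rewrite (ginvE sf) (gmulE (smGV sf) sf).
apply/(clP (smGM (smGV sf) sf) (smG_cst 1)).
by exists O; split; [exact: oO|exact: FO|move=> x Ox; exact: (mulVf (h x Ox))].
 Qed.
Lemma ginv0 : ginv (cl (fun=> 0)) = cl (fun=> 0).
Proof. rewrite (ginvE (smG_cst 0)); apply: ext => x; exact: invr0. Qed.

End GermField.

HB.instance Definition _ R n (F : gfilter R n) := Choice.on (germ F).
HB.instance Definition _ R n (F : gfilter R n) :=
  GRing.isZmodule.Build (germ F) (@gaddA R n F) (@gaddC R n F) (@gadd0 R n F) (@gaddN R n F).
HB.instance Definition _ R n (F : gfilter R n) :=
  GRing.Zmodule_isComNzRing.Build (germ F) (@gmulA R n F) (@gmulC R n F) (@gmul1 R n F) (@gmulD R n F) (g10 F).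
HB.instance Definition _ R n (F : gfilter R n) :=
  GRing.ComNzRing_isField.Build (germ F) (@gmulV R n F) (@ginv0 R n F).

(** * Derivations on the field of germs *)

Section GermCalculus.
Variables (R : realType) (n : nat) (F : gfilter R n).
Local Notation K := (germ F).
Local Notation cl := (@cl R n F).
Local Notation smG := (smG F).

Lemma clD f g : smG f -> smG g -> cl (fun x => f x + g x) = cl f + cl g.
Proof. by move=> sf sg; exact: esym (gaddE sf sg). Qed.
Lemma clM f g : smG f -> smG g -> cl (fun x => f x * g x) = cl f * cl g.
Proof. by move=> sf sg; exact: esym (gmulE sf sg). Qed.
Lemma clN f : smG f -> cl (fun x => - f x) = - cl f.
Proof. by move=> sf; exact: esym (goppE sf). Qed.
Lemma clB f g : smG f -> smG g -> cl (fun x => f x - g x) = cl f - cl g.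
Proof. by move=> sf sg; rewrite (clD sf (smGN sg)) (clN sg). Qed.
Lemma cl0 : cl (fun=> 0) = 0. Proof. by []. Qed.
Lemma cl1 : cl (fun=> 1) = 1. Proof. by []. Qed.
Lemma cl_nat k : cl (fun=> k%:R) = k%:R.
Proof.
elim: k => [//|k IH]; rewrite [RHS]mulrSr -IH -cl1 -(clD (smG_cst F _) (smG_cst F _)).
by congr cl; apply/funext => x; rewrite mulrSr.
Qed.
Lemma germ_char0 k : k.+1%:R != 0 :> K.
Proof. by rewrite -cl_nat; apply/eqP => /(@cl_cst_inj R n F k.+1%:R 0) /eqP; rewrite pnatr_eq0. Qed.
Lemma smG_sum m (f : 'I_m -> 'rV[R]_n -> R) : (forall j, smG (f j)) -> smG (fun x => \sum_j f j x).
Proof.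
elim: m f => [|m IH] f sf.
  by rewrite (_ : (fun _ => _) = (fun=> 0)); [exact: smG_cst|apply/funext => x; rewrite big_ord0].
rewrite (_ : (fun _ => _) = (fun x => f ord0 x + \sum_j f (lift ord0 j) x)).
  by apply: smGD => //; exact: IH.
by apply/funext => x; rewrite big_ord_recl.
Qed.
Lemma cl_sum m (f : 'I_m -> 'rV[R]_n -> R) : (forall j, smG (f j)) ->
  cl (fun x => \sum_j f j x) = \sum_j cl (f j).
Proof.
elim: m f => [|m IH] f sf.
  by rewrite big_ord0 -cl0; congr cl; apply/funext => x; rewrite big_ord0.
rewrite big_ord_recl -IH// -clD//; last exact: smG_sum.
by congr cl; apply/funext => x; rewrite big_ord_recl.
Qed.

Fact dK_key : {d : 'I_n -> K -> K | forall i f, smG f -> d i (cl f) = cl (partial i f)}.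
Proof.
exists (fun i a => cl (partial i (val a))) => i f sf.
apply/(clP (smG_partial i (valG (cl f))) (smG_partial i sf)); exact: (eqG_partial i (val_cl sf)).
Qed.
Definition dK := sval dK_key.
Lemma dKE i f : smG f -> dK i (cl f) = cl (partial i f).
Proof. exact: (svalP dK_key). Qed.

Lemma dKD i : {morph dK i : a b / a + b}.
Proof. 
move=> a b; have [f [sf ->]] := germP a; have [g [sg ->]] := germP b.
rewrite -(clD sf sg) (dKE i sf) (dKE i sg) (dKE i (smGD sf sg)) -(clD (smG_partial i sf) (smG_partial i sg)).
apply/(clP (smG_partial i (smGD sf sg)) (smGD (smG_partial i sf) (smG_partial i sg))).
have [ O [oO FO s1 s2]] := smG2 sf sg; exists O; split; [exact: oO|exact: FO|move=> x Ox; exact: (partialD i s1 s2 Ox)].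
 Qed.
Lemma dKM i a b : dK i (a * b) = dK i a * b + a * dK i b.
Proof. 
have [f [sf ->]] := germP a; have [g [sg ->]] := germP b.
have s1 := smG_partial i sf; have s2 := smG_partial i sg.
rewrite -(clM sf sg) (dKE i sf) (dKE i sg) (dKE i (smGM sf sg)) -(clM s1 sg) -(clM sf s2) -(clD (smGM s1 sg) (smGM sf s2)).
apply/(clP (smG_partial i (smGM sf sg)) (smGD (smGM s1 sg) (smGM sf s2))).
have [ O [oO FO t1 t2]] := smG2 sf sg; exists O; split; [exact: oO|exact: FO|move=> x Ox; exact: (partialM i t1 t2 Ox)].
 Qed.
Lemma dKC i j a : dK i (dK j a) = dK j (dK i a).
Proof. 
have [f [sf ->]] := germP a; have [s1 s2] := (smG_partial i sf, smG_partial j sf).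
rewrite (dKE i sf) (dKE j sf) (dKE i s2) (dKE j s1); apply/(clP (smG_partial i s2) (smG_partial j s1)).
have [ O [oO FO s]] := sf; exists O; split; [exact: oO|exact: FO|move=> x Ox; exact: (partial_sym i j oO s Ox)].
 Qed.

Lemma smG_comp m (C : set 'rV[R]_m) (G : 'rV[R]_m -> R) (q : 'I_m -> 'rV[R]_n -> R) O :
  open C -> smo C G -> open O -> F O -> (forall j, smo O (q j)) -> (forall x, O x -> C (\row_j q j x)) ->
  smG (fun x => G (\row_j q j x)).
Proof. by move=> oC sG oO FO sq h; exists O; split; [exact: oO|exact: FO|exact: (smo_comp oO oC sG sq h)]. Qed.

Lemma dK_comp m (C : set 'rV[R]_m) (G : 'rV[R]_m -> R) (q : 'I_m -> 'rV[R]_n -> R) O i :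
  open C -> smo C G -> open O -> F O -> (forall j, smo O (q j)) -> (forall x, O x -> C (\row_j q j x)) ->
  dK i (cl (fun x => G (\row_j q j x))) = \sum_j dK i (cl (q j)) * cl (fun x => partial j G (\row_j q j x)).
Proof.
move=> oC sG oO FO sq h.
have sqG j : smG (q j) by exists O.
have sG' j : smG (fun x => partial j G (\row_j q j x)).
  by apply: (smG_comp oC (smo_partial j sG) oO FO sq h).
have sc := smG_comp oC sG oO FO sq h.
rewrite (dKE i sc); under eq_bigr => j _ do rewrite (dKE i (sqG j)) -(clM (smG_partial i (sqG j)) (sG' j)).
have s2 j : smG (fun x => partial i (q j) x * partial j G (\row_j q j x)).
  exact: (smGM (smG_partial i (sqG j)) (sG' j)).
apply: etrans _ (cl_sum s2); apply/(clP (smG_partial i sc) (smG_sum s2)).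
by exists O; split; [exact: oO|exact: FO|move=> x Ox; exact: (partial_comp i oC sG sq (h x Ox) Ox)].
Qed.

End GermCalculus.

(** * Jets of the parameters *)

Section Jet.
Variables (R : realType) (k l : nat).
Local Notation N := (k.+3 + l.+3)%N.

Definition ui (i : nat) : 'I_N := lshift l.+3 (inord i).
Definition vi (j : nat) : 'I_N := rshift k.+3 (inord j).
(** Place of a coordinate of order (k, l) among those of order (k+2, l+2). *)
Definition eix (a : 'I_(k.+1 + l.+1)) : 'I_N :=
  match fintype.split a with inl i => ui i | inr j => vi j end.
(** The total derivative as a vector field on jets of order (k+2, l+2), cut off at the top: the two
    highest coordinates get 0, which is correct on functions that do not depend on them. *)
Definition ell (a : 'I_N) (p : 'rV[R]_N) : R :=
  match fintype.split a with
  | inl i => if (i < k.+2)%N then p 0 (ui i.+1) else 0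
  | inr j => if (j < l.+2)%N then p 0 (vi j.+1) else 0
  end.
Definition emb (p : 'rV[R]_N) : 'rV[R]_(k.+1 + l.+1) := \row_a p 0 (eix a).
Definition hat (f : 'rV[R]_(k.+1 + l.+1) -> R) (p : 'rV[R]_N) : R := f (emb p).

Lemma eixl i : eix (lshift l.+1 i) = ui i. Proof. by rewrite /eix (unsplitK (inl i)). Qed.
Lemma eixr j : eix (rshift k.+1 j) = vi j. Proof. by rewrite /eix (unsplitK (inr j)). Qed.
Lemma ellu i p : (i < k.+3)%N -> ell (ui i) p = if (i < k.+2)%N then p 0 (ui i.+1) else 0.
Proof. by move=> ik; rewrite /ell (unsplitK (inl (inord i))) inordK. Qed.
Lemma ellv j p : (j < l.+3)%N -> ell (vi j) p = if (j < l.+2)%N then p 0 (vi j.+1) else 0.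
Proof. by move=> jl; rewrite /ell (unsplitK (inr (inord j))) inordK. Qed.

Lemma ltn3 i n : (i < n.+1)%N -> (i < n.+3)%N.
Proof. by move=> h; apply: leq_trans h _; rewrite -addn2 leq_addr. Qed.

Lemma jet_ind (Q : 'I_N -> Prop) : (forall i, (i < k.+3)%N -> Q (ui i)) ->
  (forall j, (j < l.+3)%N -> Q (vi j)) -> forall a, Q a.
Proof.
move=> hu hv a; case: (split_ordP a) => i ->.
  by have := hu i (ltn_ord i); rewrite /ui inord_val.
by have := hv i (ltn_ord i); rewrite /vi inord_val.
Qed.

Lemma eq_uu i j : (i < k.+3)%N -> (j < k.+3)%N -> (ui i == ui j) = (i == j).
Proof. by move=> ik jk; rewrite /ui eq_lshift -val_eqE /= !inordK. Qed.
Lemma eq_vv i j : (i < l.+3)%N -> (j < l.+3)%N -> (vi i == vi j) = (i == j).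
Proof. by move=> ik jk; rewrite /vi eq_rshift -val_eqE /= !inordK. Qed.
Lemma eq_uv i j : (ui i == vi j) = false.
Proof. exact: eq_lrshift. Qed.
Lemma eq_vu i j : (vi i == ui j) = false.
Proof. by rewrite eq_sym eq_uv. Qed.

Lemma jet_u c t i : (i < k.+3)%N -> @jet_uv R k.+2 l.+2 c t 0 (ui i) = dern i (c (inord 0)) t.
Proof. by move=> ik; rewrite /jet_uv /ui row_mxEl mxE inordK. Qed.
Lemma jet_v c t j : (j < l.+3)%N -> @jet_uv R k.+2 l.+2 c t 0 (vi j) = dern j (c (inord 1)) t.
Proof. by move=> jl; rewrite /jet_uv /vi row_mxEr mxE inordK. Qed.

Lemma emb_jet c t : emb (@jet_uv R k.+2 l.+2 c t) = @jet_uv R k l c t.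
Proof.
apply/rowP => a; rewrite mxE; case: (split_ordP a) => i ->.
  by rewrite eixl jet_u ?ltn3// /jet_uv row_mxEl mxE.
by rewrite eixr jet_v ?ltn3// /jet_uv row_mxEr mxE.
Qed.

Lemma ell_fun a : (exists b, ell a = (fun p => p 0 b)) \/ ell a = (fun=> 0).
Proof.
elim/jet_ind: a => i hi.
  have [ik|ki] := boolP (i < k.+2)%N; [left; exists (ui i.+1)|right]; apply/funext => p.
    by rewrite ellu// ik.
  by rewrite ellu// (negbTE ki).
have [ik|ki] := boolP (i < l.+2)%N; [left; exists (vi i.+1)|right]; apply/funext => p.
  by rewrite ellv// ik.
by rewrite ellv// (negbTE ki).
Qed.

Lemma smo_ell A a : open A -> smo A (ell a).
Proof. by move=> oA; case: (ell_fun a) => [[b ->]|->]; [exact: smo_coord|exact: smo_cst]. Qed.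

Definition jtop (t t' : 'I_N) := (t = ui k.+2 /\ t' = ui k.+1) \/ (t = vi l.+2 /\ t' = vi l.+1).

Lemma partial_ell t t' a p : jtop t t' -> partial t (ell a) p = (a == t')%:R.
Proof.
have U i : (i < k.+2)%N -> ell (ui i) = (fun p => p 0 (ui i.+1)).
  by move=> ik; apply/funext => q; rewrite ellu ?ik// ltnS ltnW.
have V i : (i < l.+2)%N -> ell (vi i) = (fun p => p 0 (vi i.+1)).
  by move=> ik; apply/funext => q; rewrite ellv ?ik// ltnS ltnW.
have U0 : ell (ui k.+2) = (fun=> 0) by apply/funext => q; rewrite ellu// ltnn.
have V0 : ell (vi l.+2) = (fun=> 0) by apply/funext => q; rewrite ellv// ltnn.
elim/jet_ind: a => i; rewrite ltnS leq_eqVlt => /orP[/eqP ->|ik] [[-> ->]|[-> ->]].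
- by rewrite U0 partial_cst eq_uu// eqn_leq ltnn.
- by rewrite U0 partial_cst eq_uv.
- by rewrite U// partial_coord !eq_uu// ?ltnS ?(ltnW ik)// eqSS eq_sym.
- by rewrite U// partial_coord eq_vu eq_uv.
- by rewrite V0 partial_cst eq_vu.
- by rewrite V0 partial_cst eq_vv// eqn_leq ltnn.
- by rewrite V// partial_coord eq_vu eq_uv.
- by rewrite V// partial_coord !eq_vv// ?ltnS ?(ltnW ik)// eqSS eq_sym.
Qed.

Local Notation T := (Lie ell).
Definition dead (A : set 'rV[R]_N) (i : 'I_N) (F : 'rV[R]_N -> R) := forall p, A p -> partial i F p = 0.

(** The commutator of [partial t] with T is [partial t']: T raises the order by one. *)
Lemma dead_T A t t' F : open A -> smo A F -> jtop t t' -> dead A t F -> dead A t' F -> dead A t (T F).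
Proof.
move=> oA sF tt Ft Ft' p Ap.
have sl a : smo A (fun p => ell a p * partial a F p) by exact: (smoM oA (smo_ell a oA) (smo_partial a sF)).
have E : is_derive p (evec R t) (fun p => \sum_a ell a p * partial a F p)
    (\sum_a (partial t (ell a) p * partial a F p + ell a p * partial t (partial a F) p)).
  have h a : is_derive p (evec R t) (fun p => ell a p * partial a F p)
      (partial t (ell a) p * partial a F p + ell a p * partial t (partial a F) p).
    by rewrite -(partialM t (smo_ell a oA) (smo_partial a sF) Ap); exact: (smo_is_derive t (sl a) Ap).
  have := is_derive_sum h; rewrite (_ : \sum_(i < N) _ = (fun p => \sum_a ell a p * partial a F p))//.
  by apply/funext => q; rewrite fct_sumE.
have [_ e] := E; rewrite /partial; apply: etrans e _.
rewrite big1// => a _; rewrite (partial_ell a p tt) (partial_sym t a oA sF Ap).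
rewrite (@eq_partial R N A (partial t F) (fun=> 0) a oA Ft p Ap) partial_cst mulr0 addr0.
by case: eqP => [->|_]; rewrite ?mul0r// Ft'// mulr0.
Qed.

Lemma is_derive_jet A F c (t e : R) : open A -> smo A F -> dead A (ui k.+2) F -> dead A (vi l.+2) F ->
  (forall i, smooth_on_int e (c i)) -> `|t| < e -> A (@jet_uv R k.+2 l.+2 c t) ->
  is_derive t 1 (fun t => F (@jet_uv R k.+2 l.+2 c t)) (T F (@jet_uv R k.+2 l.+2 c t)).
Proof.
move=> oA sF du dv sc te Jt.
pose dc (a : 'I_N) : R := match fintype.split a with inl i => dern i.+1 (c (inord 0)) t | inr j => dern j.+1 (c (inord 1)) t end.
have fam i m : is_derive t 1 (dern m (c i)) (dern m.+1 (c i) t) by exact: (family_dern (@sc i)).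
have dcu i : (i < k.+3)%N -> dc (ui i) = dern i.+1 (c (inord 0)) t by move=> ik; rewrite /dc (unsplitK (inl (inord i))) inordK.
have dcv i : (i < l.+3)%N -> dc (vi i) = dern i.+1 (c (inord 1)) t by move=> ik; rewrite /dc (unsplitK (inr (inord i))) inordK.
have [h1 h2] := smo_near oA sF Jt.
have := @is_derive_comp_rV R _ N F (@jet_uv R k.+2 l.+2 c) t 1 dc h1 h2 _.
rewrite (_ : \sum_j dc j * _ = T F (@jet_uv R k.+2 l.+2 c t)).
  apply; elim/jet_ind => i hi.
    rewrite dcu// (_ : (fun t => _) = dern i (c (inord 0)))//; by apply/funext => s; rewrite jet_u.
  rewrite dcv// (_ : (fun t => _) = dern i (c (inord 1)))//; by apply/funext => s; rewrite jet_v.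
apply: eq_bigr; elim/jet_ind => i; rewrite ltnS leq_eqVlt => /orP[/eqP ->|ik] _.
- by rewrite du// !mulr0.
- by rewrite dcu ?ellu ?ik ?jet_u// ltnS ltnW.
- by rewrite dv// !mulr0.
- by rewrite dcv ?ellv ?ik ?jet_v// ltnS ltnW.
Qed.

Lemma partial_hat U f i p : open U -> smo U f -> U (emb p) ->
  partial i (hat f) p = \sum_j (i == eix j)%:R * partial j f (emb p).
Proof.
move=> oU sf Up; have oT : open [set: 'rV[R]_N] by exact: openT.
rewrite /hat /emb (partial_comp i oU sf (q := fun j p => p 0 (eix j)) (fun j => smo_coord _ oT) Up I).
by apply: eq_bigr => j _; rewrite partial_coord.
Qed.

Lemma partial_hat0 U f i p : open U -> smo U f -> U (emb p) ->
  (forall j, (j < k.+1)%N -> i != ui j) -> (forall j, (j < l.+1)%N -> i != vi j) -> partial i (hat f) p = 0.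
Proof.
move=> oU sf Up hu hv; rewrite (partial_hat i oU sf Up) big1// => a _.
case: (split_ordP a) => j ->; rewrite ?eixl ?eixr; first by rewrite (negbTE (hu j (ltn_ord j))) mul0r.
by rewrite (negbTE (hv j (ltn_ord j))) mul0r.
Qed.

Lemma partial_hat_u U f p : open U -> smo U f -> U (emb p) ->
  partial (ui k) (hat f) p = partial (lshift l.+1 ord_max) f (emb p).
Proof.
move=> oU sf Up; rewrite (partial_hat _ oU sf Up) (bigD1 (lshift l.+1 ord_max))//= eixl eqxx mul1r.
rewrite big1 ?addr0// => a; case: (split_ordP a) => j -> ne; rewrite ?eixl ?eixr ?eq_uv ?mul0r//.
rewrite eq_uu ?ltn3//; rewrite eq_lshift -val_eqE /= eq_sym in ne.
by rewrite (negbTE ne) mul0r.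
Qed.

Lemma open_emb U : open U -> open [set p | U (emb p)].
Proof.
move=> oU; apply: open_ballI => p /= Up; have [r r0 hr] := open_ballE oU Up.
exists r => // q qp; apply: hr; apply: rV_norm_lt => // i; rewrite !mxE.
by have := rV_coord_le (q - p) (eix i); rewrite !mxE => h; exact: le_lt_trans h qp.
Qed.

Lemma smo_hat U f : open U -> smo U f -> smo [set p | U (emb p)] (hat f).
Proof.
move=> oU sf; have oA := open_emb oU.
exact: (smo_comp oA oU sf (q := fun j p => p 0 (eix j)) (fun j => smo_coord _ oA) (fun p Up => Up)).
Qed.

Lemma dead_hat U f : open U -> smo U f -> forall t t', jtop t t' ->
  dead [set p | U (emb p)] t (hat f) /\ dead [set p | U (emb p)] t' (hat f).
Proof.
move=> oU sf t t' [[-> ->]|[-> ->]]; split=> p Up; apply: (partial_hat0 oU sf Up) => j hj;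
  rewrite ?eq_uv ?eq_vu// ?eq_uu ?eq_vv ?(ltn3 hj)//; by rewrite gtn_eqF// (leq_trans hj).
Qed.

Lemma near_jet A c (e : R) : open A -> (forall i, smooth_on_int e (c i)) -> 0 < e ->
  A (@jet_uv R k.+2 l.+2 c 0) -> exists d : R, [/\ 0 < d, d <= e & forall t, `|t| < d -> A (@jet_uv R k.+2 l.+2 c t)].
Proof.
move=> oA sc e0 A0; have [r r0 hr] := open_ballE oA A0.
have z0 : `|0 : R| < e by rewrite normr0.
have [|a|d d0 hd] := @common_radius R N (fun a d => forall t : R, `|t| < d ->
    `|@jet_uv R k.+2 l.+2 c t 0 a - @jet_uv R k.+2 l.+2 c 0 0 a| < r).
- by move=> a d d' h1 _ dd t ht; apply: h1; exact: lt_le_trans dd.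
- elim/jet_ind: a => i hi.
    have [d d0 hd] := derivable_ball (sc (inord 0) i 0 z0) r0; exists d => // t ht.
    by rewrite !jet_u//; apply: hd; rewrite subr0.
  have [d d0 hd] := derivable_ball (sc (inord 1) i 0 z0) r0; exists d => // t ht.
  by rewrite !jet_v//; apply: hd; rewrite subr0.
exists (Order.min d e); split; rewrite ?lt_min ?d0// ?ge_min ?lexx ?orbT//.
move=> t; rewrite lt_min => /andP[td _]; apply: hr; apply: rV_norm_lt => // a; rewrite mxE [X in _ + X]mxE; exact: hd.
Qed.

(** With at most two derivatives of a function of order (k, l), the truncation of [ell] is never
    felt. *)
Lemma dern_jet U f c : open U -> smo U f -> smooth_germ c -> U (@jet_uv R k l c 0) ->
  let F := fun t => f (@jet_uv R k l c t) in let p := @jet_uv R k.+2 l.+2 c 0 in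
  forall j, (j <= 2)%N -> dern j F 0 = iter j T (hat f) p.
Proof.
move=> oU sf [e e0 sc] U0 F p.
pose A : set 'rV[R]_N := [set p | U (emb p)]; have oA : open A by exact: open_emb.
have A0 : A (@jet_uv R k.+2 l.+2 c 0) by rewrite /A /= emb_jet.
have [d [d0 de hd]] := near_jet oA sc e0 A0.
have s0 : smo A (hat f) by exact: smo_hat.
have s1 := smo_Lie 1 oA (fun a => smo_ell a oA) s0.
have te (t : R) : `|t| < d -> `|t| < e by move=> h; exact: lt_le_trans de.
have tu : jtop (ui k.+2) (ui k.+1) by left. have tv : jtop (vi l.+2) (vi l.+1) by right.
have [du du'] := dead_hat oU sf tu; have [dv dv'] := dead_hat oU sf tv.
have D0 (t : R) : `|t| < d -> is_derive t 1 F (T (hat f) (@jet_uv R k.+2 l.+2 c t)).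
  move=> td; have := is_derive_jet oA s0 du dv sc (te t td) (hd t td).
  by rewrite /hat (_ : (fun t => _) = F)//; apply/funext => s; rewrite /F emb_jet.
have D1 (t : R) : `|t| < d -> is_derive t 1 (fun t => T (hat f) (@jet_uv R k.+2 l.+2 c t)) (T (T (hat f)) (@jet_uv R k.+2 l.+2 c t)).
  move=> td; exact: (is_derive_jet oA s1 (dead_T oA s0 tu du du') (dead_T oA s0 tv dv dv') sc (te t td) (hd t td)).
have E1 (t : R) : `|t| < d -> dern 1 F t = T (hat f) (@jet_uv R k.+2 l.+2 c t).
  by move=> td; rewrite /dern derive1nS derive1E; case: (D0 t td).
have z0 : `|0 : R| < d by rewrite normr0.
case=> [|[|[|//]]] _; first by rewrite /= /hat emb_jet.
  exact: E1.
have near0 s : `|s - 0| < d -> dern 1 F s = T (hat f) (@jet_uv R k.+2 l.+2 c s).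
  by rewrite subr0; exact: E1.
rewrite /dern derive1nS derive1E.
by have [_] := is_derive_near d0 (fun s hs => esym (near0 s hs)) (D1 0 z0).
Qed.

Lemma poly_jet (s : nat -> R) n : exists f : R -> R, (forall e, smooth_on_int e f) /\
  forall j, (j <= n)%N -> dern j f 0 = s j.
Proof.
pose Q : {poly R} := \poly_(i < n.+1) (s i / i`!%:R).
have fQ : family setT (fun j t => (Q^`(j)).[t]).
  by move=> j t _; rewrite derivnS; exact: is_derive_poly.
have D j t : dern j (fun t => Q.[t]) t = Q^`(j).[t] /\ derivable (dern j (fun t => Q.[t])) t 1.
  exact: (dern_family openT fQ (fun t _ => erefl) j I).
exists (fun t => Q.[t]); split=> [e j t _|j jn]; first exact: (D j t).2.
rewrite (D j 0).1 horner_coef0 coef_derivn addn0 coef_poly ltnS jn ffactnn -[LHS]mulr_natr.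
by rewrite divfK// pnatr_eq0 -lt0n fact_gt0.
Qed.

Lemma jet_realize (p : 'rV[R]_N) : exists c : curve R 2, smooth_germ c /\ @jet_uv R k.+2 l.+2 c 0 = p.
Proof.
have [fu [su hu]] := poly_jet (fun i => p 0 (ui i)) k.+2.
have [fv [sv hv]] := poly_jet (fun j => p 0 (vi j)) l.+2.
exists (fun i => if i == inord 0 then fu else fv); split.
  by exists 1 => // i; case: ifP => _.
apply/rowP; elim/jet_ind => i hi; first by rewrite jet_u// eqxx hu.
rewrite jet_v// ifF ?hv//; by apply/eqP => /(congr1 val); rewrite /= !inordK.
Qed.
End Jet.

Lemma germ_eq_dern (R : realType) m (c c' : curve R m) : germ_eq c c' -> smooth_germ c ->
  smooth_germ c' /\ forall i j, dern j (c' i) 0 = dern j (c i) 0.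
Proof.
move=> [e e0 he] [e' e'0 sc]; pose d := Order.min e e'.
have d0 : 0 < d by rewrite lt_min e0.
have oI : open [set t : R | `|t| < d].
  apply: open_ballI => t /= te; exists (d - `|t|); first by rewrite subr_gt0.
  by move=> s; rewrite ltrBrDr => h; apply: le_lt_trans h; rewrite -{1}[s](subrK t) ler_normD.
have D i j (t : R) : `|t| < d -> dern j (c' i) t = dern j (c i) t /\ derivable (dern j (c' i)) t 1.
  have fam : family [set t : R | `|t| < d] (fun j => dern j (c i)).
    by move=> n s /=; rewrite lt_min => /andP[_ h]; exact: (family_dern (@sc i)).
  apply: (dern_family oI fam) => s /=; rewrite lt_min => /andP[h _]; exact: esym (he i s h).
split; first by exists d => // i j t td; exact: (D i j t td).2.
by move=> i j; apply: (D i j 0 _).1; rewrite normr0.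
Qed.

(** * Openness of the parameterization read on jets *)

Section Par.
Variables (R : realType) (k l : nat) (Om : set 'rV[R]_4) (g h : 'rV[R]_4 -> R).
Hypotheses (oOm : open Om) (sg : smo Om g) (sh : smo Om h).
Variables (U : set 'rV[R]_(k.+1 + l.+1)) (phi psi chi : 'rV[R]_(k.+1 + l.+1) -> R).
Hypotheses (oU : open U) (sphi : smo U phi) (spsi : smo U psi) (schi : smo U chi).
Local Notation N := (k.+3 + l.+3)%N.
Local Notation Gm := (@Gam R k l phi psi chi).
Local Notation T := (Lie (@ell R k l)).
Local Notation cU := [set c : curve R 2 | smooth_germ c /\ U (@jet_uv R k l c 0)].
Hypothesis solU : forall c, cU c -> solves Om g h (Gm c).
Hypothesis opU : forall W, W `<=` cU -> germ_open W ->
  exists2 O, germ_open O & Gam_img phi psi chi W = O `&` solset Om g h.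

Definition W0 : set 'rV[R]_N := [set p | U (emb p)].
Let X := hat phi. Let Y := hat psi. Let Z := hat chi.
Let sX : smo W0 X. Proof. exact: smo_hat. Qed.
Let sY : smo W0 Y. Proof. exact: smo_hat. Qed.
Let sZ : smo W0 Z. Proof. exact: smo_hat. Qed.
Let oW0 : open W0. Proof. exact: open_emb. Qed.

Definition Pq (j : 'I_4) (p : 'rV[R]_N) : R := nth 0 [:: X p; Y p; Z p; T Y p - Z p * T X p] j.
Definition Pp (p : 'rV[R]_N) : 'rV[R]_4 := \row_j Pq j p.
Definition f7p (i : 'I_7) (p : 'rV[R]_N) : R :=
  nth 0 [:: X p; Y p; Z p; T X p; T Y p; T (T X) p; T (T Y) p] i.

Let sT F : smo W0 F -> smo W0 (T F).
Proof. move=> sF; exact: (smo_Lie 1 oW0 (fun a => smo_ell a oW0) sF). Qed.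

Lemma smo_Pq j : smo W0 (Pq j).
Proof.
case: j => -[|[|[|[|j]]]] hj; last exact: (False_ind _ (notF hj)).
- exact: sX.
- exact: sY.
- exact: sZ.
exact: (smoB oW0 (sT sY) (smoM oW0 sZ (sT sX))).
Qed.

Lemma smo_f7p j : smo W0 (f7p j).
Proof.
case: j => -[|[|[|[|[|[|[|j]]]]]]] hj; last exact: (False_ind _ (notF hj)).
- exact: sX.
- exact: sY.
- exact: sZ.
- exact: (sT sX).
- exact: (sT sY).
- exact: (sT (sT sX)).
- exact: (sT (sT sY)).
Qed.

Let GE c : [/\ Gm c (inord 0) = (fun t => phi (@jet_uv R k l c t)), Gm c (inord 1) = (fun t => psi (@jet_uv R k l c t))
  & Gm c (inord 2) = (fun t => chi (@jet_uv R k l c t))].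
Proof. by split; apply/funext => t; rewrite /Gam !inordK. Qed.

Let in_cU c : smooth_germ c -> W0 (@jet_uv R k.+2 l.+2 c 0) -> cU c.
Proof. by move=> sc; rewrite /W0 /= emb_jet. Qed.

Lemma dern_Gam c (p := @jet_uv R k.+2 l.+2 c 0) j : smooth_germ c -> W0 p -> (j <= 2)%N ->
  [/\ dern j (Gm c (inord 0)) 0 = iter j T X p, dern j (Gm c (inord 1)) 0 = iter j T Y p
    & dern j (Gm c (inord 2)) 0 = iter j T Z p].
Proof.
move=> sc Wp j2; have [_ Uc] := in_cU sc Wp; have [-> -> ->] := GE c.
split; [exact: (dern_jet oU sphi sc Uc j2)|exact: (dern_jet oU spsi sc Uc j2)|exact: (dern_jet oU schi sc Uc j2)].
Qed.

(** Every jet is that of a polynomial curve, so (E) along curves becomes an identity between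
    functions on jets. *)
Lemma sol_jet p : W0 p -> Om (Pp p) /\ T Z p = h (Pp p) + g (Pp p) * T X p.
Proof.
move=> Wp; have [c [sc cp]] := jet_realize p.
have Wc : W0 (@jet_uv R k.+2 l.+2 c 0) by rewrite cp.
have [e e0 he] := solU (in_cU sc Wc); have ze : `|0 : R| < e by rewrite normr0.
have [_ _ _ h1 h2] := he 0 ze.
have [x0 y0 z0] := dern_Gam sc Wc (isT : (0 <= 2)%N); have [x1 y1 z1] := dern_Gam sc Wc (isT : (1 <= 2)%N).
have {}x0 : Gm c (inord 0) 0 = X p by rewrite -cp; exact: x0.
have {}y0 : Gm c (inord 1) 0 = Y p by rewrite -cp; exact: y0.
have {}z0 : Gm c (inord 2) 0 = Z p by rewrite -cp; exact: z0.
rewrite cp in x1 y1 z1; rewrite x0 y0 z0 x1 y1 in h1 h2; rewrite z1 in h2.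
have E : mk4 (X p) (Y p) (Z p) (iter 1 T Y p - Z p * iter 1 T X p) = Pp p by apply/rowP => j; rewrite !mxE.
by rewrite E in h1 h2.
Qed.

Lemma germ_open_jet W : open W -> W `<=` W0 ->
  germ_open [set c : curve R 2 | smooth_germ c /\ W (@jet_uv R k.+2 l.+2 c 0)].
Proof.
have E (c c' : curve R 2) : (forall i j, dern j (c' i) 0 = dern j (c i) 0) ->
    @jet_uv R k.+2 l.+2 c' 0 = @jet_uv R k.+2 l.+2 c 0.
  by move=> h0; apply/rowP; elim/jet_ind => i hi; [rewrite !jet_u|rewrite !jet_v].
move=> oW WW; split=> [c c' cc [sc Wc]|c [_ Wc] [e e0 sc]].
  by have [sc' dc] := germ_eq_dern cc sc; split=> //; rewrite (E c).
have [r r0 hr] := open_ballE oW Wc; have r2 : 0 < r / 2 by rewrite divr_gt0.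
exists e, (k.+2 + l.+2)%N, (fun=> r / 2); split=> //.
  by apply: continuous_subspaceT => t; exact: cst_continuous.
move=> c' sc' close; split; first by exists e.
have z0 : `|0 : R| < e by rewrite normr0.
apply: hr; apply: rV_norm_lt => // a; apply: (@lt_le_trans _ _ (r / 2)); last by rewrite ler_pdivrMr// ler_pMr// ler1n.
rewrite mxE [X in _ + X]mxE; elim/jet_ind: a => i hi.
  by rewrite !jet_u//; apply: close => //; rewrite (leq_trans (hi : (i <= k.+2)%N))// leq_addr.
by rewrite !jet_v//; apply: close => //; rewrite (leq_trans (hi : (i <= l.+2)%N))// leq_addl.
Qed.

(* Openness of Gamma, read on jets, through the perturbation of solutions. *)
Lemma image_ball W : open W -> W !=set0 -> W `<=` W0 -> exists p (dl : R), [/\ W p, 0 < dl &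
  forall al : 'I_7 -> R, (forall i, `|al i| < dl) -> exists2 p', W p' & forall i, f7p i p' = f7p i p + al i].
Proof.
move=> oW [p Wp] WW; have [c [sc cp]] := jet_realize p.
pose A := [set c : curve R 2 | smooth_germ c /\ W (@jet_uv R k.+2 l.+2 c 0)].
have Ac : A c by split=> //; rewrite cp.
have AcU : A `<=` cU by move=> b [sb Wb]; apply: in_cU => //; exact: WW.
have [ O [gO hO] eO] := opU AcU (germ_open_jet oW WW).
have : Gam_img phi psi chi A (Gm c) by exists c => //; exists 1.
rewrite eO => -[Oc [sc0 [e e0 sol]]].
have [e1 [r [eps [e10 sc1 ceps epsp close]]]] := hO _ Oc sc0.
pose e2 := Order.min e e1.
have e20 : 0 < e2 by rewrite lt_min e0.
have e21 : e2 <= e1 by rewrite ge_min lexx orbT.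
have [|dl dl0 hdl] := perturb oOm sg sh e20 e21 sc1 _ r ceps epsp.
  by move=> t; rewrite lt_min => /andP[te _]; have [_ _ _ h1 h2] := sol t te.
exists p, dl; split=> // al hal.
(* Reordering: [perturb] shifts t, z, x, x', x'', y, y', y'', while [f7p] lists x, y, z, Tx, Ty,
   TTx, TTy. *)
pose be (j : 'I_8) : R := nth 0 [:: 0; al (inord 2); al (inord 0); al (inord 3); al (inord 5); al (inord 1); al (inord 4); al (inord 6)] j.
have hbe j : `|be j| < dl by case: j => -[|[|[|[|[|[|[|[|//]]]]]]]] hj; rewrite /be /= ?normr0.
have [c' [sc' cl' sol' z' [x' y']]] := hdl be hbe.
have : (O `&` solset Om g h) c'.
  split; last by split; [exists e1|exact: sol'].
  by apply: close.
rewrite -eO => -[b [sb Wb] cb].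
have sgc : smooth_germ c' by exists e1.
have [_ db] := germ_eq_dern cb sgc.
exists (@jet_uv R k.+2 l.+2 b 0) => // i.
have Wb' := WW _ Wb; have Wc' : W0 (@jet_uv R k.+2 l.+2 c 0) by apply: WW; rewrite cp.
have D j (j2 : (j <= 2)%N) := dern_Gam sb Wb' j2; have C j (j2 : (j <= 2)%N) := dern_Gam sc Wc' j2.
have [bx0 by0 bz0] := D 0%N isT; have [bx1 by1 _] := D 1%N isT; have [bx2 by2 _] := D 2%N isT.
have [cx0 cy0 cz0] := C 0%N isT; have [cx1 cy1 _] := C 1%N isT; have [cx2 cy2 _] := C 2%N isT.
have xE j (j2 : (j <= 2)%N) := etrans (db (inord 0) j) (x' j j2).
have yE j (j2 : (j <= 2)%N) := etrans (db (inord 1) j) (y' j j2).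
have zE := etrans (db (inord 2) 0%N) z'.
have q0 := xE 0%N isT; have q1 := xE 1%N isT; have q2 := xE 2%N isT.
have w0 := yE 0%N isT; have w1 := yE 1%N isT; have w2 := yE 2%N isT.
rewrite bx0 cx0 in q0; rewrite bx1 cx1 in q1; rewrite bx2 cx2 in q2; rewrite by0 cy0 in w0; rewrite by1 cy1 in w1; rewrite by2 cy2 in w2.
have {}zE : Z (@jet_uv R k.+2 l.+2 b 0) = Z (@jet_uv R k.+2 l.+2 c 0) + be (inord 1).
  by apply: etrans (esym bz0) (etrans zE _); congr (_ + _); exact: cz0.
rewrite cp in q0 q1 q2 w0 w1 w2 zE.
rewrite /be !inordK//= in q0 q1 q2 w0 w1 w2 zE.
have I j (j7 : (j < 7)%N) : Ordinal j7 = inord j by apply: val_inj; rewrite /= inordK.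
by case: i => -[|[|[|[|[|[|[|//]]]]]]] hj; rewrite /f7p /= I.
Qed.

(** By [image_ball] the points [Pp p'] fill a ball of Om, from which the identity theorem spreads
    the vanishing. *)
Lemma transfer F O : connected Om -> an Om F -> open O -> O !=set0 -> O `<=` W0 ->
  (forall p, O p -> F (Pp p) = 0) -> forall q, Om q -> F q = 0.
Proof.
move=> cOm aF oO O0 OW FO; have [p [dl [Op dl0 hdl]]] := image_ball oO O0 OW.
pose s := T X p; pose r := dl / (1 + `|s|).
have s1 : 0 < 1 + `|s| by rewrite ltr_pwDl.
have r0 : 0 < r by rewrite divr_gt0.
have B q : `|q - Pp p| < r -> exists2 p', O p' & Pp p' = q.
  move=> hq.
  have hi i : `|q 0 i - Pq i p| < r by have := rV_coord_le (q - Pp p) i; rewrite !mxE => h1; exact: le_lt_trans h1 hq.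
  pose d i := q 0 i - Pq i p.
  (* Tx is kept equal to s, and the shift of Ty compensates the change of z Tx in lambda = Ty - z
     Tx. *)
  pose al (i : 'I_7) : R := nth 0 [:: d (inord 0); d (inord 1); d (inord 2); 0; d (inord 3) + d (inord 2) * s] i.
  have rdl : r * (1 + `|s|) = dl by rewrite divfK// gt_eqF.
  have rd : r <= dl by rewrite -rdl ler_pMr// lerDl.
  have hal i : `|al i| < dl.
    have hd j : `|d j| < dl by exact: lt_le_trans (hi j) rd.
    case: i => -[|[|[|[|[|i]]]]] hj; rewrite /al /= ?normr0 ?nth_nil ?normr0//.
    rewrite -rdl mulrDr mulr1; apply: le_lt_trans (ler_normD _ _) _; apply: ltr_leD; first exact: hi.
    by rewrite normrM; apply: ler_wpM2r => //; exact: ltW (hi _).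
  have [p' Op' hp'] := hdl al hal; exists p' => //.
  have e j (j7 : (j < 7)%N) := hp' (Ordinal j7).
  have e0 := e 0%N isT; have e1 := e 1%N isT; have e2 := e 2%N isT; have e3 := e 3%N isT; have e4 := e 4%N isT.
  rewrite /f7p /al /= in e0 e1 e2 e3 e4.
  apply/rowP => i; rewrite mxE; case: i => -[|[|[|[|//]]]] hj; rewrite /Pq /=.
  - by rewrite e0 /d /Pq inordK//= addrC subrK; congr (q 0 _); apply: val_inj; rewrite /= inordK.
  - by rewrite e1 /d /Pq inordK//= addrC subrK; congr (q 0 _); apply: val_inj; rewrite /= inordK.
  - by rewrite e2 /d /Pq inordK//= addrC subrK; congr (q 0 _); apply: val_inj; rewrite /= inordK.
  - rewrite (_ : Ordinal hj = inord 3); last by apply: val_inj; rewrite /= inordK.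
    rewrite e4 e3 e2 /d /Pq !inordK//= /s.
    move: (q 0 (inord 3)) (q 0 (inord 2)) (T Y p) (T X p) (Z p) => a1 a2 a3 a4 a5; ring.
apply: (an_eq0 oOm cOm aF (O := [set q | `|q - Pp p| < r])).
- exact: open_ball_rV.
- by exists (Pp p); rewrite /= subrr normr0.
- by move=> q /B[p' Op' <-]; exact: (sol_jet (OW _ Op')).1.
- by move=> q /B[p' Op' <-]; exact: FO.
Qed.

End Par.

(** Supplies a solution through the given jet; as such solutions lie in the image of Gamma, U is not
    empty. *)
Lemma solution_with_jet (R : realType) (L : nat) (Om : set 'rV[R]_4) (g h : 'rV[R]_4 -> R)
    (X : R * 'rV[R]_L.+1 * 'rV[R]_L.+1) : open Om -> smo Om g -> smo Om h -> (0 < L)%N -> in_hatOmega Om X ->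
  exists c : curve R 3, solset Om g h c /\ @jet_xyz R L c = X.
Proof.
move=> oOm sg sh L0; case: X => [[z0 xs] ys] /= OmX.
have [fx [sx hx]] := poly_jet (fun j => xs 0 (inord j)) L.
have [fy [sy hy]] := poly_jet (fun j => ys 0 (inord j)) L.
pose c : curve R 3 := fun i => nth (fun=> z0) [:: fx; fy] i.
have c0 : c (inord 0) = fx by rewrite /c inordK.
have c1 : c (inord 1) = fy by rewrite /c inordK.
have c2 : c (inord 2) = fun=> z0 by rewrite /c inordK.
have sz : forall e, smooth_on_int e (fun=> z0 : R).
  move=> e j t te; apply: (@dern_family R setT (fun j t => if j is 0 then z0 else 0) _ openT _ (fun t _ => erefl) j t I).2.
  by move=> [|i] s _; exact: is_derive_cst.
have sc : forall i, smooth_on_int 1 (c i).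
  by case=> -[|[|[|//]]] hi; rewrite /c /=; [exact: sx|exact: sy|exact: sz].
have hx0 := hx 0%N isT; have hy0 := hy 0%N isT; have hx1 := hx 1%N L0; have hy1 := hy 1%N L0.
have [|c' [sc' sol' z' x' y']] := solution_exists oOm sg sh (@ltr01 R) (lexx 1) sc.
  by rewrite c0 c1 c2 hx1 hy1; move: hx0 hy0; rewrite /dern /= => -> ->.
exists c'; split; first by split.
rewrite /jet_xyz z' x' y' c0 c1 c2; congr (_, _, _); apply/rowP => j; rewrite mxE.
  by rewrite hx ?inord_val// -ltnS.
by rewrite hy ?inord_val// -ltnS.
Qed.

Lemma gs_fin (R : realType) n (F : gfilter R n) m (Q : 'I_m -> 'rV[R]_n -> Prop) :
  (forall i, exists O, [/\ open O, F O & forall x, O x -> Q i x]) ->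
  exists O, [/\ open O, F O & forall x i, O x -> Q i x].
Proof.
elim: m Q => [|m IH] Q hQ.
  by exists setT; split; [exact: openT|exact: gsT|move=> x [] []].
have [ O1 [oO1 F1 h1]] := hQ ord0; have [ O2 [oO2 F2 h2]] := IH _ (fun i => hQ (lift ord0 i)).
exists (O1 `&` O2); split; [exact: openI|exact: gsI|move=> x i [x1 x2]].
by case: (unliftP ord0 i) => [j|] ->; [exact: h2|exact: h1].
Qed.

Lemma sum4 (V : nmodType) (E : 'I_4 -> V) :
  \sum_j E j = E (inord 0) + E (inord 1) + E (inord 2) + E (inord 3).
Proof.
by rewrite !big_ord_recr big_ord0 /= add0r; congr (E _ + E _ + E _ + E _); apply: val_inj; rewrite /= inordK.
Qed.

Lemma sum4_0 (V : pzRingType) (a b c d : V) : 0 = a * 0 + b * 0 + c * 0 + d * 0.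
Proof. by rewrite !mulr0 !addr0. Qed.

(** * From the parameterization to the field of germs and back *)

Section Fin.
Variables (R : realType) (k l : nat) (Om : set 'rV[R]_4) (g h : 'rV[R]_4 -> R).
Hypotheses (oOm : open Om) (cOm : connected Om) (ag : an Om g) (ah : an Om h).
Hypothesis g40 : forall p, Om p -> d4 g p != 0.
Variables (U : set 'rV[R]_(k.+1 + l.+1)) (phi psi chi : 'rV[R]_(k.+1 + l.+1) -> R).
Hypotheses (oU : open U) (sphi : smo U phi) (spsi : smo U psi) (schi : smo U chi).
Local Notation N := (k.+3 + l.+3)%N.
Local Notation T := (Lie (@ell R k l)).
Local Notation cU := [set c : curve R 2 | smooth_germ c /\ U (@jet_uv R k l c 0)].
Hypothesis solU : forall c, cU c -> solves Om g h (@Gam R k l phi psi chi c).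
Hypothesis opU : forall W, W `<=` cU -> germ_open W ->
  exists2 O, germ_open O & Gam_img phi psi chi W = O `&` solset Om g h.
Hypothesis nondeg : forall O, open O -> O `<=` U -> O !=set0 ->
  exists2 p, O p & [\/ partial (lshift l.+1 ord_max) phi p != 0, partial (lshift l.+1 ord_max) psi p != 0
                    | partial (lshift l.+1 ord_max) chi p != 0].
Local Notation W := (@W0 R k l U).
Variable F : gfilter R N.
Hypothesis FW : F W.
Local Notation K := (germ F).
Local Notation cl := (@cl R N F).
Local Notation dK := (@dK R N F).
Local Notation smG := (@smG R N F).
Local Notation P := (@Pp R k l phi psi chi).
Local Notation Pc := (@Pq R k l phi psi chi).
Local Notation f7f := (@f7p R k l phi psi chi).
Let sg : smo Om g := ag.1.
Let sh : smo Om h := ah.1.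
Let X := hat phi. Let Y := hat psi. Let Z := hat chi.
Let oW : open W. Proof. exact: open_emb. Qed.
Let sX : smo W X. Proof. exact: smo_hat. Qed.
Let sY : smo W Y. Proof. exact: smo_hat. Qed.
Let sZ : smo W Z. Proof. exact: smo_hat. Qed.
Let POm p : W p -> Om (P p). Proof. by move=> Wp; have [] := sol_jet oU sphi spsi schi solU Wp. Qed.

Lemma smGW G : smo W G -> smG G. Proof. by move=> sG; exists W; split; [exact: oW|exact: FW|exact: sG]. Qed.

Lemma eqG_W G1 G2 : smG G1 -> smG G2 -> (forall p, W p -> G1 p = G2 p) -> cl G1 = cl G2.
Proof. by move=> s1 s2 e; apply/(clP s1 s2); exists W; split; [exact: oW|exact: FW|exact: e]. Qed.

Lemma smG_coord b : smG (fun p => p 0 b).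
Proof. exact: smGW (smo_coord b oW). Qed.

Lemma cl0_pts G : smG G -> cl G = 0 -> exists O, [/\ open O, O !=set0, O `<=` W & forall p, O p -> G p = 0].
Proof.
move=> sG; rewrite -(cl0 F) => /(clP sG (smG_cst F 0))[ O [oO FO e]].
exists (O `&` W); split; [exact: openI| |by move=> p []|by move=> p [Op _]; exact: e].
by apply/set0P/eqP => O0; apply: (@gs0 R N F); rewrite -O0; exact: gsI.
Qed.

(** Otherwise one of the seven functions has its differential spanned by those of an independent
    subfamily, so it is locally constant on the fibres of that subfamily ([fibre_constant]);
    [image_ball] however shifts this function while fixing the others. *)
Lemma rank_indep (mu : 'I_7 -> K) : (forall a, \sum_i mu i * dK a (cl (f7f i)) = 0) -> forall i, mu i = 0.
Proof.
move=> hmu; pose M : 'M[K]_(7, N) := \matrix_(i, a) dK a (cl (f7f i)).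
pose m : 'rV[K]_7 := \row_i mu i.
have mM : m *m M = 0.
  by apply/rowP => a; rewrite !mxE -[RHS](hmu a); apply: eq_bigr => i _; rewrite !mxE.
have [rf|nrf] := boolP (row_free M).
  move: mM => /eqP; rewrite (mulmx_free_eq0 _ rf) => /eqP m0 i.
  by have : m 0 i = 0 by [rewrite m0 mxE]; rewrite mxE.
exfalso.
have rM : (\rank M < 7)%N by rewrite ltn_neqAle rank_leq_row andbT.
pose gm := maxrankfun M.
have [a0 ha0] : exists a0, forall b, gm b != a0.
  apply/not_existsP => hall.
  have : (#|'I_7| <= #|'I_(\rank M)|)%N; last by rewrite !card_ord leqNgt rM.
  apply: leq_trans (leq_image_card gm predT); apply: subset_leq_card; apply/fintype.subsetP => a _.
  have /existsNP[b /negP] := hall a; rewrite negbK => /eqP <-.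
  by apply/fintype.imageP; exists b.
have /submxP[D hD] : (row a0 M <= rowsub gm M)%MS by rewrite (eq_maxrowsub M) row_sub.
have /row_freeP[B hB] := maxrowsub_free M.
have sf i : smG (f7f i) by apply: smGW; exact: smo_f7p.
have [ O1 [oO1 F1 h1]] : exists O, [/\ open O, F O & forall p i, O p ->
    partial i (f7f a0) p = \sum_b val (D 0 b) p * partial i (f7f (gm b)) p].
  apply: gs_fin => i.
  have e : cl (partial i (f7f a0)) = cl (fun p => \sum_b val (D 0 b) p * partial i (f7f (gm b)) p).
    have s b : smG (fun p => val (D 0 b) p * partial i (f7f (gm b)) p).
      by apply: smGM; [exact: valG|exact: smG_partial].
    rewrite (cl_sum s); have : row a0 M 0 i = (D *m rowsub gm M) 0 i by rewrite hD.
    rewrite !mxE (dKE i (sf a0)) => ->; apply: eq_bigr => b _.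
    by rewrite (clM (valG _) (smG_partial i (sf _))) cl_val_id !mxE (dKE i (sf _)).
  move/clP: e => [|  |O [oO FO e]]; [exact: smG_partial| |by exists O].
  apply: smG_sum => b; apply: smGM; [exact: valG|exact: smG_partial].
have [ O2 [oO2 F2 h2]] : exists O, [/\ open O, F O & forall p b, O p -> forall a,
    \sum_i val (B i a) p * partial i (f7f (gm b)) p = (a == b)%:R].
  apply: gs_fin => b.
  have [|O2 [oO2 F2 h2]] := @gs_fin R N F _ (fun a p => \sum_i val (B i a) p * partial i (f7f (gm b)) p = (a == b)%:R).
    move=> a.
    have e : cl (fun p => \sum_i val (B i a) p * partial i (f7f (gm b)) p) = cl (fun=> (a == b)%:R).
      have s i : smG (fun p => val (B i a) p * partial i (f7f (gm b)) p).
        by apply: smGM; [exact: valG|exact: smG_partial].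
      rewrite (cl_sum s) cl_nat; have : (rowsub gm M *m B) b a = (1%:M : 'M[K]_(\rank M)) b a by rewrite hB.
      rewrite !mxE [b == a]eq_sym => <-; apply: eq_bigr => i _.
      by rewrite (clM (valG _) (smG_partial i (sf _))) cl_val_id !mxE (dKE i (sf _)) mulrC.
    move/clP: e => [|  |O [oO FO e]]; [|exact: smG_cst|by exists O].
    apply: smG_sum => i; apply: smGM; [exact: valG|exact: smG_partial].
  by exists O2; split=> // p O2p a; exact: h2.
pose A := O1 `&` O2 `&` W.
have oA : open A by apply: openI => //; exact: openI.
have [p Ap] : A !=set0.
  by apply/set0P/eqP => A0; apply: (@gs0 R N F); rewrite -A0; apply: gsI => //; exact: gsI.
have sA i : smo A (f7f i) by apply: smo_sub (smo_f7p oU sphi spsi schi i) => q [].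
have hp1 (x : 'rV[R]_N) i : A x -> partial i (f7f a0) x = \sum_b val (D 0 b) x * partial i (f7f (gm b)) x.
  by move=> [[x1 _] _]; exact: h1.
have hp2 a b : \sum_i val (B i a) p * partial i (f7f (gm b)) p = (a == b)%:R.
  by case: Ap => -[_ p2] _; exact: h2.
have [d d0 [dA hd]] := fibre_constant oA Ap (fun b => sA (gm b)) (sA a0) hp1 hp2.
pose V : set 'rV[R]_N := [set x | `|x - p| < d].
have V0 : V !=set0 by exists p; rewrite /V /= subrr normr0.
have VW : V `<=` W by move=> x /dA[].
have [p1 [dl [Vp1 dl0 hdl]]] := image_ball oOm sg sh oU sphi spsi schi opU (@open_ball_rV R N p d) V0 VW.
have dl2 : 0 < dl / 2 by rewrite divr_gt0.
have [i|p2 Vp2 hp] := hdl (fun i => (i == a0)%:R * (dl / 2)).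
  by case: eqP => _; rewrite ?mul0r ?normr0// mul1r gtr0_norm// ltr_pdivrMr// ltr_pMr// ltr1n.
have := hd p2 p1 Vp2 Vp1 (fun b => _); rewrite !hp eqxx mul1r => /(_ _)/eqP.
rewrite -subr_eq0 addrAC subrr add0r (gt_eqF dl2) => H; suff: false by [].
by apply: H => b; rewrite hp (negbTE (ha0 b)) mul0r addr0.
Qed.

(** Indices count down from the top order k+2, so that the commutator with the total derivative
    raises them by one. *)
Definition pK i (f : K) : K := if (i <= k.+2)%N then dK (ui k l (k.+2 - i)) f else 0.
Definition qK i (f : K) : K := if (i <= l.+2)%N then dK (vi k l (l.+2 - i)) f else 0.
Definition uK j : K := if (j <= k.+2)%N then cl (fun p => p 0 (ui k l (k.+2 - j))) else 0.
Definition vK j : K := if (j <= l.+2)%N then cl (fun p => p 0 (vi k l (l.+2 - j))) else 0.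
Definition TK f : K := \sum_(i < 5) uK i * pK i.+1 f + \sum_(j < l.+2) vK j * qK j.+1 f.

Let ddK i : der (dK i). Proof. by split; [exact: dKD|exact: dKM]. Qed.
Let dz : der (fun _ : K => 0 : K). Proof. by split=> a b; rewrite ?addr0// mul0r mulr0 addr0. Qed.
Let dp i : der (pK i). Proof. by rewrite /pK; case: (i <= k.+2)%N; [exact: ddK|exact: dz]. Qed.
Let dq i : der (qK i). Proof. by rewrite /qK; case: (i <= l.+2)%N; [exact: ddK|exact: dz]. Qed.

Let dK_coord a b : dK a (cl (fun p => p 0 b)) = (a == b)%:R.
Proof.
rewrite (dKE a (smG_coord b)) -cl_nat; congr cl; apply/funext => p; exact: partial_coord.
Qed.

Let dK_dead t G : smo W G -> dead W t G -> dK t (cl G) = 0.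
Proof.
move=> sG dG; have s := smGW sG; rewrite (dKE t s) -(cl0 F).
by apply: eqG_W dG; [exact: smG_partial|exact: smG_cst].
Qed.

Let subj n i : (n - i < n.+1)%N. Proof. by rewrite ltnS leq_subr. Qed.
Let eq_sub n i j : (i <= n)%N -> (j <= n)%N -> (n - i == n - j)%N = (i == j).
Proof. by move=> h1 h2; rewrite eqn_sub2lE. Qed.

Let pu i j : pK i (uK j) = ((i == j) && (i <= k.+2)%N)%:R.
Proof.
rewrite /pK /uK; case: (leqP i k.+2) => ik; last by rewrite andbF.
case: (leqP j k.+2) => jk; first by rewrite dK_coord eq_uu// eq_sub// andbT.
by rewrite (der0 (ddK _)) (_ : (i == j) = false)//; apply/negbTE; rewrite neq_ltn (leq_ltn_trans ik jk).
Qed.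
Let qv i j : qK i (vK j) = ((i == j) && (i <= l.+2)%N)%:R.
Proof.
rewrite /qK /vK; case: (leqP i l.+2) => ik; last by rewrite andbF.
case: (leqP j l.+2) => jk; first by rewrite dK_coord eq_vv// eq_sub// andbT.
by rewrite (der0 (ddK _)) (_ : (i == j) = false)//; apply/negbTE; rewrite neq_ltn (leq_ltn_trans ik jk).
Qed.
Let pv i j : pK i (vK j) = 0.
Proof. by rewrite /pK /vK; case: ifP => // _; case: ifP => _; rewrite ?(der0 (ddK _))// dK_coord eq_uv. Qed.
Let qu i j : qK i (uK j) = 0.
Proof. by rewrite /qK /uK; case: ifP => // _; case: ifP => _; rewrite ?(der0 (ddK _))// dK_coord eq_vu. Qed.
Let pp i j f : pK i (pK j f) = pK j (pK i f).
Proof. by rewrite /pK; case: ifP => _; case: ifP => _; rewrite ?(der0 (ddK _))//; exact: dKC. Qed.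
Let pq i j f : pK i (qK j f) = qK j (pK i f).
Proof. by rewrite /pK /qK; case: ifP => _; case: ifP => _; rewrite ?(der0 (ddK _))//; exact: dKC. Qed.
Let qq i j f : qK i (qK j f) = qK j (qK i f).
Proof. by rewrite /qK; case: ifP => _; case: ifP => _; rewrite ?(der0 (ddK _))//; exact: dKC. Qed.
Let p0 i f : (k.+2 < i)%N -> pK i f = 0. Proof. by rewrite /pK ltnNge => /negbTE ->. Qed.
Let q0 j f : (l.+2 < j)%N -> qK j f = 0. Proof. by rewrite /qK ltnNge => /negbTE ->. Qed.

Hypothesis k3 : (k <= 3)%N.

Let sum_rev n (G : nat -> K) : \sum_(i < n.+3) G i = \sum_(i < n.+2) G (n.+2 - i.+1)%N + G n.+2.
Proof.
by rewrite big_ord_recr /=; congr (_ + _); rewrite (reindex_inj rev_ord_inj).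
Qed.

Lemma TKE G : smo W G -> TK (cl G) = cl (T G).
Proof.
move=> sG; have sGG := smGW sG.
have sl a : smo W (ell a) by exact: smo_ell.
have s a : smG (fun p => ell a p * partial a G p).
  exact: (smGM (smGW (sl a)) (smG_partial a sGG)).
have -> : cl (T G) = \sum_a cl (ell a) * dK a (cl G).
  rewrite /Lie (cl_sum s); apply: eq_bigr => a _.
  by rewrite (clM (smGW (sl a)) (smG_partial a sGG)) (dKE a sGG).
rewrite big_split_ord /=; congr (_ + _).
  rewrite (_ : \sum_(i < k.+3) _ = \sum_(i < k.+3) cl (ell (ui k l i)) * dK (ui k l i) (cl G)); last first.
    by apply: eq_bigr => i _; rewrite /ui inord_val.
  rewrite (sum_rev k (fun i => cl (ell (ui k l i)) * dK (ui k l i) (cl G))).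
  have -> : cl (ell (ui k l k.+2)) = 0.
    by rewrite -(cl0 F); congr cl; apply/funext => p; rewrite ellu// ltnn.
  rewrite mul0r addr0 (big_ord_widen 5 (fun i => cl (ell (ui k l (k.+2 - i.+1))) * dK (ui k l (k.+2 - i.+1)) (cl G))); last by rewrite ltnS ltnS.
  rewrite [RHS]big_mkcond /=; apply: eq_bigr => i _; case: ifP => ik; last by rewrite /pK ik mulr0.
  rewrite /pK ik /uK (ltnW ik); congr (_ * _); congr cl; apply/funext => p.
  by rewrite ellu ?subj// subSS ltnS leq_subr -subSn// -ltnS.
rewrite (_ : \sum_(i < l.+3) _ = \sum_(i < l.+3) cl (ell (vi k l i)) * dK (vi k l i) (cl G)); last first.
  by apply: eq_bigr => i _; rewrite /vi inord_val.
rewrite (sum_rev l (fun i => cl (ell (vi k l i)) * dK (vi k l i) (cl G))).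
have -> : cl (ell (vi k l l.+2)) = 0.
  by rewrite -(cl0 F); congr cl; apply/funext => p; rewrite ellv// ltnn.
rewrite mul0r addr0; apply: eq_bigr => i _; have il := ltn_ord i.
rewrite /qK il /vK (ltnW il); congr (_ * _); congr cl; apply/funext => p.
by rewrite ellv ?subj// subSS ltnS leq_subr -subSn// -ltnS.
Qed.

Let ordW f : smo U f -> ord pK qK (cl (hat f)).
Proof.
move=> sf; have sH := smo_hat oU sf.
have [d1 d2] := dead_hat oU sf (or_introl (conj erefl erefl) : jtop (ui k l k.+2) (ui k l k.+1)).
have [e1 e2] := dead_hat oU sf (or_intror (conj erefl erefl) : jtop (vi k l l.+2) (vi k l l.+1)).
have h1 := dK_dead sH d1; have h2 := dK_dead sH d2; have h3 := dK_dead sH e1; have h4 := dK_dead sH e2.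
by split; [exact: h1|exact: h2|exact: h3|exact: h4].
Qed.

Let sT G : smo W G -> smo W (T G).
Proof. move=> sG; exact: (smo_Lie 1 oW (fun a => smo_ell a oW) sG). Qed.

Let x := cl X. Let y := cl Y. Let z := cl Z.

Let f7E i : f7 TK x y z i = cl (f7f i).
Proof.
have [x1 y1] := (TKE sX, TKE sY); have x2 := TKE (sT sX); have y2 := TKE (sT sY).
have x3 := etrans (congr1 TK x1) x2.
have y3 := etrans (congr1 TK y1) y2.
by case: i => -[|[|[|[|[|[|[|i]]]]]]] hi; [| | |exact: x1|exact: y1|exact: x3|exact: y3|exact: (False_ind _ (notF hi))].
Qed.

Let indepK mu : (forall d, co pK qK d -> \sum_i mu i * d (f7 TK x y z i) = 0) -> forall i, mu i = 0.
Proof.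
move=> hmu; apply: rank_indep; elim/jet_ind => a ha.
  have := hmu (pK (k.+2 - a)) (or_introl (ex_intro _ _ erefl)).
  rewrite /pK leq_subr subKn// => e; rewrite -[RHS]e; apply: eq_bigr => i _; by rewrite f7E.
have := hmu (qK (l.+2 - a)) (or_intror (ex_intro _ _ erefl)).
rewrite /qK leq_subr subKn// => e; rewrite -[RHS]e; apply: eq_bigr => i _; by rewrite f7E.
Qed.

Definition lab (w : seq nat) : seq 'I_4 := [seq inord i | i <- w].
Definition cK G w : K := cl (fun p => iter_partial (lab w) G (P p)).

Let smGP G : smo Om G -> smG (fun p => G (P p)).
Proof.
move=> sG; exact: (smG_comp oOm sG oW FW (smo_Pq oU sphi spsi schi) POm).
Qed.

Let lamE : lam TK x y z = cl (Pc (inord 3)).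
Proof.
rewrite /lam /sf (TKE sX) (TKE sY) -(clM (smGW sZ) (smGW (sT sX))).
rewrite -(clB (smGW (sT sY)) (smGM (smGW sZ) (smGW (sT sX)))).
by congr cl; apply/funext => p; rewrite /Pq inordK.
Qed.

Let chainK G w : smo Om G -> chain pK qK TK x y z (cK G w) (cK G (0 :: w)%N) (cK G (1 :: w)%N) (cK G (2 :: w)%N) (cK G (3 :: w)%N).
Proof.
move=> sG d cd.
have hd a : dK a (cK G w) = cK G (0 :: w)%N * dK a x + cK G (1 :: w)%N * dK a y + cK G (2 :: w)%N * dK a z + cK G (3 :: w)%N * dK a (lam TK x y z).
  have e0 : Pc (inord 0) = X by apply/funext => p; rewrite /Pq inordK.
  have e1 : Pc (inord 1) = Y by apply/funext => p; rewrite /Pq inordK.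
  have e2 : Pc (inord 2) = Z by apply/funext => p; rewrite /Pq inordK.
  have e := dK_comp a oOm (smo_iter (lab w) sG) oW FW (smo_Pq oU sphi spsi schi) POm.
  apply: etrans e _; apply: etrans (sum4 _) _; cbv beta.
  congr (_ + _ + _ + _).
  - exact: (etrans (congr1 (fun u => dK a (cl u) * cK G (0 :: w)%N) e0) (mulrC _ _)).
  - exact: (etrans (congr1 (fun u => dK a (cl u) * cK G (1 :: w)%N) e1) (mulrC _ _)).
  - exact: (etrans (congr1 (fun u => dK a (cl u) * cK G (2 :: w)%N) e2) (mulrC _ _)).
  - exact: (etrans (congr1 (fun u => dK a u * cK G (3 :: w)%N) (esym lamE)) (mulrC _ _)).
have h0 := sum4_0 (cK G (0 :: w)%N) (cK G (1 :: w)%N) (cK G (2 :: w)%N) (cK G (3 :: w)%N).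
have [[a ->]|->] : (exists a, d = dK a) \/ d = (fun=> 0); [|exact: hd|exact: h0].
case: cd => -[i ->].
  rewrite /pK; case: (i <= k.+2)%N; [left|by right]; by exists (ui k l (k.+2 - i)).
rewrite /qK; case: (i <= l.+2)%N; [left|by right]; by exists (vi k l (l.+2 - i)).
Qed.

Let eqnK : TK z = cK h nil + cK g nil * sf TK x.
Proof.
rewrite /sf (TKE sX) (TKE sZ) /cK -(clM (smGP sg) (smGW (sT sX))) -(clD (smGP sh)); last first.
  by apply: smGM; [exact: smGP|exact: smGW (sT sX)].
apply: eqG_W; [exact: smGW (sT sZ)| |].
  by apply: smGD; [exact: smGP|apply: smGM; [exact: smGP|exact: smGW (sT sX)]].
by move=> p Wp; have [_ e] := sol_jet oU sphi spsi schi solU Wp.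
Qed.

Let g40K : cK g [:: 3]%N != 0.
Proof.
apply/eqP => /(cl0_pts (smGP (smo_partial _ sg)))[ O [_ [p Op] OW e]].
by have := g40 (POm (OW p Op)); rewrite /d4 e ?eqxx.
Qed.

(** Move only the coordinates of order (k, l): projections of open sets contain balls, which brings
    the nondegeneracy on U to the larger jets. *)
Let emb_onto (O : set 'rV[R]_N) p : open O -> O p -> exists2 r : R, 0 < r &
  forall q, `|q - emb p| < r -> exists2 p', O p' & emb p' = q.
Proof.
move=> oO Op; have [r r0 hr] := open_ballE oO Op; exists r => // q hq.
have inj b b' : @eix k l b = eix b' -> b = b'.
  case: (split_ordP b) => i ->; case: (split_ordP b') => j ->; rewrite ?eixl ?eixr => /eqP;
    rewrite ?eq_uv ?eq_vu ?eq_uu ?eq_vv ?(ltn3 (ltn_ord _))// => /eqP e; congr (lshift _ _) || congr (rshift _ _); exact: val_inj.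
pose p' : 'rV[R]_N := \row_a (p 0 a + if [pick b | eix b == a] is Some b then q 0 b - emb p 0 b else 0).
exists p'; last first.
  apply/rowP => b; rewrite !mxE; case: pickP => [b' /eqP /inj ->|/(_ b)]; last by rewrite eqxx.
  by rewrite mxE addrC subrK.
apply: hr; apply: rV_norm_lt => // a; rewrite !mxE addrAC subrr add0r.
case: pickP => [b _|_]; last by rewrite normr0.
by have := rV_coord_le (q - emb p) b; rewrite !mxE => h1; exact: le_lt_trans h1 hq.
Qed.

Let nzK : ~ [/\ pK 2 x = 0, pK 2 y = 0 & pK 2 z = 0].
Proof.
rewrite /pK /= subn2 /= => -[x0 y0 z0].
rewrite (dKE _ (smGW sX)) in x0; rewrite (dKE _ (smGW sY)) in y0; rewrite (dKE _ (smGW sZ)) in z0.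
have c0 f : smo U f -> cl (partial (ui k l k) (hat f)) = 0 ->
    exists O, [/\ open O, F O & forall p, O p -> partial (ui k l k) (hat f) p = 0].
  move=> sf; rewrite -(cl0 F) => /(clP (smG_partial _ (smGW (smo_hat oU sf))) (smG_cst F 0))[ O [oO FO e]].
  by exists O.
have [ O1 [oO1 F1 h1]] := c0 _ sphi x0; have [ O2 [oO2 F2 h2]] := c0 _ spsi y0; have [ O3 [oO3 F3 h3]] := c0 _ schi z0.
pose A := O1 `&` O2 `&` O3 `&` W.
have oA : open A by apply: openI => //; apply: openI => //; exact: openI.
have [p Ap] : A !=set0.
  apply/set0P/eqP => A0; apply: (@gs0 R N F); rewrite -A0; apply: gsI => //; apply: gsI => //; exact: gsI.
have [r r0 hr] := emb_onto oA Ap.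
have [||q /hr[p' [[[p1 p2] p3] Wp] <-]] := nondeg (@open_ball_rV R _ (emb p) r).
- by move=> q /hr[p' [_ Wp] <-].
- by exists (emb p); rewrite /= subrr normr0.
rewrite -(partial_hat_u oU sphi Wp) -(partial_hat_u oU spsi Wp) -(partial_hat_u oU schi Wp) h1// h2// h3//.
by rewrite eqxx; case.
Qed.

Let kl_final (kl : (k <= 2)%N || ((k == 3) && (l == 3))) := alg_final (@germ_char0 R N F) dp dq pp pq qq pu pv qu qv p0 q0 k3
  (fun f => erefl (TK f)) (ordW sphi) (ordW spsi) (ordW schi) indepK (fun w => chainK w sg) (fun w => chainK w sh) eqnK g40K kl nzK.

(** Pairs an element of K with the analytic function on Om it comes from; the rules below rebuild S,
    T and J, so that their vanishing in K reaches Om through [transfer]. *)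
Definition ev G (a : K) := an Om G /\ cl (fun p => G (P p)) = a.
Let evD G G' a a' : ev G a -> ev G' a' -> ev (fun q => G q + G' q) (a + a').
Proof. by move=> [aG <-] [aG' <-]; split; [exact: anD|exact: (clD (smGP aG.1) (smGP aG'.1))]. Qed.
Let evM G G' a a' : ev G a -> ev G' a' -> ev (fun q => G q * G' q) (a * a').
Proof. by move=> [aG <-] [aG' <-]; split; [exact: anM|exact: (clM (smGP aG.1) (smGP aG'.1))]. Qed.
Let evN G a : ev G a -> ev (fun q => - G q) (- a).
Proof. by move=> [aG <-]; split; [exact: anN|exact: (clN (smGP aG.1))]. Qed.
Let ev_nat n : ev (fun=> n%:R) n%:R.
Proof. by split; [exact: an_cst|exact: cl_nat]. Qed.
Let ev_iter G w : an Om G -> ev (fun q => iter_partial (lab w) G q) (cK G w).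
Proof. by move=> aG; split; last exact: erefl; elim: w => [|i w IH]; [exact: aG|exact: (an_partial (inord i) IH)]. Qed.
Let ev_z : ev (fun q => q 0 i2) z.
Proof.
by split; [exact: an_coord|congr cl; apply/funext => p; rewrite mxE /Pq inordK].
Qed.
Let evX G a : ev G a -> ev (fun q => G q ^+ 2) (a ^+ 2). Proof. by move=> e; exact: (evM e e). Qed.

Let ev0 G : ev G 0 -> forall q, Om q -> G q = 0.
Proof.
move=> [aG e]; have [ O [oO O0 OW GO]] := cl0_pts (smGP aG.1) e.
exact: (transfer oOm sg sh oU sphi spsi schi solU opU cOm aG oO O0 OW GO).
Qed.

Definition cF G (q : 'rV[R]_4) (w : seq nat) : R := iter_partial (lab w) G q.
Let gw w := ev_iter w ag.
Let hw w := ev_iter w ah.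

Let ev_qk : ev (fun q => qk (cF g q) (cF h q)) (qk (cK g) (cK h)).
Proof. exact: (evD (evM (gw [:: 3; 3]%N) (hw [:: 3]%N)) (evN (evM (gw [:: 3]%N) (hw [:: 3; 3]%N)))). Qed.

Let ev_om0 : ev (fun q => om0 (q 0 i2) (cF g q) (cF h q)) (om0 z (cK g) (cK h)).
Proof.
exact: (evD (evD (evM (evN (ev_nat 2)) (evX (gw [:: 3]%N))) (evN (evM ev_z ev_qk))) (evM (gw [:: 3; 3]%N) (gw nil))).
Qed.

Let ev_qd i : ev (fun q => qd (cF g q) (cF h q) i) (qd (cK g) (cK h) i).
Proof.
exact: (evD (evD (evD (evM (gw [:: i; 3; 3]%N) (hw [:: 3]%N)) (evM (gw [:: 3; 3]%N) (hw [:: i; 3]%N)))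
  (evN (evM (gw [:: i; 3]%N) (hw [:: 3; 3]%N)))) (evN (evM (gw [:: 3]%N) (hw [:: i; 3; 3]%N)))).
Qed.

Let ev_om0d i : ev (fun q => om0d (q 0 i2) (cF g q) (cF h q) i) (om0d z (cK g) (cK h) i).
Proof.
exact: (evD (evD (evD (evD (evM (evM (evN (ev_nat 4)) (gw [:: 3]%N)) (gw [:: i; 3]%N))
  (evN (evM (ev_nat (i == 2)%N) ev_qk))) (evN (evM ev_z (ev_qd i)))) (evM (gw [:: i; 3; 3]%N) (gw nil)))
  (evM (gw [:: 3; 3]%N) (gw [:: i]%N))).
Qed.

Let ev_Jk : ev (fun q => Jk (q 0 i2) (cF g q) (cF h q)) (Jk z (cK g) (cK h)).
Proof.
exact: (evD (evD (evM (evD (ev_qd 0) (evN (ev_om0d 1))) (evN (gw [:: 3; 3]%N)))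
  (evM (evD (evN (gw [:: 1; 3; 3]%N)) (evN (ev_qd 2))) ev_om0)) (evM (evD (ev_om0d 2) (gw [:: 0; 3; 3]%N)) ev_qk)).
Qed.

Let ev_Sk : ev (fun q => Sk (cF g q)) (Sk (cK g)).
Proof.
exact: (evD (evM (evM (ev_nat 2) (gw [:: 3]%N)) (gw [:: 3; 3; 3]%N)) (evN (evM (ev_nat 3) (evX (gw [:: 3; 3]%N))))).
Qed.

Let ev_Tk : ev (fun q => Tk (cF g q) (cF h q)) (Tk (cK g) (cK h)).
Proof.
exact: (evD (evM (evM (ev_nat 2) (gw [:: 3]%N)) (hw [:: 3; 3; 3]%N))
  (evN (evM (evM (ev_nat 3) (gw [:: 3; 3]%N)) (hw [:: 3; 3]%N)))).
Qed.

Lemma fin_vanish : (k <= 2)%N || ((k == 3) && (l == 3)) -> forall q, Om q ->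
  [/\ Sk (cF g q) = 0, Tk (cF g q) (cF h q) = 0 & Jk (q 0 i2) (cF g q) (cF h q) = 0].
Proof.
move=> /kl_final[S0 T0 J0] q Oq.
have eS := ev_Sk; have eT := ev_Tk; have eJ := ev_Jk.
rewrite S0 in eS; rewrite T0 in eT; rewrite J0 in eJ.
by split; [exact: (ev0 eS Oq)|exact: (ev0 eT Oq)|exact: (ev0 eJ Oq)].
Qed.

End Fin.

(** * Components of the differential forms *)

Section Forms.
Variables (R : realType) (Om : set 'rV[R]_4) (g h : 'rV[R]_4 -> R).
Hypotheses (oOm : open Om) (sg : smo Om g) (sh : smo Om h).
Variables (p : 'rV[R]_4) (Omp : Om p).

(** Smoothness and the value of a derivative at p together: the derivative of a long expression is
    assembled by composing the rules. *)
Definition drv (i : 'I_4) f (d : R) := smo Om f /\ partial i f p = d.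
Let drvD i f f' d d' : drv i f d -> drv i f' d' -> drv i (fun q => f q + f' q) (d + d').
Proof. by move=> [s <-] [s' <-]; split; [exact: (smoD oOm s s')|exact: (partialD i s s' Omp)]. Qed.
Let drvM i f f' d d' : drv i f d -> drv i f' d' -> drv i (fun q => f q * f' q) (d * f' p + f p * d').
Proof. by move=> [s <-] [s' <-]; split; [exact: (smoM oOm s s')|exact: (partialM i s s' Omp)]. Qed.
Let drvC i c : drv i (fun=> c) 0.
Proof. by split; [exact: smo_cst|exact: partial_cst]. Qed.
Let drvN i f d : drv i f d -> drv i (fun q => - f q) (- d).
Proof.
move=> hf; have := drvM (drvC i (-1)) hf; rewrite mul0r add0r mulN1r.
by rewrite (_ : (fun q => -1 * f q) = (fun q => - f q))//; apply/funext => q; rewrite mulN1r.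
Qed.
Let drv_iter (i : nat) G w : smo Om G -> drv (inord i) (fun q => cF G q w) (cF G p (i :: w)).
Proof. by move=> sG; split; [exact: smo_iter|]. Qed.
Let drv_z i : drv i (fun q => q 0 i2) (i == i2)%:R.
Proof. by split; [exact: smo_coord|exact: partial_coord]. Qed.

Let cg := cF g p.
Let ch := cF h p.

Lemma partial_omegaf (i : nat) (j : 'I_4) :
  let a : R := if j == i0 then 1 else 0 in let b : R := if j == i1 then 1 else 0 in
  let c : R := if j == i2 then 1 else 0 in
  partial (inord i) (omegaf g h j) p =
  - 4 * cg [:: 3]%N * cg [:: i; 3]%N * a
  + (qd cg ch i * (b - p 0 i2 * a) - qk cg ch * ((inord i == i2)%:R * a))
  - (cg [:: i; 3; 3]%N * (c - cg nil * a) - cg [:: 3; 3]%N * (cg [:: i]%N * a)).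
Proof.
move=> a b c; pose gw w := @drv_iter i g w sg; pose hw w := @drv_iter i h w sh.
have h1 := drvM (drvM (drvC (inord i) (-2)) (drvM (gw [:: 3]%N) (gw [:: 3]%N))) (drvC (inord i) a).
have h2 := drvM (drvD (drvM (gw [:: 3; 3]%N) (hw [:: 3]%N)) (drvN (drvM (gw [:: 3]%N) (hw [:: 3; 3]%N))))
  (drvD (drvC (inord i) b) (drvM (drvN (drv_z (inord i))) (drvC (inord i) a))).
have h3 := drvM (drvN (gw [:: 3; 3]%N)) (drvD (drvC (inord i) c) (drvM (drvN (gw nil)) (drvC (inord i) a))).
have e : partial (inord i) (omegaf g h j) p = _ := (drvD h1 (drvD h2 h3)).2.
rewrite e {e h1 h2 h3} /qd /qk /cg /ch; move: a b c => a b c; cbv beta.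
move: ((inord i == i2)%:R : R) (p 0 i2) => e z.
move: (cF g p nil) (cF g p [:: i]%N) (cF g p [:: 3]%N) (cF g p [:: 3; 3]%N) (cF g p [:: i; 3]%N) (cF g p [:: i; 3; 3]%N)
  (cF h p [:: 3]%N) (cF h p [:: 3; 3]%N) (cF h p [:: i; 3]%N) (cF h p [:: i; 3; 3]%N) => g0 gi g3 g33 gi3 gi33 h3 h33 hi3 hi33.
ring.
Qed.

Let ieq i j : (i < 4)%N -> (j < 4)%N -> ((inord i : 'I_4) == inord j) = (i == j).
Proof. by move=> hi hj; rewrite -val_eqE /= !inordK. Qed.

Let G0 : g p = cg nil. Proof. exact: erefl. Qed.
Let G3 : d4 g p = cg [:: 3]%N. Proof. exact: erefl. Qed.
Let G33 : d4 (d4 g) p = cg [:: 3; 3]%N. Proof. exact: erefl. Qed.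
Let H3 : d4 h p = ch [:: 3]%N. Proof. exact: erefl. Qed.
Let H33 : d4 (d4 h) p = ch [:: 3; 3]%N. Proof. exact: erefl. Qed.

Lemma omegaf_coef : [/\ omegaf g h i0 p = om0 (p 0 i2) cg ch, omegaf g h i1 p = qk cg ch & omegaf g h i2 p = - cg [:: 3; 3]%N].
Proof.
rewrite /omegaf /add1 /scale1 /omega1 /dzg /dxf /add1 /scale1 /coordform /i0 /i1 /i2 !ieq//=.
rewrite /om0 /qk G33 G3 H33 H3 G0; move: (cg nil) (cg [:: 3]%N) (cg [:: 3; 3]%N) (ch [:: 3]%N) (ch [:: 3; 3]%N) (p 0 _) => a b c d e z.
by split; ring.
Qed.

Lemma Jk_wedge : wedge21 (dform1 (omegaf g h)) (omegaf g h) i0 i1 i2 p = Jk (p 0 i2) cg ch.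
Proof.
have [e0 e1 e2] := omegaf_coef.
have D (i : nat) (i' j : 'I_4) : i' = inord i -> partial i' (omegaf g h j) p = _ := fun e => etrans (congr1 (fun k => partial k _ _) e) (partial_omegaf i j).
rewrite /wedge21 /dform1 e0 e1 e2 (D 0%N i0 i1 erefl) (D 1%N i1 i0 erefl) (D 1%N i1 i2 erefl) (D 2%N i2 i1 erefl)
  (D 2%N i2 i0 erefl) (D 0%N i0 i2 erefl).
rewrite /i0 /i1 /i2 !ieq//= /Jk /om0d /om0 /qd /qk /=.
move: (p 0 _) (ch [:: 3]%N) (ch [:: 3; 3]%N) (ch [:: 0; 3]%N) (ch [:: 1; 3]%N) (ch [:: 2; 3]%N) (ch [:: 0; 3; 3]%N) (ch [:: 1; 3; 3]%N)
  (ch [:: 2; 3; 3]%N) => z h3 h33 h03 h13 h23 h033 h133 h233.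
move: (cg nil) (cg [:: 0]%N) (cg [:: 1]%N) (cg [:: 2]%N) (cg [:: 3]%N) (cg [:: 3; 3]%N) (cg [:: 0; 3]%N) (cg [:: 1; 3]%N) (cg [:: 2; 3]%N)
  (cg [:: 0; 3; 3]%N) (cg [:: 1; 3; 3]%N) (cg [:: 2; 3; 3]%N) => g0 g_0 g_1 g_2 g3 g33 g03 g13 g23 g033 g133 g233.
ring.
Qed.

(** Once S = T = 0, the (x, y, z) component of the definition of J reads Jk = 2 g4^2 J. *)
Lemma J_eq0 J : is_Jfun Om g h J -> d4 g p != 0 -> Sk cg = 0 -> Tk cg ch = 0 -> Jk (p 0 i2) cg ch = 0 ->
  [/\ Sfun g p = 0, Tfun g h p = 0 & J p = 0].
Proof.
move=> hJ g0 S0 T0 J0; have S1 : Sfun g p = 0 := S0; have T1 : Tfun g h p = 0 := T0; split=> //.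
have := hJ p Omp i0 i1 i2; rewrite Jk_wedge J0 S1 T1 !mul0r !add0r => /esym/eqP; rewrite oppr_eq0 mulf_eq0.
have [e0 e1 e2] := omegaf_coef.
have -> : wedge21 (wedge11 (@omega1 R) (etaf g h)) (omegaf g h) i0 i1 i2 p = - 2 * d4 g p ^+ 2.
  rewrite /wedge21 e0 e1 e2 /wedge11 /etaf /add1 /scale1 /omega1 /dzg /dxf /add1 /scale1 /coordform /i0 /i1 /i2 !ieq//=.
  rewrite /om0 /qk G3 H3 G0; move: (cg nil) (cg [:: 3]%N) (cg [:: 3; 3]%N) (ch [:: 3]%N) (ch [:: 3; 3]%N) (p 0 _) => a b c d e z.
  ring.
by rewrite mulf_eq0 oppr_eq0 pnatr_eq0 expf_eq0 /= (negbTE g0) orbF => /eqP.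
Qed.
End Forms.

Lemma analytic_an (R : realType) n (A : set 'rV[R]_n) f : open A -> analytic_on A f -> an A f.
Proof.
by move=> oA af; split; [exact: (smooth_on_smo f oA).1 af.1|move=> p Ap; exact: (analytic_CE oA af Ap)].
Qed.

Theorem theorem5p4 (R : realType) (Om : set 'rV[R]_4) (g h : 'rV[R]_4 -> R)
  (J : 'rV[R]_4 -> R) (k l : nat) :
  open Om -> connected Om ->
  analytic_on Om g -> analytic_on Om h ->
  (forall p, Om p -> d4 g p != 0) ->
  diffeo_onto_image Om (Gmap g) ->
  is_Jfun Om g h J ->
  (k <= l)%N ->
  admits_parameterization Om g h k l ->
  (forall p, Om p -> [/\ Sfun g p = 0, Tfun g h p = 0 & J p = 0])
  \/ (3 <= k /\ 4 <= l)%N.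
Proof.
move=> oOm cOm /(analytic_an oOm) ag /(analytic_an oOm) ah g40 _ hJ kl [L [L0 [X [hX]]]].
move=> [V [U [phi [psi [chi [[oV VX] [oU [aphi apsi achi]] solU [opU incl] nd]]]]]].
have [/andP[k3 l4]|small] := boolP ((3 <= k) && (4 <= l))%N; [by right|left].
(* As k <= l, the negation of the second alternative leaves k <= 2 or k = l = 3. *)
have kl' : (k <= 2)%N || ((k == 3%N) && (l == 3%N)).
  move: small; rewrite negb_and -!ltnNge !ltnS => /orP[->//|l3].
  case: (leqP k 2) => //= k3; have k3' : k = 3%N by apply/eqP; rewrite eqn_leq k3 (leq_trans kl).
  by rewrite k3' eqxx /= eqn_leq l3 -k3'.
have k3 : (k <= 3)%N by case/orP: kl' => [k2|/andP[/eqP -> _]]; [exact: leq_trans k2 _|].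
have sphi := (smooth_on_smo phi oU).1 aphi.1; have spsi := (smooth_on_smo psi oU).1 apsi.1.
have schi := (smooth_on_smo chi oU).1 achi.1.
(* A solution with the jet X lies in the image of Gamma and comes from some (u, v), which provides a
   point of U around which to take germs. *)
have [c [solc jc]] := solution_with_jet oOm ag.1 ah.1 L0 hX.
have Vc : V (@jet_xyz R L c) by rewrite jc.
have [uv [suv Uuv] _] := incl c (conj solc Vc).
have W00 : @W0 R k l U !=set0 by exists (@jet_uv R k.+2 l.+2 uv 0); rewrite /W0 /= emb_jet.
have [F FW] := gfilter_exists (open_emb oU) W00.
have nd1 O (oO : open O) (OU : O `<=` U) (O0 : O !=set0) := (nd O oO OU O0).1.
move=> p Omp.
have [S0 T0 J0] := fin_vanish oOm cOm ag ah g40 oU sphi spsi schi solU opU nd1 FW k3 kl' Omp.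
exact: (J_eq0 oOm ag.1 ah.1 Omp hJ (g40 p Omp) S0 T0 J0).
Qed.
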